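(* For every $p\in(0,1)$ and every $t>0$, \[ \lim_{n\to\infty}\operatorname{Corr}\big(T_n(\omega),T_n(\omega^t)\big)=0, \] where $T_n(\omega)$ is the geometric last-passage time from $(0,0)$ to $(n,n)$ in the weight configuration $\omega$ and $\omega^t$ is the bit-resampling perturbation of $\omega$ described in the context.
   Context: Let $\mathbb{N}=\{0,1,2,\dots\}$. For $u,v\in\mathbb{Z}^2$ write $u\le v$ if $u_1\le v_1$ and $u_2\le v_2$. A directed path from $u\le v$ to $v$ is a sequence $x_0=u,x_1,\dots,x_m=v$ with $x_i-x_{i-1}\in\{(1,0),(0,1)\}$. Given weights $\omega=(\omega_x)_{x\in\mathbb{Z}^2}$, set $T(u,v)=\max\{\sum_{x\in\gamma}\omega_x:\gamma\text{ a directed path from }u\text{ to }v\}$, and $T_n(\omega)=T((0,0),(n,n))$. Let $(X_{v,i})_{v\in\mathbb{Z}^2,i\in\mathbb{N}}$, $(X'_{v,i})$ be i.i.d. Bernoulli($p$) and $(U_{v,i})$ i.i.d. exponential of mean $1$, all independent. Set $\omega_v=\min\{i\ge0:X_{v,i}=1\}$ (so the $\omega_v$ are i.i.d. with $\mathbb{P}(\omega_v=k)=p(1-p)^k$, $k\in\mathbb{N}$). For $t\ge0$ let $X^t_{v,i}=X_{v,i}$ if $t<U_{v,i}$ and $X^t_{v,i}=X'_{v,i}$ if $t\ge U_{v,i}$, and $\omega^t_v=\min\{i\ge0:X^t_{v,i}=1\}$. *)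

(* Defs.v *)
From HB Require Import structures.
From mathcomp Require Import all_boot all_order all_algebra.
From mathcomp Require Import all_classical all_reals all_analysis.
Set Implicit Arguments.
Unset Strict Implicit.
Unset Printing Implicit Defensive.
Import Order.TTheory GRing.Theory Num.Theory.
Local Open Scope classical_set_scope.
Local Open Scope ring_scope.

(* A directed path from (0,0) is encoded by its sequence of steps:
   [true] = (1,0), [false] = (0,1).  The k-th vertex (k = 0..size s) is
   the sum of the first k steps. *)
Definition path_vertex (s : seq bool) (k : nat) : int * int :=
  ((count id (take k s))%:Z, (count negb (take k s))%:Z).

Definition path_weight (w : int * int -> nat) (s : seq bool) : nat :=
  (\sum_(k < (size s).+1) w (path_vertex s k))%N.

(* T_n(w) = T((0,0),(n,n)): the directed paths from (0,0) to (n,n) are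
   exactly the step sequences of length 2n with n steps (1,0). *)
Definition lpp (w : int * int -> nat) (n : nat) : nat :=
  (\max_(s : (n + n).-tuple bool | count id s == n) path_weight w s)%N.

(* min { i >= 0 : b i = true }  (0 on the null event where no bit is 1). *)
Definition first_success (b : nat -> bool) : nat :=
  match pselect (exists i, b i) with
  | left h => ex_minn h
  | right _ => 0%N
  end.

Section Model.
Context (d : measure_display) (T : measurableType d) (R : realType)
  (P : probability T R).

Definition weights (X : int * int -> nat -> T -> bool) (w : T) : int * int -> nat :=
  fun v => first_success (fun i => X v i w).

Definition resampled (t : R) (X X' : int * int -> nat -> T -> bool)
  (U : int * int -> nat -> T -> R) : int * int -> nat -> T -> bool :=
  fun v i w => if t < U v i w then X v i w else X' v i w.

Definition mutually_independent (K : eqType) (F : K -> set (set T)) : Prop :=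
  forall (J : seq K) (E : K -> set T), uniq J ->
    (forall j, j \in J -> F j (E j)) ->
    P [set w | forall j, j \in J -> E j w] = (\prod_(j <- J) P (E j))%E.

Definition sigma_of d' (T' : measurableType d') (Y : T -> T') : set (set T) :=
  [set E | exists2 A : set T', measurable A & E = Y @^-1` A].

Definition all_sigmas (X X' : int * int -> nat -> T -> bool)
  (U : int * int -> nat -> T -> R) :
  ((int * int) * nat + ((int * int) * nat + (int * int) * nat))%type -> set (set T) :=
  fun k => match k with
  | inl (v, i) => sigma_of (X v i)
  | inr (inl (v, i)) => sigma_of (X' v i)
  | inr (inr (v, i)) => sigma_of (U v i)
  end.

Definition correlation (A B : T -> R) : R :=
  fine (covariance P A B) / Num.sqrt (fine ('V_P[A]) * fine ('V_P[B])).

End Model.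

(* Main.v *)
(** Write q = 1 - p and a = sqrt q.  Last-passage percolation with Geom(q) weights in the
    bulk and Geom(a e^y), Geom(a e^-y) weights on the two axes is stationary (Burke), so its
    exponential moments are explicit.  They give, up to factors n^(o(1)): increments of T over
    anti-diagonal shifts of size n^.55 deviate by at most n^.29, whereas T exceeds its typical
    value by K n^(1/3) with probability at least n^(-o(1)) and stays below it with probability at
    least 1/2; hence Var T >= n^(.65).

    Expand T in the Fourier-Walsh basis of the underlying bits.  Resampling at time t multiplies
    the level-k part by e^(-kt), so the covariance is at most W_{<=K}(T) + e^(-Kt) Var T.  Replace
    T by its average T' over n^.55 anti-diagonal shifts: this costs n^.58 in L^2, and a bit
    influences T' only if one of the shifted geodesics meets its site, an event whose average
    over the shifts has probability at most n^(-.55).  Hypercontractivity (Bonami) for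
    low-degree polynomials then yields W_{<=K}(T') <= n^(.59), which is o(Var T).

    Every estimate is carried out in finite product spaces, with the weights cut at a level
    c = n^(o(1)); the cut is removed in L^2 at the end. *)
Require Import Defs.
From HB Require Import structures.
From mathcomp Require Import all_boot all_order all_algebra.
From mathcomp Require Import all_classical all_reals all_analysis.
From mathcomp Require Import measurable_realfun ring lra zify.
Set Implicit Arguments.
Unset Strict Implicit.
Unset Printing Implicit Defensive.
Import Order.TTheory GRing.Theory Num.Theory numFieldNormedType.Exports.
Local Open Scope classical_set_scope.
Local Open Scope ring_scope.

(** * Expectations over finite product spaces *)

(** Only models with geometric axes have explicit moments, and the pair of axes itself need not be
    stationary: if the axis parameters a, b satisfy a b s = q, weighting by s to the sum of the
    vertical axis turns b into b s, which is stationary with a, so the generating function at s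
    factorises. Perturbing a and b within this family gives every one-sided bound. The
    corner-to-corner time is then reached by controlling where maximal paths leave the axes. The
    lower bound on its upper tail is the delicate point: it takes weakened axes, a pigeonhole over
    blocks of exit columns, a second moment argument, and a gluing of off-diagonal rectangles. The
    exponent .55 lies in a window. Averaging over m shifts costs about m in squared norm, since
    increments over m steps fluctuate by m^(1/2); the level inequality leaves a low-degree weight of
    about n m^(-3/4). Up to n^(o(1)), both are below the variance scale n^(2/3) exactly when m lies
    between n^(4/9) and n^(2/3). *)

Section FiniteProduct.
Variables (R : realFieldType) (I A : finType).
Implicit Types (mu : I -> A -> R) (x : {ffun I -> A}).

Definition upd x i a : {ffun I -> A} := [ffun j => if j == i then a else x j].

Definition Ex mu (F : {ffun I -> A} -> R) : R :=
  \sum_(x : {ffun I -> A}) (\prod_i mu i (x i)) * F x.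

Lemma eq_Ex mu F G : F =1 G -> Ex mu F = Ex mu G.
Proof. by move=> FG; apply: eq_bigr => x _; rewrite FG. Qed.

Lemma ExD mu F G : Ex mu (fun x => F x + G x) = Ex mu F + Ex mu G.
Proof. by rewrite -big_split; apply: eq_bigr => x _; rewrite mulrDr. Qed.

Lemma ExZ mu c F : Ex mu (fun x => c * F x) = c * Ex mu F.
Proof. by rewrite big_distrr; apply: eq_bigr => x _; rewrite /= mulrCA. Qed.

Lemma Ex_sum mu (J : Type) (r : seq J) (Q : pred J) (F : J -> {ffun I -> A} -> R) :
  Ex mu (fun x => \sum_(j <- r | Q j) F j x) = \sum_(j <- r | Q j) Ex mu (F j).
Proof.
rewrite exchange_big /=; apply: eq_bigr => x _.
by rewrite big_distrr.
Qed.

Lemma le_Ex mu F G : (forall i a, 0 <= mu i a) -> (forall x, F x <= G x) ->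
  Ex mu F <= Ex mu G.
Proof.
move=> mu0 FG; apply: ler_sum => x _; apply: ler_wpM2l => //.
by apply: prodr_ge0 => i _; apply: mu0.
Qed.

Lemma Ex_ge0 mu F : (forall i a, 0 <= mu i a) -> (forall x, 0 <= F x) -> 0 <= Ex mu F.
Proof.
move=> mu0 F0; apply: sumr_ge0 => x _; apply: mulr_ge0 => //.
by apply: prodr_ge0 => i _; apply: mu0.
Qed.

Lemma upd_id x i a : upd x i a i = a.
Proof. by rewrite ffunE eqxx. Qed.

Lemma upd_neq x i a j : j != i -> upd x i a j = x j.
Proof. by rewrite ffunE => /negbTE ->. Qed.

(** Exchanging the fresh letter with the coordinate it replaces is an involution of the pairs
    [(x, a)] that preserves their weight; the factor on the right is the total mass of the letter
    left over. *)
Lemma Ex_upd mu i F :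
  Ex mu (fun x => \sum_a mu i a * F (upd x i a)) = (\sum_a mu i a) * Ex mu F.
Proof.
rewrite /Ex.
under eq_bigr do rewrite big_distrr /=.
rewrite pair_big /=.
pose h (z : {ffun I -> A} * A) := (upd z.1 i z.2, z.1 i).
have hK : involutive h.
  case=> x a; rewrite /h /= upd_id; congr pair.
  apply/ffunP => j; rewrite !ffunE; case: eqP => // -> .
  by [].
rewrite (reindex_inj (inv_inj hK)) /= [RHS]mulr_suml.
under [RHS]eq_bigr do rewrite mulr_sumr.
rewrite [RHS]exchange_big /= [RHS]pair_big /=.
apply: eq_bigr => -[x a] _ /=.
have -> : upd (upd x i a) i (x i) = x.
  by apply/ffunP => j; rewrite !ffunE; case: eqP => // ->.
rewrite (bigD1 i) //= upd_id [in RHS](bigD1 i) //=.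
have -> : \prod_(j | j != i) mu j (upd x i a j) = \prod_(j | j != i) mu j (x j).
  by apply: eq_bigr => j ji; rewrite upd_neq.
ring.
Qed.

Lemma Ex1 mu : (forall i, \sum_a mu i a = 1) -> Ex mu (fun=> 1) = 1.
Proof.
move=> mu1; rewrite /Ex.
under eq_bigr do rewrite mulr1.
rewrite -(bigA_distr_bigA (fun i a => mu i a)) /=.
by rewrite big1.
Qed.

End FiniteProduct.

(** * Iterated weighted sums over lists *)

Section ListExpectation.
Variables (R : realFieldType).

(** Each position has its own weight, of any total mass: Burke invariance is proved for unnormalised
    powers and normalised afterwards. *)
Fixpoint EL (X : Type) (rng : seq X) (ms : seq (X -> R)) (F : seq X -> R) : R :=
  if ms is m :: ms' then \sum_(a <- rng) m a * EL rng ms' (fun l => F (a :: l))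
  else F [::].

Lemma eq_EL (X : eqType) (rng : seq X) ms F G :
  (forall l, size l = size ms -> all (mem rng) l -> F l = G l) -> EL rng ms F = EL rng ms G.
Proof.
elim: ms F G => [|m ms IH] F G FG /=; first exact: FG.
rewrite big_seq [RHS]big_seq; apply: eq_bigr => a ar; congr (_ * _); apply: IH => l sl al.
by apply: FG => /=; rewrite ?sl ?al ?andbT.
Qed.

Lemma eq_EL' X (rng : seq X) ms F G : F =1 G -> EL rng ms F = EL rng ms G.
Proof.
elim: ms F G => [|m ms IH] F G FG /=; first exact: FG.
by apply: eq_bigr => a _; congr (_ * _); apply: IH => l; apply: FG.
Qed.

Lemma EL_cat X (rng : seq X) ms ms' F :
  EL rng (ms ++ ms') F = EL rng ms (fun l => EL rng ms' (fun l' => F (l ++ l'))).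
Proof. by elim: ms F => [|m ms IH] F //=; apply: eq_bigr => a _; rewrite IH. Qed.

Lemma ELZ X (rng : seq X) ms c F : EL rng ms (fun l => c * F l) = c * EL rng ms F.
Proof.
elim: ms F => [|m ms IH] F //=.
by rewrite big_distrr /=; apply: eq_bigr => a _; rewrite IH mulrCA.
Qed.

Lemma ELZr X (rng : seq X) ms c F : EL rng ms (fun l => F l * c) = EL rng ms F * c.
Proof. by rewrite mulrC -ELZ; apply: eq_EL' => l; rewrite mulrC. Qed.

Lemma ELD X (rng : seq X) ms F G :
  EL rng ms (fun l => F l + G l) = EL rng ms F + EL rng ms G.
Proof.
elim: ms F G => [|m ms IH] F G //=.
by rewrite -big_split /=; apply: eq_bigr => a _; rewrite IH mulrDr.
Qed.

Lemma EL_sum X (rng : seq X) ms (J : Type) (r : seq J) (P : pred J) (F : J -> seq X -> R) :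
  EL rng ms (fun l => \sum_(j <- r | P j) F j l) = \sum_(j <- r | P j) EL rng ms (F j).
Proof.
elim: r => [|j r IH].
  under eq_EL' do rewrite big_nil.
  rewrite big_nil -[RHS](mul0r (EL rng ms (fun=> 0))) -ELZ.
  by apply: eq_EL' => l; rewrite mulr0.
rewrite big_cons -IH; case: ifP => Pj; last first.
  by apply: eq_EL' => l; rewrite big_cons Pj.
by rewrite -ELD; apply: eq_EL' => l; rewrite big_cons Pj.
Qed.

Lemma EL_exch X Y (rng : seq X) (rng' : seq Y) ms ms' (F : seq X -> seq Y -> R) :
  EL rng ms (fun l => EL rng' ms' (F l)) = EL rng' ms' (fun l' => EL rng ms (F^~ l')).
Proof.
elim: ms F => [|m ms IH] F //=.
under eq_bigr do rewrite (IH (fun l => F (_ :: l))).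
rewrite EL_sum; apply: eq_bigr => a _; by rewrite ELZ.
Qed.

Lemma le_EL (X : eqType) (rng : seq X) ms F G :
  (forall k a, a \in rng -> 0 <= nth (fun=> 0) ms k a) ->
  (forall l, size l = size ms -> all (mem rng) l -> F l <= G l) -> EL rng ms F <= EL rng ms G.
Proof.
elim: ms F G => [|m ms IH] F G m0 FG /=; first exact: FG.
rewrite big_seq [leRHS]big_seq; apply: ler_sum => a ar; apply: ler_wpM2l; first exact: (m0 0%N).
apply: IH => [k b br|l sl al]; first exact: (m0 k.+1).
by apply: FG => /=; rewrite ?sl ?al ?andbT.
Qed.

Lemma EL1 X (rng : seq X) ms :
  (forall k, (k < size ms)%N -> \sum_(a <- rng) nth (fun=> 0) ms k a = 1) -> EL rng ms (fun=> 1) = 1.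
Proof.
elim: ms => [|m ms IH] //= m1; rewrite IH => [|k kl]; last exact: (m1 k.+1).
by under eq_bigr do rewrite mulr1; exact: (m1 0%N).
Qed.

End ListExpectation.

Section ProductLaw.
Variables (R : realFieldType) (I A : finType) (X : Type) (h : A -> X) (m : I -> X -> R).
Let mu i a := m i (h a).
Hypothesis mu1 : forall i, \sum_a mu i a = 1.

(** Bridge from functions on a finite index set, where the Fourier analysis takes place, to lists,
    where the recursions on the geometry take place. [Ex_upd] averages over the head, and [uniq s]
    makes the tail blind to it. *)
Lemma Ex_law (s : seq I) (F : seq X -> R) : uniq s ->
  Ex mu (fun x => F [seq h (x i) | i <- s]) = EL [seq h a | a <- enum A] [seq m i | i <- s] F.
Proof.
elim: s F => [|i s IH] F /=.
  by move=> _; rewrite -[RHS]mulr1 -(Ex1 mu1) -ExZ; apply: eq_Ex => x; rewrite mulr1.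
case/andP=> nis us; rewrite big_map big_enum /=.
rewrite -[LHS]mul1r -(mu1 i) -Ex_upd.
have E x : \sum_a mu i a * F [seq h (upd x i a j) | j <- i :: s]
         = \sum_a mu i a * F (h a :: [seq h (x j) | j <- s]).
  apply: eq_bigr => a _ /=; rewrite upd_id; congr (_ * F (_ :: _)).
  apply/eq_in_map => j js; rewrite upd_neq //.
  by apply: contraNneq nis => <-.
rewrite (eq_Ex _ E) Ex_sum; apply: eq_bigr => a _.
by rewrite ExZ -IH.
Qed.

End ProductLaw.

(** * Last-passage times *)

Local Open Scope nat_scope.

(** Last-passage time from the corner to [(i, j)] by its recursion on the last step; the inner [fix]
    makes the recursion lexicographic. [lpp_lp] ties it to maxima over step sequences. *)
Fixpoint lp (w : nat -> nat -> nat) (i : nat) : nat -> nat :=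
  if i is i'.+1 then
    (fix col j := if j is j'.+1 then maxn (lp w i' j'.+1) (col j') + w i'.+1 j'.+1
                  else lp w i' 0 + w i'.+1 0)
  else (fix col j := if j is j'.+1 then col j' + w 0 j'.+1 else w 0 0).

Definition sh (a b : nat) (w : nat -> nat -> nat) : nat -> nat -> nat :=
  fun i j => w (a + i) (b + j).

Lemma lpS0 w i : lp w i.+1 0 = lp w i 0 + w i.+1 0. Proof. by []. Qed.
Lemma lp0S w j : lp w 0 j.+1 = lp w 0 j + w 0 j.+1. Proof. by []. Qed.
Lemma lpSS w i j :
  lp w i.+1 j.+1 = maxn (lp w i j.+1) (lp w i.+1 j) + w i.+1 j.+1.
Proof. by []. Qed.

Lemma lp00 w : lp w 0 0 = w 0 0. Proof. by []. Qed.
Lemma shE a b w i j : sh a b w i j = w (a + i) (b + j). Proof. by []. Qed.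
Arguments lp : simpl never.
Arguments sh : simpl never.

Lemma lp_ext w w' i j : (forall a b, a <= i -> b <= j -> w a b = w' a b) ->
  lp w i j = lp w' i j.
Proof.
elim: i j => [|i IHi] j; elim: j => [|j IHj] E.
- exact: E.
- by rewrite !lp0S IHj ?E // => a b ai bj; apply: E => //; apply: leqW.
- by rewrite !lpS0 IHi ?E // => a b ai bj; apply: E => //; apply: leqW.
rewrite !lpSS E // IHi ?IHj // => a b ai bj; apply: E => //; exact: leqW.
Qed.

Lemma lp_tr w i j : lp (fun a b => w b a) j i = lp w i j.
Proof.
elim: i j => [|i IHi] j; elim: j => [|j IHj] //.
- by rewrite lpS0 IHj lp0S.
- by rewrite lp0S IHi lpS0.
by rewrite !lpSS IHi IHj maxnC.
Qed.

Lemma lp_first0 w j : lp w 0 j.+1 = w 0 0 + lp (sh 0 1 w) 0 j.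
Proof. by elim: j => [//|j IH]; rewrite lp0S IH lp0S addnA. Qed.

Lemma lp_firstS w i : lp w i.+1 0 = w 0 0 + lp (sh 1 0 w) i 0.
Proof. by elim: i => [//|i IH]; rewrite lpS0 IH lpS0 addnA. Qed.

(** The same recursion on the first step: peeling rows, exits from an axis and half-turns all act at
    the starting corner. *)
Lemma lp_first w i j :
  lp w i.+1 j.+1 = w 0 0 + maxn (lp (sh 1 0 w) i j.+1) (lp (sh 0 1 w) i.+1 j).
Proof.
elim: i j => [|i IHi] j; elim: j => [|j IHj].
- rewrite lpSS !lp0S !lpS0 !lp00 !shE !add0n !add1n; lia.
- rewrite lpSS IHj (lp_first0 w) (lp0S (sh 1 0 w) j.+1) (lpSS (sh 0 1 w) 0 j) !shE !add0n !add1n; lia.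
- rewrite lpSS IHi (lp_firstS w) (lpSS (sh 1 0 w) i 0) (lpS0 (sh 0 1 w) i.+1) !shE !add0n !add1n; lia.
rewrite lpSS IHi IHj (lpSS (sh 1 0 w) i j.+1) (lpSS (sh 0 1 w) i.+1 j) !shE !add0n !add1n; lia.
Qed.

(** A half-turn reverses paths. For i.i.d. weights it turns bounds on moving the end point into
    bounds on moving the starting point. *)
Lemma lp_rot w i j : lp (fun a b => w (i - a) (j - b)) i j = lp w i j.
Proof.
elim: i j w => [|i IHi] j w; elim: j w => [|j IHj] w.
- by rewrite !lp00.
- rewrite lp0S lp_first0 sub0n subnn addnC; congr (_ + _).
  rewrite -(IHj (sh 0 1 w)); apply: lp_ext => a b a0 bj; rewrite shE; congr w; lia.
- rewrite lpS0 lp_firstS subnn sub0n addnC; congr (_ + _).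
  rewrite -(IHi 0 (sh 1 0 w)); apply: lp_ext => a b a0 bj; rewrite shE; congr w; lia.
rewrite lpSS lp_first !subnn addnC; congr (_ + maxn _ _).
  rewrite -(IHi j.+1 (sh 1 0 w)); apply: lp_ext => a b a0 bj; rewrite shE; congr w; lia.
rewrite -(IHj (sh 0 1 w)); apply: lp_ext => a b a0 bj; rewrite shE; congr w; lia.
Qed.

Lemma lp_up w i j : lp w i j + w i j.+1 <= lp w i j.+1.
Proof. by case: i => [|i]; rewrite ?lp0S ?lpSS //; lia. Qed.

Lemma lp_right w i j : lp w i j + w i.+1 j <= lp w i.+1 j.
Proof. by case: j => [|j]; rewrite ?lpS0 ?lpSS //; lia. Qed.

Lemma lp_le_right w i i' j : i <= i' -> lp w i j <= lp w i' j.
Proof.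
move=> /subnK <-; elim: (i' - i) => [//|k IH]; apply: (leq_trans IH).
by rewrite addSn; apply: leq_trans (lp_right _ _ _); apply: leq_addr.
Qed.

Lemma lp_le_up w i j j' : j <= j' -> lp w i j <= lp w i j'.
Proof.
move=> /subnK <-; elim: (j' - j) => [//|k IH]; apply: (leq_trans IH).
by rewrite addSn; apply: leq_trans (lp_up _ _ _); apply: leq_addr.
Qed.

(** The pieces are joined by a vertical step, so they use disjoint sets of rows and are independent
    under a product law. *)
Lemma lp_cat w i j k l :
  lp w i j + lp (sh i j.+1 w) k l <= lp w (i + k) (j.+1 + l).
Proof.
elim: k l => [|k IHk] l; elim: l => [|l IHl].
- by rewrite !addn0 lp00 shE !addn0; exact: lp_up.
- rewrite lp0S addnA addnS; have := lp_up w (i + 0) (j.+1 + l); move: IHl.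
  rewrite shE addnS; lia.
- rewrite lpS0 addnA [i + _]addnS; have := lp_right w (i + k) (j.+1 + 0); move: (IHk 0).
  rewrite shE addnS; lia.
rewrite lpSS !addnS lpSS.
have := IHk l.+1; rewrite shE !addnS; move: IHl; rewrite !addnS; lia.
Qed.

(** [k] is the column at which a maximal path leaves the bottom row. *)
Lemma lp_exit v i j : exists2 k, k <= i &
  lp v i j.+1 = \sum_(a < k.+1) v a 0 + lp (sh k 1 v) (i - k) j.
Proof.
elim: i v => [|i IH] v.
  by exists 0 => //; rewrite lp_first0 big_ord1 subn0; congr addn.
rewrite lp_first; case: (leqP (lp (sh 1 0 v) i j.+1) (lp (sh 0 1 v) i.+1 j)) => c.
  by exists 0 => //; rewrite big_ord1 subn0.
have [k ki ->] := IH (sh 1 0 v); exists k.+1 => //.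
by rewrite [in RHS]big_ord_recl subSS -addnA.
Qed.

(** Planar comparison: by the crossing of paths, an additional bottom row enlarges horizontal
    increments and reduces vertical ones. Both inequalities go through one induction, since each
    step of the max recursion for one needs the other. *)
Lemma remove_row v i j :
  lp v i j.+1 + lp (sh 0 1 v) i.+1 j <= lp v i.+1 j.+1 + lp (sh 0 1 v) i j /\
  lp v i j.+2 + lp (sh 0 1 v) i j <= lp v i j.+1 + lp (sh 0 1 v) i j.+1.
Proof.
have b1 a : lp v a 1 + lp (sh 0 1 v) a.+1 0 <= lp v a.+1 1 + lp (sh 0 1 v) a 0.
  rewrite lpSS (lpS0 (sh _ _ _)) shE add0n addn0; lia.
have b2 b : lp v 0 b.+2 + lp (sh 0 1 v) 0 b <= lp v 0 b.+1 + lp (sh 0 1 v) 0 b.+1.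
  rewrite lp0S (lp0S (sh _ _ _)) shE !add0n add1n; lia.
elim: i j => [|i IHi] j.
  split=> //; elim: j => [|j IHj]; first exact: b1.
  rewrite (lpSS v) (lpSS (sh _ _ _)); have := b2 j; rewrite !shE !add0n !add1n; lia.
split; last first.
  have [h1 h2] := IHi j; rewrite (lpSS v i j.+1) (lpSS (sh _ _ _)) !shE !add0n !add1n; lia.
elim: j => [|j IHj]; first exact: b1.
have [h1 h2] := IHi j.
have H2 : lp v i.+1 j.+2 + lp (sh 0 1 v) i.+1 j <= lp v i.+1 j.+1 + lp (sh 0 1 v) i.+1 j.+1.
  rewrite (lpSS v i j.+1) (lpSS (sh _ _ _)) !shE !add0n !add1n; lia.
rewrite (lpSS v i.+1 j.+1) (lpSS (sh _ _ _) i.+1 j) !shE !add0n !add1n; lia.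
Qed.

Lemma remove_row_h v i k j :
  lp (sh 0 1 v) (i + k) j - lp (sh 0 1 v) i j <= lp v (i + k) j.+1 - lp v i j.+1.
Proof.
elim: k => [|k IH]; first by rewrite addn0 !subnn.
rewrite addnS; have [h _] := remove_row v (i + k) j.
have := lp_le_right (sh 0 1 v) j (leq_addr k i).
have := lp_le_right v j.+1 (leq_addr k i).
have := lp_le_right v j.+1 (leqnSn (i + k)); lia.
Qed.

Lemma remove_row_v v i j k :
  lp v i (j + k).+1 - lp v i j.+1 <= lp (sh 0 1 v) i (j + k) - lp (sh 0 1 v) i j.
Proof.
elim: k => [|k IH]; first by rewrite addn0 !subnn.
rewrite addnS; have [_ h] := remove_row v i (j + k).
have := lp_le_up (sh 0 1 v) i (leq_addr k j).
have := lp_le_up v i (leq_addr k j.+1); rewrite addSn.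
have := lp_le_up (sh 0 1 v) i (leqnSn (j + k)); lia.
Qed.

(** * Passage times with prescribed axes, absorbed row by row *)

Definition bdw (S J : seq nat) (w : nat -> nat -> nat) (i j : nat) : nat :=
  match i, j with
  | 0, 0 => 0
  | i'.+1, 0 => nth 0 S i'
  | 0, j'.+1 => nth 0 J j'
  | i'.+1, j'.+1 => w i' j'
  end.

(** One row of the queueing map: a vertex with incoming horizontal increment [s], vertical increment
    [j] and weight [k] emits [k + (s - j)] and [k + (j - s)], which is the max recursion written in
    increments with truncated subtraction. *)
Fixpoint rowstep (S : seq nat) (j : nat) (r : seq nat) : seq nat :=
  match S, r with
  | s :: S', k :: r' => (k + (s - j)) :: rowstep S' (k + (j - s)) r'
  | _, _ => [::]
  end.

Fixpoint rowJ (S : seq nat) (j : nat) (r : seq nat) (i : nat) : nat :=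
  match i, S, r with
  | i'.+1, s :: S', k :: r' => rowJ S' (k + (j - s)) r' i'
  | _, _, _ => j
  end.

Lemma size_rowstep S j r : size (rowstep S j r) = minn (size S) (size r).
Proof. by elim: S j r => [|s S IH] j [|k r] //=; rewrite ?minn0 ?IH ?minnSS. Qed.

Lemma nth_rowstep S j r i : i < size S -> i < size r ->
  nth 0 (rowstep S j r) i = nth 0 r i + (nth 0 S i - rowJ S j r i).
Proof. by elim: S j r i => [|s S IH] j [|k r] [|i] //= iS ir; rewrite IH. Qed.

Lemma rowJS S j r i : i < size S -> i < size r ->
  rowJ S j r i.+1 = nth 0 r i + (rowJ S j r i - nth 0 S i).
Proof.
elim: S j r i => [|s S IH] j [|k r] [|i] // iS ir; first by case: S {IH iS} => [|? ?]; case: r {ir}.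
rewrite [LHS]/= [RHS]/=; exact: IH.
Qed.

Lemma lp_bdw0 S J w i : i <= size S -> lp (bdw S J w) i 0 = sumn (take i S).
Proof.
elim: i => [|i IH] iS; first by rewrite take0.
by rewrite lpS0 IH ?(ltnW iS) // (take_nth 0 iS) sumn_rcons.
Qed.

Definition rowof (w : nat -> nat -> nat) (M : nat) : seq nat := mkseq (fun a => w a 0) M.

Lemma lp_bdw1 S j J w i : i <= size S ->
  lp (bdw S (j :: J) w) i 1 = sumn (take i S) + rowJ S j (rowof w (size S)) i /\
  lp (bdw S (j :: J) w) i 1 = j + sumn (take i (rowstep S j (rowof w (size S)))).
Proof.
elim: i => [|i IH] iS.
  by rewrite lp0S !take0 /= addn0; case: S {iS}.
have sr : size (rowof w (size S)) = size S by rewrite size_mkseq.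
have [h1 h2] := IH (ltnW iS).
rewrite lpSS lp_bdw0 // (take_nth 0 iS) sumn_rcons rowJS ?sr //.
rewrite (take_nth 0) ?size_rowstep ?sr ?minnn // sumn_rcons nth_rowstep ?sr //.
have -> : bdw S (j :: J) w i.+1 1 = nth 0 (rowof w (size S)) i by rewrite nth_mkseq.
move: h1 h2; lia.
Qed.

(** Absorbing the first row leaves the same model with one row less, its horizontal axis replaced by
    the increments along that row. This is what allows Burke invariance to be iterated. *)
Lemma lp_peel S j J w i N : i <= size S ->
  lp (bdw S (j :: J) w) i N.+1 =
  j + lp (bdw (rowstep S j (rowof w (size S))) J (sh 0 1 w)) i N.
Proof.
have sz : size (rowstep S j (rowof w (size S))) = size S.
  by rewrite size_rowstep size_mkseq minnn.
elim: N i => [|N IHN] i.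
  by move=> iS; rewrite lp_bdw0 ?sz //; case: (lp_bdw1 j J w iS).
elim: i => [|i IHi] iS; first by rewrite lp0S IHN // lp0S addnA.
rewrite lpSS IHi ?(ltnW iS) // IHN // lpSS /= shE add0n add1n; lia.
Qed.

(** The horizontal increments of the passage time along row [N]; see [lp_bdw]. *)
Fixpoint topl (N : nat) (S J : seq nat) (w : nat -> nat -> nat) : seq nat :=
  if N is N'.+1
  then topl N' (rowstep S (head 0 J) (rowof w (size S))) (behead J) (sh 0 1 w)
  else S.

Lemma size_topl N S J w : size (topl N S J w) = size S.
Proof.
by elim: N S J w => [|N IH] S J w //=; rewrite IH size_rowstep size_mkseq minnn.
Qed.

Lemma lp_bdw N S J w i : i <= size S -> N <= size J ->
  lp (bdw S J w) i N = sumn (take N J) + sumn (take i (topl N S J w)).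
Proof.
elim: N S J w => [|N IH] S J w iS NJ; first by rewrite take0 lp_bdw0.
case: J NJ => [//|j J] NJ; rewrite lp_peel // IH //=; first by rewrite addnA.
by rewrite size_rowstep size_mkseq minnn.
Qed.

(** * From step sequences to the recursion *)

Definition arr (w : int * int -> nat) : nat -> nat -> nat :=
  fun i j => w (i%:Z, j%:Z)%R.

Lemma path_weight_rcons w s b : path_weight w (rcons s b) =
  path_weight w s + w ((count id (rcons s b))%:Z, (count negb (rcons s b))%:Z)%R.
Proof.
rewrite /path_weight size_rcons big_ord_recr /=; congr (_ + _); last first.
  by rewrite /path_vertex take_oversize ?size_rcons.
apply: eq_bigr => k _; congr w; rewrite /path_vertex -cats1 takel_cat //.
by rewrite -ltnS.
Qed.

Lemma path_weight_le w s :
  path_weight w s <= lp (arr w) (count id s) (count negb s).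
Proof.
elim/last_ind: s => [|s b IH].
  by rewrite /path_weight big_ord1.
rewrite path_weight_rcons -!cats1 !count_cat /=.
case: b => /=; rewrite !addn0 addn1.
  by apply: leq_trans (lp_right _ _ _); rewrite leq_add2r.
by apply: leq_trans (lp_up _ _ _); rewrite leq_add2r.
Qed.

Lemma path_weight_ex w i j : exists s,
  [/\ count id s = i, count negb s = j & path_weight w s = lp (arr w) i j].
Proof.
have R : forall s b, [/\ count id (rcons s b) = count id s + b,
   count negb (rcons s b) = count negb s + ~~ b &
   path_weight w (rcons s b) =
   path_weight w s + arr w (count id s + b) (count negb s + ~~ b)].
  by move=> s b; rewrite path_weight_rcons -!cats1 !count_cat /= !addn0.
elim: i j => [|i IHi] j; elim: j => [|j [s [s1 s2 s3]]].
- by exists [::]; rewrite /path_weight big_ord1.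
- exists (rcons s false); have [-> -> ->] := R s false.
  by rewrite s1 s2 s3 addn0 addn1 lp0S.
- have [s [s1 s2 s3]] := IHi 0; exists (rcons s true); have [-> -> ->] := R s true.
  by rewrite s1 s2 s3 addn0 addn1 lpS0.
have [s' [s1' s2' s3']] := IHi j.+1.
rewrite lpSS; case: (leqP (lp (arr w) i j.+1) (lp (arr w) i.+1 j)) => c.
  exists (rcons s false); have [-> -> ->] := R s false.
  by rewrite s1 s2 s3 addn0 addn1.
exists (rcons s' true); have [-> -> ->] := R s' true.
by rewrite s1' s2' s3' addn0 addn1.
Qed.

Lemma lpp_lp w n : lpp w n = lp (arr w) n n.
Proof.
apply/eqP; rewrite eqn_leq; apply/andP; split.
  apply/bigmax_leqP => s /eqP sn; apply: leq_trans (path_weight_le _ _) _.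
  have := count_predC id s; rewrite size_tuple sn => /addnI h.
  by rewrite (_ : count negb s = n).
have [s [s1 s2 <-]] := path_weight_ex w n n.
have sz : size s == n + n by rewrite -(count_predC id s) s1 -s2.
by apply: (@leq_bigmax_cond _ _ (fun s : (n + n).-tuple bool => path_weight w s) (Tuple sz)); apply/eqP.
Qed.

Local Open Scope ring_scope.

(** * The boundary model and Burke invariance *)

Section BoxLaw.
Variable R : realType.

Definition consrow (row : seq nat) (w : nat -> nat -> nat) (i j : nat) : nat :=
  if j is j'.+1 then w i j' else nth 0%N row i.

(** Expectation over an i.i.d. array with [M] columns and [N] rows, built by rows to match
    [lp_peel]. Entries outside the box are 0, and [boxed] singles out the functionals that do not
    see them. *)
Fixpoint Q (rng : seq nat) (m : nat -> R) (M N : nat)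
    (E : (nat -> nat -> nat) -> R) : R :=
  if N is N'.+1
  then EL rng (nseq M m) (fun row => Q rng m M N' (fun w => E (consrow row w)))
  else E (fun _ _ => 0%N).

Definition boxed (X : Type) (M N : nat) (E : (nat -> nat -> nat) -> X) :=
  forall w w', (forall i j, (i < M)%N -> (j < N)%N -> w i j = w' i j) -> E w = E w'.

Lemma boxed_consrow (X : Type) M N (E : _ -> X) row : boxed M N.+1 E ->
  boxed M N (fun w => E (consrow row w)).
Proof. by move=> bE w w' ww; apply: bE => i [|j] iM jN //=; apply: ww. Qed.

Lemma EL_Q rng m M N E : boxed M N E ->
  EL rng (nseq (N * M) m) (fun l => E (fun i j => nth 0%N l (j * M + i)%N)) = Q rng m M N E.
Proof.
elim: N E => [|N IH] E bE /=.
  exact: bE.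
rewrite mulSn nseqD EL_cat; apply: eq_EL => l; rewrite size_nseq => sl _.
rewrite -IH; last exact: boxed_consrow.
apply: eq_EL' => l'; apply: bE => i [|j] iM jN /=.
  by rewrite mul0n add0n nth_cat sl iM.
rewrite mulSn nth_cat sl -addnA ltnNge leq_addr /=; congr nth; lia.
Qed.

Lemma Ex_Q (I A : finType) (h : A -> nat) (m : nat -> R) (sg : nat -> nat -> I) M N E :
  \sum_a m (h a) = 1 -> boxed M N E ->
  (forall i j i' j', (i < M)%N -> (j < N)%N -> (i' < M)%N -> (j' < N)%N ->
     sg i j = sg i' j' -> i = i' /\ j = j') ->
  Ex (fun _ a => m (h a)) (fun x : {ffun I -> A} => E (fun i j => h (x (sg i j))))
  = Q [seq h a | a <- enum A] m M N E.
Proof.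
move=> m1 bE inj.
pose s := [seq sg (k %% M)%N (k %/ M)%N | k <- iota 0 (N * M)].
have us : uniq s.
  rewrite map_inj_in_uniq ?iota_uniq // => k k'; rewrite !mem_iota !add0n => /= kl kl' e.
  have M0 : (0 < M)%N by case: (M) kl => //; rewrite muln0.
  have [] := inj _ _ _ _ _ _ _ _ e; rewrite ?ltn_pmod ?ltn_divLR //.
  by move=> e1 e2; rewrite (divn_eq k M) (divn_eq k' M) e1 e2.
rewrite -EL_Q //.
have -> : nseq (N * M) m = [seq m | i <- s].
  have -> : [seq m | _ <- s] = nseq (size s) m by elim: (s) => //= x t ->.
  by rewrite !size_map size_iota.
rewrite -(Ex_law (m := fun=> m)) //.
apply: eq_Ex => x; apply: bE => i j iM jN.
have lt : (j * M + i < N * M)%N.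
  by apply: (@leq_trans (j * M + M)%N); rewrite ?ltn_add2l // -mulSnr leq_mul2r jN orbT.
have M0 : (0 < M)%N by apply: leq_ltn_trans iM.
rewrite (nth_map (sg 0%N 0%N)) ?size_map ?size_iota // (nth_map 0%N) ?size_iota //.
by rewrite nth_iota // add0n modnMDl modn_small // divnMDl // divn_small // addn0.
Qed.

(** An injective relabelling of cells preserves an i.i.d. array; shifts, transposition, half-turns
    and restriction to sub-boxes are instances. The detour through [Ex] makes the relabelling a mere
    change of the list of indices. *)
Lemma Q_sub c (m : nat -> R) M N M' N' (sg : nat -> nat -> nat * nat) E :
  \sum_(k <- iota 0 c) m k = 1 -> boxed M' N' E ->
  (forall i j, (i < M')%N -> (j < N')%N -> ((sg i j).1 < M)%N /\ ((sg i j).2 < N)%N) ->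
  (forall i j i' j', (i < M')%N -> (j < N')%N -> (i' < M')%N -> (j' < N')%N ->
     sg i j = sg i' j' -> i = i' /\ j = j') ->
  Q (iota 0 c) m M N (fun w => E (fun i j => w (sg i j).1 (sg i j).2)) =
  Q (iota 0 c) m M' N' E.
Proof.
move=> m1 bE sgb sgi.
have m1' : \sum_(a < c) m (val a) = 1.
  by rewrite -[RHS]m1 -val_enum_ord big_map big_enum.
have io : iota 0 c = [seq val a | a <- enum 'I_c] by rewrite val_enum_ord.
(* One extra row and one extra column keep the ordinal types inhabited for [inord]. *)
rewrite io -(@Ex_Q _ _ val m (fun i j => (inord i, inord j) : 'I_M.+1 * 'I_N.+1)) //.
- rewrite -(@Ex_Q _ _ val m (fun i j => (inord (sg i j).1, inord (sg i j).2)
     : 'I_M.+1 * 'I_N.+1)) // => i j i' j' iM jN iM' jN' [].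
  have [a1 a2] := sgb _ _ iM jN; have [b1 b2] := sgb _ _ iM' jN'.
  move=> /(congr1 val) /= e1 /(congr1 val) /= e2.
  apply: sgi => //; rewrite [sg i j]surjective_pairing [sg i' j']surjective_pairing.
  move: e1 e2; rewrite !inordK ?ltnS ?(ltnW a1) ?(ltnW a2) ?(ltnW b1) ?(ltnW b2) //.
  by move=> -> ->.
- by move=> w w' ww; apply: bE => i j iM jN; have [a1 a2] := sgb _ _ iM jN; apply: ww.
move=> i j i' j' iM jN iM' jN' [] /(congr1 val) /= e1 /(congr1 val) /= e2.
by move: e1 e2; rewrite !inordK ?ltnS ?(ltnW iM) ?(ltnW jN) ?(ltnW iM') ?(ltnW jN').
Qed.

Lemma eq_Q rng m M N E E' : (forall w, E w = E' w) -> Q rng m M N E = Q rng m M N E'.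
Proof.
elim: N E E' => [|N IH] E E' EE /=; first exact: EE.
by apply: eq_EL' => l; apply: IH => w; apply: EE.
Qed.

Lemma le_Q rng m M N E E' : (forall a, 0 <= m a) -> (forall w, E w <= E' w) ->
  Q rng m M N E <= Q rng m M N E'.
Proof.
move=> m0; elim: N E E' => [|N IH] E E' EE /=; first exact: EE.
apply: le_EL => [k a _|l _ _]; last by apply: IH => w; apply: EE.
by rewrite nth_nseq; case: ifP.
Qed.

Lemma QZ rng m M N c E : Q rng m M N (fun w => c * E w) = c * Q rng m M N E.
Proof.
elim: N E => [|N IH] E //=; rewrite -ELZ; apply: eq_EL' => l.
exact: (IH (fun w => E (consrow l w))).
Qed.

Lemma QD rng m M N E E' :
  Q rng m M N (fun w => E w + E' w) = Q rng m M N E + Q rng m M N E'.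
Proof.
elim: N E E' => [|N IH] E E' //=; rewrite -ELD; apply: eq_EL' => l.
exact: (IH (fun w => E (consrow l w)) (fun w => E' (consrow l w))).
Qed.

Lemma Q_sum rng m M N (J : Type) (r : seq J) (P : pred J) (E : J -> _ -> R) :
  Q rng m M N (fun w => \sum_(j <- r | P j) E j w) = \sum_(j <- r | P j) Q rng m M N (E j).
Proof.
elim: N E => [|N IH] E //=; rewrite -EL_sum; apply: eq_EL' => l.
exact: (IH (fun j w => E j (consrow l w))).
Qed.

Lemma EL_nseq_scale X (rng : seq X) n (c : R) (m : X -> R) F :
  EL rng (nseq n (fun a => c * m a)) F = c ^+ n * EL rng (nseq n m) F.
Proof.
elim: n F => [|n IH] F /=; first by rewrite expr0 mul1r.
rewrite exprS big_distrr /=; apply: eq_bigr => a _; rewrite IH; ring.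
Qed.

Lemma Q_scale rng (c : R) m M N E :
  Q rng (fun a => c * m a) M N E = c ^+ (M * N) * Q rng m M N E.
Proof.
elim: N E => [|N IH] E /=; first by rewrite muln0 expr0 mul1r.
rewrite EL_nseq_scale mulnS exprD -mulrA; congr (_ * _).
rewrite -ELZ; apply: eq_EL' => l; exact: IH.
Qed.

Lemma EL_nseq_ge0 (rng : seq nat) n (m : nat -> R) F : (forall a, 0 <= m a) ->
  (forall l, 0 <= F l) -> 0 <= EL rng (nseq n m) F.
Proof.
move=> m0; elim: n F => [|n IH] F F0 /=; first exact: F0.
by apply: sumr_ge0 => a _; apply: mulr_ge0 => //; apply: IH.
Qed.

Lemma Q_ge0 rng m M N E : (forall a, 0 <= m a) -> (forall w, 0 <= E w) ->
  0 <= Q rng m M N E.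
Proof.
move=> m0; elim: N E => [|N IH] E E0 /=; first exact: E0.
by apply: EL_nseq_ge0 => // l; apply: IH.
Qed.

Lemma le_EL_nseq (rng : seq nat) n (m : nat -> R) F G : (forall a, 0 <= m a) ->
  (forall l, size l = n -> F l <= G l) -> EL rng (nseq n m) F <= EL rng (nseq n m) G.
Proof.
move=> m0 FG; apply: le_EL => [k a _|l]; first by rewrite nth_nseq; case: ifP.
by rewrite size_nseq => sl _; apply: FG.
Qed.

Lemma le_sum_iota c C (f : nat -> R) : (c <= C)%N -> (forall k, 0 <= f k) ->
  \sum_(k <- iota 0 c) f k <= \sum_(k <- iota 0 C) f k.
Proof.
move=> cC f0; rewrite -(subnKC cC) iotaD big_cat /= lerDl.
by apply: sumr_ge0 => k _.
Qed.

Lemma le_EL_range c C n (m : nat -> R) F : (c <= C)%N -> (forall a, 0 <= m a) ->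
  (forall l, 0 <= F l) -> EL (iota 0 c) (nseq n m) F <= EL (iota 0 C) (nseq n m) F.
Proof.
move=> cC m0; elim: n F => [|n IH] F F0 //=.
apply: (@le_trans _ _ (\sum_(k <- iota 0 c) m k * EL (iota 0 C) (nseq n m) (fun l => F (k :: l)))).
  by apply: ler_sum => k _; apply: ler_wpM2l => //; apply: IH.
apply: le_sum_iota => // k; apply: mulr_ge0 => //; exact: EL_nseq_ge0.
Qed.

Lemma sum_inj_le (T U : eqType) (s : seq T) (t : seq U) (h : T -> U) (F : U -> R) :
  uniq s -> uniq t -> {in s &, injective h} -> {in s, forall x, h x \in t} ->
  (forall y, 0 <= F y) -> \sum_(x <- s) F (h x) <= \sum_(y <- t) F y.
Proof.
move=> us ut hi hst F0.
rewrite -(big_map h xpredT F).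
have pe : perm_eq (map h s) [seq y <- t | y \in map h s].
  apply: uniq_perm; rewrite ?filter_uniq ?map_inj_in_uniq // => y.
  rewrite mem_filter; case: (boolP (y \in map h s)) => //= /mapP [x xs ->].
  by rewrite hst.
rewrite (perm_big _ pe) /= big_filter [leRHS](bigID (fun y => y \in map h s)) /= lerDl.
by apply: sumr_ge0 => y _.
Qed.

End BoxLaw.

(** * Burke's theorem for weights cut at a finite level *)

Section Burke.
Variable R : realType.

Definition pwr (r : R) : nat -> R := fun k => r ^+ k.

(** The heart of Burke's theorem: (i, j, k) -> (k + (i - j)^+, k + (j - i)^+, min(i, j)) is an
    involution that preserves a^i b^j (ab)^k. On finite ranges the image of a box only fits into a
    larger box, so invariance becomes an inequality. *)
Lemma vertex_le (a b : R) ci cj ck di dj dk (g : nat -> nat -> nat -> R) :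
  0 <= a -> 0 <= b -> (forall i j k, 0 <= g i j k) ->
  (ci + cj + ck <= di)%N -> (ci + cj + ck <= dj)%N -> (ci + cj + ck <= dk)%N ->
  \sum_(i <- iota 0 ci) \sum_(j <- iota 0 cj) \sum_(k <- iota 0 ck)
     a ^+ i * b ^+ j * (a * b) ^+ k * g (k + (i - j))%N (k + (j - i))%N (minn i j)
  <= \sum_(i <- iota 0 di) \sum_(j <- iota 0 dj) \sum_(k <- iota 0 dk)
     a ^+ i * b ^+ j * (a * b) ^+ k * g i j k.
Proof.
move=> a0 b0 g0 h1 h2 h3.
pose G (t : nat * (nat * nat)) : R :=
  a ^+ t.1 * b ^+ t.2.1 * (a * b) ^+ t.2.2 * g t.1 t.2.1 t.2.2.
pose h (t : nat * (nat * nat)) : nat * (nat * nat) :=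
  ((t.2.2 + (t.1 - t.2.1))%N, ((t.2.2 + (t.2.1 - t.1))%N, minn t.1 t.2.1)).
pose box c1 c2 c3 : seq (nat * (nat * nat)) :=
  [seq (i, p) | i <- iota 0 c1, p <- [seq (j, k) | j <- iota 0 c2, k <- iota 0 c3]].
have E c1 c2 c3 (F : nat * (nat * nat) -> R) :
    \sum_(i <- iota 0 c1) \sum_(j <- iota 0 c2) \sum_(k <- iota 0 c3) F (i, (j, k))
    = \sum_(t <- box c1 c2 c3) F t.
  rewrite /box big_allpairs; apply: eq_bigr => i _; by rewrite big_allpairs.
have hG t : G (h t) = a ^+ t.1 * b ^+ t.2.1 * (a * b) ^+ t.2.2 *
     g (t.2.2 + (t.1 - t.2.1))%N (t.2.2 + (t.2.1 - t.1))%N (minn t.1 t.2.1).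
  rewrite /G /h /=; congr (_ * _); case: t => i [j k] /=.
  rewrite !exprMn.
  have ei : a ^+ (k + (i - j)) * a ^+ minn i j = a ^+ i * a ^+ k by rewrite -!exprD; congr (_ ^+ _); lia.
  have ej : b ^+ (k + (j - i)) * b ^+ minn i j = b ^+ j * b ^+ k by rewrite -!exprD; congr (_ ^+ _); lia.
  by rewrite mulrACA ei ej mulrACA.
have mb c1 c2 c3 i j k : ((i, (j, k)) \in box c1 c2 c3) = [&& i < c1, j < c2 & k < c3]%N.
  apply/allpairsP/idP => [[[i' p] /= []]|/and3P[h4 h5 h6]].
    rewrite mem_iota add0n => i1 /allpairsP[[j' k'] /= []]; rewrite !mem_iota !add0n => j1 k1 -> [-> -> ->].
    by apply/and3P.
  exists (i, (j, k)) => /=; rewrite mem_iota; split=> //.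
  by apply/allpairsP; exists (j, k); rewrite /= !mem_iota.
have ub c1 c2 c3 : uniq (box c1 c2 c3).
  apply: allpairs_uniq; rewrite ?iota_uniq //; last by move=> [? ?] [? ?] _ _ /= [-> ->].
  by apply: allpairs_uniq; rewrite ?iota_uniq //; move=> [? ?] [? ?] _ _ /= [-> ->].
rewrite (E di dj dk G).
rewrite (E ci cj ck (fun t => a ^+ t.1 * b ^+ t.2.1 * (a * b) ^+ t.2.2 *
     g (t.2.2 + (t.1 - t.2.1))%N (t.2.2 + (t.2.1 - t.1))%N (minn t.1 t.2.1))).
under eq_bigr do rewrite -hG.
apply: sum_inj_le => //.
- move=> [i [j k]] [i' [j' k']] _ _ []; rewrite /= => e1 e2 e3; congr (_, (_, _)); lia.
- move=> [i [j k]]; rewrite !mb => /and3P[? ? ?]; apply/and3P; split; rewrite /=; lia.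
by move=> t; rewrite /G !mulr_ge0 ?exprn_ge0 ?mulr_ge0.
Qed.

(** Unnormalised law of the outgoing row when the incoming row, the vertical increment and the bulk
    row have parameters a, b and ab; the vertical increment leaving on the right is summed out. *)
Definition RS (a b : R) ci cj ck M (F : seq nat -> R) :=
  EL (iota 0 ci) (nseq M (pwr a)) (fun S => \sum_(j <- iota 0 cj) b ^+ j *
    EL (iota 0 ck) (nseq M (pwr (a * b))) (fun r => F (rowstep S j r))).

Lemma RSS (a b : R) ci cj ck M F : RS a b ci cj ck M.+1 F =
  \sum_(i <- iota 0 ci) \sum_(j <- iota 0 cj) \sum_(k <- iota 0 ck)
     a ^+ i * b ^+ j * (a * b) ^+ k *
     EL (iota 0 ci) (nseq M (pwr a)) (fun S => EL (iota 0 ck) (nseq M (pwr (a * b)))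
        (fun r => F ((k + (i - j))%N :: rowstep S (k + (j - i)) r))).
Proof.
rewrite /RS /=; apply: eq_bigr => i _.
rewrite EL_sum big_distrr /=; apply: eq_bigr => j _.
rewrite ELZ.
under eq_EL' do under eq_bigr do rewrite -ELZ.
rewrite EL_sum !big_distrr /=; apply: eq_bigr => k _.
under eq_EL' do rewrite ELZ.
by rewrite ELZ /pwr; ring.
Qed.

Lemma RSsum (a b : R) di dj dk ci ck M (F : seq nat -> R) :
  \sum_(i <- iota 0 di) \sum_(j <- iota 0 dj) \sum_(k <- iota 0 dk)
     a ^+ i * b ^+ j * (a * b) ^+ k *
     EL (iota 0 ci) (nseq M (pwr a)) (fun S => EL (iota 0 ck) (nseq M (pwr (a * b)))
        (fun r => F (i :: rowstep S j r)))
  = (\sum_(k <- iota 0 dk) (a * b) ^+ k) *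
    \sum_(i <- iota 0 di) a ^+ i * RS a b ci dj ck M (fun l => F (i :: l)).
Proof.
rewrite mulr_sumr; apply: eq_bigr => i _.
rewrite /RS EL_sum !mulr_sumr; apply: eq_bigr => j _; rewrite ELZ.
rewrite -mulr_suml -mulr_sumr; ring.
Qed.

Lemma RS_ge0 (a b : R) ci cj ck M F : 0 <= a -> 0 <= b -> (forall l, 0 <= F l) ->
  0 <= RS a b ci cj ck M F.
Proof.
move=> a0 b0 F0; apply: EL_nseq_ge0 => [k|S]; first exact: exprn_ge0.
apply: sumr_ge0 => j _; apply: mulr_ge0; first exact: exprn_ge0.
by apply: EL_nseq_ge0 => // k; rewrite exprn_ge0 // mulr_ge0.
Qed.

Lemma mul_swap4 (x y z t : R) : x * (y * z) * t = y * (x * z * t).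
Proof. ring. Qed.

(** After [vertex_le] at the first vertex, the emitted vertical increment has weight b again and is
    independent of the emitted horizontal one, so the induction applies to the remaining columns.
    The prefactors are the masses of the summed-out variables. *)
Lemma burke_up (a b : R) M ci cj ck : 0 <= a -> 0 <= b ->
  exists C, forall F : seq nat -> R, (forall l, 0 <= F l) -> RS a b ci cj ck M F <=
  (\sum_(k <- iota 0 C) b ^+ k) * (\sum_(k <- iota 0 C) (a * b) ^+ k) ^+ M
   * EL (iota 0 C) (nseq M (pwr a)) F.
Proof.
move=> a0 b0; have ab0 : 0 <= a * b by rewrite mulr_ge0.
elim: M ci cj ck => [|M IH] ci cj ck.
  by exists cj => F F0; rewrite /RS /= expr0 mulr1 mulr_suml.
pose C1 := (ci + cj + ck)%N; have [C2 hC2] := IH ci C1 ck.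
exists (maxn C1 C2) => F F0; set C := maxn C1 C2.
rewrite RSS.
have S0 (r : R) n : 0 <= r -> 0 <= \sum_(k <- iota 0 n) r ^+ k.
  by move=> r0; apply: sumr_ge0 => k _; apply: exprn_ge0.
have Sle (r : R) n : 0 <= r -> (n <= C)%N -> \sum_(k <- iota 0 n) r ^+ k <= \sum_(k <- iota 0 C) r ^+ k.
  by move=> r0 nC; apply: le_sum_iota => // k; apply: exprn_ge0.
pose g i j := EL (iota 0 ci) (nseq M (pwr a)) (fun S => EL (iota 0 ck) (nseq M (pwr (a * b)))
        (fun r => F (i :: rowstep S j r))).
have g0 i j : 0 <= g i j.
  by do 2 (apply: EL_nseq_ge0 => [k|?]; first by rewrite /pwr exprn_ge0).
apply: le_trans (@vertex_le a b ci cj ck C1 C1 C1 (fun i j _ => g i j) a0 b0 _ _ _ _) _ => //.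
rewrite RSsum exprS mul_swap4 [EL _ (nseq M.+1 _) _]/=; apply: ler_pM; rewrite ?S0 //.
- by apply: sumr_ge0 => i _; rewrite mulr_ge0 ?exprn_ge0 ?RS_ge0.
- by apply: Sle => //; exact: leq_maxl.
rewrite mulr_sumr.
apply: (@le_trans _ _ (\sum_(i <- iota 0 C1) a ^+ i * ((\sum_(k <- iota 0 C) b ^+ k) *
   (\sum_(k <- iota 0 C) (a * b) ^+ k) ^+ M * EL (iota 0 C) (nseq M (pwr a)) (fun l => F (i :: l))))).
  apply: ler_sum => i _; apply: ler_wpM2l; first exact: exprn_ge0.
  apply: le_trans (hC2 (fun l => F (i :: l)) _) _ => //.
  have C2C : (C2 <= C)%N by exact: leq_maxr.
  apply: ler_pM; rewrite ?mulr_ge0 ?exprn_ge0 ?S0 //.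
  + by apply: EL_nseq_ge0 => // k; rewrite /pwr exprn_ge0.
  + by apply: ler_pM; rewrite ?exprn_ge0 ?S0 ?Sle // lerXn2r ?nnegrE ?S0 ?Sle.
  by apply: le_EL_range => // k; rewrite /pwr exprn_ge0.
rewrite [leRHS](_ : _ = \sum_(i <- iota 0 C) a ^+ i * ((\sum_(k <- iota 0 C) b ^+ k) *
   (\sum_(k <- iota 0 C) (a * b) ^+ k) ^+ M * EL (iota 0 C) (nseq M (pwr a)) (fun l => F (i :: l)))); last first.
  by apply: eq_bigr => i _; rewrite /pwr; ring.
apply: le_sum_iota => [|i]; first exact: leq_maxl.
rewrite !mulr_ge0 ?exprn_ge0 ?S0 //.
by apply: EL_nseq_ge0 => // k; rewrite /pwr exprn_ge0.
Qed.

Lemma burke_lo (a b : R) M c : 0 <= a -> 0 <= b ->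
  exists C, forall ci cj ck, (C <= ci)%N -> (C <= cj)%N -> (C <= ck)%N ->
  forall F : seq nat -> R, (forall l, 0 <= F l) ->
  (\sum_(k <- iota 0 c) b ^+ k) * (\sum_(k <- iota 0 c) (a * b) ^+ k) ^+ M
   * EL (iota 0 c) (nseq M (pwr a)) F <= RS a b ci cj ck M F.
Proof.
move=> a0 b0; have ab0 : 0 <= a * b by rewrite mulr_ge0.
elim: M => [|M [C1 IH]].
  exists c => ci cj ck h1 h2 h3 F F0; rewrite /RS /= expr0 mulr1 mulr_suml.
  by apply: le_sum_iota => // k; rewrite mulr_ge0 ?exprn_ge0.
exists (c + C1 + c)%N => ci cj ck h1 h2 h3 F F0.
have S0 (r : R) n : 0 <= r -> 0 <= \sum_(k <- iota 0 n) r ^+ k.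
  by move=> r0; apply: sumr_ge0 => k _; apply: exprn_ge0.
pose g i j := EL (iota 0 ci) (nseq M (pwr a)) (fun S => EL (iota 0 ck) (nseq M (pwr (a * b)))
        (fun r => F (i :: rowstep S j r))).
have g0 i j : 0 <= g i j.
  by do 2 (apply: EL_nseq_ge0 => [k|?]; first by rewrite /pwr exprn_ge0).
apply: (@le_trans _ _ (\sum_(i <- iota 0 c) \sum_(j <- iota 0 C1) \sum_(k <- iota 0 c)
     a ^+ i * b ^+ j * (a * b) ^+ k * g i j)).
  rewrite RSsum exprS mul_swap4 [EL _ (nseq M.+1 _) _]/=; apply: ler_wpM2l; rewrite ?S0 //.
  rewrite mulr_sumr; apply: ler_sum => i _; rewrite mulrCA.
  apply: ler_wpM2l; first by rewrite exprn_ge0.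
  by apply: IH => //; lia.
rewrite RSS.
(* the vertex map is an involution: apply the inequality to its inverse *)
apply: le_trans (@vertex_le a b c C1 c ci cj ck
  (fun i j k => g (k + (i - j))%N (k + (j - i))%N) a0 b0 _ h1 h2 h3) => //.
rewrite le_eqVlt; apply/orP; left; apply/eqP.
apply: eq_bigr => i _; apply: eq_bigr => j _; apply: eq_bigr => k _; congr (_ * g _ _); lia.
Qed.

Definition BR (b q : R) c M N S (F : seq nat -> R) :=
  EL (iota 0 c) (nseq N (pwr b)) (fun J =>
    Q (iota 0 c) (pwr q) M N (fun w => F (topl N S J w))).

Lemma BRS (b q : R) c M N S F : size S = M ->
  BR b q c M N.+1 S F = \sum_(j <- iota 0 c) b ^+ j *
    EL (iota 0 c) (nseq M (pwr q)) (fun r => BR b q c M N (rowstep S j r) F).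
Proof.
move=> sS; rewrite /BR /=; apply: eq_bigr => j _; congr (_ * _).
rewrite EL_exch; apply: eq_EL => r; rewrite size_nseq => sr _.
apply: eq_EL' => J; apply: eq_Q => w.
by have -> : rowof (consrow r w) (size S) = r by rewrite sS -sr; exact: (mkseq_nth 0%N).
Qed.

Lemma BR_ge0 (b q : R) c M N S F : 0 <= b -> 0 <= q -> (forall l, 0 <= F l) ->
  0 <= BR b q c M N S F.
Proof.
move=> b0 q0 F0; apply: EL_nseq_ge0 => [k|J]; first exact: exprn_ge0.
by apply: Q_ge0 => // k; exact: exprn_ge0.
Qed.

Lemma BR_up (a b : R) M N ci c : 0 <= a -> 0 <= b ->
  exists C, forall F : seq nat -> R, (forall l, 0 <= F l) ->
  EL (iota 0 ci) (nseq M (pwr a)) (fun S => BR b (a * b) c M N S F) <=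
  (\sum_(k <- iota 0 C) b ^+ k) ^+ N * (\sum_(k <- iota 0 C) (a * b) ^+ k) ^+ (M * N)
   * EL (iota 0 C) (nseq M (pwr a)) F.
Proof.
move=> a0 b0; have ab0 : 0 <= a * b by rewrite mulr_ge0.
elim: N ci => [|N IH] ci.
  by exists ci => F F0; rewrite /BR /= muln0 !expr0 !mul1r.
have [C1 hC1] := burke_up M ci c c a0 b0; have [C2 hC2] := IH C1.
exists (maxn C1 C2) => F F0; set C := maxn C1 C2.
have S0 (r : R) n : 0 <= r -> 0 <= \sum_(k <- iota 0 n) r ^+ k.
  by move=> r0; apply: sumr_ge0 => k _; apply: exprn_ge0.
have Sle (r : R) n : 0 <= r -> (n <= C)%N -> \sum_(k <- iota 0 n) r ^+ k <= \sum_(k <- iota 0 C) r ^+ k.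
  by move=> r0 nC; apply: le_sum_iota => // k; apply: exprn_ge0.
apply: (@le_trans _ _ (RS a b ci c c M (fun S => BR b (a * b) c M N S F))).
  rewrite le_eqVlt; apply/orP; left; apply/eqP; apply: eq_EL => S; rewrite size_nseq => sS _.
  exact: BRS.
apply: le_trans (hC1 _ _) _; first by move=> l; apply: BR_ge0.
apply: le_trans (ler_wpM2l _ (hC2 F F0)) _; first by rewrite mulr_ge0 ?exprn_ge0 ?S0.
have CC1 : (C1 <= C)%N by exact: leq_maxl.
have CC2 : (C2 <= C)%N by exact: leq_maxr.
rewrite mulnS exprD exprS.
have E0 : 0 <= EL (iota 0 C2) (nseq M (pwr a)) F by apply: EL_nseq_ge0 => // k; exact: exprn_ge0.
apply: (@le_trans _ _ ((\sum_(k <- iota 0 C) b ^+ k) * (\sum_(k <- iota 0 C) (a * b) ^+ k) ^+ M *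
  ((\sum_(k <- iota 0 C) b ^+ k) ^+ N * (\sum_(k <- iota 0 C) (a * b) ^+ k) ^+ (M * N) *
   EL (iota 0 C) (nseq M (pwr a)) F))); last by rewrite le_eqVlt; apply/orP; left; apply/eqP; ring.
apply: ler_pM; rewrite ?mulr_ge0 ?exprn_ge0 ?S0 //.
  by apply: ler_pM; rewrite ?exprn_ge0 ?S0 ?Sle // lerXn2r ?nnegrE ?S0 ?Sle.
apply: ler_pM; rewrite ?mulr_ge0 ?exprn_ge0 ?S0 //.
  by apply: ler_pM; rewrite ?exprn_ge0 ?S0 // lerXn2r ?nnegrE ?S0 ?Sle.
by apply: le_EL_range => // k; exact: exprn_ge0.
Qed.

Lemma BR_lo (a b : R) M N c : 0 <= a -> 0 <= b ->
  exists C, forall ci ck, (C <= ci)%N -> (C <= ck)%N ->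
  forall F : seq nat -> R, (forall l, 0 <= F l) ->
  (\sum_(k <- iota 0 c) b ^+ k) ^+ N * (\sum_(k <- iota 0 c) (a * b) ^+ k) ^+ (M * N)
   * EL (iota 0 c) (nseq M (pwr a)) F <=
  EL (iota 0 ci) (nseq M (pwr a)) (fun S => BR b (a * b) ck M N S F).
Proof.
move=> a0 b0; have ab0 : 0 <= a * b by rewrite mulr_ge0.
elim: N => [|N [C1 IH]].
  exists c => ci ck cci cck F F0; rewrite /BR /= muln0 !expr0 !mul1r.
  by apply: le_EL_range => // k; exact: exprn_ge0.
have [C2 hC2] := burke_lo M (maxn c C1) a0 b0.
exists (maxn C1 C2) => ci ck h1 h2 F F0.
have S0 (r : R) n : 0 <= r -> 0 <= \sum_(k <- iota 0 n) r ^+ k.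
  by move=> r0; apply: sumr_ge0 => k _; apply: exprn_ge0.
set D := maxn c C1.
have Sle (r : R) : 0 <= r -> \sum_(k <- iota 0 c) r ^+ k <= \sum_(k <- iota 0 D) r ^+ k.
  by move=> r0; apply: le_sum_iota => [|k]; [exact: leq_maxl|exact: exprn_ge0].
apply: (@le_trans _ _ (RS a b ci ck ck M (fun S => BR b (a * b) ck M N S F))); last first.
  rewrite le_eqVlt; apply/orP; left; apply/eqP; apply: eq_EL => S; rewrite size_nseq => sS _.
  by rewrite BRS.
apply: le_trans (hC2 ci ck ck _ _ _ _ _); try lia; last by move=> l; apply: BR_ge0.
have := IH D ck _ _ F F0 => /(_ (leq_maxr _ _)) h3.
apply: le_trans (ler_wpM2l _ (h3 _)); try lia; last by rewrite mulr_ge0 ?exprn_ge0 ?S0.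
rewrite mulnS exprD exprS.
apply: (@le_trans _ _ ((\sum_(k <- iota 0 c) b ^+ k) * (\sum_(k <- iota 0 c) (a * b) ^+ k) ^+ M *
  ((\sum_(k <- iota 0 c) b ^+ k) ^+ N * (\sum_(k <- iota 0 c) (a * b) ^+ k) ^+ (M * N) *
   EL (iota 0 c) (nseq M (pwr a)) F))); first by rewrite le_eqVlt; apply/orP; left; apply/eqP; ring.
apply: ler_wpM2r.
  by rewrite !mulr_ge0 ?exprn_ge0 ?S0 //; apply: EL_nseq_ge0 => // k; exact: exprn_ge0.
by apply: ler_pM; rewrite ?exprn_ge0 ?S0 ?Sle // lerXn2r ?nnegrE ?S0 ?Sle.
Qed.

(** A geometric weight multiplied by a power of s is geometric again. This is how a non-stationary
    pair of axes is made stationary. *)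
Lemma EL_tilt (s b : R) c N (H : seq nat -> R) :
  EL (iota 0 c) (nseq N (pwr b)) (fun J => s ^+ sumn J * H J) =
  EL (iota 0 c) (nseq N (pwr (b * s))) H.
Proof.
elim: N H => [|N IH] H /=; first by rewrite expr0 mul1r.
apply: eq_bigr => a _; rewrite -IH /pwr exprMn -mulrA; congr (_ * _).
by rewrite -ELZ; apply: eq_EL' => J; rewrite exprD mulrA.
Qed.

Lemma EL_prod (s a : R) c M :
  EL (iota 0 c) (nseq M (pwr a)) (fun S => s ^+ sumn S) = (\sum_(k <- iota 0 c) (a * s) ^+ k) ^+ M.
Proof.
elim: M => [|M IH] /=; first by rewrite !expr0.
rewrite exprS mulr_suml; apply: eq_bigr => k _; rewrite -IH /pwr exprMn -mulrA; congr (_ * _).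
by rewrite -ELZ; apply: eq_EL' => J; rewrite exprD.
Qed.

Definition geo (r : R) : nat -> R := fun k => (1 - r) * r ^+ k.

(* sub-probability of the boundary model with all weights cut at [c] *)
Definition Bs c (a b q : R) M N (F : seq nat -> seq nat -> (nat -> nat -> nat) -> R) :=
  EL (iota 0 c) (nseq M (geo a)) (fun S => EL (iota 0 c) (nseq N (geo b)) (fun J =>
    Q (iota 0 c) (geo q) M N (F S J))).

Lemma Bs_pwr c (a b q : R) M N F : Bs c a b q M N F =
  (1 - a) ^+ M * ((1 - b) ^+ N * ((1 - q) ^+ (M * N) *
  EL (iota 0 c) (nseq M (pwr a)) (fun S => EL (iota 0 c) (nseq N (pwr b)) (fun J =>
    Q (iota 0 c) (pwr q) M N (F S J))))).
Proof.
rewrite /Bs (EL_nseq_scale _ _ (1 - a) (pwr a)); congr (_ * _).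
rewrite -!ELZ; apply: eq_EL' => S.
rewrite (EL_nseq_scale _ _ (1 - b) (pwr b)); congr (_ * _).
rewrite -!ELZ; apply: eq_EL' => J.
by rewrite (Q_scale _ (1 - q) (pwr q)).
Qed.

Lemma geom_sum (r : R) c : r != 1 -> \sum_(k <- iota 0 c) r ^+ k = (1 - r ^+ c) / (1 - r).
Proof.
move=> r1; have r1' : 1 - r != 0 by rewrite subr_eq0 eq_sym.
apply: (mulIf r1'); rewrite mulfVK // mulrC.
elim: c => [|c IH]; first by rewrite big_nil mulr0 expr0 subrr.
rewrite -addn1 iotaD big_cat /= big_seq1 add0n mulrDr IH addn1 exprS; ring.
Qed.

Lemma geom_le (r : R) c : 0 <= r < 1 -> \sum_(k <- iota 0 c) r ^+ k <= (1 - r)^-1.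
Proof.
case/andP=> r0 r1; rewrite geom_sum ?lt_eqF // ler_piMl ?invr_ge0 ?subr_ge0 ?(ltW r1) //.
by rewrite gerBl exprn_ge0.
Qed.

Lemma Bs_top_split c (a b q : R) M N s (F : seq nat -> R) :
  Bs c a b q M N (fun S J w => s ^+ sumn J * F (topl N S J w)) =
  (1 - a) ^+ M * ((1 - b) ^+ N * ((1 - q) ^+ (M * N) *
  EL (iota 0 c) (nseq M (pwr a)) (fun S => BR (b * s) q c M N S F))).
Proof.
rewrite Bs_pwr; congr (_ * (_ * (_ * _))); apply: eq_EL' => S.
by rewrite /BR -EL_tilt; apply: eq_EL' => J; rewrite QZ.
Qed.

Lemma Bs_lp c (a b q : R) M N s :
  Bs c a b q M N (fun S J w => s ^+ lp (bdw S J w) M N) =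
  Bs c a b q M N (fun S J w => s ^+ sumn J * s ^+ sumn (topl N S J w)).
Proof.
apply: eq_EL => S; rewrite size_nseq => sS _; apply: eq_EL => J; rewrite size_nseq => sJ _.
apply: eq_Q => w; rewrite -exprD lp_bdw ?sS ?sJ //.
by rewrite !take_oversize ?sJ ?size_topl ?sS.
Qed.

(** The passage time is the sum of the vertical axis plus the sum of the top row. Tilting absorbs
    the first sum into the parameter b s, and a (b s) = q makes the top row independent of parameter
    a by Burke. Both factors are ratios of geometric normalisations. *)
Lemma Bs_mgf_le c (a b q s : R) M N : 0 <= a < 1 -> 0 <= b < 1 -> 0 <= s ->
  a * s < 1 -> b * s < 1 -> a * (b * s) = q -> q < 1 ->
  Bs c a b q M N (fun S J w => s ^+ lp (bdw S J w) M N) <=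
  ((1 - a) / (1 - a * s)) ^+ M * ((1 - b) / (1 - b * s)) ^+ N.
Proof.
move=> /andP[a0 a1] /andP[b0 b1] s0 as1 bs1 abq q1.
rewrite Bs_lp (Bs_top_split _ _ _ _ _ _ _ (fun l => s ^+ sumn l)) -abq.
have bs0 : 0 <= b * s by rewrite mulr_ge0.
have as0 : 0 <= a * s by rewrite mulr_ge0.
have [C hC] := BR_up M N c c a0 bs0.
have := hC (fun l => s ^+ sumn l) (fun l => exprn_ge0 _ s0); rewrite EL_prod => h.
have q0 : 0 <= a * (b * s) by rewrite mulr_ge0.
have S0 (r : R) n : 0 <= r -> 0 <= \sum_(k <- iota 0 n) r ^+ k.
  by move=> r0; apply: sumr_ge0 => k _; apply: exprn_ge0.
rewrite !expr_div_n.
set E := EL _ _ _ in h *.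
apply: (@le_trans _ _ ((1 - a) ^+ M * ((1 - b) ^+ N * ((1 - a * (b * s)) ^+ (M * N) *
   ((1 - b * s)^-1 ^+ N * (1 - a * (b * s))^-1 ^+ (M * N) * (1 - a * s)^-1 ^+ M))))).
  do 3 (apply: ler_wpM2l; first by rewrite exprn_ge0 // subr_ge0 ltW // abq).
  apply: le_trans h _.
  have L (r : R) : 0 <= r < 1 -> 0 <= \sum_(k <- iota 0 C) r ^+ k <= (1 - r)^-1.
    by move=> hr; rewrite geom_le // S0 //; case/andP: hr.
  have P n (x y : R) : 0 <= x <= y -> 0 <= x ^+ n <= y ^+ n.
    by case/andP=> x0 xy; rewrite exprn_ge0 // lerXn2r // nnegrE // (le_trans x0).
  have /andP[p1 p1'] : 0 <= (\sum_(k <- iota 0 C) (b * s) ^+ k) ^+ N <= (1 - b * s)^-1 ^+ N.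
    by apply/P/L; rewrite bs0.
  have /andP[p2 p2'] : 0 <= (\sum_(k <- iota 0 C) (a * (b * s)) ^+ k) ^+ (M * N) <= (1 - a * (b * s))^-1 ^+ (M * N).
    by apply/P/L; rewrite q0 abq.
  have /andP[p3 p3'] : 0 <= (\sum_(k <- iota 0 C) (a * s) ^+ k) ^+ M <= (1 - a * s)^-1 ^+ M.
    by apply/P/L; rewrite as0.
  apply: ler_pM => //; first by rewrite mulr_ge0.
  exact: ler_pM.
rewrite le_eqVlt; apply/orP; left; apply/eqP; rewrite !exprVn.
have n1 : (1 - a * (b * s)) ^+ (M * N) != 0 by rewrite expf_neq0 // subr_eq0 eq_sym lt_eqF // abq.
have n2 : (1 - a * s) ^+ M != 0 by rewrite expf_neq0 // subr_eq0 eq_sym lt_eqF.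
have n3 : (1 - b * s) ^+ N != 0 by rewrite expf_neq0 // subr_eq0 eq_sym lt_eqF.
by field; rewrite n1 n2 n3.
Qed.

Lemma small_pow (r e : R) : 0 <= r < 1 -> 0 < e -> exists c, forall n, (c <= n)%N -> r ^+ n <= e.
Proof.
move=> /andP[r0 r1] e0.
have : (r ^+ n @[n --> \oo] --> 0)%classic.
  by apply: cvg_expr; rewrite ger0_norm.
move=> /cvgrPdist_le /(_ e e0) [c _ hc]; exists c => n cn.
by have := hc n cn; rewrite /= sub0r normrN ger0_norm // exprn_ge0.
Qed.

Lemma bernoulli_ineq (x : R) n : 0 <= x <= 1 -> 1 - n%:R * x <= (1 - x) ^+ n.
Proof.
move=> /andP[x0 x1]; elim: n => [|n IH]; first by rewrite mul0r subr0 expr0.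
rewrite exprS; apply: le_trans (ler_wpM2l _ IH); last by rewrite subr_ge0.
rewrite -natr1; have : 0 <= n%:R * x * x by rewrite !mulr_ge0.
lra.
Qed.

(** Converse of [Bs_mgf_le], a factor 2 being lost to the cut. The level [C] comes from iterating
    [burke_lo] and is not quantified, so bounds that rest on it must later be brought down to a
    smaller cut. *)
Lemma Bs_mgf_ge (a b q s : R) M N : 0 <= a < 1 -> 0 <= b < 1 -> 0 <= s ->
  a * s < 1 -> b * s < 1 -> a * (b * s) = q -> q < 1 ->
  exists C, forall c, (C <= c)%N ->
  2^-1 * (((1 - a) / (1 - a * s)) ^+ M * ((1 - b) / (1 - b * s)) ^+ N) <=
  Bs c a b q M N (fun S J w => s ^+ lp (bdw S J w) M N).
Proof.
move=> /andP[a0 a1] /andP[b0 b1] s0 as1 bs1 abq q1.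
have bs0 : 0 <= b * s by rewrite mulr_ge0.
have as0 : 0 <= a * s by rewrite mulr_ge0.
have q0 : 0 <= q by rewrite -abq mulr_ge0.
(* [K] counts the geometric sums: vertical axis, bulk, top row. The choice of [c0] makes each lose
   at most a fraction 1 / (2 (K + 1)), and Bernoulli's inequality keeps half of the product. *)
pose K := (N + M * N + M)%N.
pose r := Num.max (b * s) (Num.max q (a * s)).
have rh : 0 <= r < 1 by rewrite /r !le_max bs0 /= !gt_max bs1 q1 as1.
have e0 : 0 < (2 * K.+1%:R)^-1 :> R by rewrite invr_gt0 mulr_gt0.
have [c0 hc0] := small_pow rh e0.
have [C hC] := BR_lo M N c0 a0 bs0.
exists C => c Cc.
have := hC c c Cc Cc (fun l => s ^+ sumn l) (fun l => exprn_ge0 _ s0); rewrite EL_prod => h.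
rewrite Bs_lp (Bs_top_split _ _ _ _ _ _ _ (fun l => s ^+ sumn l)) -abq.
apply: le_trans (ler_wpM2l _ (ler_wpM2l _ (ler_wpM2l _ h))); rewrite ?exprn_ge0 // ?subr_ge0 ?abq ?(ltW a1) ?(ltW b1) ?(ltW q1) //.
rewrite !geom_sum ?lt_eqF ?abq // !expr_div_n.
have rc : r ^+ c0 <= (2 * K.+1%:R)^-1 by apply: hc0.
have r01 : 0 <= r ^+ c0 <= 1.
  by case/andP: rh => h1 h2; rewrite exprn_ge0 // exprn_ile1 // ltW.
have P (x : R) n : 0 <= x -> x <= r -> (1 - r ^+ c0) ^+ n <= (1 - x ^+ c0) ^+ n.
  move=> x0 xr; case/andP: rh => h1 h2.
  have xr' : x ^+ c0 <= r ^+ c0 by apply: lerXn2r.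
  have r1 : r ^+ c0 <= 1 by case/andP: r01.
  rewrite lerXn2r // ?nnegrE ?subr_ge0 ?lerB //; exact: le_trans r1.
have B : 2^-1 <= (1 - (b * s) ^+ c0) ^+ N * (1 - q ^+ c0) ^+ (M * N) * (1 - (a * s) ^+ c0) ^+ M.
  apply: (@le_trans _ _ ((1 - r ^+ c0) ^+ K)).
    apply: le_trans (bernoulli_ineq _ r01).
    have : K%:R * r ^+ c0 <= K.+1%:R * (2 * K.+1%:R)^-1.
      by apply: ler_pM => //; [case/andP: r01|rewrite ler_nat].
    have -> : K.+1%:R * (2 * K.+1%:R)^-1 = 2^-1 :> R by rewrite invfM mulrCA mulfV ?mulr1 // pnatr_eq0.
    lra.
  have r0 : 0 <= 1 - r ^+ c0 by rewrite subr_ge0; case/andP: r01.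
  rewrite /K !exprD; apply: ler_pM; rewrite ?mulr_ge0 ?exprn_ge0 //.
    apply: ler_pM; rewrite ?exprn_ge0 ?P // /r ?le_max ?lexx ?orbT //.
  by apply: P; rewrite // /r !le_max lexx !orbT.
set X := (1 - a) ^+ M; set Y := (1 - b) ^+ N.
have n1 : (1 - q) ^+ (M * N) != 0 by rewrite expf_neq0 // subr_eq0 eq_sym lt_eqF.
have n2 : (1 - a * s) ^+ M != 0 by rewrite expf_neq0 // subr_eq0 eq_sym lt_eqF.
have n3 : (1 - b * s) ^+ N != 0 by rewrite expf_neq0 // subr_eq0 eq_sym lt_eqF.
rewrite [leRHS](_ : _ = ((1 - (b * s) ^+ c0) ^+ N * (1 - q ^+ c0) ^+ (M * N) * (1 - (a * s) ^+ c0) ^+ M)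
   * (X / (1 - a * s) ^+ M * (Y / (1 - b * s) ^+ N))); last by field; rewrite n1 n2 n3.
apply: ler_wpM2r => //.
by rewrite !mulr_ge0 ?invr_ge0 ?exprn_ge0 // subr_ge0 ltW.
Qed.

(** With the tilt s = 1 only Burke invariance is left, and the normalised masses of the summed-out
    variables are at most 1. *)
Lemma Bs_burke c (a b q : R) M N (F : seq nat -> R) : 0 <= a < 1 -> 0 <= b < 1 ->
  a * b = q -> (forall l, 0 <= F l) -> exists C,
  Bs c a b q M N (fun S J w => F (topl N S J w)) <= EL (iota 0 C) (nseq M (geo a)) F.
Proof.
move=> /andP[a0 a1] /andP[b0 b1] abq F0.
have ab0 : 0 <= a * b by rewrite mulr_ge0.
have ab1 : a * b < 1 by rewrite mulr_ilt1.
have [C hC] := BR_up M N c c a0 b0; exists C.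
have -> : Bs c a b q M N (fun S J w => F (topl N S J w)) =
   Bs c a b q M N (fun S J w => 1 ^+ sumn J * F (topl N S J w)).
  by do 2 (apply: eq_EL' => ?); apply: eq_Q => w; rewrite expr1n mul1r.
rewrite Bs_top_split mulr1 (EL_nseq_scale _ _ (1 - a) (pwr a)) -abq.
apply: ler_wpM2l; first by rewrite exprn_ge0 // subr_ge0 ltW.
rewrite mulrA; apply: le_trans (ler_wpM2l _ (hC F F0)) _.
  by rewrite mulr_ge0 // exprn_ge0 // subr_ge0 ltW.
have S0 (r : R) n : 0 <= r -> 0 <= \sum_(k <- iota 0 n) r ^+ k.
  by move=> r0; apply: sumr_ge0 => k _; apply: exprn_ge0.
rewrite mulrA ler_piMl //; first by apply: EL_nseq_ge0 => // k; exact: exprn_ge0.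
have L (r : R) n : 0 <= r < 1 -> 0 <= (1 - r) ^+ n * (\sum_(k <- iota 0 C) r ^+ k) ^+ n <= 1.
  move=> /andP[r0 r1]; rewrite -exprMn exprn_ge0 ?mulr_ge0 ?S0 ?subr_ge0 ?(ltW r1) //=.
  rewrite exprn_ile1 ?mulr_ge0 ?S0 ?subr_ge0 ?(ltW r1) //.
  by rewrite mulrC -ler_pdivlMr ?subr_gt0 // mul1r geom_le ?r0.
have /andP[l1 l1'] := L b N (introT andP (conj b0 b1)).
have /andP[l2 l2'] := L (a * b) (M * N)%N (introT andP (conj ab0 ab1)).
by rewrite mulrACA mulr_ile1.
Qed.

End Burke.

(** * Cumulants of the geometric law *)

Section RateFunction.
Variable R : realType.
Implicit Types x y z : R.

(** The endpoints may come in either order, because the Taylor bounds are needed on both sides of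
    the base point. *)
Lemma mvt_le (f df : R -> R) (s a b : R) : a <= s -> b <= s ->
  (forall x, x <= s -> is_derive x 1 f (df x)) ->
  exists c, [/\ Num.min a b <= c, c <= Num.max a b & f b - f a = df c * (b - a)].
Proof.
move=> as_ bs H.
wlog ab : a b as_ bs / a <= b => [hw|].
  case: (leP a b) => [ab|/ltW ba]; first by have := hw a b as_ bs ab; rewrite (min_idPl ab) (max_idPr ab).
  have [c [h1 h2 h3]] := hw b a bs as_ ba; exists c; split.
  - by move: h1; rewrite minC (min_idPr ba).
  - by move: h2; rewrite maxC (max_idPl ba).
  by rewrite -opprB h3 -mulrN opprB.
have D x : x \in `[a, b] -> is_derive x 1 f (df x).
  by rewrite in_itv /= => /andP[_ xb]; apply: H; exact: le_trans bs.
have D1 x : x \in `]a, b[ -> is_derive x 1 f (df x).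
  by rewrite in_itv /= => /andP[ax xb]; apply: D; rewrite in_itv /= !ltW.
have D2 : {within `[a, b], continuous f}.
  by apply: derivable_within_continuous => x xab; have := D x xab; case.
have [c] := MVT_segment ab D1 D2.
rewrite in_itv /= => /andP[ac cb] e; exists c; split => //.
- by rewrite (min_idPl ab).
by rewrite (max_idPr ab).
Qed.

Lemma sinh_ge x : 0 <= x -> 2 * x <= expR x - expR (- x).
Proof.
move=> x0; pose f := fun y : R => expR y - expR (- y).
have D y : y <= x -> is_derive y 1 f (expR y + expR (- y)).
  move=> _; have h1 := is_derive_expR y.
  have h2 : is_derive y 1 (fun t : R => expR (- t)) (- expR (- y)).
    have i : is_derive y 1 (fun t : R => - t) (-1) by exact: is_deriveN.
    apply: is_derive_eq (is_derive1_comp (is_derive_expR (- y)) i) _.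
    by rewrite mulrN1.
  by apply: is_derive_eq (is_deriveB h1 h2) _; rewrite opprK.
have [c [_ _]] := mvt_le x0 (lexx x) D.
move=> h; have e : expR x - expR (- x) = (expR c + expR (- c)) * x.
  have f0 : f 0 = 0 by rewrite /f oppr0 subrr.
  by move: h; rewrite f0 !subr0.
have : 2 <= expR c + expR (- c).
  rewrite expRN; have e0 := expR_gt0 c.
  have -> : expR c + (expR c)^-1 = (expR c - 1) ^+ 2 / expR c + 2 by field; rewrite gt_eqF.
  by rewrite lerDr divr_ge0 ?sqr_ge0 // ltW.
rewrite e; nra.
Qed.

Definition ch x : R := (expR x + expR (- x)) / 2.

Lemma ch_ge x : x ^+ 2 / 2 <= ch x - 1.
Proof.
wlog x0 : x / 0 <= x => [hw|].
  case: (leP 0 x) => [|/ltW x0]; first exact: hw.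
  by have := hw (- x); rewrite oppr_ge0 sqrrN /ch opprK [_ + expR x]addrC; apply.
have x20 : 0 <= x / 2 by rewrite divr_ge0.
have := sinh_ge x20; set u := expR (x / 2); set v := expR (- (x / 2)) => h.
have uv : u * v = 1 by rewrite -expRD subrr expR0.
have e1 : expR x = u ^+ 2 by rewrite expr2 -expRD; congr expR; lra.
have e2 : expR (- x) = v ^+ 2 by rewrite expr2 -expRD; congr expR; lra.
rewrite /ch e1 e2.
have : x ^+ 2 <= (u - v) ^+ 2.
  rewrite lerXn2r ?nnegrE //; [apply: le_trans h|apply: le_trans h]; lra.
have -> : (u - v) ^+ 2 = u ^+ 2 + v ^+ 2 - 2 * (u * v) by ring.
rewrite uv; lra.
Qed.

Lemma expR_le_inv x : x < 1 -> expR x <= (1 - x)^-1.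
Proof.
move=> x1; have h := expR_ge1Dx (- x); rewrite -[expR x]invrK -expRN lef_pV2 ?posrE ?expR_gt0 ?subr_gt0 //.
Qed.

Lemma ch_le x : x ^+ 2 <= 2^-1 -> ch x - 1 <= 2 * x ^+ 2.
Proof.
move=> x2; have x1 : x < 1 by nra.
have x1' : - x < 1 by nra.
have h1 := expR_le_inv x1; have h2 := expR_le_inv x1'.
apply: (@le_trans _ _ ((1 - x ^+ 2)^-1 - 1)).
  have -> : (1 - x ^+ 2)^-1 = ((1 - x)^-1 + (1 - - x)^-1) / 2.
    have n1 : 1 - x != 0 by rewrite gt_eqF // subr_gt0.
    have n2 : 1 + x != 0 by rewrite gt_eqF //; lra.
    have n3 : 1 - x ^+ 2 != 0 by rewrite gt_eqF //; lra.
    rewrite opprK; field; rewrite n1 n2 n3 //.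
  rewrite /ch; lra.
rewrite lerBlDr -[leRHS]invrK lef_pV2 ?posrE; [|lra|rewrite invr_gt0; nra].
rewrite -[leLHS]mul1r ler_pdivrMr; nra.
Qed.

Variables (al : R).
Hypothesis al0 : 0 < al.
Hypothesis al1 : al < 1.
Ltac alra := (move: (al0) (al1) => ? ?; lra).
Ltac anra := (move: (al0) (al1) => ? ?; nra).

(** Up to a constant, the cumulant generating function of the geometric law of parameter [al]. [Af],
    [A1], [A2] are its first three derivatives, so [Af y] and [A1 y] are the mean and the variance
    of the geometric law of parameter [al * expR y]. *)
Definition phi y := - ln (1 - al * expR y).
Definition Af y := al * expR y / (1 - al * expR y).
Definition A1 y := al * expR y / (1 - al * expR y) ^+ 2.
Definition A2 y := al * expR y * (1 + al * expR y) / (1 - al * expR y) ^+ 3.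
(** Chosen so that [al * expR y] is at most (1 + al) / 2 for [y <= sgm]; the uniform constants below
    hold on this range. *)
Definition sgm := ln ((1 + al) / 2 / al).
Definition d0 := (1 - al) / 2.
(** Mean of the geometric law of parameter [al]; the time constant along the diagonal is
    [2 * mm]. *)
Definition mm := al / (1 - al).
Definition CT := 2 / d0 ^+ 3.

Lemma d0_gt0 : 0 < d0. Proof. by rewrite divr_gt0 // subr_gt0. Qed.
Lemma d0_lt1 : d0 < 1. Proof. rewrite /d0; alra. Qed.
Lemma CT_gt0 : 0 < CT. Proof. by rewrite divr_gt0 // exprn_gt0 // d0_gt0. Qed.
Lemma mm_gt0 : 0 < mm. Proof. by rewrite divr_gt0 // subr_gt0. Qed.

Lemma sgm_gt0 : 0 < sgm.
Proof.
rewrite ln_gt0 // ltr_pdivlMr // mul1r; alra.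
Qed.

Lemma ale_le y : y <= sgm -> al * expR y <= (1 + al) / 2.
Proof.
move=> ys; have : expR y <= expR sgm by rewrite ler_expR.
rewrite /sgm lnK ?posrE; last by rewrite !divr_gt0 //; alra.
rewrite ler_pdivlMr // => h; by rewrite mulrC.
Qed.

Lemma ale_gt0 y : 0 < al * expR y. Proof. by rewrite mulr_gt0 ?expR_gt0. Qed.

Lemma oneale_ge y : y <= sgm -> d0 <= 1 - al * expR y.
Proof. move=> /ale_le; rewrite /d0; alra. Qed.

Lemma oneale_gt0 y : y <= sgm -> 0 < 1 - al * expR y.
Proof. by move=> ys; apply: lt_le_trans (oneale_ge ys); exact: d0_gt0. Qed.

Lemma is_derive_ale y : is_derive y 1 (fun t : R => 1 - al * expR t) (- (al * expR y)).
Proof.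
have h1 : is_derive y 1 (cst (1 : R)) 0 by exact: is_derive_cst.
have h2 := is_deriveZ al (is_derive_expR y).
by apply: is_derive_eq (is_deriveB h1 h2) _; rewrite sub0r.
Qed.

Lemma is_derive_ale' y : is_derive y 1 (fun t : R => al * expR t) (al * expR y).
Proof. exact: (is_deriveZ al (is_derive_expR y)). Qed.

Lemma is_derive_phi y : y <= sgm -> is_derive y 1 phi (Af y).
Proof.
move=> ys; have g0 := oneale_gt0 ys.
have h := @is_derive1_comp R (@ln R) (fun t : R => 1 - al * expR t) y _ _ (is_derive1_ln g0) (is_derive_ale y).
apply: is_derive_eq (is_deriveN h) _.
by rewrite mulrN opprK mulrC.
Qed.

Lemma is_derive_inv y : y <= sgm ->
  is_derive y 1 (fun t : R => (1 - al * expR t)^-1) (al * expR y / (1 - al * expR y) ^+ 2).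
Proof.
move=> ys; have g0 := oneale_gt0 ys.
have h := @is_deriveV R (fun t : R => 1 - al * expR t) y _ _ (lt0r_neq0 g0) (is_derive_ale y).
apply: is_derive_eq h _.
by rewrite /GRing.scale /= mulrNN mulrC.
Qed.

Lemma is_derive_Af y : y <= sgm -> is_derive y 1 Af (A1 y).
Proof.
move=> ys; have g0 := oneale_gt0 ys.
apply: is_derive_eq (is_deriveM (is_derive_ale' y) (is_derive_inv ys)) _.
rewrite /GRing.scale /= /A1.
by field; rewrite gt_eqF.
Qed.

Lemma is_derive_A1 y : y <= sgm -> is_derive y 1 A1 (A2 y).
Proof.
move=> ys; have g0 := oneale_gt0 ys.
have e : A1 = (Af * (fun t : R => (1 - al * expR t)^-1)).
  by apply/funext => t; rewrite /A1 /Af mulrfctE expr2 invfM mulrA.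
rewrite e; apply: is_derive_eq (is_deriveM (is_derive_Af ys) (is_derive_inv ys)) _.
rewrite /GRing.scale /= /A2 /A1 /Af.
by field; rewrite gt_eqF.
Qed.

Lemma A2_bd y : y <= sgm -> `|A2 y| <= CT.
Proof.
move=> ys; have g0 := oneale_ge ys; have a0 := ale_gt0 y; have a1 := ale_le ys.
have d0p := d0_gt0.
have u1 : al * expR y <= 1 by move: a1; alra.
rewrite /A2 ger0_norm; last by rewrite divr_ge0 ?mulr_ge0 ?exprn_ge0 //; alra.
rewrite /CT; apply: ler_pM; rewrite ?invr_ge0 ?exprn_ge0 //; try alra; first anra.
  anra.
rewrite lef_pV2 ?posrE ?exprn_gt0 //; last alra.
by rewrite lerXn2r ?nnegrE //; alra.
Qed.

Lemma A1_ge0 y : y <= sgm -> 0 <= A1 y.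
Proof.
by move=> ys; rewrite /A1 divr_ge0 ?exprn_ge0 ?(ltW (ale_gt0 y)) // ltW // oneale_gt0.
Qed.

Lemma A1_le y : y <= sgm -> A1 y <= CT.
Proof.
move=> ys; have g0 := oneale_ge ys; have a0 := ale_gt0 y; have a1 := ale_le ys.
have d0p := d0_gt0; have d1 := d0_lt1.
have u1 : al * expR y <= 1 by move: a1; alra.
rewrite /A1 /CT; apply: ler_pM; rewrite ?invr_ge0 ?exprn_ge0 //; try alra.
rewrite lef_pV2 ?posrE ?exprn_gt0 //; last alra.
apply: (@le_trans _ _ (d0 ^+ 2)); first by rewrite exprS ler_piMl ?exprn_ge0 ?ltW.
by rewrite lerXn2r ?nnegrE //; alra.
Qed.

Lemma Af0 : Af 0 = mm. Proof. by rewrite /Af expR0 mulr1. Qed.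

Lemma between_abs (u v t : R) : Num.min u v <= t -> t <= Num.max u v ->
  `|t| ^+ 2 <= u ^+ 2 + v ^+ 2.
Proof.
rewrite ge_min le_max => h1 h2; rewrite real_normK ?num_real //.
have : t ^+ 2 <= u ^+ 2 \/ t ^+ 2 <= v ^+ 2.
  case/orP: h1 => h1; case/orP: h2 => h2; have [t0|t0] := leP 0 t.
  all: try by [left; anra | right; anra].
have u0 := sqr_ge0 u; have v0 := sqr_ge0 v; by case=> ?; alra.
Qed.

Lemma Af_lin y z : y <= sgm -> y + z <= sgm -> `|Af (y + z) - Af y| <= CT * `|z|.
Proof.
move=> h1 h2; have [c [c1 c2]] := mvt_le h1 h2 is_derive_Af.
rewrite addrAC subrr add0r => ->; rewrite normrM ler_wpM2r //.
have cs : c <= sgm by apply: le_trans c2 _; rewrite ge_max h1.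
by rewrite ger0_norm ?A1_le ?A1_ge0.
Qed.

Lemma Af_taylor y z : y <= sgm -> y + z <= sgm ->
  `|Af (y + z) - Af y - A1 y * z| <= CT * z ^+ 2.
Proof.
move=> h1 h2; have [c [c1 c2]] := mvt_le h1 h2 is_derive_Af.
rewrite addrAC subrr add0r => ->; rewrite -mulrBl normrM.
have cs : c <= sgm by apply: le_trans c2 _; rewrite ge_max h1.
have [c' [c1' c2']] := mvt_le h1 cs is_derive_A1 => ->.
have cs' : c' <= sgm by apply: le_trans c2' _; rewrite ge_max h1.
rewrite normrM -mulrA; apply: ler_pM => //; first exact: A2_bd.
rewrite -[leRHS]real_normK ?num_real // expr2 ler_wpM2r //.
move: c1 c2; rewrite ge_min le_max => c1 c2.
rewrite ler_norml; have [z0|z0] := leP 0 z; [rewrite ger0_norm //|rewrite ltr0_norm //];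
  case/orP: c1 => c1; case/orP: c2 => c2; apply/andP; split; alra.
Qed.

Lemma phi_taylor y0 z z' : y0 <= sgm -> y0 + z <= sgm -> y0 + z' <= sgm ->
  `|phi (y0 + z') - phi (y0 + z) - Af y0 * (z' - z) - A1 y0 * ((z' ^+ 2 - z ^+ 2) / 2)|
  <= CT * `|z' - z| * (z ^+ 2 + z' ^+ 2).
Proof.
move=> h0 h h'.
pose f t := phi (y0 + t) - Af y0 * t - A1 y0 / 2 * t ^+ 2.
pose df t := Af (y0 + t) - Af y0 - A1 y0 * t.
have D t : t <= sgm - y0 -> is_derive t 1 f (df t).
  move=> ts; have yt : y0 + t <= sgm by alra.
  have i1 : is_derive t 1 (fun u : R => y0 + u) 1.
    by apply: is_derive_eq (is_deriveD (is_derive_cst y0 t 1) (is_derive_id t (1 : R))) _; rewrite add0r.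
  have e1 := @is_derive1_comp R phi (fun u : R => y0 + u) t _ _ (is_derive_phi yt) i1.
  rewrite mulr1 in e1.
  have e2 := is_deriveZ (Af y0) (is_derive_id t (1 : R)).
  have e3 := is_deriveZ (A1 y0 / 2) (is_deriveX 2 (is_derive_id t (1 : R))).
  apply: is_derive_eq (is_deriveB (is_deriveB e1 e2) e3) _.
  by rewrite /df /GRing.scale /=; field.
have zz : z <= sgm - y0 by alra.
have zz' : z' <= sgm - y0 by alra.
have [c [c1 c2]] := mvt_le zz zz' D.
have -> : phi (y0 + z') - phi (y0 + z) - Af y0 * (z' - z) - A1 y0 * ((z' ^+ 2 - z ^+ 2) / 2)
   = f z' - f z by rewrite /f; field.
move=> ->; rewrite normrM [leRHS]mulrAC ler_wpM2r //.
have cs : c <= sgm - y0 by apply: le_trans c2 _; rewrite ge_max; apply/andP; split; alra.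
apply: le_trans (Af_taylor h0 (_ : y0 + c <= sgm)) _; first alra.
rewrite ler_wpM2l ?(ltW CT_gt0) // -[leLHS]real_normK ?num_real //.
exact: between_abs.
Qed.

(* exponent of the moment generating function of the boundary model *)
Definition Psi (M N y y' : R) := M * (phi y' - phi y) + N * (phi (- y) - phi (- y')).

(** Expansion around [y0] with a third-order error. The linear coefficient is the mean of the
    stationary passage time at [y0]; the sign of the quadratic one will decide which axis maximal
    paths prefer. *)
Lemma Psi_le M N y0 z z' : 0 <= M -> 0 <= N -> `|y0| <= sgm -> `|y0 + z| <= sgm ->
  `|y0 + z'| <= sgm ->
  Psi M N (y0 + z) (y0 + z') <= (z' - z) * (M * Af y0 + N * Af (- y0))
   + (z' ^+ 2 - z ^+ 2) / 2 * (M * A1 y0 - N * A1 (- y0))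
   + CT * `|z' - z| * (z ^+ 2 + z' ^+ 2) * (M + N).
Proof.
move=> M0 N0; rewrite !ler_norml => /andP[a1 a2] /andP[b1 b2] /andP[c1 c2].
have t1 := phi_taylor a2 b2 c2.
have t2 : `|phi (- (y0 + z)) - phi (- (y0 + z')) - Af (- y0) * (z' - z)
     - A1 (- y0) * ((z ^+ 2 - z' ^+ 2) / 2)| <= CT * `|z' - z| * (z ^+ 2 + z' ^+ 2).
  have -> : - (y0 + z) = - y0 + - z by rewrite opprD.
  have -> : - (y0 + z') = - y0 + - z' by rewrite opprD.
  have -> : z' - z = - z - - z' by ring.
  rewrite -(sqrrN z) -(sqrrN z') [(- z) ^+ 2 + (- z') ^+ 2]addrC; apply: phi_taylor; alra.
move: t1 t2; set e := CT * _ * _; rewrite !ler_norml => /andP[_ t1] /andP[_ t2].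
have u1 := ler_wpM2l M0 t1; have u2 := ler_wpM2l N0 t2.
rewrite /Psi; alra.
Qed.

(** Excess of the symmetric exponent over its linear part, odd and cubic at 0; it governs the upper
    tail at the scale n^(1/3). *)
Definition psi y := phi y - phi (- y) - 2 * mm * y.
Definition dpsi y := Af y + Af (- y) - 2 * mm.

Lemma is_derive_psi y : `|y| <= sgm -> is_derive y 1 psi (dpsi y).
Proof.
rewrite ler_norml => /andP[h1 h2].
have d1 := is_derive_phi h2.
have d2 : is_derive y 1 (fun t : R => phi (- t)) (- Af (- y)).
  have ny : - y <= sgm by alra.
  have i : is_derive y 1 (fun t : R => - t) (-1) by exact: is_deriveN.
  apply: is_derive_eq (@is_derive1_comp R phi (fun t : R => - t) y _ _ (is_derive_phi ny) i) _.
  by rewrite mulrN1.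
have d3 := is_deriveZ (2 * mm) (is_derive_id y (1 : R)).
apply: is_derive_eq (is_deriveB (is_deriveB d1 d2) d3) _.
by rewrite opprK /GRing.scale /= mulr1.
Qed.

(** The product (1 - al e^y)(1 - al e^(-y)) depends on y only through the hyperbolic cosine. In this
    form the quadratic bounds on [ch y - 1] replace power series. *)
Lemma dpsiE y : `|y| <= sgm -> dpsi y = 2 * al * (1 + al) * (ch y - 1) /
  ((1 - al) * ((1 - al) ^+ 2 - 2 * al * (ch y - 1))).
Proof.
rewrite ler_norml => /andP[h1 h2].
have g1 := oneale_gt0 h2; have g2 := @oneale_gt0 (- y) ltac:(alra).
have a1' : 0 < 1 - al by alra.
rewrite /dpsi /Af /ch /mm; set u := expR y in g1 *; set v := expR (- y) in g2 *.
have uv : u * v = 1 by rewrite -expRD subrr expR0.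
have -> : (1 - al) ^+ 2 - 2 * al * ((u + v) / 2 - 1) = (1 - al * u) * (1 - al * v).
  have -> : (1 - al * u) * (1 - al * v) = 1 - al * (u + v) + al ^+ 2 * (u * v) by ring.
  by rewrite uv; field.
have u0 : u != 0 by rewrite gt_eqF ?expR_gt0.
have vE : v = u^-1 by rewrite /v expRN.
rewrite vE in g2 *.
have g3 : 0 < u - al.
  have : 0 < u * (1 - al / u) by rewrite mulr_gt0 ?expR_gt0.
  by rewrite mulrBr mulr1 mulrCA mulfV ?mulr1.
have [n1 n2 n3] : [/\ 1 - al != 0, 1 - al * u != 0 & u - al != 0] by rewrite !gt_eqF.
by field; rewrite ?u0 ?n1 ?n2 ?n3.
Qed.

Lemma dpsi_den y : `|y| <= sgm -> 0 < (1 - al) ^+ 2 - 2 * al * (ch y - 1).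
Proof.
rewrite ler_norml => /andP[h1 h2].
have g1 := oneale_gt0 h2; have g2 := @oneale_gt0 (- y) ltac:(alra).
rewrite /ch; have uv : expR y * expR (- y) = 1 by rewrite -expRD subrr expR0.
have := mulr_gt0 g1 g2.
have -> : (1 - al * expR y) * (1 - al * expR (- y)) =
  1 - al * (expR y + expR (- y)) + al ^+ 2 * (expR y * expR (- y)) by ring.
rewrite uv; set w := expR y + _ => h; have -> : (1 - al) ^+ 2 - 2 * al * (w / 2 - 1) = 1 - al * w + al ^+ 2 * 1 by field.
by [].
Qed.

Lemma psi0 : psi 0 = 0. Proof. by rewrite /psi oppr0 subrr mulr0 subrr. Qed.

(** Compares functions vanishing at 0 through their derivatives. Both uses take [k] negative, which
    yields lower bounds on multiples of [psi]. *)
Lemma psi_mvt y : 0 <= y -> y <= sgm -> forall (g dg : R -> R) (k : R),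
  g 0 = 0 -> (forall t, 0 <= t <= y -> is_derive t 1 g (dg t)) ->
  (forall t, 0 <= t <= y -> k * dpsi t <= dg t) -> k * psi y <= g y.
Proof.
move=> y0 ys g dg k g0 Dg le.
have D t : t \in `]0, y[ -> is_derive t 1 (fun t => g t - k * psi t) (dg t - k * dpsi t).
  rewrite in_itv /= => /andP[t0 ty].
  have ts : `|t| <= sgm by rewrite ger0_norm ltW // (lt_le_trans ty).
  have d1 := is_deriveZ k (is_derive_psi ts).
  have t0y : 0 <= t <= y by rewrite !ltW.
  exact: is_deriveB (Dg _ t0y) d1.
have D2 : {within `[0, y], continuous (fun t => g t - k * psi t)}.
  apply: derivable_within_continuous => t; rewrite in_itv /= => /andP[t0 ty].
  have ts : `|t| <= sgm by rewrite ger0_norm // (le_trans ty).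
  have d1 := is_deriveZ k (is_derive_psi ts).
  have t0y : 0 <= t <= y by rewrite t0.
  by have := is_deriveB (Dg _ t0y) d1; case.
have [c] := MVT_segment y0 D D2.
rewrite in_itv /= psi0 g0 mulr0 !subr0 => c0y e.
rewrite -subr_ge0 e mulr_ge0 // subr_ge0; exact: le.
Qed.

Definition c3 := al * (1 + al) / (3 * (1 - al) ^+ 3).

Lemma c3_gt0 : 0 < c3.
Proof. by rewrite divr_gt0 ?mulr_gt0 ?exprn_gt0 //; alra. Qed.

Lemma dpsi_ge y : `|y| <= sgm -> 3 * c3 * y ^+ 2 <= dpsi y.
Proof.
move=> ys; rewrite dpsiE //; have dn := dpsi_den ys; have h := ch_ge y.
have a1' : 0 < 1 - al by alra.
have y2 := sqr_ge0 y.
rewrite ler_pdivlMr ?mulr_gt0 //.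
apply: (@le_trans _ _ (3 * c3 * y ^+ 2 * ((1 - al) * (1 - al) ^+ 2))).
  apply: ler_wpM2l; first by rewrite mulr_ge0 // mulr_ge0 // ltW // c3_gt0.
  apply: ler_wpM2l; first exact: ltW.
  rewrite gerBl mulr_ge0 // ?mulr_ge0 ?(ltW al0) //; alra.
rewrite (_ : _ * _ = al * (1 + al) * y ^+ 2); last by rewrite /c3; field; rewrite gt_eqF.
have -> : 2 * al * (1 + al) * (ch y - 1) = al * (1 + al) * (2 * (ch y - 1)) by ring.
apply: ler_wpM2l; [anra|alra].
Qed.

Lemma psi_ge y : 0 <= y -> y <= sgm -> c3 * y ^+ 3 <= psi y.
Proof.
move=> y0 ys.
suff : -1 * psi y <= - c3 * y ^+ 3 by alra.
apply: (@psi_mvt y y0 ys (fun t => - c3 * t ^+ 3) (fun t => - (3 * c3 * t ^+ 2)) (-1)).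
- by rewrite expr0n /= mulr0.
- move=> t _; apply: is_derive_eq (is_deriveZ (- c3) (is_deriveX 3 (is_derive_id t (1 : R)))) _.
  by rewrite /GRing.scale /=; ring.
move=> t /andP[t0 ty]; rewrite mulN1r lerN2 dpsi_ge // ger0_norm //; exact: le_trans ys.
Qed.

Lemma psi_le y : 0 <= y -> y <= sgm -> psi y <= 4 * CT * y ^+ 3.
Proof.
move=> y0 ys; have s0 := sgm_gt0.
have := @phi_taylor 0 (- y) y (ltW s0) _ _; rewrite !add0r => /(_ ltac:(alra) ys).
have e : `|y - - y| = 2 * y by rewrite opprK ger0_norm; alra.
rewrite e Af0 sqrrN subrr mul0r mulr0 subr0.
rewrite ler_norml => /andP[_ h].
have -> : psi y = phi y - phi (- y) - mm * (y - - y) by rewrite /psi; ring.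
by apply: le_trans h _; rewrite le_eqVlt; apply/orP; left; apply/eqP; ring.
Qed.

(** Cubic behaviour gives the ratio 8 in the limit, and 10 leaves room for a whole interval. The
    bound compares a second moment with the square of a first moment in the upper tail. *)
Lemma psi_double : exists2 y1, 0 < y1 & forall y, 0 <= y <= y1 ->
  2 * y <= sgm /\ psi (2 * y) <= 10 * psi y.
Proof.
have a1' : 0 < 1 - al by alra.
have s0 := sgm_gt0.
pose y1 := Num.min (sgm / 2) ((1 - al) / 100).
have y10 : 0 < y1 by rewrite lt_min !divr_gt0.
exists y1 => // y /andP[y0]; rewrite le_min => /andP[h1 h2].
have h3 : 2 * y <= sgm by alra.
split=> //.
have dub t : 0 <= t -> t <= y -> 2 * dpsi (2 * t) <= 10 * dpsi t.
  move=> t0 ty.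
  have l1 : `|t| <= sgm by rewrite ger0_norm //; alra.
  have l2 : `|2 * t| <= sgm by rewrite ger0_norm; alra.
  rewrite !dpsiE //; have n1 := dpsi_den l1; have n2 := dpsi_den l2.
  have g1 := ch_ge t; have g2 := sqr_ge0 t.
  have eC : ch (2 * t) - 1 = 2 * (ch t - 1) * (ch t + 1).
    rewrite /ch; have -> : expR (2 * t) = expR t ^+ 2 by rewrite expr2 -expRD; congr expR; alra.
    have -> : expR (- (2 * t)) = expR (- t) ^+ 2 by rewrite expr2 -expRD; congr expR; alra.
    have uv : expR t * expR (- t) = 1 by rewrite -expRD subrr expR0.
    move: uv; set u := expR t; set v := expR (- t) => uv.
    have -> : 2 * ((u + v) / 2 - 1) * ((u + v) / 2 + 1) = (u ^+ 2 + v ^+ 2 + 2 * (u * v)) / 2 - 2 by field.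
    by rewrite uv; field.
  have tt : (2 * t) ^+ 2 <= (1 - al) ^+ 2 / 2500.
    have : 0 <= t * (1 - al) by rewrite mulr_ge0 // ltW.
    have : t <= (1 - al) / 100 by alra.
    anra.
  have u2 : ch (2 * t) - 1 <= (1 - al) ^+ 2 / 1000.
    apply: le_trans (ch_le _) _; anra.
  have u1 : ch t - 1 <= (1 - al) ^+ 2 / 1000.
    move: u2; rewrite eC; anra.
  set X := ch t - 1 in g1 u1 n1 eC *.
  rewrite eC in u2 n2 *.
  have cx : ch t + 1 = X + 2 by rewrite /X; ring.
  rewrite cx in u2 n2 *.
  have X0 : 0 <= X by alra.
  (* For small [X] the two sides are close to 4 (1 - al)^2 and 5 (1 - al)^2. *)
  have key : 2 * (X + 2) * ((1 - al) ^+ 2 - 2 * al * X) <= 5 * ((1 - al) ^+ 2 - 2 * al * (2 * X * (X + 2))).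
    have D2 : 5 / 1000 * (1 - al) ^+ 2 <= (1 - al) ^+ 2 by anra.
    anra.
  move: n1 n2 key; set D1 := (1 - al) ^+ 2 - 2 * al * X.
  set D2 := (1 - al) ^+ 2 - 2 * al * (2 * X * (X + 2)) => n1 n2 key.
  rewrite -subr_ge0.
  have -> : 10 * (2 * al * (1 + al) * X / ((1 - al) * D1)) -
    2 * (2 * al * (1 + al) * (2 * X * (X + 2)) / ((1 - al) * D2)) =
    (4 * al * (1 + al) * X / ((1 - al) * D1 * D2)) * (5 * D2 - 2 * (X + 2) * D1).
    by field; rewrite !gt_eqF.
  rewrite mulr_ge0 // ?subr_ge0 // divr_ge0 // ?mulr_ge0 // ?(ltW al0) ?(ltW n1) ?(ltW n2) ?(ltW a1') //; alra.
suff : (-10) * psi y <= - psi (2 * y) by alra.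
apply: (@psi_mvt y y0 _ (fun t => - psi (2 * t)) (fun t => - (2 * dpsi (2 * t))) (-10)).
- alra.
- by rewrite mulr0 psi0 oppr0.
- move=> t /andP[t0 ty].
  have l2 : `|2 * t| <= sgm by rewrite ger0_norm; alra.
  have i : is_derive t 1 (fun u : R => 2 * u) 2.
    apply: is_derive_eq (is_deriveZ (2 : R) (is_derive_id t (1 : R))) _.
    by rewrite /GRing.scale /= mulr1.
  apply: is_derive_eq (is_deriveN (@is_derive1_comp R psi (fun u : R => 2 * u) t _ _ (is_derive_psi l2) i)) _.
  by rewrite mulrC.
move=> t /andP[t0 ty]; rewrite mulNr lerN2; exact: dub.
Qed.

(** Since the variance strictly increases with the parameter, the stationary mean in the diagonal
    direction has positive slope as soon as y > 0. *)
Lemma A1_diff y : 0 <= y -> y <= sgm -> 2 * al * y <= A1 y - A1 (- y).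
Proof.
move=> y0 ys; have g1 := oneale_gt0 ys; have g2 := @oneale_gt0 (- y) ltac:(alra).
have h := sinh_ge y0; have e0 := expR_gt0 (- y).
have le : al * expR (- y) <= al * expR y by rewrite ler_wpM2l ?(ltW al0) // ler_expR; alra.
have v0 := ale_gt0 (- y).
set u := al * expR y in g1 le *; set v := al * expR (- y) in g2 le v0 *.
have l1 : u / (1 - v) ^+ 2 <= u / (1 - u) ^+ 2.
  apply: ler_wpM2l; first by alra.
  rewrite lef_pV2 ?posrE ?exprn_gt0 // lerXn2r ?nnegrE //; alra.
have l2 : (u - v) <= (u - v) / (1 - v) ^+ 2.
  apply: ler_peMr; first by alra.
  rewrite invf_ge1 ?exprn_gt0 // exprn_ile1 //; alra.
have l3 : 2 * al * y <= u - v.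
  rewrite /u /v; have := ler_wpM2l (ltW al0) h; alra.
rewrite /A1 -/u -/v; move: l2; rewrite mulrBl; alra.
Qed.

Lemma psi_cont y : 0 <= y -> y <= sgm -> {within `[0, y], continuous psi}.
Proof.
move=> y0 ys; apply: derivable_within_continuous => t; rewrite in_itv /= => /andP[t0 ty].
have ts : `|t| <= sgm by rewrite ger0_norm // (le_trans ty).
by have := is_derive_psi ts; case.
Qed.

End RateFunction.

(** * Exponential moments *)

Section BoundaryModel.
Variable R : realType.
Variable al : R.
Hypothesis al0 : 0 < al.
Hypothesis al1 : al < 1.
Local Notation phi := (phi al).
Local Notation Af := (Af al).
Local Notation A1 := (A1 al).
Local Notation sgm := (sgm al).
Local Notation CT := (CT al).
Local Notation Psi := (Psi al).

(** The geometric law conditioned to be below [c]: a genuine probability, whereas [geo] on the same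
    range is not. *)
Definition gam c (r : R) : nat -> R := fun k => (1 - r ^+ c)^-1 * geo r k.
Definition par (y : R) := al * expR y.
Definition qq := al ^+ 2.
Definition rho := (1 + al) / 2.

Definition Qn c M N E := Q (iota 0 c) (gam c qq) M N E.
Definition ELn c r M F := EL (iota 0 c) (nseq M (gam c r)) F.
Definition Bn c a b M N (F : seq nat -> seq nat -> (nat -> nat -> nat) -> R) :=
  ELn c a M (fun S => ELn c b N (fun J => Qn c M N (F S J))).

(** The cut is so high that all normalising constants of a boundary model of side at most [L] (two
    axes and the bulk) multiply to at most 2; [Bn] is then at most twice [Bs]. *)
Definition massive c L := (0 < c)%N /\ 2^-1 <= (1 - rho ^+ c) ^+ (L + L + L * L).

Lemma rho01 : 0 < rho < 1.
Proof. by rewrite /rho; move: (al0) (al1) => ? ?; apply/andP; split; lra. Qed.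

Lemma par_gt0 y : 0 < par y. Proof. by rewrite mulr_gt0 ?expR_gt0. Qed.
Lemma par_le y : y <= sgm -> par y <= rho. Proof. exact: ale_le. Qed.
Lemma par_lt1 y : y <= sgm -> par y < 1.
Proof. by move=> /par_le h; apply: le_lt_trans h _; case/andP: rho01. Qed.
Lemma qq_gt0 : 0 < qq. Proof. exact: exprn_gt0. Qed.
Lemma qq_lt1 : qq < 1.
Proof. by rewrite /qq expr2 mulr_ilt1 // ltW. Qed.
Lemma qq_le : qq <= rho.
Proof. rewrite /qq /rho; move: (al0) (al1) => ? ?; nra. Qed.

Lemma geo_ge0 (r : R) k : 0 <= r -> r <= 1 -> 0 <= geo r k.
Proof. by move=> r0 r1; rewrite mulr_ge0 ?exprn_ge0 // subr_ge0. Qed.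

Lemma gam_ge0 c (r : R) k : 0 <= r -> r <= 1 -> 0 <= gam c r k.
Proof.
move=> r0 r1; rewrite mulr_ge0 ?geo_ge0 // invr_ge0 subr_ge0.
exact: exprn_ile1.
Qed.

Lemma gam_mass c (r : R) : (0 < c)%N -> 0 <= r -> r < 1 ->
  \sum_(k <- iota 0 c) gam c r k = 1.
Proof.
move=> c0 r0 r1; rewrite -mulr_sumr -mulr_sumr geom_sum ?lt_eqF //.
have n1 : 1 - r != 0 by rewrite subr_eq0 eq_sym lt_eqF.
have n2 : 1 - r ^+ c != 0 by rewrite subr_eq0 eq_sym lt_eqF // exprn_ilt1 // -lt0n.
by rewrite [X in _ * X]mulrCA mulfV // mulr1 mulVf.
Qed.

Lemma ELn_cst c r M (x : R) : (0 < c)%N -> 0 <= r -> r < 1 -> ELn c r M (fun=> x) = x.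
Proof.
move=> c0 r0 r1; rewrite -[RHS]mulr1 -[in RHS](@EL1 R _ (iota 0 c) (nseq M (gam c r))).
  by rewrite -ELZ; apply: eq_EL' => l; rewrite mulr1.
by move=> k; rewrite size_nseq => kM; rewrite nth_nseq kM gam_mass.
Qed.

Lemma Qn_cst c M N (x : R) : (0 < c)%N -> Qn c M N (fun=> x) = x.
Proof.
move=> c0; rewrite /Qn; elim: N => [|N IH] //=; under eq_EL' do rewrite IH.
by apply: ELn_cst => //; [exact: ltW qq_gt0|exact: qq_lt1].
Qed.

Lemma le_ELn c r M F G : 0 <= r -> r <= 1 -> (forall l, size l = M -> F l <= G l) ->
  ELn c r M F <= ELn c r M G.
Proof. by move=> r0 r1 FG; apply: le_EL_nseq => // k; exact: gam_ge0. Qed.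

Lemma le_Qn c M N E E' : (forall w, E w <= E' w) -> Qn c M N E <= Qn c M N E'.
Proof.
apply: le_Q => k; apply: gam_ge0; [exact: ltW qq_gt0|exact: ltW qq_lt1].
Qed.

Lemma Qn_ge0 c M N E : (forall w, 0 <= E w) -> 0 <= Qn c M N E.
Proof.
apply: Q_ge0 => k; apply: gam_ge0; [exact: ltW qq_gt0|exact: ltW qq_lt1].
Qed.

Lemma le_Bn c y y' M N F G : y <= sgm -> y' <= sgm ->
  (forall S J w, size S = M -> size J = N -> F S J w <= G S J w) ->
  Bn c (par y) (par y') M N F <= Bn c (par y) (par y') M N G.
Proof.
move=> ys ys' FG; apply: le_ELn; rewrite ?(ltW (par_gt0 _)) ?(ltW (par_lt1 ys)) // => S sS.
apply: le_ELn; rewrite ?(ltW (par_gt0 _)) ?(ltW (par_lt1 ys')) // => J sJ.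
by apply: le_Qn => w; apply: FG.
Qed.

Lemma BnD c a b M N F G :
  Bn c a b M N (fun S J w => F S J w + G S J w) = Bn c a b M N F + Bn c a b M N G.
Proof.
rewrite /Bn /ELn -ELD; apply: eq_EL' => S; rewrite -ELD; apply: eq_EL' => J.
exact: QD.
Qed.

Lemma BnZ c a b M N x F : Bn c a b M N (fun S J w => x * F S J w) = x * Bn c a b M N F.
Proof.
rewrite /Bn /ELn -ELZ; apply: eq_EL' => S; rewrite -ELZ; apply: eq_EL' => J.
exact: QZ.
Qed.

Lemma Bn_row c y y' M N F : (0 < c)%N -> y' <= sgm ->
  Bn c (par y) (par y') M N (fun S _ w => F S w) = ELn c (par y) M (fun S => Qn c M N (F S)).
Proof.
move=> c0 ys'; apply: eq_EL' => S; apply: ELn_cst => //; last exact: par_lt1.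
exact: ltW (par_gt0 _).
Qed.

Lemma Bn_col c y y' M N F : (0 < c)%N -> y <= sgm ->
  Bn c (par y) (par y') M N (fun _ J w => F J w) = ELn c (par y') N (fun J => Qn c M N (F J)).
Proof.
move=> c0 ys; apply: ELn_cst => //; last exact: par_lt1.
exact: ltW (par_gt0 _).
Qed.

Lemma Bn_bulk c y y' M N F : (0 < c)%N -> y <= sgm -> y' <= sgm ->
  Bn c (par y) (par y') M N (fun _ _ w => F w) = Qn c M N F.
Proof.
move=> c0 ys ys'; rewrite Bn_row //; apply: ELn_cst => //; last exact: par_lt1.
exact: ltW (par_gt0 _).
Qed.

Lemma Bn_le2Bs c y y' M N L F : y <= sgm -> y' <= sgm -> (M <= L)%N -> (N <= L)%N ->
  massive c L -> (forall S J w, 0 <= F S J w) ->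
  Bn c (par y) (par y') M N F <= 2 * Bs c (par y) (par y') qq M N F.
Proof.
move=> ys ys' ML NL [c0 mc] F0.
have [r0 r1] : 0 < rho /\ rho < 1 by apply/andP; exact: rho01.
have rc0 : 0 <= rho ^+ c by rewrite exprn_ge0 // ltW.
have rc1 : 0 < 1 - rho ^+ c by rewrite subr_gt0 exprn_ilt1 // -?lt0n // ltW.
have X n (r : R) : 0 < r -> r <= rho -> 0 <= (1 - r ^+ c)^-1 ^+ n /\
    (1 - r ^+ c)^-1 ^+ n <= (1 - rho ^+ c)^-1 ^+ n.
  move=> h1 h2; have h3 : r ^+ c <= rho ^+ c by apply: lerXn2r; rewrite ?nnegrE ?(ltW h1) ?(ltW r0).
  have h4 : 0 < 1 - r ^+ c by lra.
  split; first by rewrite exprn_ge0 // invr_ge0 ltW.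
  apply: lerXn2r; rewrite ?nnegrE ?invr_ge0 ?(ltW h4) ?(ltW rc1) //.
  by rewrite lef_pV2 ?posrE //; lra.
rewrite /Bn /ELn (EL_nseq_scale _ _ _ (geo (par y))).
have -> : Bs c (par y) (par y') qq M N F =
  EL (iota 0 c) (nseq M (geo (par y))) (fun S => EL (iota 0 c) (nseq N (geo (par y')))
   (fun J => Q (iota 0 c) (geo qq) M N (F S J))) by [].
under eq_EL' do rewrite (EL_nseq_scale _ _ _ (geo (par y'))).
under eq_EL' do under eq_EL' do rewrite /Qn (Q_scale _ _ (geo qq)).
under eq_EL' do rewrite ELZ.
rewrite !ELZ !mulrA; apply: ler_wpM2r.
  apply: EL_nseq_ge0 => [k|S]; first by apply: geo_ge0; rewrite ?(ltW (par_gt0 _)) ?(ltW (par_lt1 ys)).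
  apply: EL_nseq_ge0 => [k|J]; first by apply: geo_ge0; rewrite ?(ltW (par_gt0 _)) ?(ltW (par_lt1 ys')).
  apply: Q_ge0 => // k; apply: geo_ge0; [exact: ltW qq_gt0|exact: ltW qq_lt1].
have [x1 x2] := X M _ (par_gt0 y) (par_le ys).
have [x3 x4] := X N _ (par_gt0 y') (par_le ys').
have [x5 x6] := X (M * N)%N _ qq_gt0 qq_le.
apply: (@le_trans _ _ ((1 - rho ^+ c)^-1 ^+ (M + N + M * N))).
  rewrite !exprD; apply: ler_pM; rewrite ?mulr_ge0 //.
  exact: ler_pM.
rewrite exprVn -[leRHS]invrK lef_pV2 ?posrE ?invr_gt0 ?exprn_gt0 //.
apply: le_trans mc _; apply: ler_wiXn2l; rewrite ?(ltW rc1) //; first by rewrite gerBl.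
by rewrite !leq_add ?leq_mul.
Qed.

Lemma expR_phi y : y <= sgm -> expR (phi y) = (1 - par y)^-1.
Proof. by move=> ys; rewrite expRN lnK // posrE oneale_gt0. Qed.

Lemma ratio_phi y y' : y <= sgm -> y' <= sgm ->
  (1 - par y) / (1 - par y') = expR (phi y' - phi y).
Proof. by move=> ys ys'; rewrite expRD expRN !expR_phi // invrK mulrC. Qed.

Lemma parM y z : par y * expR z = par (y + z).
Proof. by rewrite /par -mulrA -expRD. Qed.

Lemma norm_le_l (x s : R) : `|x| <= s -> x <= s /\ - x <= s.
Proof. by rewrite ler_norml => /andP[h1 h2]; split=> //; lra. Qed.

Definition eG (t : R) S J w M N := expR (t * (lp (bdw S J w) M N)%:R).

Lemma eGE t S J w M N : eG t S J w M N = expR t ^+ lp (bdw S J w) M N.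
Proof. by rewrite /eG expRM_natr. Qed.

(** The choice a = [par y], b = [par (- y')], s = [expR (y' - y)] parametrises the solutions of a b
    s = q, and the two factors become increments of [phi]. *)
Lemma mgf_formula y y' M N : `|y| <= sgm -> `|y'| <= sgm ->
  ((1 - par y) / (1 - par y * expR (y' - y))) ^+ M *
  ((1 - par (- y')) / (1 - par (- y') * expR (y' - y))) ^+ N =
  expR (Psi M%:R N%:R y y').
Proof.
move=> /norm_le_l[h1 h2] /norm_le_l[h3 h4].
rewrite !parM; have -> : y + (y' - y) = y' by ring.
have -> : - y' + (y' - y) = - y by ring.
by rewrite !ratio_phi // -!expRM_natl -expRD.
Qed.

Lemma mgf_side y y' : `|y| <= sgm -> `|y'| <= sgm ->
  [/\ 0 <= par y < 1, 0 <= par (- y') < 1, par y * expR (y' - y) < 1,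
      par (- y') * expR (y' - y) < 1 & par y * (par (- y') * expR (y' - y)) = qq].
Proof.
move=> /norm_le_l[h1 h2] /norm_le_l[h3 h4].
rewrite !parM; have -> : y + (y' - y) = y' by ring.
have -> : - y' + (y' - y) = - y by ring.
rewrite !par_lt1 // !(ltW (par_gt0 _)); split=> //.
by rewrite /par mulrACA -expRD subrr expR0 mulr1.
Qed.

Lemma G_mgf c L M N y y' : `|y| <= sgm -> `|y'| <= sgm -> massive c L ->
  (M <= L)%N -> (N <= L)%N ->
  Bn c (par y) (par (- y')) M N (fun S J w => eG (y' - y) S J w M N) <=
  2 * expR (Psi M%:R N%:R y y').
Proof.
move=> hy hy' mc ML NL; have [h1 h2] := norm_le_l hy; have [h3 h4] := norm_le_l hy'.
apply: le_trans (Bn_le2Bs _ _ ML NL mc _) _ => // [S J w|]; first exact: expR_ge0.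
rewrite ler_wpM2l //.
have -> : Bs c (par y) (par (- y')) qq M N (fun S J w => eG (y' - y) S J w M N) =
  Bs c (par y) (par (- y')) qq M N (fun S J w => expR (y' - y) ^+ lp (bdw S J w) M N).
  by do 2 (apply: eq_EL' => ?); apply: eq_Q => w; rewrite eGE.
have [p1 p2 p3 p4 p5] := mgf_side hy hy'.
by rewrite -mgf_formula //; apply: Bs_mgf_le; rewrite ?expR_ge0 ?qq_lt1.
Qed.

Lemma ind_expR (b : bool) (z : R) : (b -> 0 <= z) -> b%:R <= expR z.
Proof.
case: b => [/(_ isT) z0|_]; last exact: expR_ge0.
by apply: le_trans (expR_ge1Dx z); rewrite lerDl.
Qed.

Lemma P_G_ge c L M N y y' x : `|y| <= sgm -> `|y'| <= sgm -> y <= y' -> massive c L ->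
  (M <= L)%N -> (N <= L)%N ->
  Bn c (par y) (par (- y')) M N (fun S J w => (x <= (lp (bdw S J w) M N)%:R)%R%:R) <=
  2 * expR (Psi M%:R N%:R y y' - (y' - y) * x).
Proof.
move=> hy hy' yy mc ML NL; have [h1 h2] := norm_le_l hy; have [h3 h4] := norm_le_l hy'.
rewrite expRD mulrA [leRHS]mulrC.
apply: le_trans (ler_wpM2l (expR_ge0 _) (G_mgf hy hy' mc ML NL)).
rewrite -BnZ; apply: le_Bn => // S J w _ _; rewrite /eG -expRD.
by apply: ind_expR => xG; rewrite addrC -mulrBr mulr_ge0 // subr_ge0.
Qed.

Lemma P_G_le c L M N y y' x : `|y| <= sgm -> `|y'| <= sgm -> y' <= y -> massive c L ->
  (M <= L)%N -> (N <= L)%N ->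
  Bn c (par y) (par (- y')) M N (fun S J w => ((lp (bdw S J w) M N)%:R <= x)%R%:R) <=
  2 * expR (Psi M%:R N%:R y y' - (y' - y) * x).
Proof.
move=> hy hy' yy mc ML NL; have [h1 h2] := norm_le_l hy; have [h3 h4] := norm_le_l hy'.
rewrite expRD mulrA [leRHS]mulrC.
apply: le_trans (ler_wpM2l (expR_ge0 _) (G_mgf hy hy' mc ML NL)).
rewrite -BnZ; apply: le_Bn => // S J w _ _; rewrite /eG -expRD.
by apply: ind_expR => xG; rewrite addrC -mulrBr mulr_le0 // subr_le0.
Qed.

Definition conscol (J : seq nat) (w : nat -> nat -> nat) (i j : nat) : nat :=
  if i is i'.+1 then w i' j else nth 0%N J j.

(** A path starts along one of the axes, the corner having weight 0. Each half ignores the other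
    axis, whose parameter may therefore be changed freely when an event of that half is
    estimated. *)
Lemma G_split S J w M N : lp (bdw S J w) M.+1 N.+1 =
  maxn (lp (consrow S w) M N.+1) (lp (conscol J w) M.+1 N).
Proof.
by rewrite lp_first add0n; congr maxn; apply: lp_ext => a b _ _; case: a => [|a]; case: b.
Qed.

Lemma lp_le_bdw S J w M N : (lp w M N <= lp (bdw S J w) M.+1 N.+1)%N.
Proof.
apply: (leq_trans (n := lp (consrow S w) M N.+1)); last by rewrite G_split leq_maxl.
have -> : lp w M N = lp (sh 0 1 (consrow S w)) M N by apply: lp_ext.
have := remove_row_h (consrow S w) 0 M N.
have : (lp (sh 0 1 (consrow S w)) 0 N <= lp (consrow S w) 0 N.+1)%N.
  by rewrite lp_first0 leq_addl.
have := lp_le_right (sh 0 1 (consrow S w)) N (leq0n M).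
have := lp_le_right (consrow S w) N.+1 (leq0n M).
rewrite !add0n; lia.
Qed.

(** Adding axes only increases the passage time, so positive exponential moments of the bulk time
    are dominated by the explicit ones. *)
Lemma T_mgf c L M N y y' : `|y| <= sgm -> `|y'| <= sgm -> y <= y' -> massive c L ->
  (M < L)%N -> (N < L)%N ->
  Qn c M.+1 N.+1 (fun w => expR ((y' - y) * (lp w M N)%:R)) <=
  2 * expR (Psi M.+1%:R N.+1%:R y y').
Proof.
move=> hy hy' yy mc ML NL; have [h1 h2] := norm_le_l hy; have [h3 h4] := norm_le_l hy'.
apply: le_trans (G_mgf hy hy' mc ML NL).
rewrite -(@Bn_bulk c y (- y')) //; last by case: mc.
apply: le_Bn => // S J w _ _; rewrite ler_expR ler_wpM2l ?subr_ge0 // ler_nat.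
exact: lp_le_bdw.
Qed.

Definition bdext M N (F : seq nat -> seq nat -> (nat -> nat -> nat) -> R) :=
  forall S S' J J' w w', (forall i, (i < M)%N -> nth 0%N S i = nth 0%N S' i) ->
  (forall j, (j < N)%N -> nth 0%N J j = nth 0%N J' j) ->
  (forall i j, (i < M)%N -> (j < N)%N -> w i j = w' i j) -> F S J w = F S' J' w'.

Lemma ELn_take c r M M' F : (0 < c)%N -> 0 <= r -> r < 1 -> (M' <= M)%N ->
  (forall S S', (forall i, (i < M')%N -> nth 0%N S i = nth 0%N S' i) -> F S = F S') ->
  ELn c r M F = ELn c r M' F.
Proof.
move=> c0 r0 r1 /subnKC <- hF; rewrite /ELn nseqD EL_cat.
apply: eq_EL => S; rewrite size_nseq => sS _.
rewrite -[RHS](@ELn_cst c r (M - M')) //; apply: eq_EL' => S'.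
by apply: hF => i iM; rewrite nth_cat sS iM.
Qed.

Lemma Qn_sub c M N M' N' (sg : nat -> nat -> nat * nat) E : (0 < c)%N -> boxed M' N' E ->
  (forall i j, (i < M')%N -> (j < N')%N -> ((sg i j).1 < M)%N /\ ((sg i j).2 < N)%N) ->
  (forall i j i' j', (i < M')%N -> (j < N')%N -> (i' < M')%N -> (j' < N')%N ->
     sg i j = sg i' j' -> i = i' /\ j = j') ->
  Qn c M N (fun w => E (fun i j => w (sg i j).1 (sg i j).2)) = Qn c M' N' E.
Proof.
move=> c0; apply: Q_sub; apply: gam_mass => //; [exact: ltW qq_gt0|exact: qq_lt1].
Qed.

Lemma Qn_box c M N M' N' E : (0 < c)%N -> boxed M' N' E -> (M' <= M)%N -> (N' <= N)%N ->
  Qn c M N E = Qn c M' N' E.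
Proof.
move=> c0 bE MM NN; rewrite -(@Qn_sub c M N M' N' (fun i j => (i, j))) //.
  by move=> i j iM jN; split; rewrite /=; [exact: leq_trans MM|exact: leq_trans NN].
by move=> i j i' j' _ _ _ _ [-> ->].
Qed.

Lemma Qn_shift c M N M' N' a b E : (0 < c)%N -> boxed M' N' E ->
  (a + M' <= M)%N -> (b + N' <= N)%N -> Qn c M N (fun w => E (sh a b w)) = Qn c M' N' E.
Proof.
move=> c0 bE MM NN; rewrite -(@Qn_sub c M N M' N' (fun i j => (a + i, b + j)%N)) //.
  by move=> i j iM jN; split; rewrite /=; lia.
by move=> i j i' j' _ _ _ _ []; lia.
Qed.

Lemma Qn_tr c M N E : (0 < c)%N -> boxed N M E ->
  Qn c M N (fun w => E (fun i j => w j i)) = Qn c N M E.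
Proof.
move=> c0 bE; rewrite -(@Qn_sub c M N N M (fun i j => (j, i))) //.
by move=> i j i' j' _ _ _ _ [-> ->].
Qed.

Lemma Qn_rot c M N E : (0 < c)%N -> boxed M.+1 N.+1 E ->
  Qn c M.+1 N.+1 (fun w => E (fun i j => w (M - i)%N (N - j)%N)) = Qn c M.+1 N.+1 E.
Proof.
move=> c0 bE; rewrite -[RHS](@Qn_sub c M.+1 N.+1 _ _ (fun i j => (M - i, N - j)%N)) //.
  by move=> i j iM jN; split; rewrite /=; lia.
by move=> i j i' j' ? ? ? ? []; lia.
Qed.

Lemma Bn_restrict c y y' M N M' N' F : (0 < c)%N -> y <= sgm -> y' <= sgm ->
  (M' <= M)%N -> (N' <= N)%N -> bdext M' N' F ->
  Bn c (par y) (par y') M N F = Bn c (par y) (par y') M' N' F.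
Proof.
move=> c0 ys ys' MM NN hF.
rewrite /Bn (@ELn_take c _ M M') ?(ltW (par_gt0 _)) ?par_lt1 //; last first.
  move=> S S' SS; apply: eq_EL' => J; apply: eq_Q => w; exact: hF.
apply: eq_EL' => S; rewrite (@ELn_take c _ N N') ?(ltW (par_gt0 _)) ?par_lt1 //; last first.
  move=> J J' JJ; apply: eq_Q => w; exact: hF.
apply: eq_EL' => J; apply: Qn_box => // w w' ww; exact: hF.
Qed.

Lemma Bn_tr c a b M N F : (0 < c)%N -> (forall S J, boxed M N (F S J)) ->
  Bn c a b M N F = Bn c b a N M (fun S J w => F J S (fun i j => w j i)).
Proof.
move=> c0 bF; rewrite /Bn /ELn EL_exch; apply: eq_EL' => J; apply: eq_EL' => S.
by rewrite (Qn_tr c0 (bF S J)).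
Qed.

End BoundaryModel.

(** * Exit points and increments *)

Lemma natb_le1 (R : realType) (b : bool) : b%:R <= 1 :> R.
Proof. by case: b. Qed.

Lemma lp_bdw_tr S J w M N : lp (bdw S J w) M N = lp (bdw J S (fun i j => w j i)) N M.
Proof.
rewrite -[LHS]lp_tr; apply: lp_ext => a b _ _; by case: a => [|a]; case: b.
Qed.

Lemma boxed_lp_bdw S J M N M' N' : (M' <= M)%N -> (N' <= N)%N ->
  boxed M N (fun w => lp (bdw S J w) M' N').
Proof.
move=> MM NN w w' ww; apply: lp_ext => -[|a] [|b] aM bN //=; apply: ww; lia.
Qed.

Lemma boxed_lp M N M' N' : (M' < M)%N -> (N' < N)%N -> boxed M N (fun w => lp w M' N').
Proof. by move=> MM NN w w' ww; apply: lp_ext => a b aM bN; apply: ww; lia. Qed.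

Lemma consrow_nth S S' w w' M N : (forall i, (i <= M)%N -> nth 0%N S i = nth 0%N S' i) ->
  (forall i j, (i <= M)%N -> (j < N)%N -> w i j = w' i j) ->
  lp (consrow S w) M N = lp (consrow S' w') M N.
Proof.
by move=> SS ww; apply: lp_ext => a [|b] aM bN /=; [exact: SS|exact: ww].
Qed.

Lemma conscol_nth J J' w w' M N : (forall i, (i <= N)%N -> nth 0%N J i = nth 0%N J' i) ->
  (forall i j, (i < M)%N -> (j <= N)%N -> w i j = w' i j) ->
  lp (conscol J w) M N = lp (conscol J' w') M N.
Proof.
by move=> SS ww; apply: lp_ext => -[|a] b aM bN /=; [exact: SS|exact: ww].
Qed.

Lemma sh01_consrow S w M N : lp (sh 0 1 (consrow S w)) M N = lp w M N.
Proof. by apply: lp_ext. Qed.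

Section Increments.
Variable R : realType.
Variable al : R.
Hypothesis al0 : 0 < al.
Hypothesis al1 : al < 1.
Local Notation phi := (phi al).
Local Notation Af := (Af al).
Local Notation A1 := (A1 al).
Local Notation sgm := (sgm al).
Local Notation CT := (CT al).
Local Notation Psi := (Psi al).
Local Notation par := (par al).
Local Notation qq := (qq al).
Local Notation Qn := (Qn al).
Local Notation Bn := (Bn al).
Local Notation massive := (massive al).

(** Derivative in [y0] of the stationary mean [M * Af y0 + N * Af (- y0)]; when it is positive the
    horizontal axis is favoured. *)
Definition dch (y0 M N : R) := M * A1 y0 - N * A1 (- y0).
(** Bound for leaving along the vertical axis: 6 sums three Chernoff bounds with prefactor 2, and 27
    is the cube of the largest parameter shift, [3 * h], in units of [h]. *)
Definition ebd (y0 h M N : R) := 6 * expR (- (h ^+ 2 / 2 * dch y0 M N) + 27 * CT * h ^+ 3 * (M + N)).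

(** The row half ignores the vertical axis, whose parameter is moved to [- (y0 - h)]. Then either
    the whole time is below the level, or the column half is above it; the latter ignores the
    horizontal axis, which is moved to [y0 - 2 * h]. Both are Chernoff bounds with parameter change
    [h]. *)
Lemma exit_low c L (y0 h : R) M N (y1 : R) : massive c L -> (M < L)%N -> (N < L)%N ->
  `|y0| + 3 * h <= sgm -> 0 <= h -> 0 <= dch y0 M.+1%:R N.+1%:R -> y1 <= sgm ->
  Bn c (par y0) (par y1) M.+1 N.+1 (fun S J w => ((lp (consrow S w) M N.+1)%:R <=
     M.+1%:R * Af y0 + N.+1%:R * Af (- y0) - h * dch y0 M.+1%:R N.+1%:R)%R%:R)
  <= 2 * (2 * expR (- (h ^+ 2 / 2 * dch y0 M.+1%:R N.+1%:R) + 27 * CT * h ^+ 3 * (M.+1%:R + N.+1%:R))).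
Proof.
move=> mc ML NL yh h0 D0 y1s; have c0 : (0 < c)%N by case: mc.
set D := dch _ _ _ in D0 *; set mu := _ * Af y0 + _; set x := mu - h * D.
have CT0 : 0 <= CT by apply: ltW; exact: CT_gt0.
have hy0 : `|y0| <= sgm by lra.
have sh_le k : 0 <= k <= 3 -> `|y0 - k * h| <= sgm.
  case/andP=> k0 k3; apply: le_trans yh; apply: le_trans (ler_normB _ _) _.
  by rewrite lerD2l ger0_norm ?mulr_ge0 // ler_wpM2r.
have hy1 := sh_le 1 ltac:(apply/andP; split; lra); rewrite mul1r in hy1.
have hy2 := sh_le 2 ltac:(apply/andP; split; lra).
have [a1 a2] := norm_le_l hy0; have [b1 b2] := norm_le_l hy1; have [d1 d2] := norm_le_l hy2.
have E (y : R) : y <= sgm -> Bn c (par y0) (par y) M.+1 N.+1 (fun S J w => ((lp (consrow S w) M N.+1)%:R <= x)%R%:R)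
  = ELn c (par y0) M.+1 (fun S => Qn c M.+1 N.+1 (fun w => ((lp (consrow S w) M N.+1)%:R <= x)%R%:R)).
  move=> ys; exact: (@Bn_row R al al0 al1 c y0 y M.+1 N.+1 (fun S w => ((lp (consrow S w) M N.+1)%:R <= x)%R%:R)).
rewrite E // -(E (- (y0 - h))) //.
apply: (@le_trans _ _ (Bn c (par y0) (par (- (y0 - h))) M.+1 N.+1 (fun S J w =>
   ((lp (bdw S J w) M.+1 N.+1)%:R <= x)%R%:R + (x <= (lp (conscol J w) M.+1 N)%:R)%R%:R))).
  apply: le_Bn => // S J w _ _; rewrite G_split.
  case: (lerP (lp (consrow S w) M N.+1)%:R x) => h1 /=; last by rewrite addr_ge0.
  case: (lerP x (lp (conscol J w) M.+1 N)%:R) => h2 /=; first by rewrite lerDr.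
  rewrite (_ : ((maxn _ _)%:R <= x) = true) ?lerDl //.
  by rewrite /maxn; case: ifP => _ //; exact: ltW.
have S0 : 0 <= M.+1%:R + N.+1%:R :> R by rewrite addr_ge0.
rewrite BnD mulr_natl mulr2n; apply: lerD.
  apply: le_trans (P_G_le al0 al1 x hy0 hy1 _ mc ML NL) _; first lra.
  rewrite ler_wpM2l // ler_expR.
  have := @Psi_le R al al0 al1 M.+1%:R N.+1%:R y0 0 (- h) (ler0n _ _) (ler0n _ _) hy0.
  rewrite addr0 => /(_ hy0 hy1); rewrite subr0 -/mu -/D normrN (ger0_norm h0) expr0n /= subr0 add0r sqrrN.
  have : 0 <= CT * h ^+ 3 * (M.+1%:R + N.+1%:R) by apply: mulr_ge0 => //; apply: mulr_ge0 => //; exact: exprn_ge0.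
  rewrite /x /D /dch; lra.
rewrite (@Bn_col R al al0 al1 c y0 (- (y0 - h)) M.+1 N.+1 (fun J w => (x <= (lp (conscol J w) M.+1 N)%:R)%R%:R)) //.
rewrite -(@Bn_col R al al0 al1 c (y0 - 2 * h) (- (y0 - h)) M.+1 N.+1 (fun J w => (x <= (lp (conscol J w) M.+1 N)%:R)%R%:R)) //.
apply: (@le_trans _ _ (Bn c (par (y0 - 2 * h)) (par (- (y0 - h))) M.+1 N.+1 (fun S J w =>
   (x <= (lp (bdw S J w) M.+1 N.+1)%:R)%R%:R))).
  apply: le_Bn => // S J w _ _; rewrite G_split.
  case: (lerP x (lp (conscol J w) M.+1 N)%:R) => h2 //=.
  by rewrite (le_trans h2) // ler_nat leq_maxr.
apply: le_trans (P_G_ge al0 al1 x hy2 hy1 _ mc ML NL) _; first lra.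
rewrite ler_wpM2l // ler_expR.
have := @Psi_le R al al0 al1 M.+1%:R N.+1%:R y0 (- (2 * h)) (- h) (ler0n _ _) (ler0n _ _) hy0.
move=> /(_ hy2 hy1); rewrite -/mu -/D.
have -> : - h - - (2 * h) = h by ring.
have -> : y0 - h - (y0 - 2 * h) = h by ring.
rewrite (ger0_norm h0) !sqrrN.
have : 0 <= CT * h ^+ 3 * (M.+1%:R + N.+1%:R) by apply: mulr_ge0 => //; apply: mulr_ge0 => //; exact: exprn_ge0.
have : 0 <= h ^+ 2 * D by rewrite mulr_ge0 ?exprn_ge0.
rewrite /x /D /dch; lra.
Qed.

(** Leaving along the vertical axis puts the row half below the level [x] or the column half above
    it. [exit_low] handles the first; for the second the horizontal axis is weakened to
    [y0 - 3 * h], for which even the full time rarely reaches [x]. *)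
Lemma exit_bound c L (y0 h : R) M N : massive c L -> (M < L)%N -> (N < L)%N ->
  `|y0| + 3 * h <= sgm -> 0 <= h -> 0 <= dch y0 M.+1%:R N.+1%:R ->
  Bn c (par y0) (par (- y0)) M.+1 N.+1 (fun S J w =>
    (lp (consrow S w) M N.+1 <= lp (conscol J w) M.+1 N)%N%:R)
  <= ebd y0 h M.+1%:R N.+1%:R.
Proof.
move=> mc ML NL yh h0 D0; have c0 : (0 < c)%N by case: mc.
have hy0 : `|y0| <= sgm by lra.
have [a1 a2] := norm_le_l hy0.
have low := exit_low mc ML NL yh h0 D0 a2.
have hy3 : `|y0 - 3 * h| <= sgm.
  apply: le_trans yh; apply: le_trans (ler_normB _ _) _.
  by rewrite lerD2l ger0_norm ?mulr_ge0.
have [b1 b2] := norm_le_l hy3.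
move: low; rewrite /ebd; set D := dch _ _ _ in D0 *; set mu := _ * Af y0 + _; set x := mu - h * D => low.
have CT0 : 0 <= CT by apply: ltW; exact: CT_gt0.
set e := expR _ in low *.
rewrite (_ : 6 = 2 * 2 + 2 :> R); last by ring.
rewrite mulrDl -mulrA.
apply: (@le_trans _ _ (Bn c (par y0) (par (- y0)) M.+1 N.+1 (fun S J w =>
   ((lp (consrow S w) M N.+1)%:R <= x)%R%:R + (x <= (lp (conscol J w) M.+1 N)%:R)%R%:R))).
  apply: le_Bn => // S J w _ _; case: leqP => h1 /=; last by rewrite addr_ge0.
  case: (lerP (lp (consrow S w) M N.+1)%:R x) => h2 /=; first by rewrite lerDl.
  by rewrite (_ : (x <= _) = true) ?lerDr // (le_trans (ltW h2)) // ler_nat.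
rewrite BnD; apply: lerD => //.
rewrite (@Bn_col R al al0 al1 c y0 (- y0) M.+1 N.+1 (fun J w => (x <= (lp (conscol J w) M.+1 N)%:R)%R%:R)) //.
rewrite -(@Bn_col R al al0 al1 c (y0 - 3 * h) (- y0) M.+1 N.+1 (fun J w => (x <= (lp (conscol J w) M.+1 N)%:R)%R%:R)) //.
apply: (@le_trans _ _ (Bn c (par (y0 - 3 * h)) (par (- y0)) M.+1 N.+1 (fun S J w =>
   (x <= (lp (bdw S J w) M.+1 N.+1)%:R)%R%:R))).
  apply: le_Bn => // S J w _ _; rewrite G_split.
  case: (lerP x (lp (conscol J w) M.+1 N)%:R) => h2 //=.
  by rewrite (le_trans h2) // ler_nat leq_maxr.
apply: le_trans (P_G_ge al0 al1 x hy3 hy0 _ mc ML NL) _; first lra.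
rewrite ler_wpM2l // ler_expR.
have := @Psi_le R al al0 al1 M.+1%:R N.+1%:R y0 (- (3 * h)) 0 (ler0n _ _) (ler0n _ _) hy0.
rewrite addr0 => /(_ hy3 hy0); rewrite -/mu -/D.
have -> : 0 - - (3 * h) = 3 * h by ring.
have -> : y0 - (y0 - 3 * h) = 3 * h by ring.
rewrite (ger0_norm (mulr_ge0 _ h0)) // sqrrN expr0n /=.
have S0 : 0 <= M.+1%:R + N.+1%:R :> R by rewrite addr_ge0.
have : 0 <= CT * h ^+ 3 * (M.+1%:R + N.+1%:R) by apply: mulr_ge0 => //; apply: mulr_ge0 => //; exact: exprn_ge0.
have : 0 <= h ^+ 2 * D by rewrite mulr_ge0 ?exprn_ge0.
rewrite /x /D /dch; lra.
Qed.

Lemma sum_geo_le (r t : R) C : 0 <= r < 1 -> 0 <= t -> r * t < 1 ->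
  \sum_(k <- iota 0 C) geo r k * t ^+ k <= (1 - r) / (1 - r * t).
Proof.
move=> /andP[r0 r1] t0 rt1.
have -> : \sum_(k <- iota 0 C) geo r k * t ^+ k = (1 - r) * \sum_(k <- iota 0 C) (r * t) ^+ k.
  by rewrite mulr_sumr; apply: eq_bigr => k _; rewrite /geo exprMn mulrA.
by rewrite ler_wpM2l ?subr_ge0 ?(ltW r1) // geom_le // mulr_ge0.
Qed.

Lemma EL_geo_sumn (r t : R) C j : 0 <= r < 1 -> 0 <= t -> r * t < 1 ->
  EL (iota 0 C) (nseq j (geo r)) (fun l => t ^+ sumn l) <= ((1 - r) / (1 - r * t)) ^+ j.
Proof.
move=> hr t0 rt1; elim: j => [|j IH] /=; first by rewrite !expr0.
under eq_bigr do (under eq_EL' do rewrite exprD); under eq_bigr do rewrite ELZ mulrA.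
rewrite -mulr_suml exprS; apply: ler_pM; rewrite ?sum_geo_le //.
  by apply: sumr_ge0 => k _; rewrite mulr_ge0 ?exprn_ge0 ?geo_ge0 //; case/andP: hr => // ? ?; rewrite ltW.
by apply: EL_nseq_ge0 => k; rewrite ?exprn_ge0 // geo_ge0 //; case/andP: hr => // ? ?; rewrite ltW.
Qed.

Lemma EL_geo_mass (r x : R) C j : 0 <= r < 1 -> 0 <= x ->
  EL (iota 0 C) (nseq j (geo r)) (fun=> x) <= x.
Proof.
move=> hr x0; have := @EL_geo_sumn r 1 C j hr ler01; rewrite mulr1.
have n1 : 1 - r != 0 by case/andP: hr => _ h; rewrite subr_eq0 eq_sym lt_eqF.
rewrite divff // expr1n => /(_ ltac:(by case/andP: hr)) h.
rewrite -[leRHS]mulr1 (_ : EL _ _ _ = x * EL (iota 0 C) (nseq j (geo r)) (fun l => 1 ^+ sumn l)).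
  by rewrite ler_wpM2l.
by rewrite -ELZ; apply: eq_EL' => l; rewrite expr1n mulr1.
Qed.

(** Stationary increments along the top row are independent geometric variables by [Bs_burke], so
    [j] of them contribute a [j]-th power. *)
Lemma burke_mgf c L y0 t M1 j N : `|y0| <= sgm -> y0 + t <= sgm -> massive c L ->
  (M1 + j <= L)%N -> (N <= L)%N ->
  Bn c (par y0) (par (- y0)) (M1 + j) N (fun S J w =>
    expR (t * ((lp (bdw S J w) (M1 + j) N)%:R - (lp (bdw S J w) M1 N)%:R)))
  <= 2 * expR (j%:R * (phi (y0 + t) - phi y0)).
Proof.
move=> hy0 yt mc ML NL; have [a1 a2] := norm_le_l hy0.
apply: le_trans (Bn_le2Bs al0 al1 a1 a2 ML NL mc _) _ => [S J w|]; first exact: expR_ge0.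
rewrite ler_wpM2l //.
pose F (l : seq nat) := expR t ^+ sumn (drop M1 l).
have -> : Bs c (par y0) (par (- y0)) qq (M1 + j) N (fun S J w =>
    expR (t * ((lp (bdw S J w) (M1 + j) N)%:R - (lp (bdw S J w) M1 N)%:R))) =
  Bs c (par y0) (par (- y0)) qq (M1 + j) N (fun S J w => F (topl N S J w)).
  apply: eq_EL => S; rewrite size_nseq => sS _; apply: eq_EL => J; rewrite size_nseq => sJ _.
  apply: eq_Q => w; rewrite !lp_bdw ?sS ?sJ ?leq_addr // /F -expRM_natr; congr expR.
  rewrite !natrD [take (M1 + j) _]take_oversize ?size_topl ?sS //.
  rewrite -{1}(cat_take_drop M1 (topl N S J w)) sumn_cat natrD; ring.
have pr : 0 <= par y0 < 1 by rewrite (ltW (par_gt0 _ _)) ?par_lt1.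
have pr' : 0 <= par (- y0) < 1 by rewrite (ltW (par_gt0 _ _)) ?par_lt1.
have pq : par y0 * par (- y0) = qq.
  by rewrite /par mulrACA -expRD subrr expR0 mulr1.
have F0 l : 0 <= F l by rewrite exprn_ge0 ?expR_ge0.
have [C hC] := Bs_burke c (M1 + j) N pr pr' pq F0.
apply: le_trans hC _; rewrite nseqD EL_cat.
have -> : EL (iota 0 C) (nseq M1 (geo (par y0))) (fun l => EL (iota 0 C) (nseq j (geo (par y0)))
     (fun l' => F (l ++ l'))) =
  EL (iota 0 C) (nseq M1 (geo (par y0))) (fun=> EL (iota 0 C) (nseq j (geo (par y0)))
     (fun l' => expR t ^+ sumn l')).
  apply: eq_EL => l; rewrite size_nseq => sl _; apply: eq_EL' => l'.
  by rewrite /F drop_size_cat.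
have yt1 : par y0 * expR t < 1 by rewrite parM par_lt1.
apply: le_trans (EL_geo_mass _ _ pr _) _.
  apply: EL_nseq_ge0 => [k|l]; last by rewrite exprn_ge0 ?expR_ge0.
  by case/andP: pr => p1 p2; rewrite geo_ge0 // ltW.
apply: le_trans (EL_geo_sumn _ _ pr (expR_ge0 _) yt1) _.
by rewrite parM ratio_phi // -expRM_natl.
Qed.

Lemma burke_mgf_v c L y0 t M N1 j : `|y0| <= sgm -> - y0 + t <= sgm -> massive c L ->
  (M <= L)%N -> (N1 + j <= L)%N ->
  Bn c (par y0) (par (- y0)) M (N1 + j) (fun S J w =>
    expR (t * ((lp (bdw S J w) M (N1 + j))%:R - (lp (bdw S J w) M N1)%:R)))
  <= 2 * expR (j%:R * (phi (- y0 + t) - phi (- y0))).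
Proof.
move=> hy0 yt mc ML NL; have c0 : (0 < c)%N by case: mc.
rewrite Bn_tr //; last first.
  move=> S J w w' ww; have e1 := boxed_lp_bdw S J (leqnn M) (leqnn (N1 + j)) ww.
  have e2 := boxed_lp_bdw S J (leqnn M) (leq_addr j N1) ww.
  by rewrite e1 e2.
have hy0' : `|- y0| <= sgm by rewrite normrN.
have := burke_mgf hy0' yt mc NL ML; rewrite opprK; apply: le_trans.
apply: le_Bn => //; rewrite ?opprK; try by case: (norm_le_l hy0).
by move=> S J w _ _; rewrite !(lp_bdw_tr J S).
Qed.

Lemma exit_bound_sub c L (y0 h : R) M N M' N' : massive c L -> (M <= L)%N -> (N <= L)%N ->
  (M' < M)%N -> (N' < N)%N ->
  `|y0| + 3 * h <= sgm -> 0 <= h -> 0 <= dch y0 M'.+1%:R N'.+1%:R ->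
  Bn c (par y0) (par (- y0)) M N (fun S J w =>
    (lp (consrow S w) M' N'.+1 <= lp (conscol J w) M'.+1 N')%N%:R)
  <= ebd y0 h M'.+1%:R N'.+1%:R.
Proof.
move=> mc ML NL MM NN yh h0 D0; have c0 : (0 < c)%N by case: mc.
have hy0 : `|y0| <= sgm by lra.
have [a1 a2] := norm_le_l hy0.
rewrite (@Bn_restrict R al al0 al1 c y0 (- y0) M N M'.+1 N'.+1) //.
  by apply: (exit_bound mc) => //; [exact: leq_trans MM _|exact: leq_trans NN _].
move=> S S' J J' w w' SS JJ ww; have e1 : lp (consrow S w) M' N'.+1 = lp (consrow S' w') M' N'.+1.
  by apply: consrow_nth => [i iM|i j iM jN]; [apply: SS|apply: ww].
have e2 : lp (conscol J w) M'.+1 N' = lp (conscol J' w') M'.+1 N'.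
  by apply: conscol_nth => [i iM|i j iM jN]; [apply: JJ|apply: ww].
by rewrite e1 e2.
Qed.

(** If both end points are reached along the horizontal axis, [remove_row_h] bounds the bulk
    increment by a stationary one, for which [burke_mgf] gives a Chernoff bound. The two [ebd] terms
    pay for the other exits. *)
Lemma inc_h c L (y0 h t : R) M N j (x : R) : massive c L -> (M + j < L)%N -> (N < L)%N ->
  `|y0| + 3 * h <= sgm -> 0 <= h -> 0 <= t -> y0 + t <= sgm ->
  0 <= dch y0 M.+1%:R N.+1%:R ->
  Qn c (M + j).+1 N.+1 (fun w => (x <= (lp w (M + j) N)%:R - (lp w M N)%:R)%R%:R) <=
  ebd y0 h M.+1%:R N.+1%:R + ebd y0 h (M + j).+1%:R N.+1%:R
  + 2 * expR (j%:R * (phi (y0 + t) - phi y0) - t * x).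
Proof.
move=> mc ML NL yh h0 t0 yt D0; have c0 : (0 < c)%N by case: mc.
have hy0 : `|y0| <= sgm by lra.
have [a1 a2] := norm_le_l hy0.
rewrite -(@Bn_bulk R al al0 al1 c y0 (- y0)) //.
have D1 : 0 <= dch y0 (M + j).+1%:R N.+1%:R.
  apply: le_trans D0 _; rewrite /dch lerD2r ler_wpM2r ?A1_ge0 // ler_nat ltnS leq_addr.
  by [].
apply: (@le_trans _ _ (Bn c (par y0) (par (- y0)) (M + j).+1 N.+1 (fun S J w =>
   ((lp (consrow S w) M N.+1 <= lp (conscol J w) M.+1 N)%N%:R +
   (lp (consrow S w) (M + j) N.+1 <= lp (conscol J w) (M + j).+1 N)%N%:R) +
   expR (- t * x) * expR (t * ((lp (bdw S J w) (M.+1 + j) N.+1)%:R - (lp (bdw S J w) M.+1 N.+1)%:R))))).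
  apply: le_Bn => // S J w _ _.
  case: (leqP (lp (consrow S w) M N.+1) _) => h1 /=.
    by apply: (le_trans (natb_le1 _ _)); rewrite -addrA lerDl addr_ge0 // mulr_ge0 ?expR_ge0.
  case: (leqP (lp (consrow S w) (M + j) N.+1) _) => h2 /=.
    by apply: (le_trans (natb_le1 _ _)); rewrite add0r lerDl mulr_ge0 ?expR_ge0.
  rewrite !add0r -expRD; apply: ind_expR => xT.
  rewrite addSn !G_split (maxn_idPl (ltnW h1)) (maxn_idPl (ltnW h2)).
  have := remove_row_h (consrow S w) M j N; rewrite !sh01_consrow => h3.
  have l1 := lp_le_right w N (leq_addr j M).
  have l2 := lp_le_right (consrow S w) N.+1 (leq_addr j M).
  rewrite mulNr addrC -mulrBr mulr_ge0 // subr_ge0; apply: le_trans xT _.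
  by rewrite -!natrB // ler_nat.
rewrite !BnD BnZ; apply: lerD; first apply: lerD.
- by apply: (exit_bound_sub mc) => //; rewrite ltnS leq_addr.
- by apply: (exit_bound_sub mc).
have := @burke_mgf c L y0 t M.+1 j N.+1 hy0 yt mc _ _; rewrite !addSn => bm.
apply: le_trans (ler_wpM2l (expR_ge0 _) (bm ML NL)) _.
by rewrite mulrCA -expRD addrC mulNr.
Qed.

(** With the horizontal axis in use, the vertical increments of the bulk dominate the stationary
    ones, which gives a lower bound. The two remaining directions come from transposition. *)
Lemma inc_v c L (y0 h t : R) M N j (x : R) : massive c L -> (M < L)%N -> (N + j < L)%N ->
  `|y0| + 3 * h <= sgm -> 0 <= h -> 0 <= t -> - y0 - t <= sgm ->
  0 <= dch y0 M.+1%:R (N + j).+1%:R ->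
  Qn c M.+1 (N + j).+1 (fun w => ((lp w M (N + j))%:R - (lp w M N)%:R <= x)%R%:R) <=
  ebd y0 h M.+1%:R N.+1%:R + ebd y0 h M.+1%:R (N + j).+1%:R
  + 2 * expR (j%:R * (phi (- y0 - t) - phi (- y0)) + t * x).
Proof.
move=> mc ML NL yh h0 t0 yt D0; have c0 : (0 < c)%N by case: mc.
have hy0 : `|y0| <= sgm by lra.
have [a1 a2] := norm_le_l hy0.
rewrite -(@Bn_bulk R al al0 al1 c y0 (- y0)) //.
have D1 : 0 <= dch y0 M.+1%:R N.+1%:R.
  apply: le_trans D0 _; rewrite /dch lerB // ler_wpM2r ?A1_ge0 // ler_nat ltnS leq_addr.
  by [].
apply: (@le_trans _ _ (Bn c (par y0) (par (- y0)) M.+1 (N + j).+1 (fun S J w =>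
   ((lp (consrow S w) M N.+1 <= lp (conscol J w) M.+1 N)%N%:R +
   (lp (consrow S w) M (N + j).+1 <= lp (conscol J w) M.+1 (N + j))%N%:R) +
   expR (t * x) * expR (- t * ((lp (bdw S J w) M.+1 (N.+1 + j))%:R - (lp (bdw S J w) M.+1 N.+1)%:R))))).
  apply: le_Bn => // S J w _ _.
  case: (leqP (lp (consrow S w) M N.+1) _) => h1 /=.
    by apply: (le_trans (natb_le1 _ _)); rewrite -addrA lerDl addr_ge0 // mulr_ge0 ?expR_ge0.
  case: (leqP (lp (consrow S w) M (N + j).+1) _) => h2 /=.
    by apply: (le_trans (natb_le1 _ _)); rewrite add0r lerDl mulr_ge0 ?expR_ge0.
  rewrite !add0r -expRD; apply: ind_expR => xT.
  rewrite addSn !G_split (maxn_idPl (ltnW h1)) (maxn_idPl (ltnW h2)).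
  have := remove_row_v (consrow S w) M N j; rewrite !sh01_consrow => h3.
  have l1 := lp_le_up w M (leq_addr j N).
  have l2 := lp_le_up (consrow S w) M (leq_addr j N.+1); rewrite addSn in l2.
  rewrite mulNr -mulrBr mulr_ge0 // subr_ge0; apply: le_trans xT.
  by rewrite -!natrB // ler_nat.
rewrite !BnD BnZ; apply: lerD; first apply: lerD.
- by apply: (exit_bound_sub mc) => //; rewrite ltnS leq_addr.
- by apply: (exit_bound_sub mc).
have := @burke_mgf_v c L y0 (- t) M.+1 N.+1 j hy0 yt mc _ _; rewrite !addSn => bm.
apply: le_trans (ler_wpM2l (expR_ge0 _) (bm ML NL)) _.
by rewrite mulrCA -expRD addrC.
Qed.

End Increments.

(** * Polynomial scales *)

Ltac nlia := repeat match goal with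
  | H : context [@Order.le _ _ _ _] |- _ => clear H
  | H : context [@Order.lt _ _ _ _] |- _ => clear H
  end; lia.

Section PowerScales.
Variable R : realType.
Implicit Types a b C : R.

(** The power n^a. By the convention on [ln] at 0, [pw 0 a] is 1. *)
Definition pw (n : nat) (a : R) : R := expR (a * ln n%:R).

Lemma pw_gt0 n a : 0 < pw n a. Proof. exact: expR_gt0. Qed.
Lemma pw_ge0 n a : 0 <= pw n a. Proof. exact: expR_ge0. Qed.
Lemma pw0 n : pw n 0 = 1. Proof. by rewrite /pw mul0r expR0. Qed.
Lemma pw1 n : (0 < n)%N -> pw n 1 = n%:R.
Proof. by move=> n0; rewrite /pw mul1r lnK // posrE ltr0n. Qed.
Lemma pwD n a b : pw n (a + b) = pw n a * pw n b.
Proof. by rewrite /pw mulrDl expRD. Qed.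
Lemma pwN n a : pw n (- a) = (pw n a)^-1.
Proof. by rewrite /pw mulNr expRN. Qed.
Lemma pwX n a k : pw n a ^+ k = pw n (k%:R * a).
Proof. by rewrite /pw -expRM_natl mulrA. Qed.

Lemma ln_nat_ge0 n : 0 <= ln n%:R :> R.
Proof. by case: n => [|n]; [rewrite ln0|rewrite ln_ge0 // ler1n]. Qed.

Lemma le_pw n a b : a <= b -> pw n a <= pw n b.
Proof. by move=> ab; rewrite ler_expR ler_wpM2r // ln_nat_ge0. Qed.

Lemma pw_ge1 n a : 0 <= a -> 1 <= pw n a.
Proof. by move=> a0; rewrite -(pw0 n) le_pw. Qed.

Lemma ev_ln C : \forall n \near \oo, C <= ln n%:R :> R.
Proof.
exists (Num.truncn (expR C)).+1 => // n /= hn.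
have h : expR C <= n%:R.
  apply: ltW; apply: lt_le_trans (truncnS_gt _) _; by rewrite ler_nat.
by rewrite -[C]expRK ler_ln ?posrE ?expR_gt0 // (lt_le_trans _ h) // expR_gt0.
Qed.

Lemma ev_pw C a b : a < b -> \forall n \near \oo, C * pw n a <= pw n b.
Proof.
move=> ab; have ba : 0 < b - a by rewrite subr_gt0.
near=> n; rewrite -[b](subrK a) pwD ler_wpM2r ?pw_ge0 //.
apply: le_trans (expR_ge1Dx _); apply: (@le_trans _ _ ((b - a) * ln n%:R)); last by rewrite lerDr.
rewrite -ler_pdivrMl //; near: n; exact: ev_ln.
Unshelve. all: by end_near. Qed.

Lemma ev_pw2 C C' a b : 0 < C' -> a < b -> \forall n \near \oo, C * pw n a <= C' * pw n b.
Proof.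
move=> C0 ab; have := ev_pw (C'^-1 * C) ab; apply: filterS => n.
by rewrite -mulrA ler_pdivrMl.
Qed.

Lemma ev_pw_ge C b : 0 < b -> \forall n \near \oo, C <= pw n b.
Proof. by move=> b0; have := ev_pw C b0; apply: filterS => n; rewrite pw0 mulr1. Qed.

Lemma ev_pw_le C b : 0 < C -> b < 0 -> \forall n \near \oo, pw n b <= C.
Proof.
move=> C0 b0; have nb : 0 < - b by rewrite oppr_gt0.
have := ev_pw_ge C^-1 nb; apply: filterS => n; rewrite pwN.
by rewrite lef_pV2 ?posrE ?pw_gt0.
Qed.

Lemma ev_ln_pw C b : 0 < b -> \forall n \near \oo, C * ln n%:R <= pw n b.
Proof.
move=> b0; have b2 : 0 < b / 2 by rewrite divr_gt0.
near=> n.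
have h1 : ln n%:R <= (b / 2)^-1 * pw n (b / 2).
  rewrite ler_pdivlMl //; apply: le_trans (expR_ge1Dx _); by rewrite lerDr.
have [C0|C0] := leP 0 C; last first.
  by apply: le_trans (pw_ge0 n b); rewrite mulr_le0_ge0 ?(ltW C0) ?ln_nat_ge0.
apply: le_trans (ler_wpM2l C0 h1) _; rewrite mulrA; near: n; apply: ev_pw.
by rewrite ltr_pdivrMr // ltr_pMr // ltrDl.
Unshelve. all: by end_near. Qed.

Lemma ev_expN C a D : 0 < a -> 0 < C -> \forall n \near \oo, expR (- (C * pw n a)) <= pw n (- D).
Proof.
move=> a0 C0; have := ev_ln_pw (C^-1 * D) a0; apply: filterS => n h.
by rewrite /pw ler_expR mulNr lerN2 -ler_pdivrMl // mulrA.
Qed.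

Lemma truncn_bounds (x : R) : 1 <= x -> x / 2 <= (Num.truncn x)%:R <= x.
Proof.
move=> x1; have x0 : 0 <= x by apply: le_trans x1.
have /andP[h1 h2] := truncn_itv x0; rewrite h1 andbT.
have h3 : 1 <= (Num.truncn x)%:R :> R by rewrite ler1n truncn_gt0.
rewrite ler_pdivrMr //; apply: ltW; apply: lt_le_trans h2 _; rewrite -natr1; lra.
Qed.

End PowerScales.

(** * Increments of the bulk passage time at polynomial scales *)

Section IncrementSpec.
Variable R : realType.
Variable al : R.
Hypothesis al0 : 0 < al.
Hypothesis al1 : al < 1.
Local Notation phi := (phi al).
Local Notation Af := (Af al).
Local Notation A1 := (A1 al).
Local Notation sgm := (sgm al).
Local Notation CT := (CT al).
Local Notation mm := (mm al).
Local Notation Qn := (Qn al).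
Local Notation massive := (massive al).

Lemma massive_le c L L' : (L' <= L)%N -> massive c L -> massive c L'.
Proof.
move=> LL [c0 h]; split=> //; apply: le_trans h _.
have [r0 r1] : 0 < rho al /\ rho al < 1 by apply/andP; exact: rho01.
have rc0 : 0 <= rho al ^+ c by rewrite exprn_ge0 // ltW.
have rc1 : 0 <= 1 - rho al ^+ c by rewrite subr_ge0 exprn_ile1 // ltW.
apply: ler_wiXn2l => //; first by rewrite gerBl.
by rewrite !leq_add ?leq_mul.
Qed.

Lemma ev_rho (a D : R) : 0 < a -> \forall n \near \oo, forall c, pw n a <= c%:R ->
  rho al ^+ c <= pw n (- D).
Proof.
move=> a0; have [r0 r1] : 0 < rho al /\ rho al < 1 by apply/andP; exact: rho01.
have l0 : 0 < - ln (rho al) by rewrite oppr_gt0 ln_lt0 // r0.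
have := @ev_expN R _ a D a0 l0; apply: filterS => n h c hc.
apply: le_trans h; rewrite -{1}(@lnK _ (rho al)) ?posrE // -expRM_natl ler_expR.
by rewrite mulNr opprK mulrC ler_wnM2l // ltW // -oppr_gt0.
Qed.

Lemma ev_massive (a : R) (K : nat) : 0 < a -> \forall n \near \oo, forall c, pw n a <= c%:R ->
  massive c (K * n).
Proof.
move=> a0; have [r0 r1] : 0 < rho al /\ rho al < 1 by apply/andP; exact: rho01.
near=> n => c hc; have n0 : (0 < n)%N by near: n; exists 1%N.
have c1 : 1 <= c%:R :> R by apply: le_trans hc; rewrite pw_ge1 // ltW.
split; first by rewrite ler1n in c1.
have rc0 : 0 <= rho al ^+ c by rewrite exprn_ge0 // ltW.
have rc1 : rho al ^+ c <= 1 by rewrite exprn_ile1 // ltW.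
apply: le_trans (@bernoulli_ineq R (rho al ^+ c) _ _); last by rewrite rc0.
have h : rho al ^+ c <= pw n (- 3%:R).
  by move: c hc {c1 rc0 rc1}; near: n; exact: ev_rho.
have N2 : (K * n + K * n + K * n * (K * n))%:R <= (2 * K + K * K)%:R * pw n 2%:R :> R.
  rewrite -[X in pw n X]mulr1 -pwX pw1 // -natrX -natrM ler_nat.
  rewrite mulnACA mulnn mulnDl leq_add2r -mulnA mul2n addnn leq_double leq_mul //.
  by rewrite expnS expn1 leq_pmulr.
have : (K * n + K * n + K * n * (K * n))%:R * rho al ^+ c <= (2 * K + K * K)%:R * pw n (- 1%:R).
  apply: le_trans (ler_pM _ rc0 N2 h) _ => //.
  by rewrite -mulrA -pwD; apply: ler_wpM2l => //; apply: le_pw; lra.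
have : (2 * K + K * K)%:R * pw n (- 1%:R) <= 2^-1 :> R.
  apply: le_trans (_ : pw n (- 2^-1) <= _).
    by near: n; apply: ev_pw; lra.
  by near: n; apply: ev_pw_le; lra.
lra.
Unshelve. all: by end_near. Qed.

Lemma phi_lin (a z : R) : a <= sgm -> a + z <= sgm ->
  `|phi (a + z) - phi a - mm * z| <= CT * (`|z| * (`|a| + `|z|)).
Proof.
move=> h1 h2; have [c [c1 c2]] := mvt_le h1 h2 (is_derive_phi al0 al1).
rewrite [a + z - a]addrAC subrr add0r => ->; rewrite -mulrBl normrM.
have cs : c <= sgm by apply: le_trans c2 _; rewrite ge_max h1.
have CT0 : 0 <= CT by apply: ltW; exact: CT_gt0.
have s0 : 0 <= sgm by apply: ltW; exact: sgm_gt0.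
have ca : `|c| <= `|a| + `|z|.
  have d : Num.max a (a + z) <= `|a| + `|z|.
    rewrite ge_max (le_trans (ler_norm a)) ?lerDl //=.
    by apply: le_trans (ler_norm _) (ler_normD _ _).
  have d' : - (`|a| + `|z|) <= Num.min a (a + z).
    rewrite le_min; have := ler_norm (- a); have := ler_norm (- z); rewrite !normrN => z1 a1.
    have z0 := normr_ge0 z; by apply/andP; split; lra.
  by rewrite ler_norml (le_trans d' c1) (le_trans c2 d).
have := @Af_lin R al al0 al1 0 c s0; rewrite add0r Af0 // => /(_ cs) h.
have -> : CT * (`|z| * (`|a| + `|z|)) = CT * (`|a| + `|z|) * `|z| by ring.
apply: ler_wpM2r => //; apply: le_trans h _; exact: ler_wpM2l.
Qed.

(** The slope stays positive for rectangles that are off-diagonal by much less than y M. *)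
Lemma dch_ge (y M N : R) : 0 <= y -> y <= sgm -> 0 <= M ->
  2 * al * y * M - CT * `|M - N| <= dch al y M N.
Proof.
move=> y0 ys M0; have s0 : 0 < sgm by exact: sgm_gt0.
have CT0 : 0 <= CT by apply: ltW; exact: CT_gt0.
have ys' : - y <= sgm by lra.
have h1 := A1_diff al0 al1 y0 ys.
have h2 := A1_ge0 al0 al1 ys'; have h3 := A1_le al0 al1 ys'.
have -> : dch al y M N = M * (A1 y - A1 (- y)) + (M - N) * A1 (- y) by rewrite /dch; ring.
have h4 : - (CT * `|M - N|) <= (M - N) * A1 (- y).
  rewrite lerNl; apply: le_trans (ler_norm _) _; rewrite normrN normrM (ger0_norm h2) mulrC.
  exact: ler_wpM2r.
have h5 : 2 * al * y * M <= M * (A1 y - A1 (- y)) by rewrite [leLHS]mulrC ler_wpM2l.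
lra.
Qed.

(** The slope [dch] is of order n times [yI], that is n^(2/3 + 3e), which beats an off-diagonality
    of order n^(2/3 + 2e). With [hI] the exponent of [ebd] is then of order n^(5e), against an error
    h^3 n = n^(3e). *)
Definition yI e n : R := pw n (- 3^-1 + 3 * e).
Definition hI e n : R := pw n (- 3^-1 + e).

Lemma ev_ebd (e D : R) : 0 < e -> e < 12^-1 -> \forall n \near \oo,
  `|yI e n| + 3 * hI e n <= sgm /\ forall M N : nat,
  (n <= 2 * M)%N -> (M <= 5 * n)%N -> (N <= 5 * n)%N ->
  `|M%:R - N%:R| <= 4 * pw n (2 / 3 + 2 * e) ->
  0 <= dch al (yI e n) M%:R N%:R /\ ebd al (yI e n) (hI e n) M%:R N%:R <= pw n (- D).
Proof.
move=> e0 e1; have s0 : 0 < sgm by exact: sgm_gt0.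
have CT0 : 0 < CT by exact: CT_gt0.
near=> n; have n0 : (0 < n)%N by near: n; exists 1%N.
have y4 : yI e n <= sgm / 4.
  by near: n; apply: ev_pw_le; [rewrite divr_gt0|lra].
have h4 : hI e n <= sgm / 4.
  by near: n; apply: ev_pw_le; [rewrite divr_gt0|lra].
have y0 : 0 <= yI e n by exact: pw_ge0.
have h0 : 0 <= hI e n by exact: pw_ge0.
rewrite ger0_norm //; split; first lra.
move=> M N nM M5 N5 MN.
have d : 2^-1 * al * pw n (2 / 3 + 3 * e) <= dch al (yI e n) M%:R N%:R.
  apply: le_trans (dch_ge _ _ _ (ler0n _ M)) => //; last by lra.
  have MM : n%:R / 2 <= M%:R :> R.
    by rewrite ler_pdivrMr // -natrM ler_nat mulnC.
  have t1 : al * pw n (2 / 3 + 3 * e) <= 2 * al * yI e n * M%:R.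
    have -> : pw n (2 / 3 + 3 * e) = yI e n * n%:R.
      by rewrite -(pw1 R n0) /yI -pwD; congr pw; field.
    have : yI e n * (n%:R / 2) <= yI e n * M%:R by exact: ler_wpM2l.
    move/(ler_wpM2l (ltW al0)); clear -al0 al1; lra.
  have t2 : CT * `|M%:R - N%:R| <= 2^-1 * al * pw n (2 / 3 + 3 * e).
    apply: le_trans (ler_wpM2l (ltW CT0) MN) _; rewrite mulrA -ler_pdivrMl ?mulr_gt0 // mulrA.
    by near: n; apply: ev_pw; lra.
  move: t1 t2; clear -al0 al1; lra.
have d0 : 0 <= dch al (yI e n) M%:R N%:R.
  by apply: le_trans d; rewrite !mulr_ge0 ?pw_ge0 ?ltW // invr_ge0.
split=> //; rewrite /ebd.
have S : M%:R + N%:R <= 10 * n%:R :> R.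
  by rewrite -natrD -natrM ler_nat; nlia.
have h2 : hI e n ^+ 2 = pw n (- (2 / 3) + 2 * e) by rewrite pwX; congr pw; field.
have h3 : hI e n ^+ 3 * n%:R = pw n (3 * e).
  by rewrite pwX -(pw1 R n0) -pwD; congr pw; field.
have q1 : 4^-1 * al * pw n (5 * e) <= hI e n ^+ 2 / 2 * dch al (yI e n) M%:R N%:R.
  apply: (@le_trans _ _ (hI e n ^+ 2 / 2 * (2^-1 * al * pw n (2 / 3 + 3 * e)))); last first.
    by apply: ler_wpM2l => //; rewrite divr_ge0 // sqr_ge0.
  have -> : pw n (5 * e) = hI e n ^+ 2 * pw n (2 / 3 + 3 * e) by rewrite h2 -pwD; congr pw; field.
  clear -al0 al1; lra.
have q2 : 27 * CT * hI e n ^+ 3 * (M%:R + N%:R) <= 8^-1 * al * pw n (5 * e).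
  apply: (@le_trans _ _ (270 * CT * pw n (3 * e))).
    rewrite -h3; have := ler_wpM2l (mulr_ge0 (ltW CT0) (exprn_ge0 3 h0)) S; clear -al0 al1; lra.
  rewrite -ler_pdivrMl ?mulr_gt0 // mulrA.
  by near: n; apply: ev_pw; lra.
apply: (@le_trans _ _ (6 * expR (- (8^-1 * al * pw n (5 * e))))).
  by rewrite ler_wpM2l // ler_expR; move: q1 q2; clear -al0 al1; lra.
apply: (@le_trans _ _ (6 * pw n (- (D + 1)))).
  rewrite ler_wpM2l //; near: n; apply: ev_expN; [lra|exact: mulr_gt0].
by near: n; apply: ev_pw; lra.
Unshelve. all: by end_near. Qed.

(** The Chernoff parameter t = n^(e - x) makes the gain t n^x equal to n^e. The hypotheses relating
    [b] and [x] say that the second-order terms j t |y| and j t^2 are of smaller order. *)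
Lemma ev_inc (e b x D : R) : 0 < e -> e < 12^-1 -> - 3^-1 + 3 * e + b < x -> e + b < 2 * x ->
  e < x -> \forall n \near \oo, pw n (e - x) <= sgm / 4 /\ forall j : nat, j%:R <= pw n b ->
  forall y, `|y| <= yI e n ->
  2 * expR (j%:R * (phi (y + pw n (e - x)) - phi y) - pw n (e - x) * (mm * j%:R + pw n x)) <= pw n (- D) /\
  2 * expR (j%:R * (phi (y - pw n (e - x)) - phi y) + pw n (e - x) * (mm * j%:R - pw n x)) <= pw n (- D).
Proof.
move=> e0 e1 hb1 hb2 ex; have s0 : 0 < sgm by exact: sgm_gt0.
have CT0 : 0 < CT by exact: CT_gt0.
near=> n; have n0 : (0 < n)%N by near: n; exists 1%N.
have t4 : pw n (e - x) <= sgm / 4.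
  by near: n; apply: ev_pw_le; [rewrite divr_gt0|lra].
have y4 : yI e n <= sgm / 4.
  by near: n; apply: ev_pw_le; [rewrite divr_gt0|lra].
split=> // j jb y hy.
set t := pw n (e - x) in t4 *; have t0 : 0 <= t by exact: pw_ge0.
have [ya yb] := norm_le_l (le_trans hy y4).
have ys : y <= sgm by lra.
have tX : t * pw n x = pw n e by rewrite -pwD; congr pw; field.
have Y0 := normr_ge0 y.
have main z : `|z| = t -> y + z <= sgm ->
  j%:R * (phi (y + z) - phi y - mm * z) <= 2^-1 * pw n e.
  move=> zt yz; have := phi_lin ys yz; rewrite zt => h.
  apply: (@le_trans _ _ (j%:R * (CT * (t * (`|y| + t))))).
    by apply: ler_wpM2l => //; apply: le_trans h; exact: ler_norm.
  have h1 : CT * (`|y| + t) * j%:R <= 2^-1 * pw n x.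
    apply: (@le_trans _ _ (CT * (yI e n + t) * pw n b)).
      apply: ler_pM => //; first by apply: mulr_ge0; [exact: ltW|exact: addr_ge0].
      by apply: ler_wpM2l; [exact: ltW|lra].
    have u1 : CT * (yI e n * pw n b) <= 4^-1 * pw n x.
      rewrite -ler_pdivrMl // mulrA -pwD; near: n; apply: ev_pw; lra.
    have u2 : CT * (t * pw n b) <= 4^-1 * pw n x.
      rewrite -ler_pdivrMl // mulrA -pwD; near: n; apply: ev_pw; lra.
    move: u1 u2; clear; lra.
  rewrite -tX; have := ler_wpM2l t0 h1; clear; lra.
have fin z : z <= - (2^-1 * pw n e) -> 2 * expR z <= pw n (- D).
  move=> hz; apply: (@le_trans _ _ (2 * pw n (- (D + 1)))).
    rewrite ler_wpM2l //; apply: (@le_trans _ _ (expR (- (2^-1 * pw n e)))); first by rewrite ler_expR.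
    by near: n; apply: ev_expN; lra.
  by near: n; apply: ev_pw; lra.
split; apply: fin.
  have h1 : y + t <= sgm by move: ya t4 (s0); clear; lra.
  have := main t (ger0_norm t0) h1; move: tX; clear; lra.
have h1 : y - t <= sgm by move: ya t0 (s0); clear; lra.
have := main (- t); rewrite normrN => /(_ (ger0_norm t0) h1); move: tX; clear; lra.
Unshelve. all: by end_near. Qed.

Definition okbox (n M N j : nat) (e b : R) :=
  [/\ (n <= 2 * M)%N, (n <= 2 * N)%N, (M + j < 4 * n)%N, (N + j < 4 * n)%N &
   `|M%:R - N%:R| <= 2 * pw n (2 / 3 + 2 * e) :> R] /\ j%:R <= pw n b.

Section Inc.
Variables (e b x D : R).
Hypotheses (e0 : 0 < e) (e1 : e < 12^-1) (hb : b <= 2 / 3 + 2 * e)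
  (hb1 : - 3^-1 + 3 * e + b < x) (hb2 : e + b < 2 * x) (ex : e < x).

Lemma inc_h_up : \forall n \near \oo, forall c M N j, massive c (4 * n) -> okbox n M N j e b ->
  Qn c (M + j).+1 N.+1 (fun w => (mm * j%:R + pw n x <= (lp w (M + j) N)%:R - (lp w M N)%:R)%R%:R)
  <= pw n (- D).
Proof.
near=> n => c M N j mc [[nM nN ML NL MN] jb].
have n0 : (0 < n)%N by near: n; exists 1%N.
have [yh H] : `|yI e n| + 3 * hI e n <= sgm /\ forall M N : nat,
  (n <= 2 * M)%N -> (M <= 5 * n)%N -> (N <= 5 * n)%N ->
  `|M%:R - N%:R| <= 4 * pw n (2 / 3 + 2 * e) ->
  0 <= dch al (yI e n) M%:R N%:R /\ ebd al (yI e n) (hI e n) M%:R N%:R <= pw n (- (D + 1)).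
  by near: n; exact: ev_ebd.
have [t4 G] : pw n (e - x) <= sgm / 4 /\ forall j : nat, j%:R <= pw n b ->
  forall y, `|y| <= yI e n ->
  2 * expR (j%:R * (phi (y + pw n (e - x)) - phi y) - pw n (e - x) * (mm * j%:R + pw n x)) <= pw n (- (D + 1)) /\
  2 * expR (j%:R * (phi (y - pw n (e - x)) - phi y) + pw n (e - x) * (mm * j%:R - pw n x)) <= pw n (- (D + 1)).
  by near: n; exact: ev_inc.
have y4 : yI e n <= sgm / 4.
  near: n; apply: ev_pw_le; first by rewrite divr_gt0 // sgm_gt0.
  by move: (e1); lra.
have s0 : 0 < sgm by exact: sgm_gt0.
have y0 : `|yI e n| <= yI e n by rewrite ger0_norm // pw_ge0.
have [g1 _] := G j jb _ y0.
have P2 : pw n b <= pw n (2 / 3 + 2 * e) by exact: le_pw.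
have Z (i : nat) : (i <= j)%N -> 0 <= dch al (yI e n) (M + i).+1%:R N.+1%:R /\
   ebd al (yI e n) (hI e n) (M + i).+1%:R N.+1%:R <= pw n (- (D + 1)).
  move=> ij; apply: H; [nlia|nlia|nlia|].
  rewrite -[(M + i).+1%:R]natr1 -[N.+1%:R]natr1 natrD; have : i%:R <= j%:R :> R by rewrite ler_nat.
  move: MN; rewrite !ler_norml => /andP[? ?] ij'; have := ler0n R i; have := pw_ge0 n (2 / 3 + 2 * e).
  by move=> ? ?; apply/andP; split; lra.
have [z1 z2] := Z 0%N (leq0n j); have [z3 z4] := Z j (leqnn j); rewrite addn0 in z1 z2.
apply: le_trans (inc_h al0 al1 (t := pw n (e - x)) _ mc ML (leq_ltn_trans (leq_addr _ _) NL) yh _ _ _ z1) _.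
- exact: pw_ge0.
- exact: pw_ge0.
- by lra.
apply: (@le_trans _ _ (3 * pw n (- (D + 1)))); first lra.
by near: n; apply: ev_pw; lra.
Unshelve. all: by end_near. Qed.

Lemma inc_v_lo : \forall n \near \oo, forall c M N j, massive c (4 * n) -> okbox n M N j e b ->
  Qn c M.+1 (N + j).+1 (fun w => ((lp w M (N + j))%:R - (lp w M N)%:R <= mm * j%:R - pw n x)%R%:R)
  <= pw n (- D).
Proof.
near=> n => c M N j mc [[nM nN ML NL MN] jb].
have n0 : (0 < n)%N by near: n; exists 1%N.
have [yh H] : `|yI e n| + 3 * hI e n <= sgm /\ forall M N : nat,
  (n <= 2 * M)%N -> (M <= 5 * n)%N -> (N <= 5 * n)%N ->
  `|M%:R - N%:R| <= 4 * pw n (2 / 3 + 2 * e) ->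
  0 <= dch al (yI e n) M%:R N%:R /\ ebd al (yI e n) (hI e n) M%:R N%:R <= pw n (- (D + 1)).
  by near: n; exact: ev_ebd.
have [t4 G] : pw n (e - x) <= sgm / 4 /\ forall j : nat, j%:R <= pw n b ->
  forall y, `|y| <= yI e n ->
  2 * expR (j%:R * (phi (y + pw n (e - x)) - phi y) - pw n (e - x) * (mm * j%:R + pw n x)) <= pw n (- (D + 1)) /\
  2 * expR (j%:R * (phi (y - pw n (e - x)) - phi y) + pw n (e - x) * (mm * j%:R - pw n x)) <= pw n (- (D + 1)).
  by near: n; exact: ev_inc.
have s0 : 0 < sgm by exact: sgm_gt0.
have y0 : `|- yI e n| <= yI e n by rewrite normrN ger0_norm // pw_ge0.
have yp : 0 <= yI e n by exact: pw_ge0.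
have tp : 0 <= pw n (e - x) by exact: pw_ge0.
have [_ g1] := G j jb _ y0.
have P2 : pw n b <= pw n (2 / 3 + 2 * e) by exact: le_pw.
have Z (i : nat) : (i <= j)%N -> 0 <= dch al (yI e n) M.+1%:R (N + i).+1%:R /\
   ebd al (yI e n) (hI e n) M.+1%:R (N + i).+1%:R <= pw n (- (D + 1)).
  move=> ij; apply: H; [nlia|nlia|nlia|].
  rewrite -[(N + i).+1%:R]natr1 -[M.+1%:R]natr1 natrD; have : i%:R <= j%:R :> R by rewrite ler_nat.
  move: MN; rewrite !ler_norml => /andP[? ?] ij'; have := ler0n R i; have := pw_ge0 n (2 / 3 + 2 * e).
  by move=> ? ?; apply/andP; split; lra.
have [z1 z2] := Z 0%N (leq0n j); have [z3 z4] := Z j (leqnn j); rewrite addn0 in z1 z2.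
apply: le_trans (inc_v al0 al1 (t := pw n (e - x)) _ mc (leq_ltn_trans (leq_addr _ _) ML) NL yh _ tp _ z3) _.
- exact: pw_ge0.
- by lra.
apply: (@le_trans _ _ (3 * pw n (- (D + 1)))); first lra.
by near: n; apply: ev_pw; lra.
Unshelve. all: by end_near. Qed.

Lemma okbox_tr n M N j : okbox n M N j e b -> okbox n N M j e b.
Proof. by case=> -[? ? ? ? h] ?; split=> //; split=> //; rewrite distrC. Qed.

Lemma inc_v_up : \forall n \near \oo, forall c M N j, massive c (4 * n) -> okbox n M N j e b ->
  Qn c M.+1 (N + j).+1 (fun w => (mm * j%:R + pw n x <= (lp w M (N + j))%:R - (lp w M N)%:R)%R%:R)
  <= pw n (- D).
Proof.
have := inc_h_up; apply: filterS => n H c M N j mc /okbox_tr ok.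
have c0 : (0 < c)%N by case: mc.
apply: le_trans (H c N M j mc ok); rewrite -(Qn_tr al0 al1 c0); last first.
  move=> w w' ww; have /= e2 := boxed_lp (ltnSn M) (ltnSn (N + j)) ww.
  have /= e3 := @boxed_lp M.+1 (N + j).+1 M N (ltnSn M) (leq_addr _ _) _ _ ww.
  by rewrite e2 e3.
by apply: le_Qn => // w; rewrite (lp_tr w (N + j) M) (lp_tr w N M).
Qed.

Lemma inc_h_lo : \forall n \near \oo, forall c M N j, massive c (4 * n) -> okbox n M N j e b ->
  Qn c (M + j).+1 N.+1 (fun w => ((lp w (M + j) N)%:R - (lp w M N)%:R <= mm * j%:R - pw n x)%R%:R)
  <= pw n (- D).
Proof.
have := inc_v_lo; apply: filterS => n H c M N j mc /okbox_tr ok.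
have c0 : (0 < c)%N by case: mc.
apply: le_trans (H c N M j mc ok); rewrite -(Qn_tr al0 al1 c0); last first.
  move=> w w' ww; have /= e2 := boxed_lp (ltnSn (M + j)) (ltnSn N) ww.
  have /= e3 := @boxed_lp (M + j).+1 N.+1 M N (leq_addr _ _) (ltnSn N) _ _ ww.
  by rewrite e2 e3.
by apply: le_Qn => // w; rewrite (lp_tr w N (M + j)) (lp_tr w N M).
Qed.

End Inc.
End IncrementSpec.

(** * Left tail *)

Ltac pos := repeat (first [ done | assumption | apply: ltW; assumption | apply: sqr_ge0
  | apply: exprn_ge0 | apply: mulr_ge0 | apply: addr_ge0 ]).

Lemma sumn_take_nth S k : (\sum_(a < k) nth 0%N S a = sumn (take k S))%N.
Proof.
elim: S k => [|s S IH] [|k]; rewrite ?big_ord0 ?take0 //=.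
  by rewrite big1 // => i _; rewrite nth_nil.
by rewrite big_ord_recl /= -IH.
Qed.

Lemma exit_row S w M N : exists2 k, (k <= M)%N &
  lp (consrow S w) M N.+1 = (sumn (take k.+1 S) + lp (sh k 0 w) (M - k) N)%N.
Proof.
have [k kM e] := lp_exit (consrow S w) M N; exists k => //; rewrite e; congr addn.
exact: (sumn_take_nth S k.+1).
Qed.

Lemma lp_start_rot w M N k : (k <= M)%N ->
  lp (fun a b => w (M - a)%N (N - b)%N) (M - k) N = lp (sh k 0 w) (M - k) N.
Proof.
move=> kM; rewrite -[RHS]lp_rot; apply: lp_ext => a b aM bN; rewrite shE.
by congr w; lia.
Qed.

Section ExitCut.
Variable R : realType.
Variable al : R.
Hypothesis al0 : 0 < al.
Hypothesis al1 : al < 1.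
Local Notation phi := (phi al).
Local Notation Af := (Af al).
Local Notation A1 := (A1 al).
Local Notation sgm := (sgm al).
Local Notation CT := (CT al).
Local Notation mm := (mm al).
Local Notation Psi := (Psi al).
Local Notation par := (par al).
Local Notation Qn := (Qn al).
Local Notation Bn := (Bn al).
Local Notation massive := (massive al).

Lemma ELn_two c L y t t' a b : y <= sgm -> y + t <= sgm -> y + t' <= sgm -> massive c L ->
  (a + b <= L)%N ->
  ELn c (par y) (a + b) (fun S => expR (t * (sumn (take a S))%:R + t' * (sumn (drop a S))%:R)) <=
  2 * expR (a%:R * (phi (y + t) - phi y) + b%:R * (phi (y + t') - phi y)).
Proof.
move=> ys yt yt' mc abL.
have pr : 0 <= par y < 1 by rewrite (ltW (par_gt0 _ _)) ?par_lt1.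
have s0 : 0 <= sgm by apply: ltW; exact: sgm_gt0.
have H : ELn c (par y) (a + b) (fun S => expR (t * (sumn (take a S))%:R + t' * (sumn (drop a S))%:R)) <=
  2 * EL (iota 0 c) (nseq (a + b) (geo (par y)))
   (fun S => expR (t * (sumn (take a S))%:R + t' * (sumn (drop a S))%:R)).
  apply: (@Bn_le2Bs R al al0 al1 c y 0 (a + b) 0 L (fun S _ _ =>
    expR (t * (sumn (take a S))%:R + t' * (sumn (drop a S))%:R))) => //.
apply: le_trans H _; rewrite ler_wpM2l // nseqD EL_cat.
have -> : EL (iota 0 c) (nseq a (geo (par y))) (fun l => EL (iota 0 c) (nseq b (geo (par y)))
     (fun l' => expR (t * (sumn (take a (l ++ l')))%:R + t' * (sumn (drop a (l ++ l')))%:R))) =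
  EL (iota 0 c) (nseq a (geo (par y))) (fun l => expR t ^+ sumn l *
     EL (iota 0 c) (nseq b (geo (par y))) (fun l' => expR t' ^+ sumn l')).
  apply: eq_EL => l; rewrite size_nseq => sl _; rewrite -ELZ; apply: eq_EL' => l'.
  by rewrite take_size_cat // drop_size_cat // expRD !expRM_natr.
rewrite ELZr expRD; apply: ler_pM.
- apply: EL_nseq_ge0 => [k|l]; last by rewrite exprn_ge0 ?expR_ge0.
  by case/andP: pr => p1 p2; rewrite geo_ge0 // ltW.
- apply: EL_nseq_ge0 => [k|l]; last by rewrite exprn_ge0 ?expR_ge0.
  by case/andP: pr => p1 p2; rewrite geo_ge0 // ltW.
- have yt1 : par y * expR t < 1 by rewrite parM par_lt1.
  apply: le_trans (EL_geo_sumn _ _ pr (expR_ge0 _) yt1) _.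
  by rewrite parM ratio_phi // -expRM_natl.
- have yt1 : par y * expR t' < 1 by rewrite parM par_lt1.
  apply: le_trans (EL_geo_sumn _ _ pr (expR_ge0 _) yt1) _.
  by rewrite parM ratio_phi // -expRM_natl.
Qed.

Lemma ELn_sumn c L y t k : y <= sgm -> y + t <= sgm -> massive c L -> (k <= L)%N ->
  ELn c (par y) k (fun S => expR (t * (sumn S)%:R)) <= 2 * expR (k%:R * (phi (y + t) - phi y)).
Proof.
move=> ys yt mc kL; have := @ELn_two c L y t t k 0 ys yt yt mc; rewrite addn0 => /(_ kL).
rewrite mul0r addr0; apply: le_trans; rewrite le_eqVlt; apply/orP; left; apply/eqP.
apply: eq_EL => l; rewrite size_nseq => sl _.
by rewrite take_oversize ?sl // drop_oversize ?sl // mulr0 addr0.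
Qed.

Lemma ELn_sumn_take c L y t M k : y <= sgm -> y + t <= sgm -> massive c L -> (M <= L)%N ->
  (k <= M)%N -> ELn c (par y) M (fun S => expR (t * (sumn (take k S))%:R)) <=
  2 * expR (k%:R * (phi (y + t) - phi y)).
Proof.
move=> ys yt mc ML kM; have c0 : (0 < c)%N by case: mc.
rewrite (@ELn_take R c _ M k) ?(ltW (par_gt0 _ _)) ?par_lt1 //; last first.
  move=> S S' SS; congr (expR (_ * _%:R)); rewrite -!sumn_take_nth; apply: eq_bigr => i _.
  exact: SS.
have -> : ELn c (par y) k (fun S => expR (t * (sumn (take k S))%:R)) =
   ELn c (par y) k (fun S => expR (t * (sumn S)%:R)).
  by apply: eq_EL => l; rewrite size_nseq => sl _; rewrite take_oversize ?sl.
by apply: (ELn_sumn (L := L)) => //; exact: leq_trans ML.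
Qed.

Lemma row_bulk c a M N (F : seq nat -> R) (G : (nat -> nat -> nat) -> R) :
  ELn c a M (fun S => Qn c M N (fun w => F S * G w)) = ELn c a M F * Qn c M N G.
Proof.
rewrite -[RHS]ELZr; apply: eq_EL' => S; exact: QZ.
Qed.

Lemma V_law c M N k (F : nat -> R) : (0 < c)%N -> (k <= M)%N ->
  Qn c M.+1 N.+1 (fun w => F (lp (sh k 0 w) (M - k) N)) =
  Qn c (M - k).+1 N.+1 (fun w => F (lp w (M - k) N)).
Proof.
move=> c0 kM; apply: (@Qn_shift R al al0 al1 c M.+1 N.+1 (M - k).+1 N.+1 k 0 (fun w => F (lp w (M - k) N))) => //.
- by move=> w w' ww; congr F; exact: (boxed_lp (ltnSn _) (ltnSn _) ww).
- by clear -kM; lia.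
Qed.

(** A path leaving the axis at column [k] collects an axis sum and an independent bulk time. The
    parameter [z] of the bulk bound is free and is chosen in [exit_exponent]. *)
Lemma exit_mgf c n k y t z : massive c (4 * n) -> (0 < n)%N -> (k <= n)%N -> 0 <= t ->
  y <= sgm -> y + t <= sgm -> `|z - t / 2| <= sgm -> `|z + t / 2| <= sgm ->
  ELn c (par y) n.+1 (fun S => Qn c n.+1 n.+1 (fun w =>
    expR (t * (sumn (take k.+1 S) + lp (sh k 0 w) (n - k) n)%:R))) <=
  4 * expR (k.+1%:R * (phi (y + t) - phi y) + Psi (n - k).+1%:R n.+1%:R (z - t / 2) (z + t / 2)).
Proof.
move=> mc n0 kn t0 ys yt hz hz'; have c0 : (0 < c)%N by case: mc.
have -> : ELn c (par y) n.+1 (fun S => Qn c n.+1 n.+1 (fun w =>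
    expR (t * (sumn (take k.+1 S) + lp (sh k 0 w) (n - k) n)%:R))) =
  ELn c (par y) n.+1 (fun S => expR (t * (sumn (take k.+1 S))%:R)) *
  Qn c n.+1 n.+1 (fun w => expR (t * (lp (sh k 0 w) (n - k) n)%:R)).
  rewrite -row_bulk; apply: eq_EL' => S; apply: eq_Q => w.
  by rewrite natrD mulrDr expRD.
rewrite (@V_law c n n k (fun l => expR (t * l%:R))) //.
have n4 : (n.+1 <= 4 * n)%N by clear -n0; lia.
have nk : (n - k < 4 * n)%N by apply: leq_trans n4; rewrite ltnS leq_subr.
have -> : 4 = 2 * 2 :> R by ring.
rewrite expRD mulrACA; apply: ler_pM.
- apply: EL_nseq_ge0 => [j|l]; last exact: expR_ge0.
  by apply: gam_ge0; rewrite ?(ltW (par_gt0 _ _)) // ltW // par_lt1.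
- by apply: Qn_ge0 => // w; exact: expR_ge0.
- by apply: (ELn_sumn_take (L := 4 * n)) => //; rewrite ltnS.
have e : t = (z + t / 2) - (z - t / 2) by field.
rewrite {1}e; apply: (T_mgf al0 al1 (L := 4 * n)) => //.
by rewrite lerD2l; clear -t0; lra.
Qed.

(** The tilt [z = cc0 * k / n] suits a rectangle off-diagonal by [k]. The first entry of the minimum
    makes the gain A1(0) z k at least twice the error 4 CT z^2 n, and [cc1] measures what is left;
    the second keeps [z] in the range of the expansions. *)
Definition cc0 : R := Num.min (A1 0 / (8 * CT)) (sgm / 4).
Definition cc1 : R := cc0 * A1 0 / 2.

Lemma A10_gt0 : 0 < A1 0.
Proof.
rewrite /A1 expR0 mulr1 divr_gt0 // exprn_gt0 //.
by move: (al1); lra.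
Qed.

Lemma cc0_gt0 : 0 < cc0.
Proof.
have h1 := A10_gt0; have h2 := CT_gt0 al1; have h3 := sgm_gt0 al0 al1.
by rewrite /cc0 lt_min; apply/andP; split; apply: divr_gt0 => //; apply: mulr_gt0.
Qed.

Lemma cc1_gt0 : 0 < cc1.
Proof. by apply: divr_gt0 => //; apply: mulr_gt0; [exact: cc0_gt0|exact: A10_gt0]. Qed.

(** A stay of length [k] on the axis leaves an off-diagonal rectangle for the bulk, which costs
    about k^2 / n. The three numerical hypotheses make this loss dominate the bias of the axis, the
    third-order error and the constant terms. *)
Lemma exit_exponent (n k y t : R) : 1 <= n -> 1 <= k -> k <= n -> 0 <= t -> t <= sgm / 4 ->
  `|y| <= sgm / 4 ->
  16 * CT * (`|y| + t) * n <= cc1 * k -> 16 * CT * t ^+ 2 * n ^+ 2 <= cc1 * k ^+ 2 ->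
  32 * mm * n <= cc1 * k ^+ 2 ->
  let z := cc0 * k / n in
  [/\ `|z - t / 2| <= sgm, `|z + t / 2| <= sgm &
  (k + 1) * (phi (y + t) - phi y) + Psi (n - k + 1) (n + 1) (z - t / 2) (z + t / 2) <=
  t * (2 * mm * n - cc1 / 4 * (k ^+ 2 / n))].
Proof.
move=> n1 k1 kn t0 ts ys b1 b2 b3 z.
have CT0 := CT_gt0 al1; have s0 := sgm_gt0 al0 al1; have c00 := cc0_gt0; have A0 := A10_gt0.
have n0 : 0 < n by lra.
have nn : n != 0 by rewrite gt_eqF.
have z0 : 0 <= z by rewrite divr_ge0 ?mulr_ge0 ?ltW //; lra.
have c0s : cc0 <= sgm / 4 by rewrite /cc0 ge_min lexx orbT.
have c0A : 8 * CT * cc0 <= A1 0.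
  have : cc0 <= A1 0 / (8 * CT) by rewrite /cc0 ge_min lexx.
  by rewrite ler_pdivlMr; [clear -al0 al1; lra|rewrite mulr_gt0].
have zs : z <= sgm / 4.
  apply: le_trans c0s; rewrite /z -mulrA ler_piMr ?(ltW c00) //.
  by rewrite ler_pdivrMr // mul1r.
have w0 : 0 <= 2 * n + k - 2 by move: n1 k1; clear -al0 al1; lra.
have z1 : `|z - t / 2| <= sgm.
  by rewrite ler_norml; move: z0 zs t0 ts (s0); clear -al0 al1 => *; apply/andP; split; lra.
have z2 : `|z + t / 2| <= sgm.
  by rewrite ler_norml; move: z0 zs t0 ts (s0); clear -al0 al1 => *; apply/andP; split; lra.
split=> //.
have [ya yb] := norm_le_l ys.
have e1 : (k + 1) * (phi (y + t) - phi y) <= (k + 1) * (mm * t + CT * (t * (`|y| + t))).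
  apply: ler_wpM2l; first lra.
  have w1 : y <= sgm by move: ya (s0); clear -al0 al1; lra.
  have w2 : y + t <= sgm by move: ya ts (s0); clear -al0 al1; lra.
  have := @phi_lin R al al0 al1 y t w1 w2; rewrite (ger0_norm t0) => h.
  have := le_trans (ler_norm _) h; clear -al0 al1; lra.
have zs' : z <= sgm by move: zs (s0); clear -al0 al1; lra.
have zs2 : - z <= sgm by move: z0 (s0); clear -al0 al1; lra.
have hz : `|z| <= sgm by rewrite ger0_norm.
have v1 : 0 <= n - k + 1 by move: kn; clear -al0 al1; lra.
have v2 : 0 <= n + 1 by move: n1; clear -al0 al1; lra.
have e2 := @Psi_le R al al0 al1 (n - k + 1) (n + 1) z (- (t / 2)) (t / 2) v1 v2 hz z1 z2.
have d1 : t / 2 - - (t / 2) = t by field.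
rewrite d1 sqrrN subrr mul0r mul0r addr0 (ger0_norm t0) in e2.
have f1 := @Af_taylor R al al0 al1 0 z (ltW s0); rewrite add0r Af0 in f1.
have f2 := @Af_taylor R al al0 al1 0 (- z) (ltW s0); rewrite add0r Af0 in f2.
have g1 : Af z <= mm + A1 0 * z + CT * z ^+ 2.
  have := le_trans (ler_norm _) (f1 zs'); clear -al0 al1; lra.
have g2 : Af (- z) <= mm - A1 0 * z + CT * z ^+ 2.
  have := le_trans (ler_norm _) (f2 zs2); rewrite sqrrN; clear -al0 al1; lra.
have e3 : (n - k + 1) * Af z + (n + 1) * Af (- z) <=
   mm * (2 * n - k + 2) - A1 0 * z * k + CT * z ^+ 2 * (4 * n).
  have u1 := ler_wpM2l (_ : 0 <= n - k + 1) g1; have u2 := ler_wpM2l (_ : 0 <= n + 1) g2.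
  have u3 : 0 <= CT * z ^+ 2 * (2 * n + k - 2) by pos.
  have := u1 v1; have := u2 v2; move: u3; clear -al0 al1; lra.
set X := k ^+ 2 / n.
have X0 : 0 <= X by rewrite divr_ge0 ?sqr_ge0 // ltW.
have zk : z * k = cc0 * X by rewrite /z /X; field.
have zn : z ^+ 2 * n = cc0 ^+ 2 * X by rewrite /z /X; field.
have k1' : A1 0 * z * k - CT * z ^+ 2 * (4 * n) >= cc1 * X.
  have -> : A1 0 * z * k = A1 0 * (z * k) by ring.
  have -> : CT * z ^+ 2 * (4 * n) = 4 * CT * (z ^+ 2 * n) by ring.
  rewrite zk zn /cc1.
  have w1 : 0 <= A1 0 - 8 * CT * cc0 by rewrite subr_ge0.
  have : 0 <= cc0 * X * (A1 0 - 8 * CT * cc0) by pos.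
  clear -al0 al1; lra.
have p1 : CT * (k + 1) * (`|y| + t) <= cc1 * X / 4.
  have yt0 : 0 <= `|y| + t by rewrite addr_ge0.
  have w2 : 0 <= k - 1 by rewrite subr_ge0.
  have h1 : 2 * CT * k * (`|y| + t) <= cc1 * X / 4.
    rewrite ler_pdivlMr // /X mulrA ler_pdivlMr //.
    have kp : 0 <= k by move: k1; clear -al0 al1; lra.
    have : 0 <= CT * k * (`|y| + t) * n by pos.
    have := ler_wpM2l kp b1; clear -al0 al1; lra.
  have : 0 <= CT * (`|y| + t) * (k - 1) by pos.
  move: h1; clear -al0 al1; lra.
have p2 : CT * t ^+ 2 * (2 * n) <= cc1 * X / 4.
  rewrite ler_pdivlMr // /X mulrA ler_pdivlMr //.
  have : 0 <= CT * (t ^+ 2 * n ^+ 2) by pos.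
  move: b2; clear -al0 al1; lra.
have p3 : 4 * mm <= cc1 * X / 4.
  rewrite ler_pdivlMr // /X mulrA ler_pdivlMr //; have := mulr_ge0 (ltW (mm_gt0 al0 al1)) (ltW n0).
  move: b3; clear -al0 al1; lra.
apply: le_trans (lerD e1 e2) _.
have e4 : CT * t * ((t / 2) ^+ 2 + (t / 2) ^+ 2) * (n - k + 1 + (n + 1)) <= t * (CT * t ^+ 2 * (2 * n)).
  have : 0 <= t * (CT * t ^+ 2) * (2 * n + k - 2) by pos.
  have -> : CT * t * ((t / 2) ^+ 2 + (t / 2) ^+ 2) * (n - k + 1 + (n + 1)) = t * (CT * t ^+ 2) * (2 * n - k + 2) / 2 by field.
  clear -al0 al1; lra.
have e5 := ler_wpM2l t0 e3.
have e6 : mm * (k + 1) + CT * (k + 1) * (`|y| + t) + (mm * (2 * n - k + 2) - A1 0 * z * k + CT * z ^+ 2 * (4 * n)) +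
   CT * t ^+ 2 * (2 * n) <= 2 * mm * n - cc1 / 4 * X.
  have := mm_gt0 al0 al1; move: k1' p1 p2 p3; clear -al0 al1; lra.
have := ler_wpM2l t0 e6; move: e4 e5; clear -al0 al1; lra.
Qed.

(** From k of order n^(2/3 + 2e) on, the loss k^2 / n is of order n^(1/3 + 4e), beyond the
    fluctuation scale. *)
Lemma exit_cut (e : R) : 0 < e -> e < 12^-1 -> \forall n \near \oo, forall c k (y t : R),
  massive c (4 * n) -> `|y| <= pw n (- 3^-1 + e) -> 0 <= t -> t <= pw n (- 3^-1 + e) ->
  4^-1 * pw n (2 / 3 + 2 * e) <= k%:R -> (k <= n)%N ->
  ELn c (par y) n.+1 (fun S => Qn c n.+1 n.+1 (fun w =>
    expR (t * (sumn (take k.+1 S) + lp (sh k 0 w) (n - k) n)%:R))) <=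
  4 * expR (t * (2 * mm * n%:R - cc1 / 64 * pw n (3^-1 + 4 * e))).
Proof.
move=> e0 e1; have CT0 := CT_gt0 al1; have s0 := sgm_gt0 al0 al1; have c10 := cc1_gt0.
near=> n => c k y t mc hy t0 ht hk kn.
have n0 : (0 < n)%N by near: n; exists 1%N.
have p4 : pw n (- 3^-1 + e) <= sgm / 4.
  by near: n; apply: ev_pw_le; [rewrite divr_gt0|lra].
have k1 : 1 <= k%:R :> R.
  apply: le_trans hk; rewrite mulrC ler_pdivlMr // mul1r; near: n; apply: ev_pw_ge; lra.
have n1 : 1 <= n%:R :> R by rewrite ler1n.
have kn' : k%:R <= n%:R :> R by rewrite ler_nat.
have P0 := pw_ge0 n (2 / 3 + 2 * e).
have b1 : 16 * CT * (`|y| + t) * n%:R <= cc1 * k%:R.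
  apply: (@le_trans _ _ (cc1 * (4^-1 * pw n (2 / 3 + 2 * e)))); last by rewrite ler_pM2l.
  apply: (@le_trans _ _ (16 * CT * (2 * pw n (- 3^-1 + e)) * n%:R)).
    apply: ler_wpM2r => //; apply: ler_wpM2l; first by rewrite mulr_ge0 // ltW.
    by move: hy ht; clear -al0 al1; lra.
  have -> : 16 * CT * (2 * pw n (- 3^-1 + e)) * n%:R = 32 * CT * pw n (2 / 3 + e).
    have -> : pw n (2 / 3 + e) = pw n (- 3^-1 + e) * n%:R.
      by rewrite -(pw1 R n0) -pwD; congr pw; field.
    ring.
  by rewrite [leRHS]mulrA; near: n; apply: ev_pw2; [rewrite divr_gt0|lra].
have K2 : 16^-1 * pw n (4 / 3 + 4 * e) <= k%:R ^+ 2.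
  have -> : 16^-1 * pw n (4 / 3 + 4 * e) = (4^-1 * pw n (2 / 3 + 2 * e)) ^+ 2.
    rewrite exprMn pwX exprVn; congr (_ * pw _ _); last by field.
    by congr (_^-1); ring.
  by rewrite lerXn2r ?nnegrE // mulr_ge0.
have b2 : 16 * CT * t ^+ 2 * n%:R ^+ 2 <= cc1 * k%:R ^+ 2.
  apply: (@le_trans _ _ (cc1 * (16^-1 * pw n (4 / 3 + 4 * e)))); last by rewrite ler_pM2l.
  apply: (@le_trans _ _ (16 * CT * pw n (- 3^-1 + e) ^+ 2 * n%:R ^+ 2)).
    apply: ler_wpM2r; first exact: sqr_ge0.
    apply: ler_wpM2l; first by pos.
    by rewrite lerXn2r ?nnegrE ?pw_ge0.
  have -> : 16 * CT * pw n (- 3^-1 + e) ^+ 2 * n%:R ^+ 2 = 16 * CT * pw n (4 / 3 + 2 * e).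
    by rewrite -mulrA; congr (_ * _); rewrite -(pw1 R n0) !pwX -pwD; congr pw; field.
  by rewrite [leRHS]mulrA; near: n; apply: ev_pw2; [rewrite divr_gt0|lra].
have b3 : 32 * mm * n%:R <= cc1 * k%:R ^+ 2.
  apply: (@le_trans _ _ (cc1 * (16^-1 * pw n (4 / 3 + 4 * e)))); last by rewrite ler_pM2l.
  by rewrite -(pw1 R n0) [leRHS]mulrA; near: n; apply: ev_pw2; [rewrite divr_gt0|lra].
have [z1 z2 z3] := exit_exponent n1 k1 kn' t0 (le_trans ht p4) (le_trans hy p4) b1 b2 b3.
have [ya yb] := norm_le_l (le_trans hy p4).
have q1 : y <= sgm by move: ya (s0); clear -al0 al1; lra.
have q2 : y + t <= sgm by move: ya (s0) (le_trans ht p4); clear -al0 al1; lra.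
apply: le_trans (exit_mgf mc n0 kn t0 q1 q2 z1 z2) _.
rewrite ler_wpM2l // ler_expR.
have -> : (n - k).+1%:R = n%:R - k%:R + 1 :> R by rewrite -natr1 natrB.
rewrite -[k.+1%:R]natr1 -[n.+1%:R]natr1; apply: le_trans z3 _.
apply: ler_wpM2l => //; rewrite lerD2l lerN2.
have -> : cc1 / 64 * pw n (3^-1 + 4 * e) = cc1 / 4 * (16^-1 * pw n (3^-1 + 4 * e)) by field.
apply: ler_wpM2l; first by rewrite divr_ge0 // ltW.
rewrite ler_pdivlMr ?ltr0n // -mulrA -[X in _ * (_ * X) <= _](pw1 R n0) -pwD.
apply: le_trans K2; rewrite le_eqVlt; apply/orP; left; apply/eqP; congr (_ * pw _ _); clear -al0 al1; lra.
Unshelve. all: by end_near. Qed.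

End ExitCut.

Section LeftTail.
Variable R : realType.
Variable al : R.
Hypothesis al0 : 0 < al.
Hypothesis al1 : al < 1.
Local Notation phi := (phi al).
Local Notation sgm := (sgm al).
Local Notation CT := (CT al).
Local Notation mm := (mm al).
Local Notation Psi := (Psi al).
Local Notation par := (par al).
Local Notation Qn := (Qn al).
Local Notation Bn := (Bn al).
Local Notation massive := (massive al).

(** A left tail at the crude scale n^.45 is enough: [upper_tail] applies it to squares of side r of
    order at most about n^(2/3), where r^.45 stays below n^(1/3). The increment scale [xL] must lie
    below .45 and above the lower limits that [ev_inc] imposes for [bL]. *)
Definition eL : R := 100^-1.
Definition bL : R := 2 / 3 + 2 * eL.
Definition xL : R := 44 / 100.
Local Notation e := eL.
Local Notation b := bL.
Local Notation x := xL.
Local Notation h1 n := (pw n (- 3^-1) : R).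
Local Notation top n := (2 * mm * n%:R - pw n (45 / 100) : R).
Local Notation mid n := (2 * mm * n%:R - pw n (35 / 100) : R).

Lemma le_ELQ c y M N (F G : seq nat -> (nat -> nat -> nat) -> R) : y <= sgm ->
  (forall S w, F S w <= G S w) ->
  ELn c (par y) M (fun S => Qn c M N (F S)) <= ELn c (par y) M (fun S => Qn c M N (G S)).
Proof.
move=> ys FG; apply: le_ELn; rewrite ?(ltW (par_gt0 _ _)) // ?ltW ?par_lt1 // => S _.
by apply: le_Qn.
Qed.

Lemma ELQ_row c y M N (F : seq nat -> R) : (0 < c)%N ->
  ELn c (par y) M (fun S => Qn c M N (fun=> F S)) = ELn c (par y) M F.
Proof. by move=> c0; apply: eq_EL' => S; exact: Qn_cst. Qed.

Lemma ELQ_bulk c y M N G : (0 < c)%N -> y <= sgm ->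
  ELn c (par y) M (fun S => Qn c M N G) = Qn c M N G.
Proof.
move=> c0 ys; apply: ELn_cst => //; [exact: ltW (par_gt0 _ _)|exact: par_lt1].
Qed.

Lemma ELQD c y M N (F G : seq nat -> (nat -> nat -> nat) -> R) :
  ELn c (par y) M (fun S => Qn c M N (fun w => F S w + G S w)) =
  ELn c (par y) M (fun S => Qn c M N (F S)) + ELn c (par y) M (fun S => Qn c M N (G S)).
Proof. by rewrite /ELn -ELD; apply: eq_EL' => S; exact: QD. Qed.

Lemma ELQZ c y M N k (F : seq nat -> (nat -> nat -> nat) -> R) :
  ELn c (par y) M (fun S => Qn c M N (fun w => k * F S w)) =
  k * ELn c (par y) M (fun S => Qn c M N (F S)).
Proof. by rewrite /ELn -ELZ; apply: eq_EL' => S; exact: QZ. Qed.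

Lemma ELQ_sum c y M N (J : Type) (r : seq J) (P : pred J)
    (F : J -> seq nat -> (nat -> nat -> nat) -> R) :
  ELn c (par y) M (fun S => Qn c M N (fun w => \sum_(j <- r | P j) F j S w)) =
  \sum_(j <- r | P j) ELn c (par y) M (fun S => Qn c M N (F j S)).
Proof. by rewrite /ELn -EL_sum; apply: eq_EL' => S; exact: Q_sum. Qed.

Lemma start_inc c n k (F : nat -> nat -> R) : (0 < c)%N -> (k <= n)%N ->
  Qn c n.+1 n.+1 (fun w => F (lp w n n) (lp (sh k 0 w) (n - k) n)) =
  Qn c n.+1 n.+1 (fun w => F (lp w n n) (lp w (n - k) n)).
Proof.
move=> c0 kn; pose E w := F (lp w n n) (lp w (n - k) n).
rewrite -[RHS](@Qn_rot R al al0 al1 c n n E) //; last first.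
  move=> w w' ww; rewrite /E; congr F; first exact: (boxed_lp (ltnSn _) (ltnSn _) ww).
  by apply: (@boxed_lp n.+1 n.+1 (n - k) n) ww => //; rewrite ltnS leq_subr.
by apply: eq_Q => w; rewrite /E lp_rot lp_start_rot.
Qed.

(** Majorant for a low bulk time together with a high row half leaving at column [k]: for short
    exits the axis sum or a bulk increment must deviate, for long ones the exponential estimated by
    [exit_cut] takes over. *)
Definition rowterm (n k : nat) (S : seq nat) (w : nat -> nat -> nat) : R :=
  if (k.+1%:R <= pw n b) then
    (mm * k.+1%:R + pw n x <= (sumn (take k.+1 S))%:R)%R%:R +
    ((lp w n n)%:R - (lp (sh k 0 w) (n - k) n)%:R <= mm * k%:R - pw n x)%R%:R
  else expR (- (h1 n * mid n)) * expR (h1 n * (sumn (take k.+1 S) + lp (sh k 0 w) (n - k) n)%:R).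

Lemma rowterm_ge0 n k S w : 0 <= rowterm n k S w.
Proof. by rewrite /rowterm; case: ifP => _; rewrite ?addr_ge0 // mulr_ge0 ?expR_ge0. Qed.

Lemma rowterm_dom : \forall n \near \oo, forall S w,
  (((lp w n n)%:R <= top n) && (mid n <= (lp (consrow S w) n n.+1)%:R))%R%:R <=
  \sum_(k < n.+1) rowterm n k S w.
Proof.
near=> n => S w; case: andP => [[hT hG]|_]; last by apply: sumr_ge0 => k _; exact: rowterm_ge0.
have [k kn e1] := exit_row S w n n.
rewrite (bigD1 (Ordinal (kn : (k < n.+1)%N))) //= -[leLHS]addr0; apply: lerD; last first.
  by apply: sumr_ge0 => i _; exact: rowterm_ge0.
rewrite e1 natrD in hG; rewrite /rowterm; case: ifP => _; last first.
  rewrite -expRD; apply: le_trans (expR_ge1Dx _); rewrite lerDl natrD -mulrN -mulrDr.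
  by apply: mulr_ge0; [exact: pw_ge0|move: hG; clear -al0 al1; lra].
case: (lerP (mm * k.+1%:R + pw n x)) => /= h2; first by rewrite lerDl.
rewrite add0r; case: (lerP ((lp w n n)%:R - _)) => //= h3; exfalso.
have h4 : pw n (35 / 100) + 2 * pw n x + mm <= pw n (45 / 100) :> R.
  have u1 : 4 * pw n (35 / 100) <= pw n (45 / 100) :> R by near: n; apply: ev_pw; lra.
  have u2 : 8 * pw n x <= pw n (45 / 100) :> R by near: n; apply: ev_pw; rewrite /xL; lra.
  have u3 : 4 * mm <= pw n (45 / 100) by near: n; apply: ev_pw_ge; lra.
  by move: u1 u2 u3 (pw_ge0 n (45 / 100 : R)); clear -al0 al1; lra.
rewrite -natr1 in h2; move: hT hG h2 h3 h4; clear -al0 al1; lra.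
Unshelve. all: by end_near. Qed.

Lemma rowterm_le : \forall n \near \oo, forall c k, massive c (4 * n) -> (k <= n)%N ->
  ELn c (par (h1 n)) n.+1 (fun S => Qn c n.+1 n.+1 (rowterm n k S)) <= 2 * pw n (- 3).
Proof.
have s0 := sgm_gt0 al0 al1; have c10 := cc1_gt0 al0 al1.
have e0 : 0 < e by rewrite /eL; lra.
have e1 : e < 12^-1 by rewrite /eL; lra.
near=> n => c k mc kn; have c0 : (0 < c)%N by case: mc.
have n0 : (0 < n)%N by near: n; exists 1%N.
have hs : h1 n <= sgm / 4 by near: n; apply: ev_pw_le; [rewrite divr_gt0|lra].
have hs1 : h1 n <= sgm by move: hs (s0); clear -al0 al1; lra.
have [t4 G] : pw n (e - x) <= sgm / 4 /\ forall j : nat, j%:R <= pw n b ->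
  forall y, `|y| <= yI e n ->
  2 * expR (j%:R * (phi (y + pw n (e - x)) - phi y) - pw n (e - x) * (mm * j%:R + pw n x)) <= pw n (- 3) /\
  2 * expR (j%:R * (phi (y - pw n (e - x)) - phi y) + pw n (e - x) * (mm * j%:R - pw n x)) <= pw n (- 3).
  by near: n; apply: ev_inc => //; rewrite /bL /eL /xL; lra.
rewrite /rowterm; case kb : (k.+1%:R <= pw n b).
  rewrite (ELQD c (h1 n) n.+1 n.+1 (fun S _ => (mm * k.+1%:R + pw n x <= (sumn (take k.+1 S))%:R)%R%:R)
    (fun _ w => ((lp w n n)%:R - (lp (sh k 0 w) (n - k) n)%:R <= mm * k%:R - pw n x)%R%:R)).
  rewrite mulr_natl mulr2n; apply: lerD.
    rewrite (ELQ_row (h1 n) n.+1 n.+1 (fun S => (mm * k.+1%:R + pw n x <= (sumn (take k.+1 S))%:R)%R%:R) c0).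
    set t := pw n (e - x) in t4 G.
    have t0 : 0 <= t by exact: pw_ge0.
    have hy : `|h1 n| <= yI e n by rewrite ger0_norm ?pw_ge0 // le_pw //; move: (e0); clear -al0 al1; lra.
    have [g1 _] := G k.+1 kb _ hy; apply: le_trans g1.
    apply: (@le_trans _ _ (ELn c (par (h1 n)) n.+1 (fun S => expR (- (t * (mm * k.+1%:R + pw n x))) *
       expR (t * (sumn (take k.+1 S))%:R)))).
      apply: le_ELn; rewrite ?(ltW (par_gt0 _ _)) // ?ltW ?par_lt1 // => S _.
      rewrite -expRD; apply: ind_expR => h; rewrite addrC -mulrBr mulr_ge0 // subr_ge0 //.
    rewrite /ELn ELZ expRD mulrCA mulrC [X in _ <= X]mulrA [X in _ <= X]mulrC -mulrA.
    rewrite -[X in X <= _]mulrC; apply: ler_wpM2l; first exact: expR_ge0.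
    have q1 : h1 n + t <= sgm by move: hs t4 (s0); clear -al0 al1; lra.
    have q2 : (n.+1 <= 4 * n)%N by clear -n0; lia.
    rewrite [X in _ <= X]mulrC.
    exact: (@ELn_sumn_take R al al0 al1 c (4 * n) (h1 n) t n.+1 k.+1 hs1 q1 mc q2 kn).
  rewrite (ELQ_bulk _ _ _ c0 hs1).
  rewrite (start_inc (fun A B => (A%:R - B%:R <= mm * k%:R - pw n x)%R%:R) c0 kn).
  have I : forall c M N j, massive c (4 * n) -> okbox n M N j e b ->
    Qn c (M + j).+1 N.+1 (fun w => ((lp w (M + j) N)%:R - (lp w M N)%:R <= mm * j%:R - pw n x)%R%:R)
    <= pw n (- 3).
    by near: n; apply: inc_h_lo => //; rewrite /bL /eL /xL; lra.
  have kb' : k%:R <= pw n b by apply: le_trans kb; rewrite ler_nat.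
  have k2 : (2 * k <= n)%N.
    rewrite -(ler_nat R) natrM; apply: (@le_trans _ _ (2 * pw n b)); first by rewrite ler_wpM2l.
    by rewrite -(pw1 R n0); near: n; apply: ev_pw; rewrite /bL /eL; lra.
  have := I c (n - k)%N n k mc; rewrite subnK //; apply; split=> //; split.
  - by clear -k2; lia.
  - by clear; lia.
  - by clear -n0 kn; lia.
  - by clear -n0 kn k2; lia.
  - rewrite natrB // addrAC subrr add0r normrN ger0_norm //.
    by apply: le_trans kb' _; rewrite ler_peMl ?pw_ge0 //; clear -al0 al1; lra.
rewrite ELQZ.
have C : forall c k (y t : R),
  massive c (4 * n) -> `|y| <= pw n (- 3^-1 + e) -> 0 <= t -> t <= pw n (- 3^-1 + e) ->
  4^-1 * pw n (2 / 3 + 2 * e) <= k%:R -> (k <= n)%N ->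
  ELn c (par y) n.+1 (fun S => Qn c n.+1 n.+1 (fun w =>
    expR (t * (sumn (take k.+1 S) + lp (sh k 0 w) (n - k) n)%:R))) <=
  4 * expR (t * (2 * mm * n%:R - cc1 al / 64 * pw n (3^-1 + 4 * e))).
  by near: n; exact: exit_cut.
have h1e : h1 n <= pw n (- 3^-1 + e) by apply: le_pw; move: (e0); clear -al0 al1; lra.
have hk : 4^-1 * pw n (2 / 3 + 2 * e) <= k%:R.
  move/negbT: kb; rewrite -ltNge -natr1 -/bL => kb.
  have : 2 <= pw n b by near: n; apply: ev_pw_ge; rewrite /bL /eL; lra.
  by move: kb; clear -al0 al1; lra.
have hn : `|h1 n| <= pw n (- 3^-1 + e) by rewrite ger0_norm ?pw_ge0.
apply: le_trans (ler_wpM2l (expR_ge0 _) (C c k (h1 n) (h1 n) mc hn (pw_ge0 _ _) h1e hk kn)) _.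
rewrite mulrCA -expRD -mulrN -mulrDr.
have u1 : h1 n * pw n (35 / 100) = pw n (60^-1) by rewrite -pwD; congr pw; clear -al0 al1; lra.
have u2 : h1 n * pw n (3^-1 + 4 * e) = pw n (4 * e) by rewrite -pwD; congr pw; clear -al0 al1; lra.
(* The loss n^(4e) = n^.04 beats n^(1/60), the price of the room n^.35 left in [mid]. *)
have u3 : 2 * pw n (60^-1) <= cc1 al / 64 * pw n (4 * e).
  by near: n; apply: ev_pw2; [rewrite divr_gt0|rewrite /eL; lra].
have -> : h1 n * (- mid n + (2 * mm * n%:R - cc1 al / 64 * pw n (3^-1 + 4 * e))) =
  pw n (60^-1) - cc1 al / 64 * pw n (4 * e) by rewrite -u1 -u2; ring.
apply: (@le_trans _ _ (4 * expR (- (1 * pw n (60^-1))))).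
  by rewrite ler_wpM2l // ler_expR mul1r; move: u3; clear -al0 al1; lra.
apply: (@le_trans _ _ (4 * pw n (- 4))).
  by rewrite ler_wpM2l //; near: n; apply: ev_expN; lra.
apply: (@le_trans _ _ (pw n (- 3))); first by near: n; apply: ev_pw; lra.
by rewrite ler_peMl ?pw_ge0 //; clear -al0 al1; lra.
Unshelve. all: by end_near. Qed.

(** Both axes are strengthened by n^(-1/3), so the boundary time is rarely below [mid]. If it is
    above while the bulk time is below [top], the exit analysis applies to the row half or, after
    transposition, to the column half. *)
Lemma left_tail : \forall n \near \oo, forall c, massive c (4 * n) ->
  Qn c n.+1 n.+1 (fun w => ((lp w n n)%:R <= top n)%R%:R) <= 2^-1.
Proof.
have s0 := sgm_gt0 al0 al1; have CT0 := CT_gt0 al1.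
near=> n => c mc; have c0 : (0 < c)%N by case: mc.
have n0 : (0 < n)%N by near: n; exists 1%N.
have hs : h1 n <= sgm / 4 by near: n; apply: ev_pw_le; [rewrite divr_gt0|lra].
have hp : 0 < h1 n by exact: pw_gt0.
have hs1 : h1 n <= sgm by move: hs (s0); clear -al0 al1; lra.
have hn : `|h1 n| <= sgm by rewrite ger0_norm // ltW.
have hn' : `|- h1 n| <= sgm by rewrite normrN.
have dom : forall S w,
  (((lp w n n)%:R <= top n) && (mid n <= (lp (consrow S w) n n.+1)%:R))%R%:R <=
  \sum_(k < n.+1) rowterm n k S w by near: n; exact: rowterm_dom.
have tle : forall c k, massive c (4 * n) -> (k <= n)%N ->
  ELn c (par (h1 n)) n.+1 (fun S => Qn c n.+1 n.+1 (rowterm n k S)) <= 2 * pw n (- 3).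
  by near: n; exact: rowterm_le.
pose F S w : R := (((lp w n n)%:R <= top n) && (mid n <= (lp (consrow S w) n n.+1)%:R))%R%:R.
pose F' J w : R := (((lp w n n)%:R <= top n) && (mid n <= (lp (conscol J w) n.+1 n)%:R))%R%:R.
have row : ELn c (par (h1 n)) n.+1 (fun S => Qn c n.+1 n.+1 (F S)) <= pw n (- 1).
  apply: (@le_trans _ _ (\sum_(k < n.+1) 2 * pw n (- 3))); last first.
    rewrite sumr_const card_ord -[X in X <= _]mulr_natl.
    apply: (@le_trans _ _ (2 * pw n 1 * (2 * pw n (- 3)))).
      rewrite ler_wpM2r ?mulr_ge0 ?pw_ge0 // pw1 // -natrM ler_nat; clear -n0; lia.
    rewrite mulrACA -pwD; near: n; apply: ev_pw; lra.
  apply: (@le_trans _ _ (ELn c (par (h1 n)) n.+1 (fun S => Qn c n.+1 n.+1 (fun w => \sum_(k < n.+1) rowterm n k S w)))).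
    exact: le_ELQ.
  by rewrite ELQ_sum; apply: ler_sum => k _; apply: tle => //; rewrite -ltnS.
have col : ELn c (par (h1 n)) n.+1 (fun J => Qn c n.+1 n.+1 (F' J)) = ELn c (par (h1 n)) n.+1 (fun S => Qn c n.+1 n.+1 (F S)).
  apply: eq_EL' => J; rewrite -(@Qn_tr R al al0 al1 c n.+1 n.+1 (F' J)) //.
    apply: eq_Q => w; rewrite /F' /F (lp_tr w n n).
    have -> : lp (conscol J (fun i j => w j i)) n.+1 n = lp (consrow J w) n n.+1; last by [].
    by rewrite -lp_tr; apply: lp_ext => a [|i] _ _.
  move=> w w' ww; rewrite /F'; have /= -> := boxed_lp (ltnSn n) (ltnSn n) ww.
  have -> // : lp (conscol J w) n.+1 n = lp (conscol J w') n.+1 n.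
  by apply: conscol_nth => // i j iM jN; apply: ww.
have G := P_G_le al0 al1 (mid n) hn hn' ltac:(move: hp; clear -al0 al1; lra) mc
  (M := n.+1) (N := n.+1) ltac:(clear -n0; lia) ltac:(clear -n0; lia).
rewrite opprK in G.
have Gs : 2 * expR (Psi n.+1%:R n.+1%:R (h1 n) (- h1 n) - (- h1 n - h1 n) * mid n) <= pw n (- 1).
  have := @Psi_le R al al0 al1 n.+1%:R n.+1%:R 0 (h1 n) (- h1 n) (ler0n _ _) (ler0n _ _).
  rewrite !add0r normr0 => /(_ (ltW s0) hn hn').
  rewrite oppr0 Af0 sqrrN subrr mul0r mul0r addr0.
  have -> : `|- h1 n - h1 n| = 2 * h1 n.
    by rewrite -opprD normrN ger0_norm ?addr_ge0 ?ltW //; ring.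
  move=> P.
  have u1 : h1 n * pw n (35 / 100) = pw n (60^-1) by rewrite -pwD; congr pw; clear -al0 al1; lra.
  have u2 : h1 n ^+ 3 * n.+1%:R <= 2.
    have : n.+1%:R <= 2 * n%:R :> R by rewrite -natrM ler_nat; clear -n0; lia.
    move/(ler_wpM2l (exprn_ge0 3 (ltW hp)))/le_trans; apply.
    by rewrite mulrCA pwX -(pw1 R n0) -pwD (_ : _ + 1 = 0) ?pw0 ?mulr1 //; clear -al0 al1; lra.
  have mp := mulr_gt0 (mm_gt0 al0 al1) hp.
  have u3 : 8 * CT * (h1 n ^+ 3 * n.+1%:R) <= 16 * CT by have := ler_wpM2l (ltW CT0) u2; clear -al0 al1; lra.
  have u4 : 32 * CT <= pw n (60^-1) by near: n; apply: ev_pw_ge; clear -al0 al1; lra.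
  apply: (@le_trans _ _ (2 * expR (- (1 * pw n (60^-1))))).
    rewrite ler_wpM2l // ler_expR mul1r; rewrite -natr1 in P u3 *.
    move: P u1 u3 u4 mp (pw_ge0 n (60^-1 : R)); clear -al0 al1; lra.
  apply: (@le_trans _ _ (2 * pw n (- 2))).
    by rewrite ler_wpM2l //; near: n; apply: ev_expN; lra.
  by near: n; apply: ev_pw; lra.
have E1 := @Bn_bulk R al al0 al1 c (h1 n) (h1 n) n.+1 n.+1 (fun w => ((lp w n n)%:R <= top n)%R%:R) c0 hs1 hs1.
rewrite -E1.
apply: (@le_trans _ _ (Bn c (par (h1 n)) (par (h1 n)) n.+1 n.+1 (fun S J w =>
  (((lp (bdw S J w) n.+1 n.+1)%:R <= mid n)%R%:R + F S w) + F' J w))).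
  apply: le_Bn => // S J w _ _; rewrite /F /F'; case: (lerP (lp w n n)%:R (top n)) => hT /=; last by rewrite !addr0.
  case: (lerP (mid n) (lp (consrow S w) n n.+1)%:R) => r1 /=.
    by rewrite -addrA addrCA lerDl addr_ge0.
  case: (lerP (mid n) (lp (conscol J w) n.+1 n)%:R) => r2 /=; first by rewrite lerDr addr_ge0.
  rewrite (_ : (_ <= mid n) = true) ?addr0 // G_split /maxn.
  by case: ifP => _; exact: ltW.
rewrite !BnD.
have -> : Bn c (par (h1 n)) (par (h1 n)) n.+1 n.+1 (fun S J w => F S w) =
   ELn c (par (h1 n)) n.+1 (fun S => Qn c n.+1 n.+1 (F S)) by exact: Bn_row.
have -> : Bn c (par (h1 n)) (par (h1 n)) n.+1 n.+1 (fun S J w => F' J w) =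
   ELn c (par (h1 n)) n.+1 (fun S => Qn c n.+1 n.+1 (F' S)) by exact: Bn_col.
rewrite col.
have p1 : pw n (- 1) <= 6^-1 :> R by near: n; apply: ev_pw_le; lra.
have := le_trans G Gs; move: row p1; clear -al0 al1; lra.
Unshelve. all: by end_near. Qed.

End LeftTail.

(** * Upper tail *)

Section UpperTail.
Variable R : realType.
Variable al : R.
Hypothesis al0 : 0 < al.
Hypothesis al1 : al < 1.
Local Notation phi := (phi al).
Local Notation sgm := (sgm al).
Local Notation CT := (CT al).
Local Notation mm := (mm al).
Local Notation psi := (psi al).
Local Notation Psi := (Psi al).
Local Notation par := (par al).
Local Notation qq := (qq al).
Local Notation Qn := (Qn al).
Local Notation Bn := (Bn al).
Local Notation massive := (massive al).
Local Notation c3 := (c3 al).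

(** Exponent per unit of [M + N] when both axes have the weakened parameter [par (- y)] and the tilt
    is [2 * y]; see [Psi_sym]. *)
Definition Dl (y : R) := phi y - phi (- y).

Lemma DlE y : Dl y = 2 * mm * y + psi y.
Proof. by rewrite /Dl /psi; ring. Qed.

Lemma Psi_sym (M N : R) y : Psi M N (- y) y = (M + N) * Dl y.
Proof. by rewrite /Psi /Dl (opprK y) mulrDl. Qed.

Lemma expR1_le4 : expR 1 <= 4 :> R.
Proof.
have h : expR (2^-1 : R) <= 2.
  have h1 : 2^-1 < 1 :> R by lra.
  by have := expR_le_inv h1; rewrite (_ : 1 - 2^-1 = 2^-1) ?invrK //; lra.
have -> : (1 : R) = 2^-1 + 2^-1 by lra.
rewrite expRD; have := ler_pM (expR_ge0 _) (expR_ge0 _) h h.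
by move/le_trans; apply; lra.
Qed.

Lemma inv_pow_ge1 c (r : R) k : (0 < c)%N -> 0 <= r -> r < 1 -> 1 <= (1 - r ^+ c)^-1 ^+ k.
Proof.
move=> c0 r0 r1; apply: exprn_ege1; rewrite invf_ge1; last by rewrite subr_gt0 exprn_ilt1 // -lt0n.
by rewrite gerBl exprn_ge0.
Qed.

Lemma Bs_leBn c y y' M N F : (0 < c)%N -> y <= sgm -> y' <= sgm ->
  (forall S J w, 0 <= F S J w) ->
  Bs c (par y) (par y') qq M N F <= Bn c (par y) (par y') M N F.
Proof.
move=> c0 ys ys' F0.
rewrite /Bn /ELn (EL_nseq_scale _ _ _ (geo (par y))).
have -> : Bs c (par y) (par y') qq M N F =
  EL (iota 0 c) (nseq M (geo (par y))) (fun S => EL (iota 0 c) (nseq N (geo (par y')))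
   (fun J => Q (iota 0 c) (geo qq) M N (F S J))) by [].
under [X in _ <= _ * X]eq_EL' do rewrite (EL_nseq_scale _ _ _ (geo (par y'))).
under [X in _ <= _ * X]eq_EL' do under eq_EL' do rewrite /Qn (Q_scale _ _ (geo qq)).
under [X in _ <= _ * X]eq_EL' do rewrite ELZ.
rewrite !ELZ !mulrA; apply: ler_peMl.
  apply: EL_nseq_ge0 => [k|S]; first by apply: geo_ge0; rewrite ?(ltW (par_gt0 _ _)) ?(ltW (par_lt1 _ _ ys)).
  apply: EL_nseq_ge0 => [k|J]; first by apply: geo_ge0; rewrite ?(ltW (par_gt0 _ _)) ?(ltW (par_lt1 _ _ ys')).
  apply: Q_ge0 => // k; apply: geo_ge0; [exact: ltW (qq_gt0 al0)|exact: ltW (qq_lt1 al0 al1)].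
have h1 := inv_pow_ge1 M c0 (ltW (par_gt0 al0 y)) (par_lt1 al0 al1 ys).
have h2 := inv_pow_ge1 N c0 (ltW (par_gt0 al0 y')) (par_lt1 al0 al1 ys').
have h3 := inv_pow_ge1 (M * N) c0 (ltW (qq_gt0 al0)) (qq_lt1 al0 al1).
by apply: mulr_ege1 => //; apply: mulr_ege1.
Qed.

(** The only lower bound on an exponential moment. The axes are weakened so that the moment has to
    come from the bulk and not from long stays on an axis. *)
Lemma weak_mgf y M : `|y| <= sgm -> exists C, forall c, (C <= c)%N -> (0 < c)%N /\
  2^-1 * expR ((M + M)%:R * Dl y) <=
  Bn c (par (- y)) (par (- y)) M M (fun S J w => eG (2 * y) S J w M M).
Proof.
move=> hy; have hyN : `|- y| <= sgm by rewrite normrN.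
have [y1 y2] := norm_le_l hy.
have [p1 p2 p3 p4 p5] := mgf_side al0 al1 hyN hy.
have [C hC] := Bs_mgf_ge M M p1 p2 (expR_ge0 _) p3 p4 p5 (qq_lt1 al0 al1).
exists C.+1 => c Cc; have c0 : (0 < c)%N by apply: leq_trans Cc.
split=> //; have := hC c (ltnW Cc).
rewrite mgf_formula // Psi_sym -natrD => h; apply: le_trans h _.
have -> : y - - y = 2 * y by ring.
apply: le_trans (_ : Bs c (par (- y)) (par (- y)) qq M M (fun S J w => eG (2 * y) S J w M M) <= _).
  by rewrite le_eqVlt; apply/orP; left; apply/eqP; do 2 (apply: eq_EL' => ?); apply: eq_Q => w; rewrite eGE.
by apply: Bs_leBn => // S J w; exact: expR_ge0.
Qed.

Section Scale.
Variable e : R.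
Hypothesis e0 : 0 < e.
Hypothesis e1 : 1000 * (100 * e) <= 1.

(** Exit columns up to about n^(2/3 + 2e) are cut into n^(8e) blocks of length n^(2/3 - 6e), inside
    which increments fluctuate by less than n^(1/3 - e). [kap = 9 * e] exceeds the 8e lost to the
    pigeonhole over the blocks. *)
Definition kap := 9 * e.
Definition bexp := 2 / 3 - 6 * e.
Definition xexp := 3^-1 - e.
Definition bw n := Num.truncn (pw n bexp : R).
Definition nb n := Num.truncn (pw n (8 * e) : R).

(** The tilt is of order (ln n / n)^(1/3): the gain n psi(y) is then logarithmic, all relevant
    moments are powers of n, and a second moment argument loses only n to a multiple of [kap]. *)
Definition good_theta n (y : R) :=
  [/\ 0 < y, 2 * y <= sgm / 4, psi y = 2 * kap * ln n%:R / n%:R, psi (2 * y) <= 10 * psi y &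
   pw n (- 3^-1) <= 2 * y] /\ 2 * y <= pw n (- 3^-1 + e).

Lemma e_small : e < 12^-1. Proof. by move: (e0) (e1); lra. Qed.
Lemma kap_gt0 : 0 < kap. Proof. by rewrite /kap; move: (e0); lra. Qed.

Lemma cube_le (a b : R) : 0 <= b -> a ^+ 3 <= b ^+ 3 -> a <= b.
Proof.
move=> b0; case: (leP 0 a) => [a0|/ltW a0 _]; last exact: le_trans b0.
by rewrite ler_pXn2r // nnegrE.
Qed.

(** The intermediate value theorem solves the equation for [psi y]. The last bound holds for every
    [K] because y n^(1/3) grows only like (ln n)^(1/3). *)
Lemma theta_ex (K : R) : 0 < K -> \forall n \near \oo, exists2 y, good_theta n y &
  2 * y * (K * pw n 3^-1) <= 2^-1 * kap * ln n%:R.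
Proof.
move=> K0; have s0 := sgm_gt0 al0 al1; have CT0 := CT_gt0 al1; have c30 := c3_gt0 al0 al1.
have k0 := kap_gt0.
have [y1 y10 hy1] := psi_double al0 al1.
pose ys := Num.min y1 (sgm / 8).
have ys0 : 0 < ys by rewrite lt_min y10 divr_gt0.
have ysy : ys <= y1 by rewrite ge_min lexx.
have yss : ys <= sgm / 8 by rewrite ge_min lexx orbT.
have yss' : ys <= sgm by apply: le_trans yss _; move: (s0); clear -al0 al1 e0 e1; lra.
near=> n.
have n0 : (0 < n)%N by near: n; exists 1%N.
have nR : 0 < n%:R :> R by rewrite ltr0n.
have ln1 : 1 <= ln n%:R :> R by near: n; exact: ev_ln.
have ha : 2 * kap * ln n%:R <= pw n 2^-1 by near: n; apply: ev_ln_pw; lra.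
have hb : 1 * pw n 2^-1 <= c3 * ys ^+ 3 * pw n 1.
  near: n; apply: ev_pw2; last lra.
  by rewrite mulr_gt0 // exprn_gt0.
have hc : CT / kap <= ln n%:R by near: n; exact: ev_ln.
have hd : 16 * kap / c3 * ln n%:R <= pw n (3 * (- 3^-1 + e) + 1).
  by near: n; apply: ev_ln_pw; move: (e0); lra.
have he : (8^-1 * kap ^+ 3)^-1 * (16 * K ^+ 3 * kap / c3) <= ln n%:R by near: n; exact: ev_ln.
set L := ln n%:R : R in ln1 ha hc hd he *.
have L0 : 0 < L by exact: lt_le_trans ln1.
set v := 2 * kap * L / n%:R.
have v0 : 0 < v by rewrite divr_gt0 // !mulr_gt0.
have vE : v * n%:R = 2 * kap * L by rewrite /v divfK // gt_eqF.
have vs : v <= psi ys.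
  apply: le_trans (psi_ge al0 al1 (ltW ys0) yss'); rewrite /v ler_pdivrMr //.
  by apply: le_trans ha _; rewrite -(pw1 R n0) -[X in X <= _]mul1r.
have hv : Num.min (psi 0) (psi ys) <= v <= Num.max (psi 0) (psi ys).
  by rewrite psi0 // ge_min (ltW v0) /= le_max vs orbT.
have [y yin psiy] := IVT (ltW ys0) (psi_cont al0 al1 (ltW ys0) yss') hv.
move: yin; rewrite in_itv /= => /andP[yge yle].
have yp : 0 < y.
  by rewrite lt_neqAle yge andbT; apply: contraTneq v0 => yz; rewrite -psiy -yz psi0 // ltxx.
have yy1 : 0 <= y <= y1 by rewrite yge (le_trans yle).
have [_ d1] := hy1 y yy1.
have ysg : y <= sgm by exact: (le_trans yle yss').
have up : c3 * y ^+ 3 <= v by rewrite -psiy; exact: psi_ge.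
have lo : v <= 4 * CT * y ^+ 3 by rewrite -psiy; exact: psi_le.
have p3 a : pw n a ^+ 3 * n%:R = pw n (3 * a + 1) :> R.
  by rewrite pwX -(pw1 R n0) -pwD.
have up' : c3 * y ^+ 3 * n%:R <= 2 * kap * L by rewrite -vE ler_pM2r.
have lo' : 2 * kap * L <= 4 * CT * y ^+ 3 * n%:R by rewrite -vE ler_pM2r.
exists y.
  split; [split=> //|].
  - by move: yle (yss); clear -al0 al1 e0 e1; lra.
  - apply: cube_le; first by rewrite mulr_ge0.
    rewrite -(ler_pM2r nR) p3 (_ : 3 * - 3^-1 + 1 = 0) ?pw0; last by clear -al0 al1 e0 e1; lra.
    have kL : CT <= kap * L.
      by rewrite mulrC -ler_pdivrMr.
    have : CT * 1 <= CT * (2 * (y ^+ 3 * n%:R)).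
      rewrite mulr1; move: kL lo'; clear -al0 al1 e0 e1; lra.
    rewrite ler_pM2l // => h; have y3 : 0 <= y ^+ 3 * n%:R by rewrite mulr_ge0 ?exprn_ge0.
    by move: h y3; clear -al0 al1 e0 e1; lra.
  apply: cube_le; first exact: pw_ge0.
  rewrite -(ler_pM2r nR) p3.
  apply: le_trans hd; rewrite [leRHS]mulrAC ler_pdivlMr //.
  by move: up'; clear -al0 al1 e0 e1; lra.
apply: cube_le; first by apply: mulr_ge0; [apply: mulr_ge0 => //; exact: ltW|exact: ltW].
have e3 : pw n 3^-1 ^+ 3 = n%:R :> R.
  by rewrite pwX -(pw1 R n0); congr pw; clear -al0 al1 e0 e1; lra.
have -> : (2 * y * (K * pw n 3^-1)) ^+ 3 = 8 * K ^+ 3 * (y ^+ 3 * n%:R).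
  by rewrite !exprMn e3; ring.
have K3 : 0 < K ^+ 3 by exact: exprn_gt0.
have b1 : 8 * K ^+ 3 * (y ^+ 3 * n%:R) <= 16 * K ^+ 3 * kap / c3 * L.
  rewrite [leRHS]mulrAC ler_pdivlMr //.
  have := ler_wpM2l (ltW K3) up'; clear -al0 al1 e0 e1; lra.
apply: le_trans b1 _.
have -> : (2^-1 * kap * L) ^+ 3 = 8^-1 * kap ^+ 3 * L ^+ 2 * L by field.
rewrite ler_pM2r //.
have kk : 0 < 8^-1 * kap ^+ 3 by rewrite mulr_gt0 ?exprn_gt0 // invr_gt0.
rewrite -ler_pdivrMl // .
apply: (@le_trans _ _ L); first exact: he.
by rewrite expr2 ler_pMr.
Unshelve. all: by end_near. Qed.

Definition Xe n : R := pw n xexp.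
Local Notation V n k w := (lp (sh k 0 w) (n - k) n).
Local Notation Sk k S := (sumn (take k.+1 S)).

Definition badS n k (S : seq nat) : R :=
  (mm * (k %% bw n)%:R + Xe n <= (Sk k S)%:R - (Sk (k %/ bw n * bw n) S)%:R)%R%:R.
Definition badV n k w : R :=
  (mm * ((k %/ bw n).+1 * bw n - k)%:R + Xe n <= (V n k w)%:R - (V n ((k %/ bw n).+1 * bw n) w)%:R)%R%:R.

(** Three kinds of exit columns: long ones, ordinary ones, and those for which the axis sum or the
    bulk time moves too much within the block. The axis sum is compared with the block start and the
    bulk time with the block end, so that an ordinary column costs only the factor with
    [2 * Xe n]. *)
Lemma row_dom n (t : R) S w : (0 < bw n)%N -> 0 <= t ->
  expR (t * (lp (consrow S w) n n.+1)%:R) <=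
  \sum_(k < n.+1 | (nb n * bw n <= k)%N) expR (t * (Sk k S + V n k w)%:R) +
  (\sum_(i < nb n) expR (t * (mm * (bw n)%:R + 2 * Xe n)) *
      (expR (t * (Sk (i * bw n) S)%:R) * expR (t * (V n (i.+1 * bw n) w)%:R)) +
  \sum_(k < n.+1 | (k < nb n * bw n)%N)
      (expR (t * (Sk k S)%:R) * badS n k S * expR (t * (V n k w)%:R) +
       expR (t * (Sk k S)%:R) * (expR (t * (V n k w)%:R) * badV n k w))).
Proof.
move=> b0 t0; have [k kn ->] := exit_row S w n n.
have p0 (J : finType) (P : pred J) (F : J -> R) : (forall j, 0 <= F j) -> 0 <= \sum_(j | P j) F j.
  by move=> F0; apply: sumr_ge0.
have p1 (J : finType) (P : pred J) (F : J -> R) i : (forall j, 0 <= F j) -> P i -> F i <= \sum_(j | P j) F j.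
  by move=> F0 Pi; rewrite (bigD1 i) //= lerDl; apply: sumr_ge0.
have F1 (j : 'I_n.+1) : 0 <= expR (t * (Sk j S + V n j w)%:R) by exact: expR_ge0.
have F2 (i : 'I_(nb n)) : 0 <= expR (t * (mm * (bw n)%:R + 2 * Xe n)) *
      (expR (t * (Sk (i * bw n) S)%:R) * expR (t * (V n (i.+1 * bw n) w)%:R)).
  by rewrite !mulr_ge0 ?expR_ge0.
have F3 (j : 'I_n.+1) : 0 <= expR (t * (Sk j S)%:R) * badS n j S * expR (t * (V n j w)%:R) +
       expR (t * (Sk j S)%:R) * (expR (t * (V n j w)%:R) * badV n j w).
  by rewrite addr_ge0 ?mulr_ge0 ?expR_ge0.
have kn' : (k < n.+1)%N by [].
have A0 := p0 _ (fun k : 'I_n.+1 => (nb n * bw n <= k)%N) _ F1.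
have B0 := p0 _ xpredT _ F2.
have C0 := p0 _ (fun k : 'I_n.+1 => (k < nb n * bw n)%N) _ F3.
case: (leqP (nb n * bw n) k) => kK.
  apply: le_trans (p1 _ (fun k : 'I_n.+1 => (nb n * bw n <= k)%N) _ (Ordinal kn') F1 kK) _.
  by rewrite lerDl addr_ge0.
set i := (k %/ bw n)%N.
have iB : (i < nb n)%N by rewrite ltn_divLR.
have G3 := p1 _ (fun k : 'I_n.+1 => (k < nb n * bw n)%N) _ (Ordinal kn') F3 kK.
have G2 := p1 _ xpredT _ (Ordinal iB) F2 isT.
case bS : (mm * (k %% bw n)%:R + Xe n <= (Sk k S)%:R - (Sk (i * bw n) S)%:R).
  apply: (@le_trans _ _ (expR (t * (Sk k S)%:R) * badS n k S * expR (t * (V n k w)%:R))).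
    by rewrite /badS -/i bS mulr1 -expRD -mulrDr -natrD.
  apply: le_trans (_ : _ <= expR (t * (Sk k S)%:R) * badS n k S * expR (t * (V n k w)%:R) +
       expR (t * (Sk k S)%:R) * (expR (t * (V n k w)%:R) * badV n k w)) _.
    by rewrite lerDl !mulr_ge0 ?expR_ge0.
  by apply: le_trans G3 _; rewrite addrA lerDr addr_ge0.
case bV : (mm * (i.+1 * bw n - k)%:R + Xe n <= (V n k w)%:R - (V n (i.+1 * bw n) w)%:R).
  apply: (@le_trans _ _ (expR (t * (Sk k S)%:R) * (expR (t * (V n k w)%:R) * badV n k w))).
    by rewrite /badV -/i bV mulr1 -expRD -mulrDr -natrD.
  apply: le_trans (_ : _ <= expR (t * (Sk k S)%:R) * badS n k S * expR (t * (V n k w)%:R) +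
       expR (t * (Sk k S)%:R) * (expR (t * (V n k w)%:R) * badV n k w)) _.
    by rewrite lerDr !mulr_ge0 ?expR_ge0.
  by apply: le_trans G3 _; rewrite addrA lerDr addr_ge0.
move/negbT: bS; rewrite -ltNge => bS; move/negbT: bV; rewrite -ltNge => bV.
apply: le_trans (_ : _ <= \sum_(i < nb n) expR (t * (mm * (bw n)%:R + 2 * Xe n)) *
      (expR (t * (Sk (i * bw n) S)%:R) * expR (t * (V n (i.+1 * bw n) w)%:R))) _; last first.
  by rewrite addrCA lerDl addr_ge0.
apply: le_trans G2; rewrite /=.
rewrite -!expRD ler_expR -!mulrDr ler_wpM2l // natrD.
have kE : k%:R = i%:R * (bw n)%:R + (k %% bw n)%:R :> R.
  by rewrite -natrM -natrD -divn_eq.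
have kb : (k <= i.+1 * bw n)%N by apply: ltnW; rewrite -ltn_divLR.
rewrite natrB // natrM -natr1 in bV.
move: bS bV kE; clear -al0 al1 e0 e1.
set a := (Sk k S)%:R; set b := (Sk _ S)%:R; set c := (V n k w)%:R; set d := (V n _ w)%:R.
set m1 := (k %% bw n)%:R; set B := (bw n)%:R; set X := Xe n; set I := i%:R; set K := k%:R.
move=> h1 h2 h3; rewrite h3 in h2; move: h1 h2; lra.
Qed.

Lemma S_mgf c n k y : massive c (4 * n) -> (0 < n)%N -> (k <= n)%N -> `|y| <= sgm ->
  ELn c (par (- y)) n.+1 (fun S => expR (2 * y * (Sk k S)%:R)) <= 2 * expR (k.+1%:R * Dl y).
Proof.
move=> mc n0 kn hy; have [y1 y2] := norm_le_l hy.
have e2 : - y + 2 * y = y by ring.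
have n4 : (n.+1 <= 4 * n)%N by clear -n0; lia.
have h : - y + 2 * y <= sgm by rewrite e2.
by have := @ELn_sumn_take R al al0 al1 c (4 * n) (- y) (2 * y) n.+1 k.+1 y2 h mc n4 kn; rewrite e2.
Qed.

Lemma V_mgf c n k z : massive c (4 * n) -> (0 < n)%N -> (k <= n)%N -> 0 <= z -> `|z| <= sgm ->
  Qn c n.+1 n.+1 (fun w => expR (2 * z * (V n k w)%:R)) <=
  2 * expR (((n - k).+1 + n.+1)%:R * Dl z).
Proof.
move=> mc n0 kn z0 hz; have c0 : (0 < c)%N by case: mc.
have hz' : `|- z| <= sgm by rewrite normrN.
rewrite (@V_law R al al0 al1 c n n k (fun l => expR (2 * z * l%:R))) //.
have n4 : (n < 4 * n)%N by clear -n0; lia.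
have nk : (n - k < 4 * n)%N by apply: leq_ltn_trans n4; rewrite leq_subr.
have zz : - z <= z by move: z0; clear -al0 al1 e0 e1; lra.
have := @T_mgf R al al0 al1 c (4 * n) (n - k) n (- z) z hz' hz zz mc nk n4.
by rewrite Psi_sym -natrD (_ : z - - z = 2 * z) //; ring.
Qed.

Lemma ELn_two_take c n l d y t t' : y <= sgm -> y + t <= sgm -> y + t' <= sgm ->
  massive c (4 * n) -> (0 < n)%N -> (l + d <= n)%N ->
  ELn c (par y) n.+1 (fun S => expR (t * (Sk l S)%:R + t' * ((Sk (l + d) S)%:R - (Sk l S)%:R))) <=
  2 * expR (l.+1%:R * (phi (y + t) - phi y) + d%:R * (phi (y + t') - phi y)).
Proof.
move=> ys yt yt' mc n0 ldn; have c0 : (0 < c)%N by case: mc.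
have n4 : (l.+1 + d <= 4 * n)%N by clear -n0 ldn; lia.
rewrite (@ELn_take R c _ n.+1 (l.+1 + d)) ?(ltW (par_gt0 _ _)) ?par_lt1 //.
- apply: le_trans (ELn_two al0 al1 ys yt yt' mc n4); rewrite le_eqVlt; apply/orP; left; apply/eqP.
  apply: eq_EL => S; rewrite size_nseq => sS _; rewrite -[in Sk (l + d) S]addSn.
  have -> : (sumn (take (l.+1 + d) S))%:R = (sumn (drop l.+1 S))%:R + (Sk l S)%:R :> R.
    by rewrite take_oversize ?sS // -natrD addnC -sumn_cat cat_take_drop.
  by rewrite addrK.
- move=> S S' SS; have E m : (m <= l.+1 + d)%N -> sumn (take m S) = sumn (take m S').
    move=> mm'; rewrite -!sumn_take_nth; apply: eq_bigr => i _; apply: SS.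
    exact: leq_trans mm'.
  by rewrite !E // leq_addr.
Qed.

(** A further tilt by n^(e - xexp), put on the part of the axis inside the block only, detects the
    deviation and leaves the main exponential unchanged elsewhere. *)
Lemma badS_le D : \forall n \near \oo, forall c k y, massive c (4 * n) -> good_theta n y ->
  (k <= n)%N ->
  ELn c (par (- y)) n.+1 (fun S => expR (2 * y * (Sk k S)%:R) * badS n k S) <=
  expR (k.+1%:R * Dl y) * pw n (- D).
Proof.
have s0 := sgm_gt0 al0 al1.
near=> n => c k y mc [[y0 ys _ _ _] y2] kn; have n0 : (0 < n)%N by near: n; exists 1%N.
have b1 : 1 <= pw n bexp by rewrite pw_ge1 // /bexp; move: (e0) (e1); clear -al0 al1 e0 e1; lra.
have /andP[bl bu] := truncn_bounds b1.
have b0 : (0 < bw n)%N by rewrite truncn_gt0.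
have [t4 G] : pw n (e - xexp) <= sgm / 4 /\ forall j : nat, j%:R <= pw n bexp ->
  forall y, `|y| <= yI e n ->
  2 * expR (j%:R * (phi (y + pw n (e - xexp)) - phi y) - pw n (e - xexp) * (mm * j%:R + pw n xexp)) <= pw n (- D) /\
  2 * expR (j%:R * (phi (y - pw n (e - xexp)) - phi y) + pw n (e - xexp) * (mm * j%:R - pw n xexp)) <= pw n (- D).
  near: n; apply: ev_inc => //; first exact: e_small.
  - by rewrite /bexp /xexp; move: (e0); clear -al0 al1 e0 e1; lra.
  - by rewrite /bexp /xexp; move: (e0); clear -al0 al1 e0 e1; lra.
  - by rewrite /xexp; move: (e0) (e1); clear -al0 al1 e0 e1; lra.
set t := pw n (e - xexp) in t4 G; have t0 : 0 <= t by exact: pw_ge0.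
set d := (k %% bw n)%N; set l := (k %/ bw n * bw n)%N.
have kE : k = (l + d)%N by rewrite /l /d -divn_eq.
have db : d%:R <= pw n bexp by apply: le_trans bu; rewrite ler_nat ltnW // ltn_pmod.
have yI' : `|y| <= yI e n.
  rewrite gtr0_norm //; apply: le_trans (_ : 2 * y <= _); first by move: y0; clear -al0 al1 e0 e1; lra.
  by apply: le_trans y2 _; apply: le_pw; move: (e0); clear -al0 al1 e0 e1; lra.
have [g _] := G d db y yI'.
have e2 : - y + 2 * y = y by ring.
have q1 : - y <= sgm by move: y0 (s0); clear -al0 al1 e0 e1; lra.
have q2 : - y + 2 * y <= sgm by rewrite e2; move: y0 ys (s0); clear -al0 al1 e0 e1; lra.
have q3 : - y + (2 * y + t) <= sgm by rewrite addrA e2; move: y0 ys t4 (s0); clear -al0 al1 e0 e1; lra.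
apply: (@le_trans _ _ (ELn c (par (- y)) n.+1 (fun S => expR (- (t * (mm * d%:R + Xe n))) *
   expR (2 * y * (Sk l S)%:R + (2 * y + t) * ((Sk (l + d) S)%:R - (Sk l S)%:R))))).
  apply: le_ELn; rewrite ?(ltW (par_gt0 _ _)) // ?ltW ?par_lt1 // => S _.
  rewrite -expRD /badS -/d -/l -kE.
  case: (lerP (mm * d%:R + Xe n)) => h; last by rewrite mulr0 expR_ge0.
  rewrite mulr1 ler_expR; have := mulr_ge0 t0 (_ : 0 <= (Sk k S)%:R - (Sk l S)%:R - (mm * d%:R + Xe n)).
  by rewrite subr_ge0 => /(_ h); clear -al0 al1 e0 e1; lra.
rewrite /ELn ELZ.
have ldn : (l + d <= n)%N by rewrite -kE.
apply: le_trans (ler_wpM2l (expR_ge0 _) (ELn_two_take q1 q2 q3 mc n0 ldn)) _.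
rewrite addrA e2 -/(Dl y) mulrCA -expRD.
have -> : - (t * (mm * d%:R + Xe n)) + (l.+1%:R * Dl y + d%:R * (phi (y + t) - phi (- y))) =
  k.+1%:R * Dl y + (d%:R * (phi (y + t) - phi y) - t * (mm * d%:R + pw n xexp)).
  have -> : k.+1%:R = l.+1%:R + d%:R :> R by rewrite -natrD addSn -kE.
  by rewrite /Dl /Xe; ring.
by rewrite expRD mulrCA ler_wpM2l ?expR_ge0.
Unshelve. all: by end_near. Qed.

Lemma start_inc2 c n k r (F : nat -> nat -> R) : (0 < c)%N -> (k <= r)%N -> (r <= n)%N ->
  Qn c n.+1 n.+1 (fun w => F (V n k w) (V n r w)) =
  Qn c (n - k).+1 n.+1 (fun w => F (lp w (n - k) n) (lp w (n - r) n)).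
Proof.
move=> c0 kr rn; have kn := leq_trans kr rn.
pose E w := F (lp w (n - k) n) (lp w (n - r) n).
have bE : boxed (n - k).+1 n.+1 E.
  move=> w w' ww; rewrite /E; congr F; first exact: (boxed_lp (ltnSn _) (ltnSn _) ww).
  by apply: (@boxed_lp (n - k).+1 n.+1 (n - r) n) ww => //; rewrite ltnS leq_sub2l.
rewrite -(@Qn_box R al al0 al1 c n.+1 n.+1 (n - k).+1 n.+1 E) //; last by rewrite ltnS leq_subr.
rewrite -[RHS](@Qn_rot R al al0 al1 c n n E) //; last first.
  move=> w w' ww; apply: bE => i j ik jn; apply: ww => //; apply: leq_trans ik _.
  by rewrite ltnS leq_subr.
by apply: eq_Q => w; rewrite /E !lp_start_rot.
Qed.

Lemma badV_prob D : \forall n \near \oo, forall c k, massive c (4 * n) ->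
  (k < nb n * bw n)%N -> Qn c n.+1 n.+1 (badV n k) <= pw n (- D).
Proof.
near=> n => c k mc kK; have c0 : (0 < c)%N by case: mc.
have n0 : (0 < n)%N by near: n; exists 1%N.
have b1 : 1 <= pw n bexp by rewrite pw_ge1 // /bexp; move: (e0) (e1); clear -al0 al1 e0 e1; lra.
have /andP[bl bu] := truncn_bounds b1.
have b0 : (0 < bw n)%N by rewrite truncn_gt0.
have m1 : 1 <= pw n (8 * e) by rewrite pw_ge1 //; move: (e0) (e1); clear -al0 al1 e0 e1; lra.
have /andP[_ mu] := truncn_bounds m1.
set r := ((k %/ bw n).+1 * bw n)%N.
have iB : (k %/ bw n < nb n)%N by rewrite ltn_divLR.
have rK : (r <= nb n * bw n)%N by rewrite leq_mul.
have rR : r%:R <= pw n (2 / 3 + 2 * e) :> R.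
  apply: le_trans (_ : (nb n * bw n)%:R <= _); first by rewrite ler_nat.
  rewrite natrM (_ : 2 / 3 + 2 * e = 8 * e + bexp); last by rewrite /bexp; ring.
  by rewrite (pwD n (8 * e) bexp); exact: ler_pM.
have r2 : (2 * r <= n)%N.
  rewrite -(ler_nat R) natrM; apply: (@le_trans _ _ (2 * pw n (2 / 3 + 2 * e))); first by rewrite ler_wpM2l.
  by rewrite -(pw1 R n0); near: n; apply: ev_pw; move: (e0) (e1); clear -al0 al1 e0 e1; lra.
have kr : (k <= r)%N by apply: ltnW; rewrite -ltn_divLR.
have rn : (r <= n)%N by clear -r2; lia.
rewrite /badV -/r (start_inc2 (fun A B => (mm * (r - k)%:R + Xe n <= A%:R - B%:R)%R%:R) c0 kr rn).
have I : forall c M N j, massive c (4 * n) -> okbox n M N j e bexp ->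
  Qn c (M + j).+1 N.+1 (fun w => (mm * j%:R + pw n xexp <= (lp w (M + j) N)%:R - (lp w M N)%:R)%R%:R)
  <= pw n (- D).
  near: n; apply: inc_h_up => //; first exact: e_small.
  - by rewrite /bexp; move: (e0); clear -al0 al1 e0 e1; lra.
  - by rewrite /bexp /xexp; move: (e0); clear -al0 al1 e0 e1; lra.
  - by rewrite /bexp /xexp; move: (e0); clear -al0 al1 e0 e1; lra.
  - by rewrite /xexp; move: (e0) (e1); clear -al0 al1 e0 e1; lra.
have := I c (n - r)%N n (r - k)%N mc.
have -> : (n - r + (r - k) = n - k)%N by clear -kr rn; lia.
apply; split; last first.
  apply: le_trans bu; rewrite ler_nat -/(bw n) /r mulSn leq_subLR [(k + _)%N]addnC leq_add2l.
  exact: leq_trunc_div.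
split.
- by clear -r2; lia.
- by clear; lia.
- by clear -n0 rn kr; lia.
- by clear -n0 r2 kr; lia.
- rewrite natrB // addrAC subrr add0r normrN ger0_norm //.
  by apply: le_trans rR _; rewrite ler_peMl ?pw_ge0 //; clear -al0 al1 e0 e1; lra.
Unshelve. all: by end_near. Qed.

Lemma psi_total n y : (2 <= n)%N -> good_theta n y ->
  (n + n).+2%:R * psi y <= 6 * kap * ln n%:R /\ (n + n).+2%:R * psi (2 * y) <= 60 * kap * ln n%:R.
Proof.
move=> n2 [[y0 ys py p2 _] _]; have nR : 0 < n%:R :> R by rewrite ltr0n; exact: leq_trans n2.
have L0 := ln_nat_ge0 R n; have k0 := kap_gt0.
have h3 : (n + n).+2%:R <= 3 * n%:R :> R by rewrite -natrM ler_nat; clear -n2; lia.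
have v0 : 0 <= psi y.
  by rewrite py; apply: divr_ge0 => //; apply: mulr_ge0 => //; apply: mulr_ge0 => //; exact: ltW.
have h1 : (n + n).+2%:R * psi y <= 6 * kap * ln n%:R.
  apply: le_trans (ler_wpM2r v0 h3) _; rewrite py mulrA mulrAC mulrA mulfK ?gt_eqF //.
  by rewrite le_eqVlt; apply/orP; left; apply/eqP; ring.
split=> //; have := ler_wpM2l (ler0n R (n + n).+2) p2; move: h1; clear -al0 al1 e0 e1; lra.
Qed.

(** A rare event against a large exponential: Cauchy-Schwarz, in the linearised form a B <= (la a^2
    + B / la) / 2 for an indicator B, costs only the ratio n^(60 kap) of second to squared first
    exponential bounds. *)
Lemma badV_le : \forall n \near \oo, forall c k y, massive c (4 * n) -> good_theta n y ->
  (k < nb n * bw n)%N -> (k <= n)%N ->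
  Qn c n.+1 n.+1 (fun w => expR (2 * y * (V n k w)%:R) * badV n k w) <=
  expR (((n - k).+1 + n.+1)%:R * Dl y) * pw n (- 3).
Proof.
have s0 := sgm_gt0 al0 al1; have k0 := kap_gt0.
near=> n => c k y mc gt kK kn; have n0 : (0 < n)%N by near: n; exists 1%N.
have n2 : (2 <= n)%N by near: n; exists 2%N.
have c0 : (0 < c)%N by case: mc.
have [_ ps2] := psi_total n2 gt; case: gt => -[y0 ys py pd _] y2.
have hy2 : `|2 * y| <= sgm by rewrite ger0_norm; move: y0 ys (s0); clear -al0 al1 e0 e1; lra.
set m := ((n - k).+1 + n.+1)%N.
have vm := @V_mgf c n k (2 * y) mc n0 kn (_ : 0 <= 2 * y) hy2.
have {vm} vm := vm ltac:(move: y0; clear -al0 al1 e0 e1; lra); rewrite -/m in vm.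
have bp : Qn c n.+1 n.+1 (badV n k) <= pw n (- 8).
  by move: c k mc kK {kn c0 m vm}; near: n; exact: badV_prob.
set Z := expR (m%:R * Dl y); have Z0 : 0 < Z by exact: expR_gt0.
have Dd : expR (m%:R * Dl (2 * y)) <= Z ^+ 2 * pw n (60 * kap).
  rewrite /Z -expRM_natl /pw -expRD ler_expR !DlE.
  have mle : m%:R <= (n + n).+2%:R :> R by rewrite ler_nat /m; clear -kn; lia.
  have psy : 0 <= psi y.
    rewrite py; apply: divr_ge0 => //; apply: mulr_ge0; last exact: ln_nat_ge0.
    by apply: mulr_ge0 => //; exact: ltW.
  have ps2y : 0 <= psi (2 * y).
    have y20 : 0 <= 2 * y by rewrite mulr_ge0 // ltW.
    have [y2s _] := norm_le_l hy2; apply: le_trans (psi_ge al0 al1 y20 y2s).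
    by apply: mulr_ge0; [exact: ltW (c3_gt0 al0 al1)|exact: exprn_ge0].
  have u1 := ler_wpM2r ps2y mle.
  have u2 : 0 <= m%:R * psi y by rewrite mulr_ge0.
  by move: ps2 u1 u2; clear -al0 al1 e0 e1; lra.
(* Balances a second moment of order [Z ^+ 2], up to n^(60 kap), against the probability n^(-8). *)
set la := pw n (- 4) / Z.
have la0 : 0 < la by apply: divr_gt0 => //; exact: pw_gt0.
apply: (@le_trans _ _ (Qn c n.+1 n.+1 (fun w => 2^-1 * la * expR (2 * (2 * y) * (V n k w)%:R) + 2^-1 * la^-1 * badV n k w))).
  apply: le_Qn => // w; rewrite /badV; case: (mm * _ + Xe n <= _); last first.
    rewrite !mulr0 addr0; apply: mulr_ge0; last exact: expR_ge0.
    by apply: mulr_ge0 => //; exact: ltW.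
  rewrite !mulr1; set a := expR (2 * y * _).
  have -> : expR (2 * (2 * y) * (V n k w)%:R) = a ^+ 2.
    by rewrite /a -expRM_natl; congr expR; ring.
  have := sqr_ge0 (la * a - 1); have lan : la != 0 by rewrite gt_eqF.
  move=> h; rewrite -(ler_pM2l la0) mulrDr.
  have -> : la * (2^-1 * la^-1) = 2^-1 by field.
  by move: h; clear -al0 al1 e0 e1; lra.
rewrite /Qn QD !QZ.
have w1 := ler_wpM2l (_ : 0 <= 2^-1 * la) (le_trans vm (ler_wpM2l _ Dd)).
have {w1} w1 := w1 ltac:(by rewrite mulr_ge0 // ltW) ltac:(by []).
have w2 := ler_wpM2l (_ : 0 <= 2^-1 * la^-1) bp.
have {w2} w2 := w2 ltac:(by rewrite mulr_ge0 // invr_ge0 ltW).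
apply: le_trans (lerD w1 w2) _.
have Zn : Z != 0 by rewrite gt_eqF.
have -> : 2^-1 * la * (2 * (Z ^+ 2 * pw n (60 * kap))) = Z * (pw n (- 4) * pw n (60 * kap)).
  by rewrite /la; field.
have -> : 2^-1 * la^-1 * pw n (- 8) = Z * (2^-1 * (pw n 4 * pw n (- 8))).
  by rewrite /la invfM invrK -pwN opprK; ring.
rewrite -mulrDr ler_wpM2l ?(ltW Z0) // -!pwD.
have v1 : pw n (- 4 + 60 * kap) <= 2^-1 * pw n (- 3) :> R.
  rewrite -[X in X <= _]mul1r; near: n; apply: ev_pw2 => //.
  by rewrite /kap; move: (e0) (e1); clear -al0 al1 e0 e1; lra.
have v2 : pw n (4 + - 8) <= pw n (- 3) :> R by apply: le_pw; clear -al0 al1 e0 e1; lra.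
by move: v1 v2; clear -al0 al1 e0 e1; lra.
Unshelve. all: by end_near. Qed.

Definition rowE c n y := ELn c (par (- y)) n.+1 (fun S => Qn c n.+1 n.+1 (fun w =>
  expR (2 * y * (lp (consrow S w) n n.+1)%:R))).

(** The two axes have the same law, so by transposition the row half carries half of the moment from
    [weak_mgf]. *)
Lemma rowE_ge n y : 0 <= y -> `|y| <= sgm -> exists C, forall c, (C <= c)%N ->
  4^-1 * expR ((n + n).+2%:R * Dl y) <= rowE c n y.
Proof.
move=> y0 hy; have [C hC] := weak_mgf n.+1 hy; exists C => c /hC[c0 h].
have [y1 y2] := norm_le_l hy.
have t0 : 0 <= 2 * y by rewrite mulr_ge0.
pose F S w := expR (2 * y * (lp (consrow S w) n n.+1)%:R).
pose F' J w := expR (2 * y * (lp (conscol J w) n.+1 n)%:R).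
have B : Bn c (par (- y)) (par (- y)) n.+1 n.+1 (fun S J w => eG (2 * y) S J w n.+1 n.+1) <=
  Bn c (par (- y)) (par (- y)) n.+1 n.+1 (fun S J w => F S w + F' J w).
  apply: le_Bn => // S J w _ _; rewrite /eG /F /F' G_split /maxn; case: ifP => _.
    by rewrite lerDr expR_ge0.
  by rewrite lerDl expR_ge0.
have col : ELn c (par (- y)) n.+1 (fun J => Qn c n.+1 n.+1 (F' J)) = rowE c n y.
  apply: eq_EL' => J; rewrite -(@Qn_tr R al al0 al1 c n.+1 n.+1 (F' J)) //.
    apply: eq_Q => w; rewrite /F'.
    have -> : lp (conscol J (fun i j => w j i)) n.+1 n = lp (consrow J w) n n.+1; last by [].
    by rewrite -lp_tr; apply: lp_ext => a [|i] _ _.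
  move=> w w' ww; rewrite /F'.
  have -> // : lp (conscol J w) n.+1 n = lp (conscol J w') n.+1 n.
  by apply: conscol_nth => // i j iM jN; apply: ww.
have rw : Bn c (par (- y)) (par (- y)) n.+1 n.+1 (fun S J w => F S w) = rowE c n y by exact: Bn_row.
have cl : Bn c (par (- y)) (par (- y)) n.+1 n.+1 (fun S J w => F' J w) = rowE c n y.
  by rewrite -col; exact: Bn_col.
have := le_trans h B; rewrite BnD rw cl addSn addnS; clear -al0 al1 e0 e1; lra.
Qed.

Lemma rowE_le c n y : (0 < bw n)%N -> 0 <= y -> `|y| <= sgm ->
  rowE c n y <=
  \sum_(k < n.+1 | (nb n * bw n <= k)%N) ELn c (par (- y)) n.+1 (fun S => Qn c n.+1 n.+1 (fun w =>
    expR (2 * y * (Sk k S + V n k w)%:R))) +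
  (\sum_(i < nb n) expR (2 * y * (mm * (bw n)%:R + 2 * Xe n)) *
     (ELn c (par (- y)) n.+1 (fun S => expR (2 * y * (Sk (i * bw n) S)%:R)) *
      Qn c n.+1 n.+1 (fun w => expR (2 * y * (V n (i.+1 * bw n) w)%:R))) +
  \sum_(k < n.+1 | (k < nb n * bw n)%N)
    (ELn c (par (- y)) n.+1 (fun S => expR (2 * y * (Sk k S)%:R) * badS n k S) *
      Qn c n.+1 n.+1 (fun w => expR (2 * y * (V n k w)%:R)) +
     ELn c (par (- y)) n.+1 (fun S => expR (2 * y * (Sk k S)%:R)) *
      Qn c n.+1 n.+1 (fun w => expR (2 * y * (V n k w)%:R) * badV n k w))).
Proof.
move=> b0 y0 hy; have [y1 y2] := norm_le_l hy.
have t0 : 0 <= 2 * y by rewrite mulr_ge0.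
apply: le_trans (le_ELQ al0 al1 c n.+1 n.+1 y2 (fun S w => row_dom S w b0 t0)) _.
rewrite (ELQD al c (- y) n.+1 n.+1 (fun S w => \sum_(k < n.+1 | (nb n * bw n <= k)%N) expR (2 * y * (Sk k S + V n k w)%:R))
  (fun S w => \sum_(i < nb n) expR (2 * y * (mm * (bw n)%:R + 2 * Xe n)) *
      (expR (2 * y * (Sk (i * bw n) S)%:R) * expR (2 * y * (V n (i.+1 * bw n) w)%:R)) +
  \sum_(k < n.+1 | (k < nb n * bw n)%N)
      (expR (2 * y * (Sk k S)%:R) * badS n k S * expR (2 * y * (V n k w)%:R) +
       expR (2 * y * (Sk k S)%:R) * (expR (2 * y * (V n k w)%:R) * badV n k w)))).
rewrite (ELQD al c (- y) n.+1 n.+1 (fun S w => \sum_(i < nb n) expR (2 * y * (mm * (bw n)%:R + 2 * Xe n)) *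
      (expR (2 * y * (Sk (i * bw n) S)%:R) * expR (2 * y * (V n (i.+1 * bw n) w)%:R)))
  (fun S w => \sum_(k < n.+1 | (k < nb n * bw n)%N)
      (expR (2 * y * (Sk k S)%:R) * badS n k S * expR (2 * y * (V n k w)%:R) +
       expR (2 * y * (Sk k S)%:R) * (expR (2 * y * (V n k w)%:R) * badV n k w)))).
rewrite !ELQ_sum lerD2l; apply: lerD; apply: ler_sum => k _.
  rewrite (ELQZ al c (- y) n.+1 n.+1 _ (fun S w =>
    expR (2 * y * (Sk (k * bw n) S)%:R) * expR (2 * y * (V n (k.+1 * bw n) w)%:R))).
  by rewrite row_bulk.
rewrite (ELQD al c (- y) n.+1 n.+1
  (fun S w => expR (2 * y * (Sk k S)%:R) * badS n k S * expR (2 * y * (V n k w)%:R))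
  (fun S w => expR (2 * y * (Sk k S)%:R) * (expR (2 * y * (V n k w)%:R) * badV n k w))).
by rewrite (row_bulk al c _ n.+1 n.+1 (fun S => expR (2 * y * (Sk k S)%:R) * badS n k S)
  (fun w => expR (2 * y * (V n k w)%:R))) (row_bulk al c _ n.+1 n.+1 (fun S => expR (2 * y * (Sk k S)%:R))
  (fun w => expR (2 * y * (V n k w)%:R) * badV n k w)).
Qed.

(** Long exits and bad columns each amount to at most 1/16 of the main exponential, so ordinary
    columns keep 1/8 of the initial 1/4. The factor 32 collects the 2 of [S_mgf] and the 16 of the
    block correction. *)
Lemma block_sum : \forall n \near \oo, forall c y, massive c (4 * n) -> good_theta n y ->
  4^-1 * expR ((n + n).+2%:R * Dl y) <= rowE c n y ->
  8^-1 * expR ((n + n).+2%:R * Dl y) <=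
  \sum_(i < nb n) 32 * expR ((i.+1 * bw n).+1%:R * Dl y) *
     Qn c n.+1 n.+1 (fun w => expR (2 * y * (V n (i.+1 * bw n) w)%:R)).
Proof.
have s0 := sgm_gt0 al0 al1; have k0 := kap_gt0; have m0 := mm_gt0 al0 al1.
have c10 := cc1_gt0 al0 al1.
near=> n => c y mc gt lo; have c0 : (0 < c)%N by case: mc.
have n0 : (0 < n)%N by near: n; exists 1%N.
have n2 : (2 <= n)%N by near: n; exists 2%N.
have [gt1 gt2] := gt; case: gt1 => y0 ys py pd yl.
have yp : 0 <= y by exact: ltW.
have y4 : y <= sgm / 4 by move: y0 ys; clear -al0 al1 e0 e1; lra.
have hy : `|y| <= sgm by rewrite ger0_norm //; move: y4 (s0); clear -al0 al1 e0 e1; lra.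
have b1 : 1 <= pw n bexp by rewrite pw_ge1 // /bexp; move: (e0) (e1); clear -al0 al1 e0 e1; lra.
have /andP[bl bu] := truncn_bounds b1.
have b0 : (0 < bw n)%N by rewrite truncn_gt0.
have m1 : 1 <= pw n (8 * e) by rewrite pw_ge1 //; move: (e0); clear -al0 al1 e0 e1; lra.
have /andP[ml mu] := truncn_bounds m1.
have psy : 0 <= psi y.
  by rewrite py; apply: divr_ge0 => //; apply: mulr_ge0; [apply: mulr_ge0 => //; exact: ltW|exact: ln_nat_ge0].
have Dm : 2 * mm * y <= Dl y by rewrite DlE lerDl.
have my : 0 <= 2 * mm * y by pos.
have D0 : 0 <= Dl y by exact: le_trans Dm.
have ps1 : psi y <= 2^-1.
  have [h _] := psi_total n2 gt.
  have h6 : 6 * kap * ln n%:R <= pw n 2^-1 by near: n; apply: ev_ln_pw; clear -al0 al1 e0 e1; lra.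
  have h7 : 2 * pw n 2^-1 <= pw n 1 :> R by near: n; apply: ev_pw; clear -al0 al1 e0 e1; lra.
  rewrite pw1 // in h7.
  have h8 : n%:R * psi y <= (n + n).+2%:R * psi y by rewrite ler_wpM2r // ler_nat; clear; lia.
  have nR : 0 < n%:R :> R by rewrite ltr0n.
  rewrite -(ler_pM2l nR); move: h h6 h7 h8; clear -al0 al1 e0 e1; lra.
have D1 : Dl y <= 1.
  have h9 : 2 * mm * pw n (- 3^-1 + e) <= 1 * pw n 0.
    by near: n; apply: ev_pw2 => //; move: (e1); clear -al0 al1 e0 e1; lra.
  rewrite pw0 mul1r in h9; rewrite DlE.
  have := ler_wpM2l (ltW m0) gt2; move: h9 ps1; clear -al0 al1 e0 e1; lra.
have eD : expR (Dl y) <= 4 by apply: le_trans expR1_le4; rewrite ler_expR.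
set Z := expR ((n + n).+2%:R * Dl y) in lo *.
have Z0 : 0 < Z by exact: expR_gt0.
have up := le_trans lo (rowE_le c b0 yp hy).
have cut : \sum_(k < n.+1 | (nb n * bw n <= k)%N) ELn c (par (- y)) n.+1 (fun S => Qn c n.+1 n.+1 (fun w =>
    expR (2 * y * (Sk k S + V n k w)%:R))) <= 16^-1 * Z.
  have X : forall c k (y t : R),
    massive c (4 * n) -> `|y| <= pw n (- 3^-1 + e) -> 0 <= t -> t <= pw n (- 3^-1 + e) ->
    4^-1 * pw n (2 / 3 + 2 * e) <= k%:R -> (k <= n)%N ->
    ELn c (par y) n.+1 (fun S => Qn c n.+1 n.+1 (fun w =>
      expR (t * (sumn (take k.+1 S) + lp (sh k 0 w) (n - k) n)%:R))) <=
    4 * expR (t * (2 * mm * n%:R - cc1 al / 64 * pw n (3^-1 + 4 * e))).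
    by near: n; apply: exit_cut => //; exact: e_small.
  have yn : `|- y| <= pw n (- 3^-1 + e).
    by rewrite normrN ger0_norm //; apply: le_trans gt2; move: y0; clear -al0 al1 e0 e1; lra.
  have K0 : 4^-1 * pw n (2 / 3 + 2 * e) <= (nb n * bw n)%:R.
    rewrite natrM (_ : 2 / 3 + 2 * e = 8 * e + bexp); last by rewrite /bexp; ring.
    rewrite (pwD n (8 * e) bexp).
    have := ler_pM (_ : 0 <= pw n (8 * e) / 2) (_ : 0 <= pw n bexp / 2) ml bl.
    by rewrite !divr_ge0 ?pw_ge0 // => /(_ isT isT); rewrite /nb /bw; clear -al0 al1 e0 e1; lra.
  have one : 4 * expR (2 * y * (2 * mm * n%:R - cc1 al / 64 * pw n (3^-1 + 4 * e))) <= Z * pw n (- 3).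
    rewrite mulrBr expRD mulrCA.
    apply: ler_pM; rewrite ?expR_ge0 // ?mulr_ge0 ?expR_ge0 //.
      rewrite ler_expR; apply: (@le_trans _ _ ((n + n).+2%:R * (2 * mm * y))); last by rewrite ler_wpM2l.
      move: my; rewrite -addn2 !natrD; clear -al0 al1 e0 e1; lra.
    apply: (@le_trans _ _ (4 * pw n (- 4))); last by near: n; apply: ev_pw; clear -al0 al1 e0 e1; lra.
    rewrite ler_wpM2l //.
    apply: (@le_trans _ _ (expR (- (cc1 al / 64 * pw n (4 * e))))); last first.
      near: n; apply: ev_expN; first by move: (e0); clear -al0 al1 e0 e1; lra.
      by rewrite divr_gt0.
    rewrite ler_expR lerN2 mulrCA; apply: ler_wpM2l; first by apply: divr_ge0 => //; exact: ltW.
    have -> : pw n (4 * e) = pw n (- 3^-1) * pw n (3^-1 + 4 * e) by rewrite -pwD; congr pw; ring.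
    by apply: ler_wpM2r => //; exact: pw_ge0.
  apply: (@le_trans _ _ (\sum_(k < n.+1) Z * pw n (- 3))).
    rewrite big_mkcond /=; apply: ler_sum => k _; case: ifP => kK; last by apply: mulr_ge0; [exact: ltW|exact: pw_ge0].
    apply: le_trans one; apply: X => //.
    - by rewrite mulr_ge0.
    - by apply: le_trans K0 _; rewrite ler_nat.
    - by rewrite -ltnS.
  rewrite sumr_const card_ord -[X in X <= _]mulr_natl mulrCA mulrC ler_wpM2r ?(ltW Z0) //.
  apply: (@le_trans _ _ (2 * pw n 1 * pw n (- 3))).
    by rewrite ler_wpM2r ?pw_ge0 // pw1 // -natrM ler_nat; clear -n0; lia.
  rewrite -mulrA -pwD; apply: (@le_trans _ _ (16^-1 * pw n 0)); last by rewrite pw0 mulr1.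
  by near: n; apply: ev_pw2 => //; clear -al0 al1 e0 e1; lra.
have bad : \sum_(k < n.+1 | (k < nb n * bw n)%N)
    (ELn c (par (- y)) n.+1 (fun S => expR (2 * y * (Sk k S)%:R) * badS n k S) *
      Qn c n.+1 n.+1 (fun w => expR (2 * y * (V n k w)%:R)) +
     ELn c (par (- y)) n.+1 (fun S => expR (2 * y * (Sk k S)%:R)) *
      Qn c n.+1 n.+1 (fun w => expR (2 * y * (V n k w)%:R) * badV n k w)) <= 16^-1 * Z.
  have bS : forall c k y, massive c (4 * n) -> good_theta n y -> (k <= n)%N ->
    ELn c (par (- y)) n.+1 (fun S => expR (2 * y * (Sk k S)%:R) * badS n k S) <=
    expR (k.+1%:R * Dl y) * pw n (- 3) by near: n; exact: badS_le.
  have bV : forall c k y, massive c (4 * n) -> good_theta n y ->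
    (k < nb n * bw n)%N -> (k <= n)%N ->
    Qn c n.+1 n.+1 (fun w => expR (2 * y * (V n k w)%:R) * badV n k w) <=
    expR (((n - k).+1 + n.+1)%:R * Dl y) * pw n (- 3) by near: n; exact: badV_le.
  apply: (@le_trans _ _ (\sum_(k < n.+1) 16 * Z * pw n (- 3))).
    rewrite big_mkcond /=; apply: ler_sum => k _.
    have kn : (k <= n)%N by rewrite -ltnS.
    have Zk : expR (k.+1%:R * Dl y) * expR (((n - k).+1 + n.+1)%:R * Dl y) <= 4 * Z.
      rewrite -expRD -mulrDl -natrD (_ : (k.+1 + ((n - k).+1 + n.+1) = (n + n).+2 + 1)%N); last by clear -kn; lia.
      by rewrite natrD mulrDl mul1r expRD mulrC ler_wpM2r ?(ltW Z0).
    case: ifP => kK; last by apply: mulr_ge0; [apply: mulr_ge0 => //; exact: ltW|exact: pw_ge0].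
    have p3 := pw_ge0 n (- 3 : R).
    have t1 := ler_pM _ _ (bS c k y mc gt kn) (@V_mgf c n k y mc n0 kn yp hy).
    have t2 := ler_pM _ _ (@S_mgf c n k y mc n0 kn hy) (bV c k y mc gt kK kn).
    have yns : - y <= sgm by case: (norm_le_l hy).
    have nn F : (forall S, 0 <= F S) -> 0 <= ELn c (par (- y)) n.+1 F.
      move=> F0; apply: EL_nseq_ge0 => // j; apply: gam_ge0; first exact: ltW (par_gt0 _ _).
      exact: ltW (par_lt1 al0 al1 yns).
    have t1' := t1 (nn _ (fun S => mulr_ge0 (expR_ge0 _) (ler0n _ _))) (Qn_ge0 al0 al1 c n.+1 n.+1 (fun w => expR_ge0 _)).
    have t2' := t2 (nn _ (fun S => expR_ge0 _)) (Qn_ge0 al0 al1 c n.+1 n.+1 (fun w => mulr_ge0 (expR_ge0 _) (ler0n _ _))).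
    apply: le_trans (lerD t1' t2') _.
    have := ler_wpM2r p3 Zk; clear -al0 al1 e0 e1; lra.
  rewrite sumr_const card_ord -[X in X <= _]mulr_natl.
  apply: (@le_trans _ _ (2 * pw n 1 * (16 * Z * pw n (- 3)))).
    apply: ler_wpM2r; first by apply: mulr_ge0; [apply: mulr_ge0 => //; exact: ltW|exact: pw_ge0].
    by rewrite pw1 // -natrM ler_nat; clear -n0; lia.
  have -> : 2 * pw n 1 * (16 * Z * pw n (- 3)) = 32 * (pw n 1 * pw n (- 3)) * Z by ring.
  rewrite ler_wpM2r ?(ltW Z0) // -pwD; apply: (@le_trans _ _ (16^-1 * pw n 0)); last by rewrite pw0 mulr1.
  by near: n; apply: ev_pw2 => //; clear -al0 al1 e0 e1; lra.
set U := \sum_(i < nb n) _ in up.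
have UZ : 8^-1 * Z <= U by move: up cut bad; clear -al0 al1 e0 e1; lra.
apply: le_trans UZ _; apply: ler_sum => i _.
have rK : (i.+1 * bw n <= nb n * bw n)%N by rewrite leq_mul.
have K2 : (nb n * bw n <= n)%N.
  rewrite -(ler_nat R) natrM; apply: (@le_trans _ _ (pw n (8 * e) * pw n bexp)); first exact: ler_pM.
  by rewrite -pwD -(pw1 R n0); apply: le_pw; rewrite /bexp; move: (e1); clear -al0 al1 e0 e1; lra.
have rn : (i.+1 * bw n <= n)%N by exact: leq_trans K2.
have ln' : (i * bw n <= n)%N by apply: leq_trans rn; rewrite leq_mul.
rewrite mulrA ler_wpM2r //; first by apply: Qn_ge0 => // w; exact: expR_ge0.
apply: le_trans (ler_wpM2l (expR_ge0 _) (@S_mgf c n (i * bw n) y mc n0 ln' hy)) _.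
(* [xexp] is chosen for this: y times n^(1/3 - e) stays bounded because [2 * y] is at most n^(-1/3 +
   e). *)
have x3 : expR (4 * y * Xe n) <= 16.
  have x2 : 4 * y * Xe n <= 1 + 1.
    have h : pw n (- 3^-1 + e) * Xe n = 1.
      by rewrite /Xe -pwD (_ : _ + xexp = 0) ?pw0 // /xexp; ring.
    have := ler_wpM2r (pw_ge0 n xexp) gt2; rewrite -/(Xe n) h; clear -al0 al1 e0 e1; lra.
  apply: le_trans (_ : expR (1 + 1) <= _); first by rewrite ler_expR.
  rewrite expRD; have := ler_pM (expR_ge0 _) (expR_ge0 _) expR1_le4 expR1_le4.
  by move/le_trans; apply; clear -al0 al1 e0 e1; lra.
have -> : 2 * y * (mm * (bw n)%:R + 2 * Xe n) = (bw n)%:R * (2 * mm * y) + 4 * y * Xe n by ring.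
have Bd : expR ((bw n)%:R * (2 * mm * y)) <= expR ((bw n)%:R * Dl y) by rewrite ler_expR ler_wpM2l.
have -> : (i.+1 * bw n).+1 = (bw n + (i * bw n).+1)%N by rewrite mulSn addnS.
rewrite [(bw n + _)%:R]natrD (mulrDl (bw n)%:R) (expRD ((bw n)%:R * Dl y)) (expRD ((bw n)%:R * (2 * mm * y))).
have := ler_pM (expR_ge0 _) (expR_ge0 _) Bd x3.
move/(ler_wpM2r (expR_ge0 ((i * bw n).+1%:R * Dl y))); clear -al0 al1 e0 e1; lra.
Unshelve. all: by end_near. Qed.

(** Pigeonhole over the [nb n] blocks selects a starting column [r], and a Paley-Zygmund argument
    applies to [Zf]: its first moment is at least n^kap, its second at most n^(61 kap), and it is
    below n^(kap / 2) off the event. *)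
Lemma upper_block (K : R) : 0 < K -> \forall n \near \oo, exists C, forall c, (C <= c)%N ->
  massive c (4 * n) -> exists r, [/\ r%:R <= pw n (2 / 3 + 2 * e), (2 * r <= n)%N &
  pw n (- (60 * kap)) <= Qn c (n - r).+1 n.+1 (fun w =>
    (mm * (n + n + 1 - r)%:R + K * pw n 3^-1 <= (lp w (n - r) n)%:R)%R%:R)].
Proof.
move=> K0; have s0 := sgm_gt0 al0 al1; have k0 := kap_gt0; have m0 := mm_gt0 al0 al1.
near=> n.
have n0 : (0 < n)%N by near: n; exists 1%N.
have n2 : (2 <= n)%N by near: n; exists 2%N.
have [y gt yK] : exists2 y, good_theta n y & 2 * y * (K * pw n 3^-1) <= 2^-1 * kap * ln n%:R.
  by near: n; exact: theta_ex.
have BS : forall c y, massive c (4 * n) -> good_theta n y ->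
  4^-1 * expR ((n + n).+2%:R * Dl y) <= rowE c n y ->
  8^-1 * expR ((n + n).+2%:R * Dl y) <=
  \sum_(i < nb n) 32 * expR ((i.+1 * bw n).+1%:R * Dl y) *
     Qn c n.+1 n.+1 (fun w => expR (2 * y * (V n (i.+1 * bw n) w)%:R)).
  by near: n; exact: block_sum.
have [_ ps2] := psi_total n2 gt.
have [gt1 gt2] := gt; case: gt1 => y0 ys py pd yl.
have yp : 0 <= y by exact: ltW.
have y4 : y <= sgm / 4 by move: y0 ys; clear -al0 al1 e0 e1; lra.
have hy : `|y| <= sgm by rewrite ger0_norm //; move: y4 (s0); clear -al0 al1 e0 e1; lra.
have hy2 : `|2 * y| <= sgm by rewrite ger0_norm; move: y0 ys (s0); clear -al0 al1 e0 e1; lra.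
have [C hC] := rowE_ge n yp hy; exists C => c /hC lo mc; have c0 : (0 < c)%N by case: mc.
have {BS} BS := BS c y mc gt lo.
have b1 : 1 <= pw n bexp by rewrite pw_ge1 // /bexp; move: (e0) (e1); clear -al0 al1 e0 e1; lra.
have /andP[bl bu] := truncn_bounds b1.
have m1 : 1 <= pw n (8 * e) by rewrite pw_ge1 //; move: (e0); clear -al0 al1 e0 e1; lra.
have /andP[ml mu] := truncn_bounds m1.
have nb0 : (0 < nb n)%N by rewrite truncn_gt0.
have nbR : 0 < (nb n)%:R :> R by rewrite ltr0n.
set Z := expR ((n + n).+2%:R * Dl y) in BS.
have Z0 : 0 < Z by exact: expR_gt0.
have [i hi] : exists i : 'I_(nb n), Z <= 256 * (nb n)%:R * (expR ((i.+1 * bw n).+1%:R * Dl y) *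
     Qn c n.+1 n.+1 (fun w => expR (2 * y * (V n (i.+1 * bw n) w)%:R))).
  apply: contrapT => /forallNP h.
  suff : \sum_(i < nb n) 32 * expR ((i.+1 * bw n).+1%:R * Dl y) *
     Qn c n.+1 n.+1 (fun w => expR (2 * y * (V n (i.+1 * bw n) w)%:R)) < 8^-1 * Z by rewrite ltNge BS.
  have -> : 8^-1 * Z = \sum_(i < nb n) 8^-1 * Z / (nb n)%:R.
    by rewrite sumr_const card_ord -[RHS]mulr_natr divfK // gt_eqF.
  apply: ltr_sum; first by apply/hasP; exists (Ordinal nb0); rewrite ?mem_index_enum.
  move=> i _; rewrite ltr_pdivlMr //.
  have /negP := h i; rewrite -ltNge; clear -al0 al1 e0 e1; lra.
set r := (i.+1 * bw n)%N in hi.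
have rR : r%:R <= pw n (2 / 3 + 2 * e).
  rewrite (_ : 2 / 3 + 2 * e = 8 * e + bexp); last by rewrite /bexp; ring.
  rewrite (pwD n (8 * e) bexp) /r natrM; apply: ler_pM => //.
  by apply: le_trans mu; rewrite ler_nat.
have r2 : (2 * r <= n)%N.
  rewrite -(ler_nat R) natrM; apply: (@le_trans _ _ (2 * pw n (2 / 3 + 2 * e))); first by rewrite ler_wpM2l.
  by rewrite -(pw1 R n0); near: n; apply: ev_pw; move: (e0) (e1); clear -al0 al1 e0 e1; lra.
have rn : (r <= n)%N by clear -r2; lia.
exists r; split=> //.
set N := (n + n + 1 - r)%N.
pose A : R := mm * N%:R.
pose Zf w : R := expR (2 * y * ((lp w (n - r) n)%:R - A)).
have E1 : pw n kap <= Qn c (n - r).+1 n.+1 Zf.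
  have -> : Qn c (n - r).+1 n.+1 Zf = expR (- (2 * y * A)) * Qn c n.+1 n.+1 (fun w => expR (2 * y * (V n r w)%:R)).
    rewrite (@V_law R al al0 al1 c n n r (fun l => expR (2 * y * l%:R))) // /Qn -QZ; apply: eq_Q => w.
    by rewrite -expRD /Zf mulrBr addrC.
  have nE : (n + n).+2%:R * Dl y = N%:R * Dl y + r.+1%:R * Dl y.
    by rewrite -mulrDl -natrD; congr (_%:R * _); rewrite /N; clear -rn; lia.
  rewrite /Z nE expRD in hi.
  have e1p := expR_gt0 (r.+1%:R * Dl y).
  have h2 : expR (N%:R * Dl y) <= 256 * (nb n)%:R * Qn c n.+1 n.+1 (fun w => expR (2 * y * (V n r w)%:R)).
    by rewrite -(ler_pM2r e1p); apply: le_trans hi _; rewrite le_eqVlt; apply/orP; left; apply/eqP; ring.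
  have h3 : pw n (2 * kap) <= expR (N%:R * Dl y - 2 * y * A).
    rewrite /pw ler_expR.
    have -> : N%:R * Dl y - 2 * y * A = N%:R * psi y by rewrite /A DlE; ring.
    have psy : 0 <= psi y.
      by rewrite py; apply: divr_ge0 => //; apply: mulr_ge0; [apply: mulr_ge0 => //; exact: ltW|exact: ln_nat_ge0].
    apply: (@le_trans _ _ (n%:R * psi y)); last by rewrite ler_wpM2r // ler_nat /N; clear -rn; lia.
    by rewrite py [leRHS]mulrC divfK // gt_eqF // ltr0n.
  have h4 : 256 * (nb n)%:R * pw n kap <= pw n (2 * kap).
    apply: (@le_trans _ _ (256 * pw n (8 * e) * pw n kap)).
      by apply: ler_wpM2r; [exact: pw_ge0|apply: ler_wpM2l; [exact: ler0n|exact: mu]].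
    rewrite -mulrA -pwD; near: n; apply: ev_pw; rewrite /kap; move: (e0); clear -al0 al1 e0 e1; lra.
  have p256 : 0 < 256 * (nb n)%:R :> R by apply: mulr_gt0; [rewrite ltr0n|exact: nbR].
  rewrite -(ler_pM2l p256); apply: le_trans h4 _; apply: le_trans h3 _.
  rewrite expRD [leRHS]mulrCA [leLHS]mulrC; apply: ler_wpM2l => //; exact: expR_ge0.
have E2 : Qn c (n - r).+1 n.+1 (fun w => Zf w ^+ 2) <= pw n (61 * kap).
  have -> : Qn c (n - r).+1 n.+1 (fun w => Zf w ^+ 2) =
     expR (- (2 * (2 * y) * A)) * Qn c n.+1 n.+1 (fun w => expR (2 * (2 * y) * (V n r w)%:R)).
    rewrite (@V_law R al al0 al1 c n n r (fun l => expR (2 * (2 * y) * l%:R))) // /Qn -QZ; apply: eq_Q => w.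
    by rewrite -expRD /Zf -expRM_natl; congr expR; ring.
  have y20 : 0 <= 2 * y by rewrite mulr_ge0.
  apply: le_trans (ler_wpM2l (expR_ge0 _) (V_mgf mc n0 rn y20 hy2)) _.
  rewrite mulrCA -expRD.
  have -> : ((n - r).+1 + n.+1 = N + 1)%N by rewrite /N; clear -rn; lia.
  have -> : - (2 * (2 * y) * A) + (N + 1)%:R * Dl (2 * y) = 4 * mm * y + (N + 1)%:R * psi (2 * y).
    by rewrite natrD DlE /A; ring.
  have [y2s _] := norm_le_l hy2.
  have ps2y : 0 <= psi (2 * y).
    apply: le_trans (psi_ge al0 al1 y20 y2s).
    by apply: mulr_ge0; [exact: ltW (c3_gt0 al0 al1)|exact: exprn_ge0].
  have h5 : (N + 1)%:R * psi (2 * y) <= 60 * kap * ln n%:R.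
    by apply: le_trans ps2; rewrite ler_wpM2r // ler_nat /N; clear -rn; lia.
  have h9 : 2 * mm * pw n (- 3^-1 + e) <= 1 * pw n 0.
    by near: n; apply: ev_pw2 => //; move: (e1); clear -al0 al1 e0 e1; lra.
  rewrite pw0 mul1r in h9.
  have h6 : 4 * mm * y <= 1 by have := ler_wpM2l (ltW m0) gt2; move: h9; clear -al0 al1 e0 e1; lra.
  apply: (@le_trans _ _ (2 * (4 * pw n (60 * kap)))).
    rewrite ler_wpM2l // expRD; apply: ler_pM; rewrite ?expR_ge0 //.
      by apply: le_trans expR1_le4; rewrite ler_expR.
    by rewrite ler_expR.
  rewrite mulrA; near: n; apply: ev_pw; move: (k0); clear -al0 al1 e0 e1; lra.
pose B w : R := (mm * N%:R + K * pw n 3^-1 <= (lp w (n - r) n)%:R)%R%:R.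
rewrite -/(B).
set P := Qn c (n - r).+1 n.+1 _.
(* With this weight the second-moment term is at most a quarter of n^kap; the complement of the
   event takes half, so a quarter is left for the probability. *)
pose la := pw n (- (60 * kap)) / 2.
have la0 : 0 < la by apply: divr_gt0 => //; exact: pw_gt0.
have kh : 2 * pw n (kap / 2) <= pw n kap.
  by near: n; apply: ev_pw; move: (k0); clear -al0 al1 e0 e1; lra.
have E3 : Qn c (n - r).+1 n.+1 Zf <= 2^-1 * pw n kap + (2^-1 * la * Qn c (n - r).+1 n.+1 (fun w => Zf w ^+ 2) + 2^-1 * la^-1 * P).
  rewrite /P /Qn -!QZ -(@Qn_cst R al al0 al1 c (n - r).+1 n.+1 (2^-1 * pw n kap)) // /Qn -!QD.
  apply: le_Q => [k|w].
    by apply: gam_ge0; [exact: ltW (qq_gt0 al0)|exact: ltW (qq_lt1 al0 al1)].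
  rewrite -/(B w).
  have Zp : 0 <= Zf w by exact: expR_ge0.
  have lan : la != 0 by rewrite gt_eqF.
  have kp := pw_ge0 n kap.
  rewrite /B; case: (lerP (mm * N%:R + K * pw n 3^-1)) => hB; rewrite ?mulr1 ?mulr0 ?addr0.
    have h : Zf w <= 2^-1 * la * Zf w ^+ 2 + 2^-1 * la^-1.
      rewrite -(ler_pM2l la0) mulrDr.
      have -> : la * (2^-1 * la^-1) = 2^-1 by field.
      have := sqr_ge0 (la * Zf w - 1); clear -al0 al1 e0 e1; lra.
    by move: h kp; clear -al0 al1 e0 e1; lra.
  have h : Zf w <= pw n (kap / 2).
    rewrite /Zf /pw ler_expR; apply: (@le_trans _ _ (2 * y * (K * pw n 3^-1))).
      apply: ler_wpM2l; first by rewrite mulr_ge0.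
      by move: hB; rewrite /A; clear -al0 al1 e0 e1; lra.
    by apply: le_trans yK _; rewrite le_eqVlt; apply/orP; left; apply/eqP; field.
  have h' : 0 <= 2^-1 * la * Zf w ^+ 2 by pos.
  by move: h h' kh; clear -al0 al1 e0 e1; lra.
have laE : la * pw n (61 * kap) = 2^-1 * pw n kap.
  have -> : pw n kap = pw n (- (60 * kap)) * pw n (61 * kap) by rewrite -pwD; congr pw; ring.
  by rewrite /la; field.
have laV : 2^-1 * la^-1 = pw n (60 * kap).
  by rewrite /la invfM invrK -pwN opprK; field.
have h7 : 2^-1 * la * Qn c (n - r).+1 n.+1 (fun w => Zf w ^+ 2) <= 4^-1 * pw n kap.
  have h := ler_wpM2l (ltW la0) E2; rewrite laE in h; move: h; clear -al0 al1 e0 e1; lra.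
rewrite laV in E3.
have h8 : 4^-1 * pw n kap <= pw n (60 * kap) * P by move: E1 E3 h7; clear -al0 al1 e0 e1; lra.
have p60 : 0 < pw n (60 * kap) :> R by exact: pw_gt0.
rewrite -(ler_pM2l p60); apply: le_trans h8; rewrite -pwD subrr pw0.
have : 4 <= pw n kap by near: n; exact: ev_pw_ge.
clear -al0 al1 e0 e1; lra.
Unshelve. all: by end_near. Qed.

End Scale.
End UpperTail.

(** * Tails of the diagonal passage time *)

Section RowsAndLaws.
Variable R : realType.

Lemma Q_rows rng (m : nat -> R) M N1 N2 E1 E2 : boxed M N1 E1 ->
  Q rng m M (N1 + N2) (fun w => E1 w * E2 (sh 0 N1 w)) = Q rng m M N1 E1 * Q rng m M N2 E2.
Proof.
elim: N1 E1 => [|N1 IH] E1 bE.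
  rewrite add0n /= -QZ; apply: eq_Q => w; congr (_ * _); exact: bE.
rewrite addSn /= -ELZr; apply: eq_EL' => row.
exact: (IH (fun w => E1 (consrow row w)) (boxed_consrow _ bE)).
Qed.

Section Compare.
Variables (r1 r2 : seq nat) (m1 m2 : nat -> R) (d : R).
Hypotheses (m10 : forall k, 0 <= m1 k) (m20 : forall k, 0 <= m2 k) (d0 : 0 <= d)
  (s1 : \sum_(k <- r1) m1 k <= 1) (s2 : \sum_(k <- r2) m2 k <= 1)
  (cmp : forall g : nat -> R, (forall k, 0 <= g k <= 1) ->
    \sum_(k <- r1) m1 k * g k <= \sum_(k <- r2) m2 k * g k + d).

Lemma EL_01 r (m : nat -> R) n F : (forall k, 0 <= m k) -> \sum_(k <- r) m k <= 1 ->
  (forall l, 0 <= F l <= 1) -> 0 <= EL r (nseq n m) F <= 1.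
Proof.
move=> m0 s; elim: n F => [|n IH] F F01 /=; first exact: F01.
apply/andP; split.
  by apply: sumr_ge0 => k _; apply: mulr_ge0 => //; case/andP: (IH (fun l => F (k :: l)) (fun l => F01 _)).
apply: le_trans s; apply: ler_sum => k _; rewrite ler_piMr //.
by case/andP: (IH (fun l => F (k :: l)) (fun l => F01 _)).
Qed.

Lemma Q_01 r (m : nat -> R) M N E : (forall k, 0 <= m k) -> \sum_(k <- r) m k <= 1 ->
  (forall w, 0 <= E w <= 1) -> 0 <= Q r m M N E <= 1.
Proof.
move=> m0 s; elim: N E => [|N IH] E E01 /=; first exact: E01.
by apply: EL_01 => // l; apply: IH.
Qed.

Lemma EL_shift r (m : nat -> R) n F a : (forall k, 0 <= m k) -> \sum_(k <- r) m k <= 1 -> 0 <= a ->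
  EL r (nseq n m) (fun l => F l + a) <= EL r (nseq n m) F + a.
Proof.
move=> m0 s a0; rewrite ELD lerD2l.
have -> : EL r (nseq n m) (fun=> a) = a * EL r (nseq n m) (fun=> 1).
  by rewrite -ELZ; apply: eq_EL' => l; rewrite mulr1.
have h : 0 <= EL r (nseq n m) (fun=> 1) <= 1 by apply: EL_01 => // l; rewrite ler01 lexx.
by rewrite ler_piMr //; case/andP: h.
Qed.

Lemma EL_compare n F : (forall l, 0 <= F l <= 1) ->
  EL r1 (nseq n m1) F <= EL r2 (nseq n m2) F + n%:R * d.
Proof.
elim: n F => [|n IH] F F01 /=; first by rewrite mul0r addr0.
pose g k := EL r2 (nseq n m2) (fun l => F (k :: l)).
apply: (@le_trans _ _ (\sum_(k <- r1) (m1 k * g k + m1 k * (n%:R * d)))).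
  by apply: ler_sum => k _; rewrite -mulrDr ler_wpM2l //; apply: IH.
rewrite big_split /= -mulr_suml.
have nd : 0 <= n%:R * d by rewrite mulr_ge0.
have h1 : (\sum_(k <- r1) m1 k) * (n%:R * d) <= n%:R * d by rewrite ler_piMl.
have h2 := cmp (fun k => @EL_01 r2 m2 n (fun l => F (k :: l)) m20 s2 (fun l => F01 _)).
rewrite -natr1; move: h1 h2; rewrite -/g; lra.
Qed.

(** Replacing the law of one cell costs [d] for functionals with values in [0, 1], and there are
    [M * N] cells. *)
Lemma Q_compare M N E : (forall w, 0 <= E w <= 1) ->
  Q r1 m1 M N E <= Q r2 m2 M N E + (M * N)%:R * d.
Proof.
elim: N E => [|N IH] E E01 /=; first by rewrite muln0 mul0r addr0.
apply: (@le_trans _ _ (EL r1 (nseq M m1) (fun row => Q r2 m2 M N (fun w => E (consrow row w)) + (M * N)%:R * d))).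
  by apply: le_EL_nseq => // row _; apply: IH.
have nd : 0 <= (M * N)%:R * d by rewrite mulr_ge0.
apply: le_trans (EL_shift _ _ m10 s1 nd) _.
have := @EL_compare M (fun row => Q r2 m2 M N (fun w => E (consrow row w))) _.
move=> /(_ (fun row => Q_01 M N m20 s2 (fun w => E01 _))).
rewrite mulnS natrD; lra.
Qed.

End Compare.
End RowsAndLaws.

Section FiniteTails.
Variable R : realType.
Variable al : R.
Hypothesis al0 : 0 < al.
Hypothesis al1 : al < 1.
Local Notation phi := (phi al).
Local Notation sgm := (sgm al).
Local Notation CT := (CT al).
Local Notation mm := (mm al).
Local Notation psi := (psi al).
Local Notation par := (par al).
Local Notation qq := (qq al).
Local Notation Qn := (Qn al).
Local Notation massive := (massive al).

Lemma sum_geo c : \sum_(k <- iota 0 c) geo qq k = 1 - qq ^+ c.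
Proof.
have q1 := qq_lt1 al0 al1; rewrite -mulr_sumr geom_sum ?lt_eqF // mulrCA divff ?mulr1 //.
by rewrite subr_eq0 eq_sym lt_eqF.
Qed.

(** On the common range the law cut at [C] is pointwise the smaller one, and beyond [c] it has mass
    at most [qq ^+ c]. *)
Lemma gam_cut c C (g : nat -> R) : (0 < c)%N -> (c <= C)%N -> (forall k, 0 <= g k <= 1) ->
  \sum_(k <- iota 0 C) gam C qq k * g k <= \sum_(k <- iota 0 c) gam c qq k * g k + qq ^+ c.
Proof.
move=> c0 cC g01; have q0 := qq_gt0 al0; have q1 := qq_lt1 al0 al1.
have C0 := leq_trans c0 cC.
have qc0 : 0 <= qq ^+ c by rewrite exprn_ge0 // ltW.
have qC0 : 0 <= qq ^+ C by rewrite exprn_ge0 // ltW.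
have qc1 : qq ^+ c < 1 by rewrite exprn_ilt1 ?(ltW q0) // -lt0n.
have qC1 : qq ^+ C < 1 by rewrite exprn_ilt1 ?(ltW q0) // -lt0n.
have qcC : qq ^+ C <= qq ^+ c by apply: ler_wiXn2l; rewrite ?(ltW q0) ?(ltW q1).
have G0 k : 0 <= gam C qq k by apply: gam_ge0; rewrite ltW.
rewrite -(subnKC cC) iotaD big_cat /= subnKC //; apply: lerD.
  apply: ler_sum => k _; apply: ler_wpM2r; first by case/andP: (g01 k).
  rewrite /gam ler_wpM2r ?geo_ge0 ?(ltW q0) ?(ltW q1) // lef_pV2 ?posrE ?subr_gt0 //.
  by move: qcC; lra.
apply: (@le_trans _ _ (\sum_(k <- iota (0 + c) (C - c)) gam C qq k)).
  by apply: ler_sum => k _; rewrite ler_piMr //; case/andP: (g01 k).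
have m := gam_mass C0 (ltW q0) q1; rewrite -{1}(subnKC cC) iotaD big_cat /= in m.
have h : \sum_(k <- iota 0 c) gam C qq k = (1 - qq ^+ c) / (1 - qq ^+ C).
  by rewrite -mulr_sumr sum_geo mulrC.
rewrite h in m.
have -> : \sum_(k <- iota (0 + c) (C - c)) gam C qq k = 1 - (1 - qq ^+ c) / (1 - qq ^+ C).
  by apply/esym/eqP; rewrite subr_eq [X in _ == X]addrC m.
rewrite lerBlDr -lerBlDl ler_pdivlMr ?subr_gt0 //.
have : 0 <= qq ^+ C * (1 - qq ^+ c) by apply: mulr_ge0 => //; rewrite subr_ge0 ltW.
lra.
Qed.

(** Brings the unquantified level of [Bs_mgf_ge] down to a power of n. *)
Lemma Qn_cut c C M N E : (0 < c)%N -> (c <= C)%N -> (forall w, 0 <= E w <= 1) ->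
  Qn C M N E <= Qn c M N E + (M * N)%:R * qq ^+ c.
Proof.
move=> c0 cC E01; have q0 := qq_gt0 al0; have q1 := qq_lt1 al0 al1.
have C0 := leq_trans c0 cC.
apply: Q_compare => //.
- by move=> k; apply: gam_ge0; rewrite ltW.
- by move=> k; apply: gam_ge0; rewrite ltW.
- by rewrite exprn_ge0 // ltW.
- by rewrite gam_mass // ltW.
- by rewrite gam_mass // ltW.
- by move=> g g01; exact: gam_cut.
Qed.

(** [C0] absorbs the finitely many sides on which the asymptotic statement is silent; in
    [upper_tail] the side [r] comes from a pigeonhole and may be small. *)
Lemma left_tail_all : exists2 C0, 0 <= C0 & forall r c, massive c (4 * r) ->
  2^-1 <= Qn c r.+1 r.+1 (fun w => (2 * mm * r%:R - pw r (45 / 100) - C0 <= (lp w r r)%:R)%R%:R).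
Proof.
have [r0 _ H] := left_tail al0 al1; have m0 := mm_gt0 al0 al1.
exists (2 * mm * r0%:R); first by apply: mulr_ge0 => //; apply: mulr_ge0 => //; exact: ltW.
move=> r c mc; have c0 : (0 < c)%N by case: mc.
have one := @Qn_cst R al al0 al1 c r.+1 r.+1 1 c0.
have C00 : 0 <= 2 * mm * r0%:R by apply: mulr_ge0 => //; apply: mulr_ge0 => //; exact: ltW.
case: (leqP r0 r) => rr.
  have h := H r rr c mc.
  have : 1 <= Qn c r.+1 r.+1 (fun w => (2 * mm * r%:R - pw r (45 / 100) - 2 * mm * r0%:R <= (lp w r r)%:R)%R%:R +
     ((lp w r r)%:R <= 2 * mm * r%:R - pw r (45 / 100))%R%:R).
    rewrite -{1}one; apply: le_Qn => // w.
    case: (lerP (lp w r r)%:R (2 * mm * r%:R - pw r (45 / 100))) => h1 /=; first by rewrite lerDr.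
    rewrite addr0 (_ : (2 * mm * r%:R - pw r (45 / 100) - 2 * mm * r0%:R <= _) = true) //.
    by move: h1 C00; clear -al0 al1; lra.
  by rewrite /Qn QD; move: h; clear -al0 al1; rewrite /Qn; lra.
apply: (@le_trans _ _ 1); first by clear -al0 al1; lra.
rewrite -{1}one; apply: le_Qn => // w.
rewrite (_ : (2 * mm * r%:R - pw r (45 / 100) - 2 * mm * r0%:R <= _) = true) //; apply: le_trans (ler0n R _).
have : 2 * mm * r%:R <= 2 * mm * r0%:R.
  by apply: ler_wpM2l; [apply: mulr_ge0 => //; exact: ltW|rewrite ler_nat ltnW].
have := pw_ge0 r (45 / 100 : R); clear -al0 al1; lra.
Qed.

Definition Kup : R := 4 + 4 * mm + 4 * CT.

(** With the tilt h = n^(-1/3), split evenly around 0, h^3 n is bounded, so the centred exponential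
    moment is O(1) and [Kup] brings Chernoff's bound down to 2 e^(-3). *)
Lemma right_tail : \forall n \near \oo, forall c, massive c (4 * n) ->
  2^-1 <= Qn c n.+1 n.+1 (fun w => ((lp w n n)%:R <= 2 * mm * n%:R + Kup * pw n 3^-1)%R%:R).
Proof.
have s0 := sgm_gt0 al0 al1; have m0 := mm_gt0 al0 al1; have CT0 := CT_gt0 al1.
near=> n => c mc; have c0 : (0 < c)%N by case: mc.
have n0 : (0 < n)%N by near: n; exists 1%N.
have hs : pw n (- 3^-1) <= sgm by near: n; apply: ev_pw_le => //; clear -al0 al1; lra.
set h : R := pw n (- 3^-1) in hs; have h0 : 0 < h by exact: pw_gt0.
have h1 : h <= 1 by have := @le_pw R n (- 3^-1) 0; rewrite pw0; apply; clear -al0 al1; lra.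
have hy : `|h / 2| <= sgm by rewrite ger0_norm ?divr_ge0 ?ltW //; move: h0 hs; clear -al0 al1; lra.
have hyN : `|- (h / 2)| <= sgm by rewrite normrN.
have hh : - (h / 2) <= h / 2 by move: h0; clear -al0 al1; lra.
have n4 : (n < 4 * n)%N by clear -n0; lia.
have TM := @T_mgf R al al0 al1 c (4 * n) n n (- (h / 2)) (h / 2) hyN hy hh mc n4 n4.
rewrite Psi_sym (_ : h / 2 - - (h / 2) = h) in TM; last by field.
set a := 2 * mm * n%:R + Kup * pw n 3^-1.
have hX : h * pw n 3^-1 = 1 by rewrite /h -pwD addNr pw0.
have bad : Qn c n.+1 n.+1 (fun w => (a <= (lp w n n)%:R)%R%:R) <= 2^-1.
  apply: (@le_trans _ _ (expR (- (h * a)) * (2 * expR ((n.+1%:R + n.+1%:R) * Dl al (h / 2))))).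
    apply: le_trans (ler_wpM2l (expR_ge0 _) TM); rewrite /Qn -QZ.
    apply: le_Q => [k|w].
      by apply: gam_ge0; [exact: ltW (qq_gt0 al0)|exact: ltW (qq_lt1 al0 al1)].
    rewrite -expRD; apply: ind_expR => ha.
    by rewrite addrC -mulrBr mulr_ge0 ?(ltW h0) // subr_ge0.
  rewrite mulrCA -expRD.
  have pl : psi (h / 2) <= 4 * CT * (h / 2) ^+ 3.
    by apply: (psi_le al0 al1); [rewrite divr_ge0 // ltW|case: (norm_le_l hy)].
  have h3 : h ^+ 3 * n.+1%:R <= 2.
    have : n.+1%:R <= 2 * n%:R :> R by rewrite -natrM ler_nat; clear -n0; lia.
    move/(ler_wpM2l (exprn_ge0 3 (ltW h0)))/le_trans; apply.
    by rewrite /h mulrCA pwX -(pw1 R n0) -pwD (_ : _ + 1 = 0) ?pw0 ?mulr1 //; clear -al0 al1; lra.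
  have p2 : (n.+1%:R + n.+1%:R) * psi (h / 2) <= 2 * CT.
    have N0 : 0 <= n.+1%:R + n.+1%:R :> R by rewrite addr_ge0.
    apply: le_trans (ler_wpM2l N0 pl) _.
    have := ler_wpM2l (ltW CT0) h3.
    have -> : (n.+1%:R + n.+1%:R) * (4 * CT * (h / 2) ^+ 3) = CT * (h ^+ 3 * n.+1%:R) by field.
    clear -al0 al1; lra.
  have z : - (h * a) + (n.+1%:R + n.+1%:R) * Dl al (h / 2) <= - 3.
    rewrite DlE mulrDr /a mulrDr mulrCA [h * (Kup * _)]mulrCA hX mulr1 /Kup.
    have mh : mm * h <= mm by rewrite ler_piMr // ltW.
    move: p2 mh (m0) (CT0); rewrite -natr1; clear -al0 al1.
    set u := (_ + _) * psi _; lra.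
  apply: (@le_trans _ _ (2 * expR (- 3))); first by rewrite ler_wpM2l // ler_expR.
  have := expR_ge1Dx (3 : R); rewrite expRN => e3.
  rewrite -ler_pdivlMl // -invfM -[X in _ <= X]invrK lef_pV2 ?posrE ?expR_gt0 // ?invr_gt0 //.
  by move: e3; rewrite ?invrK; clear -al0 al1; lra.
have one := @Qn_cst R al al0 al1 c n.+1 n.+1 1 c0.
have : 1 <= Qn c n.+1 n.+1 (fun w => ((lp w n n)%:R <= a)%R%:R + (a <= (lp w n n)%:R)%R%:R).
  rewrite -{1}one; apply: le_Qn => // w.
  by case: (lerP (lp w n n)%:R a) => h2 /=; [rewrite lerDl|rewrite add0r (ltW h2)].
by rewrite /Qn QD; move: bad; rewrite /Qn; clear -al0 al1; lra.
Unshelve. all: by end_near. Qed.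

(** Extending a square by [j] columns at its end or at its start produces the same drift [mm * j],
    so sliding it sideways costs only fluctuations. One slide uses a rectangle with [j] more
    columns, the other one with [j] more rows, both based at the lower left square of [u w]. *)
Lemma shift_small (D : R) : \forall n \near \oo, forall c m j, massive c (4 * n) ->
  (j <= m)%N -> j%:R <= pw n (55 / 100) :> R ->
  Qn c (n + m).+1 (n + m).+1 (fun w =>
    (4 * pw n (29 / 100) < `|(lp (sh 0 m w) n n)%:R - (lp (sh j (m - j) w) n n)%:R| :> R)%R%:R)
  <= pw n (- D).
Proof.
pose e : R := 100^-1; pose b : R := 55 / 100; pose x : R := 29 / 100.
have e0 : 0 < e by rewrite /e; lra.
have e1 : e < 12^-1 by rewrite /e; lra.
have hb : b <= 2 / 3 + 2 * e by rewrite /b /e; lra.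
have hb1 : - 3^-1 + 3 * e + b < x by rewrite /b /e /x; lra.
have hb2 : e + b < 2 * x by rewrite /b /e /x; lra.
have ex : e < x by rewrite /e /x; lra.
near=> n => c m j mc jm jb; have c0 : (0 < c)%N by case: mc.
have n0 : (0 < n)%N by near: n; exists 1%N.
have jn : (j <= n)%N.
  rewrite -(ler_nat R); apply: le_trans jb _; rewrite -(pw1 R n0); apply: le_pw; lra.
have ok : okbox n n n j e b.
  split; last by []; split; try by clear -n0 jn; lia.
  by rewrite subrr normr0 mulr_ge0 ?pw_ge0.
have I1 : forall c M N j, massive c (4 * n) -> okbox n M N j e b ->
  Qn c (M + j).+1 N.+1 (fun w => (mm * j%:R + pw n x <= (lp w (M + j) N)%:R - (lp w M N)%:R)%R%:R)
  <= pw n (- (D + 1)) by near: n; exact: inc_h_up.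
have I2 : forall c M N j, massive c (4 * n) -> okbox n M N j e b ->
  Qn c (M + j).+1 N.+1 (fun w => ((lp w (M + j) N)%:R - (lp w M N)%:R <= mm * j%:R - pw n x)%R%:R)
  <= pw n (- (D + 1)) by near: n; exact: inc_h_lo.
have I3 : forall c M N j, massive c (4 * n) -> okbox n M N j e b ->
  Qn c M.+1 (N + j).+1 (fun w => (mm * j%:R + pw n x <= (lp w M (N + j))%:R - (lp w M N)%:R)%R%:R)
  <= pw n (- (D + 1)) by near: n; exact: inc_v_up.
have I4 : forall c M N j, massive c (4 * n) -> okbox n M N j e b ->
  Qn c M.+1 (N + j).+1 (fun w => ((lp w M (N + j))%:R - (lp w M N)%:R <= mm * j%:R - pw n x)%R%:R)
  <= pw n (- (D + 1)) by near: n; exact: inc_v_lo.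
have {}I1 := I1 c n n j mc ok; have {}I2 := I2 c n n j mc ok.
have {}I3 := I3 c n n j mc ok; have {}I4 := I4 c n n j mc ok.
pose bad (A B : nat) : R := (mm * j%:R + pw n x <= A%:R - B%:R)%R%:R + (A%:R - B%:R <= mm * j%:R - pw n x)%R%:R.
have Ih : Qn c (n + j).+1 n.+1 (fun w => bad (lp w (n + j) n) (lp w n n)) <= 2 * pw n (- (D + 1)).
  by rewrite /bad /Qn QD; move: I1 I2; rewrite /Qn; lra.
have Iv : Qn c n.+1 (n + j).+1 (fun w => bad (lp w n (n + j)) (lp w n n)) <= 2 * pw n (- (D + 1)).
  by rewrite /bad /Qn QD; move: I3 I4; rewrite /Qn; lra.
have bh : boxed (n + j).+1 n.+1 (fun w => bad (lp w (n + j) n) (lp w n n)).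
  move=> w w' ww; have /= e2 := boxed_lp (ltnSn (n + j)) (ltnSn n) ww.
  have /= e3 := @boxed_lp (n + j).+1 n.+1 n n (leq_addr _ _) (ltnSn n) _ _ ww.
  by rewrite e2 e3.
have bv : boxed n.+1 (n + j).+1 (fun w => bad (lp w n (n + j)) (lp w n n)).
  move=> w w' ww; have /= e2 := boxed_lp (ltnSn n) (ltnSn (n + j)) ww.
  have /= e3 := @boxed_lp n.+1 (n + j).+1 n n (ltnSn n) (leq_addr _ _) _ _ ww.
  by rewrite e2 e3.
have Rh : Qn c (n + j).+1 n.+1 (fun w => bad (lp w (n + j) n) (lp (sh j 0 w) n n)) <= 2 * pw n (- (D + 1)).
  apply: le_trans Ih; rewrite -(@Qn_rot R al al0 al1 c (n + j) n _ c0 bh).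
  rewrite le_eqVlt; apply/orP; left; apply/eqP; apply: eq_Q => w; rewrite lp_rot; congr bad.
  rewrite -[LHS]lp_rot; apply: lp_ext => a i an ib; rewrite shE; congr w; clear -ib an; lia.
have Rv : Qn c n.+1 (n + j).+1 (fun w => bad (lp w n (n + j)) (lp (sh 0 j w) n n)) <= 2 * pw n (- (D + 1)).
  apply: le_trans Iv; rewrite -(@Qn_rot R al al0 al1 c n (n + j) _ c0 bv).
  rewrite le_eqVlt; apply/orP; left; apply/eqP; apply: eq_Q => w; rewrite lp_rot; congr bad.
  rewrite -[LHS]lp_rot; apply: lp_ext => a i an ib; rewrite shE; congr w; clear -ib an; lia.
have bh' : boxed (n + j).+1 n.+1 (fun w => bad (lp w (n + j) n) (lp (sh j 0 w) n n)).
  move=> w w' ww; have /= e2 := boxed_lp (ltnSn (n + j)) (ltnSn n) ww.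
  have e3 : lp (sh j 0 w) n n = lp (sh j 0 w') n n.
    by apply: lp_ext => a i an ib; rewrite !shE; apply: ww; clear -an ib; lia.
  by rewrite e2 e3.
have bv' : boxed n.+1 (n + j).+1 (fun w => bad (lp w n (n + j)) (lp (sh 0 j w) n n)).
  move=> w w' ww; have /= e2 := boxed_lp (ltnSn n) (ltnSn (n + j)) ww.
  have e3 : lp (sh 0 j w) n n = lp (sh 0 j w') n n.
    by apply: lp_ext => a i an ib; rewrite !shE; apply: ww; clear -an ib; lia.
  by rewrite e2 e3.
pose u w := sh 0 (m - j) w.
have L1 : (0 + (n + j).+1 <= (n + m).+1)%N by clear -jm; lia.
have L2 : (m - j + n.+1 <= (n + m).+1)%N by clear -jm; lia.
have L3 : (0 + n.+1 <= (n + m).+1)%N by clear -jm; lia.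
have L4 : (m - j + (n + j).+1 <= (n + m).+1)%N by clear -jm; lia.
have A1 := @Qn_shift R al al0 al1 c (n + m).+1 (n + m).+1 (n + j).+1 n.+1 0 (m - j) _ c0 bh L1 L2.
have A2 := @Qn_shift R al al0 al1 c (n + m).+1 (n + m).+1 (n + j).+1 n.+1 0 (m - j) _ c0 bh' L1 L2.
have A3 := @Qn_shift R al al0 al1 c (n + m).+1 (n + m).+1 n.+1 (n + j).+1 0 (m - j) _ c0 bv L3 L4.
have A4 := @Qn_shift R al al0 al1 c (n + m).+1 (n + m).+1 n.+1 (n + j).+1 0 (m - j) _ c0 bv' L3 L4.
rewrite -A1 in Ih; rewrite -A2 in Rh; rewrite -A3 in Iv; rewrite -A4 in Rv.
apply: (@le_trans _ _ (8 * pw n (- (D + 1)))); last by near: n; apply: ev_pw; lra.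
apply: (@le_trans _ _ (Qn c (n + m).+1 (n + m).+1 (fun w =>
  (bad (lp (u w) (n + j) n) (lp (u w) n n) + bad (lp (u w) (n + j) n) (lp (sh j 0 (u w)) n n)) +
  (bad (lp (u w) n (n + j)) (lp (u w) n n) + bad (lp (u w) n (n + j)) (lp (sh 0 j (u w)) n n))))); last first.
  have H4 E1 E2 E3 E4 : Qn c (n + m).+1 (n + m).+1 E1 + Qn c (n + m).+1 (n + m).+1 E2 +
      (Qn c (n + m).+1 (n + m).+1 E3 + Qn c (n + m).+1 (n + m).+1 E4) =
    Qn c (n + m).+1 (n + m).+1 (fun w => E1 w + E2 w + (E3 w + E4 w)) by rewrite /Qn !QD.
  have S4 := lerD (lerD Ih Rh) (lerD Iv Rv); rewrite H4 in S4; apply: le_trans S4 _.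
  by clear -al0 al1; lra.
apply: le_Qn => // w.
have E0 : lp (sh 0 m w) n n = lp (sh 0 j (u w)) n n.
  by apply: lp_ext => a i _ _; rewrite /u !shE; congr w; clear -jm; lia.
have E1 : lp (sh j (m - j) w) n n = lp (sh j 0 (u w)) n n.
  by apply: lp_ext => a i _ _; rewrite /u !shE; congr w; clear -jm; lia.
rewrite E0 E1; move: (u w) => v.
have B0 A B : 0 <= bad A B by rewrite /bad addr_ge0.
have B1 A B : 1 <= bad A B \/ (A%:R - B%:R < mm * j%:R + pw n x /\ mm * j%:R - pw n x < A%:R - B%:R).
  rewrite /bad; case: (lerP (mm * j%:R + pw n x)) => p1 /=; first by left; rewrite lerDl.
  by case: lerP => p2 /=; [left; rewrite add0r|right].
set a1 := lp v (n + j) n; set a2 := lp v n n; set a3 := lp (sh j 0 v) n n.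
set a4 := lp v n (n + j); set a5 := lp (sh 0 j v) n n.
have P1 := B0 a1 a2; have P2 := B0 a1 a3; have P3 := B0 a4 a2; have P4 := B0 a4 a5.
case: (B1 a1 a2) => [h|[h1 h2]]; first by apply: le_trans (natb_le1 _ _) _; move: h P2 P3 P4; clear -al0 al1; lra.
case: (B1 a1 a3) => [h|[h3 h4]]; first by apply: le_trans (natb_le1 _ _) _; move: h P1 P3 P4; clear -al0 al1; lra.
case: (B1 a4 a2) => [h|[h5 h6]]; first by apply: le_trans (natb_le1 _ _) _; move: h P1 P2 P4; clear -al0 al1; lra.
case: (B1 a4 a5) => [h|[h7 h8]]; first by apply: le_trans (natb_le1 _ _) _; move: h P1 P2 P3; clear -al0 al1; lra.
rewrite (_ : (_ < _) = false); first by rewrite !addr_ge0.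
apply/negbTE; rewrite -leNgt ler_norml -/x; move: h1 h2 h3 h4 h5 h6 h7 h8; clear -al0 al1.
set y1 := a1%:R : R; set y2 := a2%:R : R; set y3 := a3%:R : R; set y4 := a4%:R : R; set y5 := a5%:R : R.
set z := mm * _; set t := pw n x.
by move=> *; apply/andP; split; lra.
Unshelve. all: by end_near. Qed.

(** Gluing: a favourable rectangle (n - r) by n, an independent transposed copy that returns to the
    diagonal, and an r by r square above its left tail. The pieces occupy disjoint rows, and the two
    vertical joints explain why the side is 2n + 2; 2n + 3 covers the other parity. *)
Lemma upper_tail (e K : R) : 0 < e -> 1000 * (100 * e) <= 1 -> 0 < K ->
  \forall n \near \oo, forall N c, (n + n + 2 <= N <= n + n + 3)%N -> pw n e <= c%:R ->
  pw n (- (121 * kap e)) <=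
  Qn c N.+1 N.+1 (fun w => (2 * mm * N%:R + K * pw n 3^-1 <= (lp w N N)%:R)%R%:R).
Proof.
move=> e0 e1 K0; have m0 := mm_gt0 al0 al1; have k0 := kap_gt0 e0.
have [C0 C00 LT] := left_tail_all.
have q0 := qq_gt0 al0; have q1 := qq_lt1 al0 al1.
have qrho : qq <= rho al by exact: qq_le.
near=> n => N c NN nc.
have n2 : (2 <= n)%N by near: n; exists 2%N.
have n0 : (0 < n)%N by clear -n2; lia.
have UB : exists C, forall c, (C <= c)%N -> massive c (4 * n) ->
  exists r, [/\ r%:R <= pw n (2 / 3 + 2 * e), (2 * r <= n)%N &
  pw n (- (60 * kap e)) <= Qn c (n - r).+1 n.+1 (fun w =>
    (mm * (n + n + 1 - r)%:R + K * pw n 3^-1 <= (lp w (n - r) n)%:R)%R%:R)].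
  by near: n; exact: (upper_block al0 al1 e0 e1 K0).
have MV : forall c, pw n e <= c%:R -> massive c (4 * n) by near: n; exact: ev_massive.
have RH : forall c, pw n e <= c%:R -> rho al ^+ c <= pw n (- (3 + 121 * kap e)) by near: n; exact: ev_rho.
have S1 : 1 * pw n (31 / 100) <= (K / 2) * pw n 3^-1 by near: n; apply: ev_pw2; [rewrite divr_gt0|lra].
have S2 : (C0 + 6 * mm) * pw n 0 <= (K / 2) * pw n 3^-1 by near: n; apply: ev_pw2; [rewrite divr_gt0|lra].
have S3 : 64 * pw n (- (1 + 121 * kap e)) <= pw n (- (121 * kap e)) by near: n; apply: ev_pw; lra.
have S4 : 4 * pw n (- (121 * kap e)) <= pw n (- (120 * kap e)).
  by near: n; apply: ev_pw; move: k0; clear -al0 al1; lra.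
have c0 : (0 < c)%N.
  by rewrite -(ltr0n R); apply: lt_le_trans nc; exact: pw_gt0.
(* [upper_block] needs a level above [C]; the return to [c] costs the number of cells times
   [qq ^+ c]. *)
have [C UBC] := UB; set b := maxn C c.
have cb : (c <= b)%N by exact: leq_maxr.
have b0 : (0 < b)%N by exact: leq_trans cb.
have nb : pw n e <= b%:R by apply: le_trans nc _; rewrite ler_nat.
have mb := MV _ nb.
have [r [rR r2 PA]] := UBC b (leq_maxl _ _) mb.
have rn : (r <= n)%N by clear -r2; lia.
have PD := LT r b (massive_le al0 al1 (leq_mul (leqnn 4) rn) mb).
set a := mm * (n + n + 1 - r)%:R + K * pw n 3^-1 in PA.
pose EA w : R := (a <= (lp w (n - r) n)%:R)%R%:R.
pose EB w : R := (a <= (lp w n (n - r))%:R)%R%:R.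
pose ED w : R := (2 * mm * r%:R - pw r (45 / 100) - C0 <= (lp w r r)%:R)%R%:R.
have bA : boxed (n - r).+1 n.+1 EA by move=> w w' ww; rewrite /EA (boxed_lp _ _ ww).
have bB : boxed n.+1 (n - r).+1 EB by move=> w w' ww; rewrite /EB (boxed_lp _ _ ww).
have bD : boxed r.+1 r.+1 ED by move=> w w' ww; rewrite /ED (boxed_lp _ _ ww).
have QA : Qn b N.+1 n.+1 EA = Qn b (n - r).+1 n.+1 EA by apply: Qn_box => //; clear -NN rn; lia.
have QB : Qn b N.+1 (n - r).+1 (fun w => EB (sh (n - r) 0 w)) = Qn b (n - r).+1 n.+1 EA.
  rewrite (@Qn_shift R al al0 al1 b N.+1 (n - r).+1 n.+1 (n - r).+1) //; last by clear -NN rn; lia.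
  rewrite -(@Qn_tr R al al0 al1 b n.+1 (n - r).+1 EA) //; apply: eq_Q => w.
  by rewrite /EA /EB (lp_tr w n (n - r)).
set N3 := (N.+1 - (n.+1 + (n - r).+1))%N.
have QD' : Qn b N.+1 N3 (fun w => ED (sh (n + n - r) 0 w)) = Qn b r.+1 r.+1 ED.
  by rewrite (@Qn_shift R al al0 al1 b N.+1 N3 r.+1 r.+1) // /N3; clear -NN rn; lia.
have bA' : boxed N.+1 n.+1 EA by move=> w w' ww; apply: bA => i j hi hj; apply: ww => //; clear -hi NN rn; lia.
have bB' : boxed N.+1 (n - r).+1 (fun w => EB (sh (n - r) 0 w)).
  by move=> w w' ww; apply: bB => i j hi hj; rewrite !shE; apply: ww; clear -hi hj NN rn; lia.
have QQ := @Q_rows R (iota 0 b) (gam b qq) N.+1 n.+1 ((n - r).+1 + N3) EA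
  (fun v => EB (sh (n - r) 0 v) * ED (sh (n + n - r) 0 (sh 0 (n - r).+1 v))) bA'.
have QQ2 := @Q_rows R (iota 0 b) (gam b qq) N.+1 (n - r).+1 N3 (fun v => EB (sh (n - r) 0 v))
  (fun v => ED (sh (n + n - r) 0 v)) bB'.
rewrite QQ2 addnA (_ : n.+1 + (n - r).+1 + N3 = N.+1)%N in QQ; last by rewrite /N3; clear -NN rn; lia.
rewrite -!/(Qn b _ _ _) QA QB QD' in QQ.
have big : 2^-1 * pw n (- (120 * kap e)) <=
  Qn b N.+1 N.+1 (fun w => (2 * mm * N%:R + K * pw n 3^-1 <= (lp w N N)%:R)%R%:R).
  have hA := pw_ge0 n (- (60 * kap e)).
  apply: (@le_trans _ _ (Qn b (n - r).+1 n.+1 EA * (Qn b (n - r).+1 n.+1 EA * Qn b r.+1 r.+1 ED))).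
    have -> : 2^-1 * pw n (- (120 * kap e)) = pw n (- (60 * kap e)) * (pw n (- (60 * kap e)) * 2^-1).
      by rewrite mulrA -pwD mulrC; congr (pw _ _ * _); ring.
    apply: ler_pM => //; first by apply: mulr_ge0.
    by apply: ler_pM.
  rewrite -QQ; apply: le_Qn => // w.
  rewrite /EA /EB /ED; case: (lerP a) => h1; last by rewrite mul0r.
  case: (lerP a) => h2; last by rewrite mul0r mulr0.
  case: (lerP (2 * mm * r%:R - _ - _)) => h3; last by rewrite !mulr0.
  rewrite (_ : (2 * mm * N%:R + _ <= _) = true) ?mulr1 //.
  have c1 := @lp_cat w (n - r) n n (n - r).
  have c2 := @lp_cat w (n - r + n) (n.+1 + (n - r)) r r.
  have c3 : (lp w (n - r + n + r) ((n.+1 + (n - r)).+1 + r) <= lp w N N)%N.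
    apply: leq_trans (@lp_le_right w (n - r + n + r) N _ _) _; first by clear -NN rn; lia.
    by apply: lp_le_up; clear -NN rn; lia.
  have e2 : lp (sh (n - r) 0 (sh 0 n.+1 w)) n (n - r) = lp (sh (n - r) n.+1 w) n (n - r).
    by apply: lp_ext => i j _ _; rewrite !shE; congr w; clear; lia.
  have e3 : lp (sh (n + n - r) 0 (sh 0 (n - r).+1 (sh 0 n.+1 w))) r r =
            lp (sh (n - r + n) (n.+1 + (n - r)).+1 w) r r.
    by apply: lp_ext => i j _ _; rewrite !shE; congr w; clear -rn; lia.
  rewrite e2 in h2; rewrite e3 in h3.
  have tot : (lp w (n - r) n + lp (sh (n - r) n.+1 w) n (n - r) +
     lp (sh (n - r + n) (n.+1 + (n - r)).+1 w) r r <= lp w N N)%N.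
    by move: c1 c2 c3; clear; lia.
  rewrite -(ler_nat R) !natrD in tot.
  (* For r = 0 the power is 1 by convention; otherwise r <= n^(2/3 + 2e), and 2/3 of .45 is .30. *)
  have pr : pw r (45 / 100) <= pw n (31 / 100) :> R.
    have l0 := ln_nat_ge0 R n.
    case: (posnP r) => [->|r0].
      by rewrite /pw ln0 // mulr0 expR0; apply: pw_ge1; clear -al0 al1; lra.
    have : ln r%:R <= (2 / 3 + 2 * e) * ln n%:R.
      by rewrite -[leRHS]expRK ler_ln ?posrE ?ltr0n // expR_gt0.
    by rewrite /pw ler_expR; move: l0 (e1) (e0); clear -al0 al1; nra.
  have nN : 2 * mm * N%:R <= mm * (n + n + 1 - r)%:R + mm * (n + n + 1 - r)%:R + 2 * mm * r%:R + 6 * mm.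
    have nn : 2 * N%:R <= (n + n + 1 - r)%:R + (n + n + 1 - r)%:R + 2 * r%:R + 6 :> R.
      by rewrite -!natrM -!natrD ler_nat; clear -NN rn; lia.
    have := ler_wpM2l (ltW m0) nn; clear -al0 al1; lra.
  rewrite pw0 in S2; move: h1 h2 h3 tot pr nN S1 S2; rewrite /a; clear -al0 al1.
  set x1 := (lp w (n - r) n)%:R; set x2 := (lp _ n (n - r))%:R; set x3 := (lp _ r r)%:R.
  set z := mm * (n + n + 1 - r)%:R; set z2 := 2 * mm * r%:R; lra.
have cut := @Qn_cut c b N.+1 N.+1 (fun w => (2 * mm * N%:R + K * pw n 3^-1 <= (lp w N N)%:R)%R%:R) c0 cb.
have {}cut := le_trans big (cut ltac:(by move=> w; rewrite ler0n natb_le1)).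
have qc : qq ^+ c <= pw n (- (3 + 121 * kap e)).
  by apply: le_trans (RH _ nc); apply: lerXn2r; rewrite ?nnegrE ?(ltW q0) // (le_trans (ltW q0) qrho).
have err : (N.+1 * N.+1)%:R * qq ^+ c <= pw n (- (121 * kap e)).
  apply: le_trans S3.
  have -> : 64 * pw n (- (1 + 121 * kap e)) = (64 * (n%:R * n%:R)) * pw n (- (3 + 121 * kap e)).
    by rewrite -(pw1 R n0) -pwD -[RHS]mulrA -pwD; congr (_ * pw _ _); ring.
  apply: ler_pM => //; first by rewrite exprn_ge0 // ltW.
  by rewrite -!natrM ler_nat; have : (N.+1 <= 8 * n)%N by [clear -NN n2; lia]; clear; nia.
move: cut err S4; clear -al0 al1; lra.
Unshelve. all: by end_near. Qed.

End FiniteTails.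

(** * Fourier analysis on biased bits *)

Section Fourier.
Variables (R : realType) (I : finType) (p : R).
Hypothesis p01 : 0 < p < 1.
Implicit Types (x y : {ffun I -> bool}) (f g h : {ffun I -> bool} -> R) (S : {set I}).

Local Notation s0 := (@finset.set0 I).

Definition bit (b : bool) : R := if b then p else 1 - p.
Definition Eb (f : {ffun I -> bool} -> R) : R := Ex (fun _ => bit) f.
(** The bit normalised to mean 0 and variance 1; [chi S] is the corresponding Walsh function. *)
Definition rr (b : bool) : R :=
  if b then Num.sqrt ((1 - p) / p) else - Num.sqrt (p / (1 - p)).
Definition chi S x : R := \prod_(i in S) rr (x i).
Definition coef f S : R := Eb (fun x => f x * chi S x).

Lemma p_gt0 : 0 < p. Proof. by case/andP: p01. Qed.
Lemma q_gt0 : 0 < 1 - p. Proof. by rewrite subr_gt0; case/andP: p01. Qed.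
Lemma bit_gt0 b : 0 < bit b. Proof. by case: b; [exact: p_gt0|exact: q_gt0]. Qed.
Lemma bit_ge0 b : 0 <= bit b. Proof. exact/ltW/bit_gt0. Qed.
Lemma sum_bit : \sum_b bit b = 1.
Proof. by rewrite big_bool /= addrC subrK. Qed.

(** Completeness of {1, [rr]} on one bit. Mean, variance and the relation [rr_sq] are read off from
    it, and its product over coordinates is the reproducing kernel in [fourier]. *)
Lemma rr_complete a b : 1 + rr a * rr b = (a == b)%:R / bit a.
Proof.
have p0 := p_gt0; have q0 := q_gt0.
have e1 : Num.sqrt ((1 - p) / p) * Num.sqrt (p / (1 - p)) = 1.
  rewrite -sqrtrM ?divr_ge0 ?ltW // mulf_div [p * _]mulrC divff ?sqrtr1 //.
  by rewrite mulf_neq0 // gt_eqF.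
have e2 : Num.sqrt ((1 - p) / p) * Num.sqrt ((1 - p) / p) = (1 - p) / p.
  by rewrite -expr2 sqr_sqrtr // divr_ge0 ?ltW.
have e3 : Num.sqrt (p / (1 - p)) * Num.sqrt (p / (1 - p)) = p / (1 - p).
  by rewrite -expr2 sqr_sqrtr // divr_ge0 ?ltW.
have pn : p != 0 by rewrite gt_eqF.
have qn : 1 - p != 0 by rewrite gt_eqF.
case: a; case: b; rewrite /rr /bit /=.
- by rewrite e2; field.
- by rewrite mulrN e1 subrr mul0r.
- by rewrite mulNr mulrC e1 subrr mul0r.
- by rewrite mulrNN e3; field.
Qed.

Lemma rr_mean : \sum_b bit b * rr b = 0.
Proof.
have h : \sum_b bit b * (1 + rr true * rr b) = 1.
  under eq_bigr do rewrite rr_complete.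
  by rewrite big_bool /= mul0r mulr0 addr0 mul1r divff // gt_eqF // p_gt0.
have h2 : \sum_b bit b * (1 + rr true * rr b) = 1 + rr true * \sum_b bit b * rr b.
  by rewrite !big_bool /= ; ring.
have r0 : rr true != 0.
  by rewrite /rr gt_eqF // sqrtr_gt0 divr_gt0 ?p_gt0 ?q_gt0.
move: h; rewrite h2 => /eqP; rewrite -subr_eq0 addrAC subrr add0r mulf_eq0 (negbTE r0) /=.
by move/eqP.
Qed.

Lemma rr_var : \sum_b bit b * (rr b * rr b) = 1.
Proof.
have h a : bit a * (rr a * rr a) = 1 - bit a.
  have := rr_complete a a; rewrite eqxx => e.
  have -> : rr a * rr a = 1%:R / bit a - 1 by rewrite -e; ring.
  by rewrite mulrBr mulr1 mulrC divfK // gt_eqF // bit_gt0.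
rewrite big_bool; have := h true; have := h false; rewrite /= => -> ->; ring.
Qed.

(** Third moment of [rr], since rr^2 = 1 + l3 rr. *)
Definition l3 : R := rr true + rr false.

Lemma rr_sq b : rr b * rr b = 1 + l3 * rr b.
Proof.
have h : rr true * rr false = -1.
  by have := rr_complete true false; rewrite mul0r => /eqP; rewrite addrC addr_eq0 => /eqP.
by case: b; rewrite /l3 mulrDl ?[rr false * rr true]mulrC h; ring.
Qed.

Lemma Eb_upd i f : Eb (fun x => \sum_b bit b * f (upd x i b)) = Eb f.
Proof. by rewrite /Eb (Ex_upd (fun _ => bit) i f) sum_bit mul1r. Qed.

Lemma EbD f g : Eb (fun x => f x + g x) = Eb f + Eb g. Proof. exact: ExD. Qed.
Lemma EbZ (a : R) f : Eb (fun x => a * f x) = a * Eb f. Proof. exact: ExZ. Qed.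
Lemma EbN f : Eb (fun x => - f x) = - Eb f.
Proof. by rewrite -mulN1r -EbZ; apply: eq_Ex => x; rewrite mulN1r. Qed.
Lemma EbB f g : Eb (fun x => f x - g x) = Eb f - Eb g.
Proof. by rewrite EbD EbN. Qed.
Lemma le_Eb f g : (forall x, f x <= g x) -> Eb f <= Eb g.
Proof. by apply: le_Ex => i a; exact: bit_ge0. Qed.
Lemma Eb_ge0 f : (forall x, 0 <= f x) -> 0 <= Eb f.
Proof. by apply: Ex_ge0 => i a; exact: bit_ge0. Qed.
Lemma Eb_sum (J : Type) (s : seq J) (P : pred J) (F : J -> {ffun I -> bool} -> R) :
  Eb (fun x => \sum_(j <- s | P j) F j x) = \sum_(j <- s | P j) Eb (F j).
Proof. exact: Ex_sum. Qed.
Lemma eq_Eb f g : f =1 g -> Eb f = Eb g. Proof. exact: eq_Ex. Qed.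
Lemma Eb_cst (a : R) : Eb (fun=> a) = a.
Proof.
rewrite -[RHS]mulr1 -[in RHS](@Ex1 R I _ (fun _ => bit)) => [|_]; last exact: sum_bit.
by rewrite -ExZ; apply: eq_Ex => x; rewrite mulr1.
Qed.

Lemma Eb_CS f g : Eb (fun x => f x * g x) ^+ 2 <=
  Eb (fun x => f x ^+ 2) * Eb (fun x => g x ^+ 2).
Proof.
set a := Eb (fun x => f x ^+ 2); set b := Eb (fun x => g x ^+ 2).
set c := Eb (fun x => f x * g x).
have a0 : 0 <= a by apply: Eb_ge0 => x; exact: sqr_ge0.
have b0 : 0 <= b by apply: Eb_ge0 => x; exact: sqr_ge0.
have H (s t : R) : 0 <= s ^+ 2 * a + t ^+ 2 * b + 2 * (s * t) * c.
  have : 0 <= Eb (fun x => (s * f x + t * g x) ^+ 2) by apply: Eb_ge0 => x; exact: sqr_ge0.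
  have -> : Eb (fun x => (s * f x + t * g x) ^+ 2) =
     Eb (fun x => (s ^+ 2 * f x ^+ 2 + t ^+ 2 * g x ^+ 2) + 2 * (s * t) * (f x * g x)).
    by apply: eq_Eb => x; ring.
  by rewrite !EbD !EbZ.
have [bz|bn] := eqVneq b 0.
  have [cz|cn] := eqVneq c 0; first by rewrite cz expr0n /= mulr_ge0.
  have := H 1 (- (a + 1) / (2 * c)); rewrite bz.
  have -> : 1 ^+ 2 * a + (- (a + 1) / (2 * c)) ^+ 2 * 0 + 2 * (1 * (- (a + 1) / (2 * c))) * c = -1.
    by field.
  by rewrite ler0N1.
have bp : 0 < b by rewrite lt_neqAle eq_sym bn.
have := H b (- c).
have -> : b ^+ 2 * a + (- c) ^+ 2 * b + 2 * (b * - c) * c = b * (a * b - c ^+ 2) by ring.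
by rewrite pmulr_rge0 // subr_ge0.
Qed.

Lemma fourier f x : f x = \sum_S coef f S * chi S x.
Proof.
have K y : \sum_S chi S y * chi S x = \prod_i (1 + rr (y i) * rr (x i)).
  under [RHS]eq_bigr do rewrite addrC.
  rewrite bigA_distr; apply: eq_bigr => S _; rewrite /chi -big_split /=.
  exact: big_mkcond.
have -> : \sum_S coef f S * chi S x = Eb (fun y => f y * \prod_i (1 + rr (y i) * rr (x i))).
  rewrite /coef; under eq_bigr do rewrite mulrC -EbZ.
  rewrite -Eb_sum; apply: eq_Eb => y; rewrite -K mulr_sumr; apply: eq_bigr => S _; ring.
rewrite /Eb /Ex (bigD1 x) //= [X in _ + X]big1 ?addr0 => [|y yx]; last first.
  have [i yi] : exists i, y i != x i.
    by apply/existsP; apply: contraR yx => /existsPn h; apply/eqP/ffunP => i; apply/eqP; have := h i; rewrite negbK.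
  by rewrite [X in _ * (_ * X)](bigD1 i) //= rr_complete (negbTE yi) !mul0r !mulr0.
under [X in _ * (_ * X)]eq_bigr do rewrite rr_complete eqxx mul1r.
rewrite prodfV mulrCA mulfV ?mulr1 //.
by apply/prodf_neq0 => i _; rewrite gt_eqF // bit_gt0.
Qed.

Lemma parseval f g : Eb (fun x => f x * g x) = \sum_S coef f S * coef g S.
Proof.
have -> : Eb (fun x => f x * g x) = Eb (fun x => \sum_S coef g S * (f x * chi S x)).
  apply: eq_Eb => x; rewrite {1}(fourier g x) mulr_sumr; apply: eq_bigr => S _; ring.
by rewrite Eb_sum; apply: eq_bigr => S _; rewrite EbZ mulrC.
Qed.

Lemma Eb_sq f : Eb (fun x => f x ^+ 2) = \sum_S coef f S ^+ 2.
Proof.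
by rewrite (_ : Eb _ = Eb (fun x => f x * f x)) ?parseval //; apply: eq_Eb => x; rewrite expr2.
Qed.

Lemma coef_set0 f : coef f s0 = Eb f.
Proof. by apply: eq_Eb => x; rewrite /chi big_set0 mulr1. Qed.

Lemma Eb_indep i (u : bool -> R) g : (forall x b, g (upd x i b) = g x) ->
  Eb (fun x => u (x i) * g x) = (\sum_b bit b * u b) * Eb g.
Proof.
move=> gi; rewrite -EbZ -(Eb_upd i); apply: eq_Eb => x; rewrite mulr_suml.
by apply: eq_bigr => b _; rewrite upd_id gi mulrA.
Qed.

Lemma coef_indep i f S : (forall x b, f (upd x i b) = f x) -> i \in S -> coef f S = 0.
Proof.
move=> fi iS; rewrite /coef.
have -> : Eb (fun x => f x * chi S x) = Eb (fun x => rr (x i) * (f x * chi (S :\ i) x)).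
  by apply: eq_Eb => x; rewrite /chi (big_setD1 i) //=; ring.
rewrite (@Eb_indep i rr) ?rr_mean ?mul0r // => x b; rewrite fi; congr (_ * _).
by apply: eq_bigr => j; rewrite !inE => /andP[ji _]; rewrite upd_neq.
Qed.

Lemma chi_orth S S' : Eb (fun x => chi S x * chi S' x) = (S == S')%:R.
Proof.
rewrite /Eb /Ex.
have -> : \sum_(x : {ffun I -> bool}) (\prod_i bit (x i)) * (chi S x * chi S' x) =
  \sum_(x : {ffun I -> bool}) \prod_i (bit (x i) *
     ((if i \in S then rr (x i) else 1) * (if i \in S' then rr (x i) else 1))).
  apply: eq_bigr => x _; rewrite big_split /= big_split /=.
  by congr (_ * (_ * _)); rewrite /chi big_mkcond.
rewrite -(bigA_distr_bigA (fun i b => bit b *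
     ((if i \in S then rr b else 1) * (if i \in S' then rr b else 1)))) /=.
have F i : \sum_b bit b * ((if i \in S then rr b else 1) * (if i \in S' then rr b else 1))
  = ((i \in S) == (i \in S'))%:R.
  case: (i \in S); case: (i \in S') => /=; first exact: rr_var.
  - by under eq_bigr do rewrite mulr1; exact: rr_mean.
  - by under eq_bigr do rewrite mul1r; exact: rr_mean.
  - by under eq_bigr do rewrite mul1r mulr1; exact: sum_bit.
under eq_bigr do rewrite F.
case: eqP => [->|SS]; first by rewrite big1 // => i _; rewrite eqxx.
have [i iS] : exists i, (i \in S) != (i \in S').
  have [i iS|h] := pickP (fun i => (i \in S) != (i \in S')); first by exists i.
  by case: SS; apply/finset.setP => i; apply/eqP; have := h i; move/negbFE.
by rewrite (bigD1 i) //= (negbTE iS) mul0r.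
Qed.

Definition low K f x : R := \sum_(S : {set I} | (#|S| <= K)%N) coef f S * chi S x.

Lemma coef_low K f S : coef (low K f) S = if (#|S| <= K)%N then coef f S else 0.
Proof.
rewrite {1}/coef.
have -> : Eb (fun x => low K f x * chi S x) =
  \sum_(S' : {set I} | (#|S'| <= K)%N) coef f S' * Eb (fun x => chi S' x * chi S x).
  under [RHS]eq_bigr do rewrite -EbZ; rewrite -Eb_sum; apply: eq_Eb => x.
  by rewrite /low mulr_suml; apply: eq_bigr => S' _; ring.
under eq_bigr do rewrite chi_orth.
case: ifP => SK.
  rewrite (bigD1 S) //= eqxx mulr1 big1 ?addr0 // => S' /andP[_ /negbTE ->].
  by rewrite mulr0.
by rewrite big1 // => S' S'K; case: eqP => [e|_]; [rewrite -e S'K in SK|rewrite mulr0].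
Qed.

Lemma Eb_low_sq K f : Eb (fun x => low K f x ^+ 2) = \sum_(S : {set I} | (#|S| <= K)%N) coef f S ^+ 2.
Proof.
rewrite Eb_sq [RHS]big_mkcond; apply: eq_bigr => S _; rewrite coef_low.
by case: ifP => // _; rewrite expr0n.
Qed.

Lemma Eb_low_mul K f : Eb (fun x => f x * low K f x) = Eb (fun x => low K f x ^+ 2).
Proof.
rewrite Eb_low_sq parseval [RHS]big_mkcond; apply: eq_bigr => S _; rewrite coef_low.
by case: ifP => // _; rewrite ?expr2 // mulr0.
Qed.

(** Polynomials of degree at most [k] in the normalised bits, presented one variable at a time
    because Bonami's inequality is an induction on variables; the relation [rr_sq] keeps products in
    this form. *)
Fixpoint pol (s : seq I) (k : nat) (g : {ffun I -> bool} -> R) : Prop :=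
  if s is i :: s' then
    exists g0 g1, [/\ forall x, g x = g0 x + rr (x i) * g1 x, pol s' k g0 &
      if k is k'.+1 then pol s' k' g1 else forall x, g1 x = 0]
  else exists a, forall x, g x = a.

Lemma pol_ext s k f g : (forall x, f x = g x) -> pol s k f -> pol s k g.
Proof.
case: s => [|i s] fg /=; first by case=> a h; exists a => x; rewrite -fg.
by case=> g0 [g1 [h1 h2 h3]]; exists g0, g1; split=> // x; rewrite -fg.
Qed.

Lemma pol_cst s k a : pol s k (fun=> a).
Proof.
elim: s k a => [|i s IH] k a /=; first by exists a.
exists (fun=> a), (fun=> 0); split=> // [x|]; first by rewrite mulr0 addr0.
by case: k => // k; exact: IH.
Qed.

Lemma pol0 s k g : (forall x, g x = 0) -> pol s k g.
Proof. by move=> g0; apply: pol_ext (pol_cst s k 0) => x; rewrite g0. Qed.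

Lemma polD s k f g : pol s k f -> pol s k g -> pol s k (fun x => f x + g x).
Proof.
elim: s k f g => [|i s IH] k f g /=.
  by case=> a fa [b gb]; exists (a + b) => x; rewrite fa gb.
case=> f0 [f1 [hf pf0 pf1]] [g0 [g1 [hg pg0 pg1]]].
exists (fun x => f0 x + g0 x), (fun x => f1 x + g1 x); split=> [x||]; [|exact: IH|].
  by rewrite hf hg; ring.
by case: k pf0 pf1 pg0 pg1 => [|k] pf0 pf1 pg0 pg1; [move=> x; rewrite pf1 pg1 addr0|exact: IH].
Qed.

Lemma polZ s k a f : pol s k f -> pol s k (fun x => a * f x).
Proof.
elim: s k f => [|i s IH] k f /=.
  by case=> b fa; exists (a * b) => x; rewrite fa.
case=> f0 [f1 [hf pf0 pf1]].
exists (fun x => a * f0 x), (fun x => a * f1 x); split=> [x||]; [|exact: IH|].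
  by rewrite hf; ring.
by case: k pf0 pf1 => [|k] pf0 pf1; [move=> x; rewrite pf1 mulr0|exact: IH].
Qed.

Lemma pol_le s k k' f : (k <= k')%N -> pol s k f -> pol s k' f.
Proof.
elim: s k k' f => [|i s IH] k k' f kk //=.
case=> f0 [f1 [hf pf0 pf1]]; exists f0, f1; split=> //; first exact: IH pf0.
case: k' k kk pf0 pf1 => [|k'] [|k] kk pf0 pf1 //; last exact: IH pf1.
exact: pol0.
Qed.

Lemma pol_sum s k (J : Type) (r : seq J) (P : pred J) (F : J -> {ffun I -> bool} -> R) :
  (forall j, P j -> pol s k (F j)) -> pol s k (fun x => \sum_(j <- r | P j) F j x).
Proof.
move=> h; elim: r => [|j r IH].
  by apply: pol_ext (pol_cst s k 0) => x; rewrite big_nil.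
case Pj: (P j); last by apply: pol_ext IH => x; rewrite big_cons Pj.
by apply: pol_ext (polD (h j Pj) IH) => x; rewrite big_cons Pj.
Qed.

Lemma polM s k k' f g : pol s k f -> pol s k' g -> pol s (k + k') (fun x => f x * g x).
Proof.
elim: s k k' f g => [|i s IH] k k' f g /=.
  by case=> a fa [b gb]; exists (a * b) => x; rewrite fa gb.
case=> f0 [f1 [hf pf0 pf1]] [g0 [g1 [hg pg0 pg1]]].
exists (fun x => f0 x * g0 x + f1 x * g1 x),
  (fun x => (f0 x * g1 x + f1 x * g0 x) + l3 * (f1 x * g1 x)); split.
- move=> x; rewrite hf hg.
  have -> : (f0 x + rr (x i) * f1 x) * (g0 x + rr (x i) * g1 x) =
    f0 x * g0 x + rr (x i) * (f0 x * g1 x + f1 x * g0 x) + (rr (x i) * rr (x i)) * (f1 x * g1 x).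
    by ring.
  by rewrite rr_sq; ring.
- apply: polD; first exact: IH.
  case: k k' pf0 pf1 pg0 pg1 => [|k] [|k'] pf0 pf1 pg0 pg1.
  + by apply: pol0 => x; rewrite pf1 mul0r.
  + by apply: pol0 => x; rewrite pf1 mul0r.
  + by apply: pol0 => x; rewrite pg1 mulr0.
  + by apply: (@pol_le _ (k + k')); [lia|exact: IH].
- case: k k' pf0 pf1 pg0 pg1 => [|k] [|k'] pf0 pf1 pg0 pg1.
  + by move=> x; rewrite pf1 pg1; ring.
  + rewrite add0n; apply: polD; last by apply: pol0 => x; rewrite pf1; ring.
    apply: polD; first exact: (IH 0%N k').
    by apply: pol0 => x; rewrite pf1; ring.
  + rewrite addn0; apply: polD; last by apply: pol0 => x; rewrite pg1; ring.
    apply: polD; first by apply: pol0 => x; rewrite pg1; ring.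
    by rewrite -[X in pol s X _]addn0; apply: IH.
  + rewrite addSn; apply: polD; first apply: polD.
    * by rewrite addnS -addSn; apply: IH.
    * exact: IH.
    * by apply: polZ; apply: (@pol_le _ (k + k')); [lia|exact: IH].
Qed.

Lemma pol_chi s S : uniq s -> {subset S <= s} -> pol s #|S| (chi S).
Proof.
elim: s S => [|i s IH] S us Ss.
  exists 1 => x; rewrite /chi big1 // => i iS; by have := Ss _ iS.
case/andP: us => nis us /=.
case iS: (i \in S).
  exists (fun=> 0), (chi (S :\ i)); split.
  - by move=> x; rewrite add0r /chi (big_setD1 i).
  - exact: pol_cst.
  rewrite (cardsD1 i) iS add1n; apply: IH => // j; rewrite !inE => /andP[ji jS].
  by have := Ss _ jS; rewrite inE (negbTE ji).
exists (chi S), (fun=> 0); split=> [x||]; first by rewrite mulr0 addr0.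
  apply: IH => // j jS; have := Ss _ jS; rewrite inE => /orP[/eqP ji|//].
  by rewrite -ji jS in iS.
by case: #|S| => // k; exact: pol_cst.
Qed.

Lemma pol_low K f : pol (enum I) K (low K f).
Proof.
apply: pol_sum => S SK; apply: polZ; apply: pol_le SK _.
by apply: pol_chi; [exact: enum_uniq|move=> i _; rewrite mem_enum].
Qed.

Lemma pol_upd s k g i : pol s k g -> i \notin s -> forall x b, g (upd x i b) = g x.
Proof.
elim: s k g => [|j s IH] k g /=; first by case=> a h _ x b; rewrite !h.
case=> g0 [g1 [hg pg0 pg1]]; rewrite inE negb_or => /andP[ij nis] x b.
rewrite !hg upd_neq 1?eq_sym // (IH _ _ pg0 nis).
by case: k pg0 pg1 => [|k] pg0 pg1; rewrite ?pg1 // (IH _ _ pg1 nis).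
Qed.

Definition Bon : R := 4 + 3 * l3 ^+ 2.

Lemma Bon_ge4 : 4 <= Bon.
Proof. by rewrite /Bon lerDl mulr_ge0 // sqr_ge0. Qed.

(** Here [a], [b] are second moments of the two coefficients of a variable, and [u], [v], [w] the
    fourth-order terms. Cauchy-Schwarz gives v <= D^(k+1) a b, and D >= 4 lets 8 v fit into the
    cross term of (a + b)^2. *)
Lemma bonami_step (D a b u v w : R) k : 4 <= D -> 3 * l3 ^+ 2 + 1 <= D ->
  0 <= a -> 0 <= b -> 0 <= u -> 0 <= v -> 0 <= w ->
  u <= D ^+ k.+2 * a ^+ 2 -> w <= D ^+ k * b ^+ 2 -> v ^+ 2 <= u * w ->
  u + 8 * v + (3 * l3 ^+ 2 + 1) * w <= D ^+ k.+2 * (a + b) ^+ 2.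
Proof.
move=> D4 Dl a0 b0 u0 v0 w0 hu hw hv.
have D0 : 0 <= D by lra.
have Dk : 0 <= D ^+ k by exact: exprn_ge0.
have v1 : v <= D ^+ k.+1 * (a * b).
  have : v ^+ 2 <= (D ^+ k.+1 * (a * b)) ^+ 2.
    apply: le_trans hv _; apply: le_trans (ler_pM u0 w0 hu hw) _.
    by rewrite [leRHS](_ : _ = D ^+ k.+2 * a ^+ 2 * (D ^+ k * b ^+ 2)) // !exprS; ring.
  by rewrite ler_pXn2r // nnegrE ?mulr_ge0 // exprn_ge0.
have h8 : 8 * v <= 2 * (D ^+ k.+2 * (a * b)).
  have : 8 * v <= 8 * (D ^+ k.+1 * (a * b)) by lra.
  move/le_trans; apply; rewrite !exprS.
  have := mulr_ge0 (mulr_ge0 (mulr_ge0 D0 Dk) (mulr_ge0 a0 b0)) (_ : 0 <= D - 4).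
  rewrite subr_ge0 => /(_ D4); lra.
have h9 : (3 * l3 ^+ 2 + 1) * w <= D ^+ k.+2 * b ^+ 2.
  have l0 := sqr_ge0 l3.
  apply: (@le_trans _ _ (D * (D ^+ k * b ^+ 2))).
    by apply: ler_pM => //; lra.
  rewrite !exprS -!mulrA ler_wpM2l //.
  by rewrite ler_peMl ?mulr_ge0 ?sqr_ge0 //; lra.
have -> : D ^+ k.+2 * (a + b) ^+ 2 = D ^+ k.+2 * a ^+ 2 + 2 * (D ^+ k.+2 * (a * b)) + D ^+ k.+2 * b ^+ 2 by ring.
by lra.
Qed.

(** The first four moments of [rr] are 0, 1, l3 and 1 + l3^2. The term 4 l3 g0 g1^3 is absorbed by
    twice the square of g0 g1 - l3 g1^2, whence 8 = 6 + 2 and 3 l3^2 + 1. *)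
Lemma bonami s k g : uniq s -> pol s k g ->
  Eb (fun x => g x ^+ 4) <= Bon ^+ (2 * k) * Eb (fun x => g x ^+ 2) ^+ 2.
Proof.
have D4 := Bon_ge4.
have Dl : 3 * l3 ^+ 2 + 1 <= Bon by rewrite /Bon; lra.
elim: s k g => [|i s IH] k g /=.
  move=> _ [a ga]; rewrite (@eq_Eb _ (fun=> a ^+ 4)) => [|x]; last by rewrite ga.
  rewrite (@eq_Eb (fun x => g x ^+ 2) (fun=> a ^+ 2)) => [|x]; last by rewrite ga.
  have e4 : (a ^+ 2) ^+ 2 = a ^+ 4 by rewrite -exprM.
  rewrite !Eb_cst e4 ler_peMl ?exprn_even_ge0 //.
  by apply: exprn_ege1; lra.
case/andP=> nis us [g0 [g1 [hg pg0 pg1]]].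
have i0 := pol_upd pg0 nis.
have E2 : Eb (fun x => g x ^+ 2) = Eb (fun x => g0 x ^+ 2) + Eb (fun x => g1 x ^+ 2) /\
  Eb (fun x => g x ^+ 4) <= Eb (fun x => g0 x ^+ 4) + 8 * Eb (fun x => g0 x ^+ 2 * g1 x ^+ 2)
    + (3 * l3 ^+ 2 + 1) * Eb (fun x => g1 x ^+ 4).
  have i1 x b : g1 (upd x i b) = g1 x.
    by case: k pg0 pg1 => [|k] pg0 pg1; [rewrite !pg1|exact: pol_upd pg1 nis x b].
  have ind (G : R -> R -> R) : Eb (fun x => rr (x i) * G (g0 x) (g1 x)) = 0.
    by rewrite (@Eb_indep i rr (fun x => G (g0 x) (g1 x))) ?rr_mean ?mul0r // => x b; rewrite i0 i1.
  split.
    have -> : Eb (fun x => g x ^+ 2) = Eb (fun x => (g0 x ^+ 2 + g1 x ^+ 2) +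
       rr (x i) * (2 * (g0 x * g1 x) + l3 * g1 x ^+ 2)).
      apply: eq_Eb => x; rewrite hg.
      have -> : (g0 x + rr (x i) * g1 x) ^+ 2 = g0 x ^+ 2 + 2 * rr (x i) * (g0 x * g1 x) +
        (rr (x i) * rr (x i)) * g1 x ^+ 2 by ring.
      by rewrite rr_sq; ring.
    by rewrite !EbD (ind (fun a b => 2 * (a * b) + l3 * b ^+ 2)) addr0.
  have -> : Eb (fun x => g x ^+ 4) = Eb (fun x => (g0 x ^+ 4 + 6 * (g0 x ^+ 2 * g1 x ^+ 2)
     + 4 * l3 * (g0 x * g1 x ^+ 3) + (1 + l3 ^+ 2) * g1 x ^+ 4) +
       rr (x i) * (4 * (g0 x ^+ 3 * g1 x) + 6 * l3 * (g0 x ^+ 2 * g1 x ^+ 2)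
       + 4 * (1 + l3 ^+ 2) * (g0 x * g1 x ^+ 3) + (2 * l3 + l3 ^+ 3) * g1 x ^+ 4)).
    apply: eq_Eb => x; rewrite hg.
    have r2 : rr (x i) ^+ 2 = 1 + l3 * rr (x i) by rewrite expr2 rr_sq.
    have r3 : rr (x i) ^+ 3 = l3 + (1 + l3 ^+ 2) * rr (x i).
      by rewrite exprSr r2 mulrDl mul1r -mulrA rr_sq; ring.
    have r4 : rr (x i) ^+ 4 = 1 + l3 ^+ 2 + (2 * l3 + l3 ^+ 3) * rr (x i).
      by rewrite exprSr r3 mulrDl -mulrA rr_sq; ring.
    have -> : (g0 x + rr (x i) * g1 x) ^+ 4 = g0 x ^+ 4 + 4 * (rr (x i) * (g0 x ^+ 3 * g1 x))
      + 6 * rr (x i) ^+ 2 * (g0 x ^+ 2 * g1 x ^+ 2) + 4 * rr (x i) ^+ 3 * (g0 x * g1 x ^+ 3)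
      + rr (x i) ^+ 4 * g1 x ^+ 4 by ring.
    by rewrite r2 r3 r4; ring.
  rewrite EbD (ind (fun a b => 4 * (a ^+ 3 * b) + 6 * l3 * (a ^+ 2 * b ^+ 2)
       + 4 * (1 + l3 ^+ 2) * (a * b ^+ 3) + (2 * l3 + l3 ^+ 3) * b ^+ 4)) addr0.
  rewrite -!EbZ -!EbD; apply: le_Eb => x.
  have := sqr_ge0 (g0 x * g1 x - l3 * g1 x ^+ 2).
  have -> : (g0 x * g1 x - l3 * g1 x ^+ 2) ^+ 2 = g0 x ^+ 2 * g1 x ^+ 2 - 2 * l3 * (g0 x * g1 x ^+ 3)
     + l3 ^+ 2 * g1 x ^+ 4 by ring.
  by lra.
case: E2 => -> e4; apply: le_trans e4 _.
have sq0 (f : {ffun I -> bool} -> R) m : 0 <= Eb (fun x => f x ^+ (2 * m)).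
  by apply: Eb_ge0 => x; rewrite exprM exprn_ge0 // sqr_ge0.
case: k pg0 pg1 {hg} => [|k] pg0 pg1.
  have z (m : nat) : (0 < m)%N -> Eb (fun x => g1 x ^+ m) = 0.
    by move=> m0; rewrite -[RHS](Eb_cst 0); apply: eq_Eb => x; rewrite pg1 expr0n gtn_eqF.
  have z2 : Eb (fun x => g0 x ^+ 2 * g1 x ^+ 2) = 0.
    by rewrite -[RHS](Eb_cst 0); apply: eq_Eb => x; rewrite pg1 expr0n mulr0.
  rewrite !z // z2 !mulr0 !addr0; exact: IH pg0.
rewrite mulnS; apply: bonami_step => //; try exact: (sq0 _ 1%N); try exact: (sq0 _ 2%N).
- by apply: Eb_ge0 => x; rewrite mulr_ge0 ?sqr_ge0.
- by have := IH k.+1 g0 us pg0; rewrite mulnS.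
- exact: IH pg1.
- have := Eb_CS (fun x => g0 x ^+ 2) (fun x => g1 x ^+ 2).
  move/le_trans; apply; rewrite le_eqVlt; apply/orP; left; apply/eqP.
  by congr (_ * _); apply: eq_Eb => x; rewrite -exprM.
Qed.

(** The fourth-moment inequality is applied to the square of the low-degree part, of degree 2K, and
    then to the low-degree part itself. *)
Lemma bonami8 K f : Eb (fun x => low K f x ^+ 8) <=
  Bon ^+ (8 * K) * Eb (fun x => low K f x ^+ 2) ^+ 4.
Proof.
have B0 : 0 <= Bon by apply: le_trans Bon_ge4.
have pg := pol_low K f.
have b1 := bonami (enum_uniq I) pg.
have := bonami (enum_uniq I) (polM pg pg).
set g := low K f in b1 *.
have -> : Eb (fun x => (g x * g x) ^+ 4) = Eb (fun x => g x ^+ 8).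
  by apply: eq_Eb => x; rewrite -expr2 -exprM.
have -> : Eb (fun x => (g x * g x) ^+ 2) = Eb (fun x => g x ^+ 4).
  by apply: eq_Eb => x; rewrite -expr2 -exprM.
move/le_trans; apply.
have g4 : 0 <= Eb (fun x => g x ^+ 4) by apply: Eb_ge0 => x; rewrite exprn_even_ge0.
apply: (@le_trans _ _ (Bon ^+ (2 * (K + K)) * (Bon ^+ (2 * K) * Eb (fun x => g x ^+ 2) ^+ 2) ^+ 2)).
  rewrite ler_wpM2l ?exprn_ge0 // lerXn2r // nnegrE //.
  by apply: mulr_ge0; [exact: exprn_ge0|exact: sqr_ge0].
rewrite exprMn -!exprM mulrA -exprD.
by rewrite (_ : (2 * (K + K) + 2 * K * 2 = 8 * K)%N) //; lia.
Qed.

(** [dl] bounds the fourth root of [P], so that P^(7/4) is replaced by an expression without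
    fractional powers. With m = l^4 shifts, [dl] will be 1 / l. *)
Lemma quartic_root_le (G C P B dl : R) K : 0 <= G -> 0 <= C -> 0 <= P -> 0 <= B -> 0 <= dl ->
  P <= dl ^+ 4 -> G ^+ 4 <= C ^+ 8 * P ^+ 7 * B ^+ (8 * K) ->
  G <= C ^+ 2 * B ^+ (2 * K) * (P * dl ^+ 3).
Proof.
move=> G0 C0 P0 B0 dl0 Pdl; rewrite (_ : 8 * K = 2 * K * 4)%N; last by lia.
rewrite (exprM B (2 * K) 4).
have := exprn_ge0 (2 * K) B0; move: (B ^+ (2 * K)) => b b0 h.
have : G ^+ 4 <= (C ^+ 2 * b * (P * dl ^+ 3)) ^+ 4.
  apply: le_trans h _.
  have -> : (C ^+ 2 * b * (P * dl ^+ 3)) ^+ 4 = C ^+ 8 * (P ^+ 4 * (dl ^+ 4) ^+ 3) * b ^+ 4 by ring.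
  have -> : P ^+ 7 = P ^+ 4 * P ^+ 3 by ring.
  rewrite ler_wpM2r ?exprn_ge0 // ler_wpM2l ?exprn_ge0 // ler_wpM2l ?exprn_ge0 //.
  by rewrite lerXn2r ?nnegrE ?exprn_ge0.
by rewrite ler_pXn2r // nnegrE !mulr_ge0 ?exprn_ge0.
Qed.

(* Three nested Cauchy-Schwarz inequalities play the role of Hölder with exponents 8/7 and 8. *)
Lemma level_bound K (h a : {ffun I -> bool} -> R) (C dl : R) : 0 <= C -> 0 <= dl ->
  (forall x, 0 <= a x <= 1) -> (forall x, `|h x| <= C * a x) -> Eb a <= dl ^+ 4 ->
  Eb (fun x => low K h x ^+ 2) <= C ^+ 2 * Bon ^+ (2 * K) * (Eb a * dl ^+ 3).
Proof.
move=> C0 dl0 a01 ha Ea; set g := low K h; set G := Eb _; set P := Eb a in Ea *.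
have a0 x : 0 <= a x by case/andP: (a01 x).
have P0 : 0 <= P by apply: Eb_ge0.
have B0 : 0 <= Bon by apply: le_trans Bon_ge4.
have G0 : 0 <= G by apply: Eb_ge0 => x; exact: sqr_ge0.
pose A m := Eb (fun x => a x * g x ^+ (2 * m)).
have A0 m : 0 <= A m by apply: Eb_ge0 => x; rewrite mulr_ge0 // exprM exprn_ge0 // sqr_ge0.
have CS (u : {ffun I -> bool} -> R) : Eb (fun x => a x * u x) ^+ 2 <= P * Eb (fun x => a x * u x ^+ 2).
  have := Eb_CS (fun x => Num.sqrt (a x)) (fun x => Num.sqrt (a x) * u x).
  have -> : Eb (fun x => Num.sqrt (a x) * (Num.sqrt (a x) * u x)) = Eb (fun x => a x * u x).
    by apply: eq_Eb => x; rewrite mulrA -expr2 sqr_sqrtr.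
  have -> : Eb (fun x => Num.sqrt (a x) ^+ 2) = P by apply: eq_Eb => x; rewrite sqr_sqrtr.
  by have -> : Eb (fun x => (Num.sqrt (a x) * u x) ^+ 2) = Eb (fun x => a x * u x ^+ 2)
    by apply: eq_Eb => x; rewrite exprMn sqr_sqrtr.
have Gle : G <= C * Eb (fun x => a x * `|g x|).
  rewrite /G -Eb_low_mul -EbZ; apply: le_Eb => x; apply: le_trans (ler_norm _) _.
  by rewrite normrM mulrA ler_wpM2r.
have s1 : Eb (fun x => a x * `|g x|) ^+ 2 <= P * A 1%N.
  apply: le_trans (CS _) _; rewrite /A muln1 le_eqVlt; apply/orP; left; apply/eqP; congr (_ * _).
  by apply: eq_Eb => x; rewrite real_normK ?num_real.
have s2 : A 1%N ^+ 2 <= P * A 2%N.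
  apply: le_trans (CS (fun x => g x ^+ (2 * 1))) _; rewrite le_eqVlt; apply/orP; left; apply/eqP; congr (_ * _).
  by apply: eq_Eb => x; rewrite -exprM.
have s3 : A 2%N ^+ 2 <= P * Eb (fun x => g x ^+ 8).
  apply: le_trans (CS (fun x => g x ^+ (2 * 2))) _; rewrite ler_wpM2l //; apply: le_Eb => x.
  rewrite -exprM ler_piMl ?exprn_even_ge0 //; by case/andP: (a01 x).
have b8 := bonami8 K h; rewrite -/g -/G in b8.
set N1 := Eb (fun x => a x * `|g x|) in Gle s1.
have N10 : 0 <= N1 by apply: Eb_ge0 => x; rewrite mulr_ge0.
set E8 := Eb (fun x => g x ^+ 8) in s3 b8.
have E80 : 0 <= E8 by apply: Eb_ge0 => x; rewrite exprn_even_ge0.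
have N8 : N1 ^+ 8 <= P ^+ 7 * E8.
  have t1 : N1 ^+ 4 <= P ^+ 3 * A 2%N.
    apply: (@le_trans _ _ ((P * A 1%N) ^+ 2)).
      by rewrite (_ : 4 = 2 * 2)%N // exprM lerXn2r ?nnegrE ?mulr_ge0 // sqr_ge0.
    rewrite exprMn [P ^+ 3]exprSr -mulrA.
    by apply: ler_wpM2l => //; exact: sqr_ge0.
  apply: (@le_trans _ _ ((P ^+ 3 * A 2%N) ^+ 2)).
    by rewrite (_ : 8 = 4 * 2)%N // exprM lerXn2r ?nnegrE ?mulr_ge0 ?exprn_ge0.
  rewrite exprMn -exprM [P ^+ 7]exprSr -mulrA; apply: ler_wpM2l => //; exact: exprn_ge0.
have [Gz|Gn] := eqVneq G 0.
  by rewrite Gz !mulr_ge0 ?exprn_ge0.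
have Gp : 0 < G by rewrite lt_neqAle eq_sym Gn.
have Q : G ^+ 8 <= C ^+ 8 * (P ^+ 7 * (Bon ^+ (8 * K) * G ^+ 4)).
  apply: (@le_trans _ _ ((C * N1) ^+ 8)); first by rewrite lerXn2r ?nnegrE ?mulr_ge0.
  rewrite exprMn ler_wpM2l ?exprn_ge0 //; apply: le_trans N8 _.
  by rewrite ler_wpM2l ?exprn_ge0.
have Q' : G ^+ 4 <= C ^+ 8 * P ^+ 7 * Bon ^+ (8 * K).
  rewrite -(ler_pM2r (exprn_gt0 4 Gp)) -exprD; apply: le_trans Q _.
  by rewrite !mulrA.
by apply: quartic_root_le Ea Q'.
Qed.

Definition wt K f : R := \sum_(S : {set I} | (0 < #|S| <= K)%N) coef f S ^+ 2.
Definition Varb f : R := Eb (fun x => f x ^+ 2) - Eb f ^+ 2.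

Lemma VarbE f : Varb f = \sum_(S : {set I} | S != s0) coef f S ^+ 2.
Proof.
by rewrite /Varb Eb_sq (bigD1 s0) //= coef_set0 addrAC subrr add0r.
Qed.

Lemma coefB f g S : coef (fun x => f x - g x) S = coef f S - coef g S.
Proof. by rewrite /coef -EbB; apply: eq_Eb => x; rewrite mulrBl. Qed.

Lemma wt_approx K f g : wt K f <= 2 * wt K g + 2 * Eb (fun x => (f x - g x) ^+ 2).
Proof.
rewrite Eb_sq /wt !mulr_sumr.
apply: (@le_trans _ _ (\sum_(S : {set I} | (0 < #|S| <= K)%N)
   (2 * coef g S ^+ 2 + 2 * coef (fun x => f x - g x) S ^+ 2))).
  apply: ler_sum => S _; rewrite coefB.
  have := sqr_ge0 (coef f S - 2 * coef g S); lra.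
rewrite big_split /= lerD2l [leRHS](bigID (fun S : {set I} => (0 < #|S| <= K)%N)) /= lerDl.
by apply: sumr_ge0 => S _; rewrite mulr_ge0 // sqr_ge0.
Qed.

(* Each nonempty S is charged to one of its elements i, and S \ni i has the same coefficient
   in f and in the discrete derivative of f in the direction i. *)
Lemma wt_deriv K f : wt K f <=
  \sum_i Eb (fun x => low K (fun x => f x - f (upd x i true)) x ^+ 2).
Proof.
under eq_bigr do rewrite Eb_low_sq.
apply: (@le_trans _ _ (\sum_i \sum_(S : {set I} | (#|S| <= K)%N && (i \in S)) coef f S ^+ 2)).
  under eq_bigr do rewrite big_mkcondr /=.
  rewrite exchange_big /= /wt.
  rewrite big_mkcond [leRHS]big_mkcond; apply: ler_sum => S _.
  case: (leqP #|S| K) => SK; last by rewrite andbF.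
  rewrite andbT; case: ifP => [|_]; last by apply: sumr_ge0 => i _; case: ifP => // _; exact: sqr_ge0.
  rewrite card_gt0 => /set0Pn[i iS]; rewrite (bigD1 i) //= iS lerDl.
  by apply: sumr_ge0 => j _; case: ifP => // _; exact: sqr_ge0.
apply: ler_sum => i _; rewrite big_mkcondr /=; apply: ler_sum => S _.
case: ifP => [iS|_]; last exact: sqr_ge0.
rewrite coefB (@coef_indep i (fun x => f (upd x i true))) ?subr0 // => x b.
by congr f; apply/ffunP => j; rewrite !ffunE; case: eqP.
Qed.

(** Law of two bit strings with correlation [rho] in each coordinate; for [rho = expR (- t)] it is
    the law before and after resampling, by [sel_pair_law]. *)
Definition Eb2 (rho : R) (F : {ffun I -> bool} -> {ffun I -> bool} -> R) : R :=
  \sum_(x : {ffun I -> bool}) \sum_(y : {ffun I -> bool}) (\prod_i (bit (x i) * bit (y i) * (1 + rho * (rr (x i) * rr (y i))))) * F x y.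

Lemma noise_fourier (rho : R) f :
  Eb2 rho (fun x y => f x * f y) = \sum_(S : {set I}) rho ^+ #|S| * coef f S ^+ 2.
Proof.
have K x y : \prod_i (1 + rho * (rr (x i) * rr (y i))) = \sum_(S : {set I}) rho ^+ #|S| * (chi S x * chi S y).
  under eq_bigr do rewrite addrC.
  rewrite bigA_distr; apply: eq_bigr => S _.
  by rewrite -big_mkcond /= big_split /= prodr_const /chi -big_split.
rewrite /Eb2.
under eq_bigr => x _ do under eq_bigr => y _ do rewrite !big_split /= K mulr_sumr mulr_suml.
under eq_bigr => x _ do rewrite exchange_big /=.
rewrite exchange_big /=; apply: eq_bigr => S _.
rewrite expr2 {1}/coef {1}/Eb /Ex mulr_suml mulr_sumr; apply: eq_bigr => x _.
rewrite /coef /Eb /Ex !mulr_sumr; apply: eq_bigr => y _; ring.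
Qed.

(** Levels up to K are kept at full weight, and those above are damped by [rho ^+ K]. *)
Lemma noise_cov (rho : R) K f : 0 <= rho <= 1 ->
  0 <= Eb2 rho (fun x y => f x * f y) - Eb f ^+ 2 <= wt K f + rho ^+ K * Varb f.
Proof.
case/andP=> r0 r1.
have e : Eb2 rho (fun x y => f x * f y) - Eb f ^+ 2 = \sum_(S : {set I} | S != s0) rho ^+ #|S| * coef f S ^+ 2.
  by rewrite noise_fourier (bigD1 s0) //= cards0 expr0 mul1r coef_set0 addrAC subrr add0r.
rewrite e; apply/andP; split.
  by apply: sumr_ge0 => S _; apply: mulr_ge0; [exact: exprn_ge0|exact: sqr_ge0].
rewrite VarbE (bigID (fun S : {set I} => (#|S| <= K)%N)) /=; apply: lerD.
  rewrite /wt [leRHS](eq_bigl (fun S : {set I} => (S != s0) && (#|S| <= K)%N)); last first.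
    by move=> S; rewrite card_gt0.
  apply: ler_sum => S _; rewrite ler_piMl ?sqr_ge0 // exprn_ile1 //.
rewrite mulr_sumr big_mkcondr /=; apply: ler_sum => S _; case: ifP => [SK|_].
  rewrite ler_wpM2r ?sqr_ge0 // ler_wiXn2l //; lia.
by apply: mulr_ge0; [exact: exprn_ge0|exact: sqr_ge0].
Qed.

End Fourier.

(** * Low-degree weight of the passage time *)

Section Geodesic.
Variable n : nat.
Implicit Types w : int * int -> nat.

Lemma staircase_size : size (nseq n true ++ nseq n false) == (n + n)%N.
Proof. by rewrite size_cat !size_nseq. Qed.

Definition geo0 : (n + n).-tuple bool := Tuple staircase_size.
Definition pweight w (s : (n + n).-tuple bool) : nat :=
  if count id s == n then path_weight w s else 0%N.
(** A definite maximal path is needed to speak of the sites it meets. It is a function of the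
    weights alone, so its law is the same for every shift of an i.i.d. environment. *)
Definition geod w : (n + n).-tuple bool :=
  [arg max_(s > geo0 | count id s == n) pweight w s]%N.
Definition onp w (v : int * int) : bool :=
  [exists k : 'I_(n + n).+1, path_vertex (geod w) k == v].

Lemma geodP w : count id (geod w) = n /\ path_weight w (geod w) = lpp w n.
Proof.
rewrite /geod; case: arg_maxnP => [|s /eqP sn smax].
  by rewrite count_cat !count_nseq /= mul1n mul0n addn0.
split=> //; apply/eqP; rewrite eqn_leq; apply/andP; split.
  by apply: leq_trans (leq_bigmax_cond _ _) => //; exact/eqP.
apply/bigmax_leqP => s' s'n; have := smax _ s'n.
by rewrite /pweight s'n sn eqxx.
Qed.

Lemma count_take_level (s : seq bool) k : (k <= size s)%N ->
  (count id (take k s) + count negb (take k s))%N = k.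
Proof. by move=> ks; rewrite (count_predC id) size_takel. Qed.

Lemma path_vertex_inj (s : seq bool) k k' : (k <= size s)%N -> (k' <= size s)%N ->
  path_vertex s k = path_vertex s k' -> k = k'.
Proof.
move=> ks ks' [e1 e2].
by rewrite -(count_take_level ks) -(count_take_level ks') e1 e2.
Qed.

Lemma path_vertex_le (s : (n + n).-tuple bool) (k : 'I_(n + n).+1) : count id s = n ->
  exists a b : nat, [/\ path_vertex s k = (a%:Z, b%:Z), (a <= n)%N & (b <= n)%N].
Proof.
move=> sn; exists (count id (take k s)), (count negb (take k s)); split=> //.
  rewrite -[leqRHS]sn -{2}(cat_take_drop k s) count_cat; exact: leq_addr.
have : count negb s = n.
  by have := count_predC id s; rewrite size_tuple sn => /addnI.
by move=> sn'; rewrite -[leqRHS]sn' -{2}(cat_take_drop k s) count_cat leq_addr.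
Qed.

Lemma eq_path_weight w w' (s : (n + n).-tuple bool) : count id s = n ->
  (forall a b : nat, (a <= n)%N -> (b <= n)%N -> w (a%:Z, b%:Z) = w' (a%:Z, b%:Z)) ->
  path_weight w s = path_weight w' s.
Proof.
move=> sn ww; rewrite /path_weight size_tuple; apply: eq_bigr => k _.
by have [a [b [-> an bn]]] := path_vertex_le k sn; rewrite ww.
Qed.

Lemma eq_geod w w' :
  (forall a b : nat, (a <= n)%N -> (b <= n)%N -> w (a%:Z, b%:Z) = w' (a%:Z, b%:Z)) ->
  geod w = geod w'.
Proof.
move=> ww; rewrite /geod; suff -> : pweight w = pweight w' by [].
by apply/funext => s; rewrite /pweight; case: eqP => // sn; exact: eq_path_weight.
Qed.

(** The maximal path of the larger configuration remains a competitor in the smaller one, and it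
    meets [v0] at most once. *)
Lemma lpp_change w w' v0 C :
  (forall a b : nat, (a <= n)%N -> (b <= n)%N -> (a%:Z, b%:Z) != v0 ->
     w' (a%:Z, b%:Z) = w (a%:Z, b%:Z)) ->
  (w' v0 <= w v0)%N -> (w v0 <= C)%N ->
  (lpp w' n <= lpp w n)%N /\ (lpp w n <= lpp w' n + C * onp w v0)%N.
Proof.
move=> ww w'w wC; split.
  apply/bigmax_leqP => s /eqP sn.
  apply: (@leq_trans (path_weight w s)); last by apply: leq_bigmax_cond; exact/eqP.
  rewrite /path_weight size_tuple; apply: leq_sum => k _.
  have [a [b [-> an bn]]] := path_vertex_le k sn.
  by have [->//|ne] := eqVneq ((a%:Z, b%:Z) : int * int) v0; rewrite ww.
have [gn <-] := geodP w; set g := geod w in gn *.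
apply: (@leq_trans (path_weight w' g + \sum_(k < (n + n).+1) C * (path_vertex g k == v0))).
  rewrite /path_weight size_tuple -big_split /=; apply: leq_sum => k _.
  have [a [b [-> an bn]]] := path_vertex_le k gn.
  have [->|ne] := eqVneq ((a%:Z, b%:Z) : int * int) v0; last by rewrite ww // muln0 addn0.
  by rewrite muln1; apply: leq_trans wC (leq_addl _ _).
apply: leq_add; first by apply: leq_bigmax_cond; exact/eqP.
rewrite -big_distrr /= leq_mul2l; apply/orP; right.
case: (boolP (onp w v0)) => [/existsP[k /eqP gk]|/existsPn h]; last first.
  by rewrite big1 // => k _; rewrite (negbTE (h k)).
rewrite (bigD1 k) //= [X in (_ + X)%N]big1 ?addn0 ?leq_b1 // => k' kk'.
case: eqP => // gk'; case/negP: kk'; apply/eqP/val_inj/(@path_vertex_inj g).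
- by rewrite size_tuple; exact: leq_ord.
- by rewrite size_tuple; exact: leq_ord.
- by rewrite gk' -gk.
Qed.

End Geodesic.

(** * Weights read from finitely many bits *)

Section CellLaw.
Variables (R : realType) (p : R).
Hypothesis p01 : 0 < p < 1.
Local Notation bit := (bit p).

(** Law of the number of failures before the first success among [c] bits: geometric, with the
    remaining mass at [c]. *)
Definition trm (c k : nat) : R := if (k < c)%N then p * (1 - p) ^+ k else (1 - p) ^+ c.
Definition rbits := [seq b | b <- enum {: bool}].

Lemma sum_rbits (F : bool -> R) : \sum_(b <- rbits) F b = F true + F false.
Proof. by rewrite /rbits map_id big_enum /= big_bool. Qed.

Lemma EL_find c (H : nat -> R) :
  EL rbits (nseq c bit) (fun l => H (find id l)) = \sum_(k <- iota 0 c.+1) trm c k * H k.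
Proof.
elim: c H => [|c IH] H; first by rewrite /= big_seq1 /trm /= expr0 mul1r.
rewrite [in RHS](_ : iota 0 c.+2 = 0%N :: [seq k.+1 | k <- iota 0 c.+1]); last first.
  by rewrite -[LHS]/(0%N :: iota 1 c.+1) -(iotaDl 1 0 c.+1).
rewrite big_cons big_map [LHS]/= sum_rbits (IH (fun k => H k.+1)); congr (_ + _).
  rewrite /trm /= expr0 mulr1; congr (_ * _).
  rewrite -[RHS]mul1r -(@EL1 R _ rbits (nseq c bit)) ?mulr1.
    by rewrite -ELZr; apply: eq_EL' => l; rewrite mul1r.
  move=> k; rewrite size_nseq => kc; rewrite nth_nseq kc sum_rbits /=; ring.
rewrite mulr_sumr; apply: eq_bigr => k _; rewrite mulrA; congr (_ * _).
by rewrite /trm /bit ltnS; case: ifP => _; rewrite exprS; ring.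
Qed.

Lemma EL_cells c N (G : seq nat -> R) :
  EL rbits (nseq (N * c) bit) (fun l => G [seq find id r | r <- reshape (nseq N c) l]) =
  EL (iota 0 c.+1) (nseq N (trm c)) G.
Proof.
elim: N G => [|N IH] G //.
rewrite mulSn nseqD EL_cat.
rewrite -[RHS](EL_find c (fun k => EL (iota 0 c.+1) (nseq N (trm c)) (fun l => G (k :: l)))).
apply: eq_EL => l; rewrite size_nseq => sl _; rewrite -IH; apply: eq_EL' => l' /=.
by rewrite take_size_cat // drop_size_cat.
Qed.

Variables (L c : nat).
Definition cell : finType := ('I_L.+1 * 'I_L.+1)%type.
Definition idx : finType := (cell * 'I_c)%type.
Implicit Types x : {ffun idx -> bool}.

Definition cellbits x (a b : nat) : seq bool :=
  [seq x ((inord a, inord b), k) | k <- enum 'I_c].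
Definition Wt x (a b : nat) : nat := find id (cellbits x a b).

Lemma Wt_le x a b : (Wt x a b <= c)%N.
Proof. by apply: leq_trans (find_size _ _) _; rewrite size_map size_enum_ord. Qed.

(** The bits of the box are listed cell by cell; [reshape] recovers the cells, each of which
    contributes an independent variable of law [trm]. *)
Lemma Eb_Q a0 b0 M N (F : (nat -> nat -> nat) -> R) : (a0 + M <= L.+1)%N -> (b0 + N <= L.+1)%N ->
  boxed M N F -> (0 < M)%N ->
  Eb p (fun x => F (sh a0 b0 (Wt x))) = Q (iota 0 c.+1) (trm c) M N F.
Proof.
move=> aL bL bF M0.
pose cl t : cell := (inord (a0 + t %% M), inord (b0 + t %/ M)).
pose ss := [seq [seq (cl t, k) | k <- enum 'I_c] | t <- iota 0 (N * M)].
pose dec (l : seq nat) i j := nth 0%N l (j * M + i)%N.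
have shp : shape ss = nseq (N * M) c.
  rewrite /shape /ss -map_comp; apply: (@eq_from_nth _ 0%N).
    by rewrite size_map size_iota size_nseq.
  move=> t; rewrite size_map size_iota => tN.
  by rewrite (nth_map 0%N) ?size_iota //= size_map size_enum_ord nth_nseq tN.
have us : uniq (flatten ss).
  rewrite /ss; apply: allpairs_uniq_dep; first exact: iota_uniq.
    by move=> t _; exact: enum_uniq.
  move=> [t k] [t' k'] /allpairsPdep[t1 [k1 [t1N _ e1]]] /allpairsPdep[t2 [k2 [t2N _ e2]]] /=.
  have et : t = t1 by case: e1.
  have et' : t' = t2 by case: e2.
  rewrite -et mem_iota /= add0n in t1N; rewrite -et' mem_iota /= add0n in t2N.
  case=> /(congr1 val) /= h1 /(congr1 val) /= h2 ->; congr existT.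
  have b1 := ltn_pmod t M0; have b2 := ltn_pmod t' M0.
  have d1 : (t %/ M < N)%N by rewrite ltn_divLR.
  have d2 : (t' %/ M < N)%N by rewrite ltn_divLR.
  rewrite !inordK in h1; [|lia..]; rewrite !inordK in h2; [|lia..].
  rewrite (divn_eq t M) (divn_eq t' M).
  by rewrite (addnI h1) (addnI h2).
have E x : F (sh a0 b0 (Wt x)) = F (dec [seq find id r | r <- reshape (nseq (N * M) c) [seq x i | i <- flatten ss]]).
  apply: bF => i j iM jN; rewrite map_flatten -shp.
  have -> : shape ss = shape [seq [seq x i | i <- r] | r <- ss].
    by rewrite /shape -map_comp; apply: eq_map => r /=; rewrite size_map.
  rewrite flattenK /dec /ss -!map_comp (nth_map 0%N); last first.
    by rewrite size_iota; nia.
  have tN : (j * M + i < N * M)%N by nia.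
  rewrite nth_iota // add0n /= /sh /Wt /cellbits -map_comp; congr find; apply: eq_map => k /=.
  by rewrite /cl modnMDl modn_small // divnMDl // divn_small // addn0.
rewrite /Eb (eq_Ex _ E).
have -> := @Ex_law R idx bool bool id (fun _ => bit) (fun _ => @sum_bit R p) (flatten ss)
  (fun l => F (dec [seq find id r | r <- reshape (nseq (N * M) c) l])) us.
have -> : [seq bit | _ <- flatten ss] = nseq (N * M * c) bit.
  have -> : (N * M * c)%N = size (flatten ss) by rewrite size_flatten shp sumn_nseq mulnC.
  by elim: (flatten ss) => //= a l ->.
rewrite -(EL_Q (iota 0 c.+1) (trm c) bF).
exact: (EL_cells c (N * M) (fun l => F (dec l))).
Qed.

End CellLaw.

(** * Averaging over anti-diagonal shifts *)

Section AveragedWeight.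
Variables (R : realType) (p : R).
Hypothesis p01 : 0 < p < 1.
Variables (n l c : nat).
Hypothesis l0 : (0 < l)%N.
Let m := (l ^ 4)%N.
Let L := (n + m)%N.
Local Notation idx := (idx L c).
Implicit Types x : {ffun idx -> bool}.
Local Notation E := (@Eb R idx p).

(** The environment seen from (j, m - j): all base points lie on one anti-diagonal. *)
Definition shw (j : nat) x : int * int -> nat :=
  fun v => Wt x (j + `|v.1|)%N ((m - j) + `|v.2|)%N.
Definition fsh j x : R := (lpp (shw j x) n)%:R.
Definition fav x : R := m%:R^-1 * \sum_(j < m) fsh j x.
(** Position of the cell relative to base point [j]; with a negative coordinate no path visits
    it. *)
Definition cpos (v : cell L) (j : nat) : int * int :=
  ((v.1 : nat)%:Z - j%:Z, (v.2 : nat)%:Z - (m - j)%N%:Z).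
Definition acell (v : cell L) x : R :=
  m%:R^-1 * \sum_(j < m) (onp n (shw j x) (cpos v j))%:R.

Lemma m_gt0 : (0 < m)%N. Proof. by rewrite expn_gt0 l0. Qed.

Lemma arr_shw j x : arr (shw j x) = sh j (m - j) (Wt x).
Proof. by []. Qed.

Lemma fsh_lp j x : fsh j x = (lp (sh j (m - j) (Wt x)) n n)%:R.
Proof. by rewrite /fsh lpp_lp arr_shw. Qed.

Lemma Wt_upd x (v : cell L) k a b : (inord a, inord b) != v -> Wt (upd x (v, k) true) a b = Wt x a b.
Proof.
move=> ne; rewrite /Wt /cellbits; congr find; apply: eq_map => k'; rewrite upd_neq //.
by apply: contraNneq ne => -[e _]; rewrite e.
Qed.

Lemma find_map_le (U : Type) (s : seq U) (f g : U -> bool) : (forall u, f u -> g u) ->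
  (find id (map g s) <= find id (map f s))%N.
Proof.
move=> fg; elim: s => //= u s IH; have := fg u.
by case: (f u) => [/(_ isT) ->|_] //; case: (g u).
Qed.

Lemma Wt_upd_le x i a b : (Wt (upd x i true) a b <= Wt x a b)%N.
Proof.
apply: find_map_le => k; set u := (_, _) : idx.
by have [->|ne] := eqVneq u i; rewrite ?upd_id // upd_neq.
Qed.

(** Turning a bit into a success can only lower the weight of its cell, and weights are at most
    [c]. *)
Lemma fsh_deriv x i j : (j < m)%N ->
  0 <= fsh j x - fsh j (upd x i true) <= c%:R * (onp n (shw j x) (cpos i.1 j))%:R.
Proof.
move=> jm; case: i => v k; rewrite /= /fsh.
have [h1 h2] : (lpp (shw j (upd x (v, k) true)) n <= lpp (shw j x) n)%N /\
  (lpp (shw j x) n <= lpp (shw j (upd x (v, k) true)) n + c * onp n (shw j x) (cpos v j))%N.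
  apply: lpp_change.
  - move=> a b an bn ne; apply: Wt_upd; apply: contraNneq ne => <-.
    rewrite /cpos /= !inordK; [|by rewrite /L; lia..].
    by apply/eqP; congr pair; lia.
  - exact: Wt_upd_le.
  - exact: Wt_le.
rewrite subr_ge0 ler_nat h1 /= lerBlDl -natrM -natrD ler_nat; exact: h2.
Qed.

Lemma acell_01 v x : 0 <= acell v x <= 1.
Proof.
have m0 : 0 < m%:R :> R by rewrite ltr0n m_gt0.
rewrite /acell mulr_ge0 ?invr_ge0 ?(ltW m0) ?sumr_ge0 //= ler_pdivrMl // mulr1.
apply: (@le_trans _ _ (\sum_(j < m) 1)); first by apply: ler_sum => j _; case: onp.
by rewrite sumr_const card_ord.
Qed.

Lemma fav_deriv x i : `|fav x - fav (upd x i true)| <= c%:R * acell i.1 x.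
Proof.
have m0 : 0 < m%:R :> R by rewrite ltr0n m_gt0.
rewrite /fav -mulrBr -sumrB.
have S0 : 0 <= \sum_(j < m) (fsh j x - fsh j (upd x i true)).
  by apply: sumr_ge0 => j _; case/andP: (fsh_deriv x i (ltn_ord j)).
rewrite ger0_norm; last by rewrite mulr_ge0 // invr_ge0 ltW.
rewrite /acell mulrCA ler_wpM2l ?invr_ge0 ?(ltW m0) // mulr_sumr.
by apply: ler_sum => j _; case/andP: (fsh_deriv x i (ltn_ord j)).
Qed.

Lemma onp_boxed v : boxed n.+1 n.+1 (fun w => (onp n (fun u => w `|u.1|%N `|u.2|%N) v)%:R : R).
Proof.
move=> w w' ww; rewrite /onp.
by rewrite (@eq_geod n _ (fun u : int * int => w' `|u.1|%N `|u.2|%N)) // => a b an bn /=; apply: ww.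
Qed.

Lemma Eb_onp j v : (j <= m)%N -> E (fun x => (onp n (shw j x) v)%:R) = E (fun x => (onp n (shw 0 x) v)%:R).
Proof.
move=> jm.
have h i : (i <= m)%N -> E (fun x => (onp n (shw i x) v)%:R) =
  Q (iota 0 c.+1) (trm p c) n.+1 n.+1 (fun w => (onp n (fun u => w `|u.1|%N `|u.2|%N) v)%:R : R).
  move=> im; rewrite -(@Eb_Q R p p01 L c i (m - i)) //; first by rewrite /L; lia.
  - by rewrite /L; lia.
  - exact: onp_boxed.
exact: etrans (h j jm) (esym (h 0%N (leq0n m))).
Qed.

(** By shift invariance ([Eb_onp]) the average over j becomes, up to the factor 1 / m, the expected
    number of visits of a single path to [m] distinct points of one anti-diagonal, and a directed
    path meets an anti-diagonal at most once. *)
Lemma acell_small v : E (acell v) <= m%:R^-1.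
Proof.
have m0 : 0 < m%:R :> R by rewrite ltr0n m_gt0.
rewrite /acell EbZ ler_piMr ?invr_ge0 ?(ltW m0) // Eb_sum.
under eq_bigr => j _ do rewrite (Eb_onp _ (ltnW (ltn_ord j))).
rewrite -Eb_sum -[leRHS](@Eb_cst R idx p 1); apply: le_Eb => // x.
rewrite -natr_sum lern1.
have [->//|] := posnP (\sum_(j < m) onp n (shw 0 x) (cpos v j)).
rewrite lt0n => nz.
have /existsP[j oj] : [exists j : 'I_m, onp n (shw 0 x) (cpos v j)].
  apply: contraNT nz => /existsPn h; rewrite big1 // => j _.
  by rewrite (negbTE (h j)).
rewrite (bigD1 j) //= [X in (_ + X)%N]big1 ?addn0 ?leq_b1 // => j' jj'.
apply/eqP; rewrite eqb0; apply: contra jj' => oj'.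
set g := geod n (shw 0 x).
case/existsP: oj => k /eqP ek; case/existsP: oj' => k' /eqP ek'.
have kg : (k <= size g)%N by rewrite size_tuple -ltnS.
have kg' : (k' <= size g)%N by rewrite size_tuple -ltnS.
have lk := count_take_level kg; have lk' := count_take_level kg'.
move: ek ek'; rewrite -/g /path_vertex /cpos => -[e1 e2] [e3 e4].
have ? := ltn_ord j; have ? := ltn_ord j'.
have kk : (k : nat) = k' by lia.
by apply/eqP/val_inj => /=; rewrite kk in e1; lia.
Qed.

(** For every shift the path has 2n + 1 vertices, each of which lies in at most one cell. *)
Lemma acell_total : \sum_(v : cell L) E (acell v) <= (n + n).+1%:R.
Proof.
have m0 : 0 < m%:R :> R by rewrite ltr0n m_gt0.
rewrite -Eb_sum -[leRHS](@Eb_cst R idx p); apply: le_Eb => // x.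
rewrite /acell -mulr_sumr ler_pdivrMl // exchange_big /= mulr_natl -[X in _ *+ X]card_ord -sumr_const.
apply: ler_sum => j _; rewrite -natr_sum ler_nat.
apply: (@leq_trans (\sum_(v : cell L) \sum_(k < (n + n).+1) (path_vertex (geod n (shw j x)) k == cpos v j))).
  apply: leq_sum => v _; rewrite /onp; case: existsP => [[k /eqP h]|_]//.
  by rewrite (bigD1 k) //= h eqxx.
rewrite exchange_big /= -[leqRHS]muln1 -[X in (X * _)%N]card_ord -sum_nat_const.
apply: leq_sum => k _; set u := path_vertex _ _.
have [->//|] := posnP (\sum_(v : cell L) (u == cpos v j)).
rewrite lt0n => nz.
have /existsP[v /eqP uv] : [exists v : cell L, u == cpos v j].
  apply: contraNT nz => /existsPn h; rewrite big1 // => v _.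
  by rewrite (negbTE (h v)).
rewrite (bigD1 v) //= [X in (_ + X)%N]big1 ?addn0 ?leq_b1 // => v' vv'.
apply/eqP; rewrite eqb0; apply: contra vv' => /eqP; rewrite uv /cpos => -[e1 e2].
by apply/eqP; case: v v' e1 e2 {uv} => [a b] [a' b'] /= e1 e2; congr pair; apply: val_inj => /=; lia.
Qed.

(** [level_bound] applies to each bit with [dl] = 1 / l because the visit average is at most l^(-4).
    Two factors [c] come from the size of the derivative, the third from the number of bits per
    cell. *)
Lemma wt_average K : wt p K fav <=
  c%:R ^+ 3 * Bon p ^+ (2 * K) * (n + n).+1%:R / l%:R ^+ 3.
Proof.
have lp : 0 < l%:R :> R by rewrite ltr0n.
have m0 : 0 < m%:R :> R by rewrite ltr0n m_gt0.
have B0 : 0 <= Bon p by apply: le_trans (Bon_ge4 p).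
apply: le_trans (wt_deriv p01 K fav) _.
apply: (@le_trans _ _ (\sum_(i : idx) c%:R ^+ 2 * Bon p ^+ (2 * K) * (E (acell i.1) * l%:R^-1 ^+ 3))).
  apply: ler_sum => i _; apply: level_bound => //; rewrite ?invr_ge0 ?(ltW lp) //.
  - exact: acell_01.
  - by move=> x; exact: fav_deriv.
  - by apply: le_trans (acell_small _) _; rewrite exprVn -natrX.
rewrite -mulr_sumr -mulr_suml exprVn.
have -> : \sum_(i : idx) E (acell i.1) = c%:R * \sum_(v : cell L) E (acell v).
  rewrite -(pair_bigA _ (fun v k => E (acell v))) /= mulr_sumr; apply: eq_bigr => v _.
  by rewrite sumr_const card_ord mulr_natl.
have t := acell_total.
have l3 : 0 <= (l%:R ^+ 3)^-1 :> R by rewrite invr_ge0 exprn_ge0 // ltW.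
rewrite -[leRHS]mulrA [X in _ <= X * _](_ : _ = c%:R ^+ 2 * Bon p ^+ (2 * K) * c%:R); last by ring.
rewrite -[leRHS]mulrA; apply: ler_wpM2l; first by rewrite mulr_ge0 ?exprn_ge0.
by rewrite -mulrA ler_wpM2l // ler_wpM2r.
Qed.

Lemma fav_close (D : R) : (forall j, (j < m)%N -> E (fun x => (fsh 0 x - fsh j x) ^+ 2) <= D) ->
  E (fun x => (fsh 0 x - fav x) ^+ 2) <= D.
Proof.
move=> hD; have m0 : 0 < m%:R :> R by rewrite ltr0n m_gt0.
have mn : m%:R != 0 :> R by rewrite gt_eqF.
apply: (@le_trans _ _ (E (fun x => m%:R^-1 * \sum_(j < m) (fsh 0 x - fsh j x) ^+ 2))).
  apply: le_Eb => // x; set u := fsh 0 x - fav x.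
  have hu : \sum_(j < m) (fsh 0 x - fsh j x) = m%:R * u.
    rewrite sumrB sumr_const card_ord /u /fav mulrBr mulrA divff // mul1r mulr_natl //.
  have : 0 <= \sum_(j < m) ((fsh 0 x - fsh j x) - u) ^+ 2 by apply: sumr_ge0 => j _; exact: sqr_ge0.
  have -> : \sum_(j < m) ((fsh 0 x - fsh j x) - u) ^+ 2 =
    \sum_(j < m) (fsh 0 x - fsh j x) ^+ 2 - 2 * u * \sum_(j < m) (fsh 0 x - fsh j x) + m%:R * u ^+ 2.
    rewrite mulr_sumr -sumrB (_ : m%:R * u ^+ 2 = \sum_(j < m) u ^+ 2); last first.
      by rewrite sumr_const card_ord mulr_natl.
    by rewrite -big_split /=; apply: eq_bigr => j _; ring.
  rewrite hu ler_pdivlMl //; lra.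
rewrite EbZ Eb_sum ler_pdivrMl // mulr_natl -[X in _ *+ X]card_ord -sumr_const.
by apply: ler_sum => j _; exact: hD.
Qed.

Lemma wt_lpp K (D : R) :
  (forall j, (j < m)%N -> E (fun x => (fsh 0 x - fsh j x) ^+ 2) <= D) ->
  wt p K (fsh 0) <= 2 * (c%:R ^+ 3 * Bon p ^+ (2 * K) * (n + n).+1%:R / l%:R ^+ 3) + 2 * D.
Proof.
move=> hD; apply: le_trans (wt_approx p01 K (fsh 0) fav) _.
by apply: lerD; rewrite ler_wpM2l // ?wt_average // fav_close.
Qed.

End AveragedWeight.

(** * Decorrelation for finitely many bits *)

Section PowerBase.
Variable R : realType.

Lemma le_pw_base k n (a : R) : (0 < k)%N -> (k <= n)%N -> 0 <= a -> pw k a <= pw n a.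
Proof.
move=> k0 kn a0; rewrite /pw ler_expR ler_wpM2l // ler_ln ?posrE ?ltr0n ?ler_nat //.
exact: leq_trans kn.
Qed.

Lemma pw_dilate k n m (a : R) : (0 < k)%N -> (0 < m)%N -> (0 < n)%N -> (n <= m * k)%N ->
  0 <= a <= 1 -> pw n a <= m%:R * pw k a.
Proof.
move=> k0 m0 n0 nm /andP[a0 a1]; apply: le_trans (le_pw_base n0 nm a0) _.
rewrite /pw natrM lnM ?posrE ?ltr0n // mulrDr expRD ler_wpM2r ?expR_ge0 //.
rewrite -[leRHS](@lnK R) ?posrE ?ltr0n // ler_expR ler_piMl // ln_ge0 // ler1n //.
Qed.

Lemma lp_le_max w c i j : (forall a b, (w a b <= c)%N) -> (lp w i j <= c * (i + j).+1)%N.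
Proof.
move=> wc; elim: i j => [|i IHi] j; elim: j => [|j IHj].
- by have := wc 0%N 0%N; rewrite muln1.
- by rewrite lp0S; have := wc 0%N j.+1; move: IHj; rewrite !add0n !mulnS; lia.
- by rewrite lpS0; have := wc i.+1 0%N; have := IHi 0%N; rewrite !addn0 !mulnS; lia.
- rewrite lpSS; have := wc i.+1 j.+1; have := IHi j.+1; move: IHj.
  by rewrite !addSn !addnS !mulnS; lia.
Qed.

End PowerBase.

Section TwoTails.
Variables (R : realType) (I : finType) (p : R).
Hypothesis p01 : 0 < p < 1.
Implicit Types f : {ffun I -> bool} -> R.

Lemma Varb_centered f : Varb p f = Eb p (fun x => (f x - Eb p f) ^+ 2).
Proof.
set u := Eb p f; rewrite (_ : Eb p (fun x => (f x - u) ^+ 2) =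
  Eb p (fun x => (f x ^+ 2 + (- (2 * u)) * f x) + u ^+ 2)); last by apply: eq_Eb => x; ring.
by rewrite EbD EbD EbZ Eb_cst -/u /Varb -/u; ring.
Qed.

Lemma Varb_two_tails f (u v a : R) : v <= u -> 0 <= a ->
  a <= Eb p (fun x => (u <= f x)%R%:R) -> a <= Eb p (fun x => (f x <= v)%R%:R) ->
  a * ((u - v) / 2) ^+ 2 <= Varb p f.
Proof.
move=> uv a0 au av; rewrite Varb_centered; set mu := Eb p f.
have s0 : 0 <= (u - v) / 2 by rewrite divr_ge0 // subr_ge0.
have [h|/ltW h] := leP mu ((u + v) / 2).
  apply: le_trans (ler_wpM2r (sqr_ge0 _) au) _; rewrite mulrC -EbZ; apply: le_Eb => // x.
  case: (lerP u (f x)) => hx; rewrite ?mulr0 ?sqr_ge0 // mulr1.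
  by rewrite ler_pXn2r ?nnegrE //; move: hx h uv; lra.
apply: le_trans (ler_wpM2r (sqr_ge0 _) av) _; rewrite mulrC -EbZ; apply: le_Eb => // x.
case: (lerP (f x) v) => hx; rewrite ?mulr0 ?sqr_ge0 // mulr1.
by rewrite -[leRHS]sqrrN ler_pXn2r ?nnegrE //; move: hx h uv; lra.
Qed.

End TwoTails.

Lemma exists_expr_le (R : realType) (r d : R) : 0 <= r < 1 -> 0 < d -> exists K, r ^+ K <= d.
Proof.
move=> /andP[r0 r1] d0; have nr : `|r| < 1 by rewrite ger0_norm.
have /cvgrPdist_le /(_ d d0) [K _ /(_ K (leqnn K))] := cvg_expr nr.
by rewrite sub0r normrN ger0_norm ?exprn_ge0 //; exists K.
Qed.

Section FiniteModel.
Variables (R : realType) (p : R).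
Hypothesis p01 : 0 < p < 1.

Definition alp : R := Num.sqrt (1 - p).

Lemma alp_gt0 : 0 < alp.
Proof. by rewrite sqrtr_gt0 subr_gt0; case/andP: (p01). Qed.

Lemma alp_lt1 : alp < 1.
Proof.
rewrite -[ltRHS]sqrtr1 ltr_sqrt ?ltr01 //; case/andP: (p01) => a b; lra.
Qed.

Lemma qq_alp : qq alp = 1 - p.
Proof. by rewrite /qq sqr_sqrtr // subr_ge0; case/andP: (p01) => _ /ltW. Qed.

Let al0 := alp_gt0.
Let al1 := alp_lt1.
Local Notation q := (qq alp).
Local Notation Qn := (Qn alp).
Local Notation mm := (mm alp).

Let q0 : 0 < q. Proof. exact: qq_gt0 al0. Qed.
Let q1 : q < 1. Proof. exact: qq_lt1 al0 al1. Qed.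

Lemma sum_trm c (g : nat -> R) : \sum_(k <- iota 0 c.+1) trm p c k * g k =
  \sum_(k <- iota 0 c) geo q k * g k + q ^+ c * g c.
Proof.
rewrite -addn1 iotaD big_cat /= big_seq1 add0n /trm ltnn qq_alp; congr (_ + _).
apply: eq_big_seq => k; rewrite mem_iota /= add0n => ->.
by rewrite /geo; congr (_ * _ * _); ring.
Qed.

Lemma geo_gam c k : (0 < c)%N -> geo q k = (1 - q ^+ c) * gam c q k.
Proof.
move=> c0; rewrite /gam mulrA divff ?mul1r // subr_eq0 eq_sym lt_eqF //.
by rewrite exprn_ilt1 ?(ltW q0) // -lt0n.
Qed.

Lemma sum_gam_01 c (g : nat -> R) : (0 < c)%N -> (forall k, 0 <= g k <= 1) ->
  0 <= \sum_(k <- iota 0 c) gam c q k * g k <= 1.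
Proof.
move=> c0 g01; have G0 k : 0 <= gam c q k by apply: gam_ge0; exact: ltW.
apply/andP; split.
  by apply: sumr_ge0 => k _; apply: mulr_ge0 => //; case/andP: (g01 k).
rewrite -(gam_mass c0 (ltW q0) q1); apply: ler_sum => k _.
by rewrite ler_piMr //; case/andP: (g01 k).
Qed.

Lemma gam_trm c (g : nat -> R) : (0 < c)%N -> (forall k, 0 <= g k <= 1) ->
  \sum_(k <- iota 0 c) gam c q k * g k <= \sum_(k <- iota 0 c.+1) trm p c k * g k + q ^+ c.
Proof.
move=> c0 g01; rewrite sum_trm.
have /andP[s0 s1] := sum_gam_01 c0 g01.
have qc : 0 <= q ^+ c by apply: exprn_ge0; exact: ltW.
have gc : 0 <= q ^+ c * g c by apply: mulr_ge0 => //; case/andP: (g01 c).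
under [X in _ <= X + _ + _]eq_bigr do rewrite (geo_gam _ c0) -mulrA.
rewrite -mulr_sumr; move: s0 s1 qc gc; set S := \sum_(_ <- _) _ => s0 s1 qc gc.
have := ler_wpM2l qc s1; rewrite mulr1; move: gc; lra.
Qed.

Lemma trm_gam c (g : nat -> R) : (0 < c)%N -> (forall k, 0 <= g k <= 1) ->
  \sum_(k <- iota 0 c.+1) trm p c k * g k <= \sum_(k <- iota 0 c) gam c q k * g k + q ^+ c.
Proof.
move=> c0 g01; rewrite sum_trm.
have /andP[s0 s1] := sum_gam_01 c0 g01.
have qc : 0 <= q ^+ c by apply: exprn_ge0; exact: ltW.
have gc : q ^+ c * g c <= q ^+ c by rewrite ler_piMr //; case/andP: (g01 c).
under [X in X + _ <= _]eq_bigr do rewrite (geo_gam _ c0) -mulrA.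
rewrite -mulr_sumr; move: s0 s1 qc gc; set S := \sum_(_ <- _) _ => s0 s1 qc gc.
have := mulr_ge0 qc s0; move: gc; lra.
Qed.

Lemma trm_ge0 c k : 0 <= trm p c k.
Proof.
have p0 : 0 <= p by case/andP: (p01) => /ltW.
have p1 : 0 <= 1 - p by rewrite subr_ge0; case/andP: (p01) => _ /ltW.
by rewrite /trm; case: ifP => _; rewrite ?mulr_ge0 ?exprn_ge0.
Qed.

Lemma trm_mass c : \sum_(k <- iota 0 c.+1) trm p c k = 1.
Proof.
have h := sum_trm c (fun=> 1); under eq_bigr do rewrite -[trm _ _ _]mulr1.
rewrite h; under eq_bigr do rewrite mulr1.
by rewrite sum_geo // mulr1 subrK.
Qed.

(** [trm] piles the excess mass at [c] while [gam] renormalises; on one cell they differ by at most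
    [q ^+ c] in either direction. *)
Lemma Eb_Qn L c a0 b0 M N F : (a0 + M <= L.+1)%N -> (b0 + N <= L.+1)%N ->
  boxed M N F -> (0 < M)%N -> (0 < c)%N -> (forall w, 0 <= F w <= 1) ->
  Qn c M N F - (M * N)%:R * q ^+ c <= Eb p (fun x => F (sh a0 b0 (@Wt L c x))) <=
  Qn c M N F + (M * N)%:R * q ^+ c.
Proof.
move=> aL bL bF M0 c0 F01; rewrite (Eb_Q p01 c aL bL bF M0).
have G0 k : 0 <= gam c q k by apply: gam_ge0; exact: ltW.
have qc : 0 <= q ^+ c by apply: exprn_ge0; exact: ltW.
apply/andP; split; rewrite ?lerBlDr; apply: Q_compare => //.
all: rewrite ?trm_mass ?gam_mass ?(ltW q0) //.
all: try exact: trm_ge0.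
- by move=> g g01; exact: gam_trm.
- by move=> g g01; exact: trm_gam.
Qed.

(** Every large n equals 2k + 2 or 2k + 3 for [k = (n - 2) %/ 2]. Starting from [5 * K] pays for the
    passage from k to n <= 5k. *)
Lemma upper_tail_diag (e K : R) : 0 < e -> 1000 * (100 * e) <= 1 -> 0 < K ->
  \forall n \near \oo, forall c, pw n e <= c%:R ->
  pw n (- (121 * kap e)) <=
  Qn c n.+1 n.+1 (fun w => (2 * mm * n%:R + K * pw n 3^-1 <= (lp w n n)%:R)%R%:R).
Proof.
move=> e0 e1 K0; have K5 : 0 < 5 * K by rewrite mulr_gt0.
have k0 := kap_gt0 e0.
have [N0 _ H] := upper_tail al0 al1 e0 e1 K5.
exists (N0 + N0 + 4)%N => // n /= hn c nc.
pose k := ((n - 2) %/ 2)%N.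
have kN : (N0 <= k)%N by rewrite /k; clear -hn; lia.
have k1 : (0 < k)%N by rewrite /k; clear -hn; lia.
have nk : (k + k + 2 <= n <= k + k + 3)%N by rewrite /k; clear -hn; lia.
have kn : (k <= n)%N by clear -nk; lia.
have n5 : (n <= 5 * k)%N by clear -nk k1; lia.
have n0 : (0 < n)%N by clear -nk; lia.
have kc : pw k e <= c%:R by apply: le_trans nc; apply: le_pw_base => //; exact: ltW.
have h := H k kN n c nk kc.
apply: le_trans (_ : pw k (- (121 * kap e)) <= _).
  by rewrite !pwN lef_pV2 ?posrE ?pw_gt0 //; apply: le_pw_base => //; move: k0; lra.
apply: le_trans h _; apply: (le_Qn al0 al1) => w.
have h5 : pw n 3^-1 <= 5 * pw k 3^-1 :> R by apply: pw_dilate => //; apply/andP; split; lra.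
have := ler_wpM2l (ltW K0) h5.
case: (lerP (2 * mm * n%:R + 5 * K * pw k 3^-1)) => // h1 h2.
rewrite (_ : (2 * mm * n%:R + K * pw n 3^-1 <= _) = true) //.
by move: h1 h2; set z := 2 * mm * _; lra.
Qed.

(** The variance is at least n^(2/3 - be) / 16 with be <= .011. The averaged low-degree weight is of
    order n^(1 + 3e - 3x), about n^.5875, and the shift cost is of order n^.58, so both are
    negligible. [K] is fixed beforehand to make [ro ^+ K] small. *)
Lemma finite_decorrelation (ro dl : R) : 0 <= ro < 1 -> 0 < dl ->
  \forall n \near \oo, exists l c, let f := @fsh R n l c 0 in [/\ (0 < l)%N,
    0 <= Eb2 p ro (fun x y => f x * f y) - Eb p f ^+ 2 <= dl * Varb p f,
    dl^-1 <= Varb p f & n.+1%:R ^+ 4 * (1 - p) ^+ c <= dl].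
Proof.
move=> r01 d0; have [r0 r1] := andP r01.
have d2 : 0 < dl / 2 by rewrite divr_gt0.
have d64 : 0 < dl / 64 by rewrite divr_gt0.
have [K hK] := exists_expr_le r01 d2.
pose e : R := 100^-1 / 1000.
have e0 : 0 < e by rewrite /e; lra.
have e1 : 1000 * (100 * e) <= 1 by rewrite /e; lra.
pose be := 121 * kap e.
have beE : 0 <= be <= 11 / 1000 by rewrite /be /kap /e; apply/andP; split; lra.
have [be0 be1] := andP beE.
have Ku0 : 0 < Kup alp + 1.
  by rewrite /Kup; have := mm_gt0 al0 al1; have := CT_gt0 al1; lra.
(* The side parameter is l of order n^(11/80), so the number of shifts m = l^4 is of order n^.55. *)
pose x : R := 11 / 80.
pose B := Bon p ^+ (2 * K).
near=> n.
have n1 : (1 <= n)%N by near: n; exists 1%N.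
have nR : pw n 1 = n%:R :> R by rewrite pw1.
have nR1 : 1 <= n%:R :> R by rewrite ler1n.
have UT : forall c, pw n e <= c%:R -> pw n (- be) <=
  Qn c n.+1 n.+1 (fun w => (2 * mm * n%:R + (Kup alp + 1) * pw n 3^-1 <= (lp w n n)%:R)%R%:R).
  by near: n; exact: upper_tail_diag.
have RT : forall c, massive alp c (4 * n) ->
  2^-1 <= Qn c n.+1 n.+1 (fun w => ((lp w n n)%:R <= 2 * mm * n%:R + Kup alp * pw n 3^-1)%R%:R).
  by near: n; exact: right_tail.
have SS : forall c m j, massive alp c (4 * n) ->
  (j <= m)%N -> j%:R <= pw n (55 / 100) :> R ->
  Qn c (n + m).+1 (n + m).+1 (fun w =>
    (4 * pw n (29 / 100) < `|(lp (sh 0 m w) n n)%:R - (lp (sh j (m - j) w) n n)%:R| :> R)%R%:R)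
  <= pw n (- 8) by near: n; exact: shift_small.
have MV : forall c, pw n e <= c%:R -> massive alp c (4 * n) by near: n; exact: ev_massive.
have RH : forall c, pw n e <= c%:R -> rho alp ^+ c <= pw n (- 8) by near: n; exact: ev_rho.
have A1 : 8 * pw n (- 6) <= pw n (- be) by near: n; apply: ev_pw; move: (be0) (be1); clear -p01 al0 al1 q0 q1; lra.
have A2 : 16 * pw n (- 6) <= 1 * pw n 0 :> R by near: n; apply: ev_pw2; clear -p01 al0 al1 q0 q1; lra.
have A3 : 10 * pw n (- 2) <= pw n (58 / 100) :> R by near: n; apply: ev_pw; clear -p01 al0 al1 q0 q1; lra.
have A4 : 6 * pw n (e + 1) <= pw n 2 by near: n; apply: ev_pw; rewrite /e; clear -p01 al0 al1 q0 q1; lra.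
have A5 : 16 * pw n (- 4) <= dl * pw n 0 by near: n; apply: ev_pw2 => //; clear -p01 al0 al1 q0 q1; lra.
have A6 : dl^-1 * pw n 0 <= 16^-1 * pw n (2 / 3 - be) by near: n; apply: ev_pw2; move: (be0) (be1); clear -p01 al0 al1 q0 q1; lra.
have A7 : 384 * B * pw n (3 * e + 1 - 3 * x) <= dl / 64 * pw n (2 / 3 - be).
  by near: n; apply: ev_pw2 => //; rewrite /x /e; move: (be1); clear -p01 al0 al1 q0 q1; lra.
have A8 : 34 * pw n (58 / 100) <= dl / 64 * pw n (2 / 3 - be).
  by near: n; apply: ev_pw2 => //; move: (be0) (be1); clear -p01 al0 al1 q0 q1; lra.
have P1 : 1 <= pw n e by apply: pw_ge1; exact: ltW.
have P2 : 1 <= pw n x by apply: pw_ge1; rewrite /x; clear -p01 al0 al1 q0 q1; lra.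
have /andP[T1 T2] := truncn_itv (le_trans ler01 P1).
have /andP[L1 L2] := truncn_bounds P2.
pose c := (Num.truncn (pw n e)).+1; pose l := Num.truncn (pw n x).
have cR : c%:R <= 2 * pw n e by rewrite /c -natr1; move: T1 P1; clear -p01 al0 al1 q0 q1; lra.
have ec : pw n e <= c%:R by exact: ltW.
have c0 : (0 < c)%N by [].
have l0 : (0 < l)%N by rewrite -(ltr0n R); move: L1 P2; rewrite -/l; clear -p01 al0 al1 q0 q1; lra.
have mv := MV c ec.
have qc : q ^+ c <= pw n (- 8).
  apply: le_trans (RH c ec); apply: lerXn2r; rewrite ?nnegrE; try exact: ltW q0.
    exact: le_trans (ltW q0) (qq_le al0 al1).
  exact: qq_le al0 al1.
have qc0 : 0 <= q ^+ c by apply: exprn_ge0; exact: ltW.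
pose m := (l ^ 4)%N.
have mR : m%:R <= pw n (55 / 100) :> R.
  rewrite natrX; apply: (@le_trans _ _ (pw n x ^+ 4)); first by rewrite lerXn2r ?nnegrE ?pw_ge0.
  by rewrite pwX; apply: le_pw; rewrite /x; clear -p01 al0 al1 q0 q1; lra.
have mn : (m <= n)%N.
  by rewrite -(ler_nat R) -nR; apply: le_trans mR _; apply: le_pw; clear -p01 al0 al1 q0 q1; lra.
have p8 a : n%:R ^+ a * pw n (- 8) = pw n (a%:R - 8) :> R by rewrite -nR pwX -pwD mulr1.
exists l, c; pose f := @fsh R n l c 0; rewrite -/f.
have ind01 (b : (nat -> nat -> nat) -> bool) : forall w, 0 <= ((b w)%:R : R) <= 1.
  by move=> w; rewrite ler0n natb_le1.
have E0 F : boxed n.+1 n.+1 F -> (forall w, 0 <= F w <= 1) ->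
  Qn c n.+1 n.+1 F - 4 * pw n (- 6) <= Eb p (fun y => F (sh 0 m (@Wt (n + m) c y))).
  move=> bF F01; have aL : (0 + n.+1 <= (n + m).+1)%N by clear -p01 al0 al1 q0 q1; lia.
  have bL : (m + n.+1 <= (n + m).+1)%N by clear -p01 al0 al1 q0 q1; lia.
  have /andP[h _] := Eb_Qn aL bL bF (ltn0Sn n) c0 F01; apply: le_trans h; rewrite lerD2l lerN2.
  have -> : - 6 = 2%:R - 8 :> R by clear -p01 al0 al1 q0 q1; lra.
  rewrite -p8 mulrA; apply: ler_pM => //.
  by rewrite -natrX -natrM ler_nat; clear -n1; nia.
have fE y : f y = (lp (sh 0 m (@Wt (n + m) c y)) n n)%:R by rewrite /f fsh_lp subn0.
set u := 2 * mm * n%:R + (Kup alp + 1) * pw n 3^-1 in UT.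
set v := 2 * mm * n%:R + Kup alp * pw n 3^-1 in RT.
have uvE : u - v = pw n 3^-1 by rewrite /u /v; ring.
have Vu : 4^-1 * pw n (- be) <= Eb p (fun y => (u <= f y)%R%:R).
  apply: le_trans (_ : pw n (- be) - 4 * pw n (- 6) <= _).
    by move: A1 (pw_ge0 n (- be)); clear -p01 al0 al1 q0 q1; lra.
  apply: (@le_trans _ _ (Qn c n.+1 n.+1 (fun w => (u <= (lp w n n)%:R)%R%:R) - 4 * pw n (- 6))).
    by rewrite lerD2r; exact: UT.
  have h := E0 (fun w => (u <= (lp w n n)%:R)%R%:R) _ (ind01 _).
  have {}h := h ltac:(by move=> w w' ww; rewrite (boxed_lp _ _ ww)).
  by apply: le_trans h _; rewrite le_eqVlt; apply/orP; left; apply/eqP; apply: eq_Eb => y; rewrite fE.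
have pb1 : pw n (- be) <= 1.
  by have := @le_pw R n (- be) 0; rewrite pw0; apply; move: (be0); clear -p01 al0 al1 q0 q1; lra.
have Vv : 4^-1 * pw n (- be) <= Eb p (fun y => (f y <= v)%R%:R).
  apply: le_trans (_ : 2^-1 - 4 * pw n (- 6) <= _).
    by move: A2 pb1; rewrite pw0; clear -p01 al0 al1 q0 q1; lra.
  apply: (@le_trans _ _ (Qn c n.+1 n.+1 (fun w => ((lp w n n)%:R <= v)%R%:R) - 4 * pw n (- 6))).
    by rewrite lerD2r; exact: RT.
  have h := E0 (fun w => ((lp w n n)%:R <= v)%R%:R) _ (ind01 _).
  have {}h := h ltac:(by move=> w w' ww; rewrite (boxed_lp _ _ ww)).
  by apply: le_trans h _; rewrite le_eqVlt; apply/orP; left; apply/eqP; apply: eq_Eb => y; rewrite fE.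
have Vf : 16^-1 * pw n (2 / 3 - be) <= Varb p f.
  have uv : v <= u by rewrite -subr_ge0 uvE pw_ge0.
  have a0 : 0 <= 4^-1 * pw n (- be) by apply: mulr_ge0; rewrite ?pw_ge0.
  have := Varb_two_tails p01 uv a0 Vu Vv; rewrite uvE; apply: le_trans.
  have -> : pw n (2 / 3 - be) = pw n 3^-1 ^+ 2 * pw n (- be) :> R.
    by rewrite pwX -pwD; congr pw; clear -p01 al0 al1 q0 q1; lra.
  by rewrite le_eqVlt; apply/orP; left; apply/eqP; field.
have cq6 : 10 * pw n (- 6) = 10 * (n%:R ^+ 2 * pw n (- 8)) :> R.
  by rewrite p8; congr (_ * pw _ _); clear -p01 al0 al1 q0 q1; lra.
(* Off an event of probability at most 10 n^(-6) the difference is at most 4 n^.29; on that event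
   the crude bound n^2 on passage times is enough. *)
have Dj j : (j < m)%N -> Eb p (fun y => (@fsh R n l c 0 y - @fsh R n l c j y) ^+ 2) <= 17 * pw n (58 / 100).
  move=> jm; have jm' := ltnW jm.
  have jR : j%:R <= pw n (55 / 100) :> R by apply: le_trans mR; rewrite ler_nat.
  pose F w : R := (4 * pw n (29 / 100) < `|(lp (sh 0 m w) n n)%:R - (lp (sh j (m - j) w) n n)%:R| :> R)%R%:R.
  have bF : boxed (n + m).+1 (n + m).+1 F.
    move=> w w' ww; rewrite /F.
    have -> : lp (sh 0 m w) n n = lp (sh 0 m w') n n.
      by apply: lp_ext => a b an bn; rewrite !shE; apply: ww; clear -an bn; lia.
    have -> // : lp (sh j (m - j) w) n n = lp (sh j (m - j) w') n n.
    by apply: lp_ext => a b an bn; rewrite !shE; apply: ww; clear -an bn jm; lia.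
  have FL : (0 + (n + m).+1 <= (n + m).+1)%N by [].
  have /andP[_ hF] := Eb_Qn FL FL bF (ltn0Sn _) c0 (ind01 _).
  have {}hF : Eb p (fun y => F (sh 0 0 (@Wt (n + m) c y))) <= 10 * pw n (- 6).
    apply: le_trans hF _; rewrite cq6.
    have s1 := SS c m j mv jm' jR.
    have s2 : ((n + m).+1 * (n + m).+1)%:R * q ^+ c <= 9 * n%:R ^+ 2 * pw n (- 8).
      by apply: ler_pM => //; rewrite -natrX -natrM ler_nat; clear -n1 mn; nia.
    have s3 : pw n (- 8) <= n%:R ^+ 2 * pw n (- 8) :> R by rewrite ler_peMl ?pw_ge0 // exprn_ege1.
    apply: le_trans (lerD s1 s2) _; move: s3; rewrite -[9 * _ * _]mulrA.
    by clear -p01 al0 al1 q0 q1; lra.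
  apply: (@le_trans _ _ (Eb p (fun y => 16 * pw n (58 / 100) + pw n 4 * F (sh 0 0 (@Wt (n + m) c y))))); last first.
    rewrite EbD Eb_cst EbZ.
    have s4 := ler_wpM2l (pw_ge0 n (4 : R)) hF.
    have s5 : pw n 4 * (10 * pw n (- 6)) = 10 * pw n (- 2) :> R.
      by rewrite mulrCA -pwD; congr (_ * pw _ _); clear -p01 al0 al1 q0 q1; lra.
    by move: s4 A3; rewrite s5; clear -p01 al0 al1 q0 q1; lra.
  apply: le_Eb => // y; rewrite !fsh_lp subn0 -/m.
  have WW a b a' b' : (sh a' b' (@Wt (n + m) c y) a b <= c)%N by exact: Wt_le.
  have b1 := lp_le_max n n (fun a b => WW a b 0 m).
  have b2 := lp_le_max n n (fun a b => WW a b j (m - j)%N).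
  rewrite /F -[sh 0 0 _]/(@Wt (n + m) c y).
  set X := lp _ n n in b1 *; set Y := lp (sh j _ _) n n in b2 *.
  have s6 : 16 * pw n (58 / 100) = (4 * pw n (29 / 100)) ^+ 2 :> R.
    by rewrite exprMn pwX -natrX; congr (_ * pw _ _); clear -p01 al0 al1 q0 q1; lra.
  case: (ltrP (4 * pw n (29 / 100))) => h; rewrite ?mulr1 ?mulr0 ?addr0; last first.
    rewrite s6 -(real_normK (num_real (X%:R - Y%:R : R))) lerXn2r ?nnegrE ?normr_ge0 //.
    by apply: mulr_ge0 => //; exact: pw_ge0.
  apply: le_trans (_ : pw n 4 <= _); last by rewrite lerDr s6 sqr_ge0.
  have -> : pw n 4 = pw n 2 ^+ 2 :> R by rewrite pwX; congr pw; clear -p01 al0 al1 q0 q1; lra.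
  rewrite -(real_normK (num_real (X%:R - Y%:R : R))) lerXn2r ?nnegrE ?pw_ge0 //.
  have bd (Z : nat) : (Z <= c * (n + n).+1)%N -> Z%:R <= pw n 2 :> R.
    move=> hZ; apply: le_trans A4; rewrite pwD nR.
    apply: (@le_trans _ _ (c%:R * (3 * n%:R))).
      by rewrite -!natrM ler_nat; apply: leq_trans hZ _; rewrite leq_mul2l; apply/orP; right; clear -n1; lia.
    rewrite (_ : 6 * (pw n e * n%:R) = 2 * pw n e * (3 * n%:R)); last by clear -p01 al0 al1 q0 q1; ring.
    by rewrite ler_wpM2r // mulr_ge0.
  have bX := bd _ b1; have bY := bd _ b2.
  rewrite ler_norml; have := ler0n R X; have := ler0n R Y; move: bX bY; clear -p01 al0 al1 q0 q1 => *.
  by apply/andP; split; lra.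
have W := wt_lpp p01 l0 K Dj.
have l3 : (l%:R ^+ 3)^-1 <= 8 * pw n (- (3 * x)).
  rewrite pwN -[8]invrK -invfM lef_pV2 ?posrE ?exprn_gt0 ?ltr0n //; last first.
    by apply: mulr_gt0; rewrite ?pw_gt0.
  have := @lerXn2r R 3 (pw n x / 2) l%:R; rewrite !nnegrE => /(_ _ _ L1) h.
  rewrite (_ : 8^-1 * pw n (3 * x) = (pw n x / 2) ^+ 3).
    by apply: h; rewrite ?divr_ge0 ?pw_ge0.
  by rewrite expr_div_n pwX mulrC; congr (_ / _); rewrite -natrX.
have B0 : 0 <= B by apply: exprn_ge0; apply: le_trans (Bon_ge4 p).
have W1 : c%:R ^+ 3 * Bon p ^+ (2 * K) * (n + n).+1%:R / l%:R ^+ 3 <= 192 * B * pw n (3 * e + 1 - 3 * x).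
  have c3 : c%:R ^+ 3 <= 8 * pw n (3 * e).
    have -> : 8 * pw n (3 * e) = (2 * pw n e) ^+ 3 :> R by rewrite exprMn pwX -natrX.
    by rewrite lerXn2r ?nnegrE //; apply: mulr_ge0 => //; exact: pw_ge0.
  have n3 : (n + n).+1%:R <= 3 * pw n 1 :> R by rewrite nR -natrM ler_nat; clear -n1; lia.
  have -> : 192 * B * pw n (3 * e + 1 - 3 * x) = 8 * pw n (3 * e) * B * (3 * pw n 1) * (8 * pw n (- (3 * x))) :> R.
    by rewrite (pwD n (3 * e + 1)) (pwD n (3 * e)); clear -p01 al0 al1 q0 q1; ring.
  apply: ler_pM => //; rewrite ?invr_ge0 ?exprn_ge0 //.
    by apply: mulr_ge0 => //; apply: mulr_ge0 => //; exact: exprn_ge0.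
  apply: ler_pM => //; first by apply: mulr_ge0 => //; exact: exprn_ge0.
  by apply: ler_wpM2r.
have Wt2 : wt p K f <= dl / 2 * Varb p f.
  apply: le_trans W _.
  have := ler_wpM2l (ltW d2) Vf; move: W1 A7 A8; clear -p01 al0 al1 q0 q1.
  set z := _ / _; set y1 := pw n (2 / 3 - be); set y2 := pw n (3 * e + 1 - 3 * x); lra.
have V0 : 0 <= Varb p f by apply: le_trans Vf; apply: mulr_ge0; rewrite ?pw_ge0.
have r01' : 0 <= ro <= 1 by rewrite r0 ltW.
have /andP[N1 N2] := noise_cov p01 K f r01'.
split=> //.
- rewrite N1 /=; apply: le_trans N2 _.
  by have := ler_wpM2r V0 hK; move: Wt2; clear -p01 al0 al1 q0 q1; lra.
- by move: A6 Vf; rewrite pw0; clear -p01 al0 al1 q0 q1; lra.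
- rewrite -qq_alp; apply: le_trans (_ : 16 * pw n (- 4) <= _); last first.
    by move: A5; rewrite pw0 mulr1.
  have -> : - 4 = 4%:R - 8 :> R by clear -p01 al0 al1 q0 q1; lra.
  rewrite -p8 mulrA; apply: ler_pM => //.
  have h : n.+1%:R <= 2 * n%:R :> R by rewrite -natrM ler_nat; clear -n1; lia.
  have -> : 16 * n%:R ^+ 4 = (2 * n%:R) ^+ 4 :> R by clear -p01 al0 al1 q0 q1; ring.
  by rewrite lerXn2r ?nnegrE // mulr_ge0.
Unshelve. all: by end_near. Qed.

End FiniteModel.

(** * Correlation and approximation *)

Section CorrelationBound.
Context (d : measure_display) (T : measurableType d) (R : realType) (P : probability T R).
Implicit Types X Y Z : T -> R.
Local Notation cv X Y := (fine (covariance P X Y)).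
Local Notation L2 := (Lfun P 2%:E).

Lemma Lfun2_sqr_lty X : measurable_fun setT X ->
  (\int[P]_w ((X w) ^+ 2)%:E < +oo)%E -> X \in L2.
Proof.
move=> mf h; rewrite inE; apply/andP; split; first by rewrite inE.
rewrite inE /= /finite_norm unlock /=; apply: poweR_lty.
apply: le_lt_trans h; rewrite le_eqVlt; apply/orP; left; apply/eqP; apply: eq_integral => w _ /=.
by rewrite powR_mulrn // real_normK ?num_real.
Qed.

Let Pfin : P setT \is a fin_num. Proof. exact: fin_num_measure. Qed.

Lemma cov_fin_num X Y : X \in L2 -> Y \in L2 -> covariance P X Y \is a fin_num.
Proof.
move=> X2 Y2; apply: covariance_fin_num; try exact: (Lfun_subset12 Pfin).
exact: Lfun2_mul_Lfun1.
Qed.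

Lemma fine_covC X Y : cv X Y = cv Y X. Proof. by rewrite covarianceC. Qed.

Lemma fine_covDl X Y Z : X \in L2 -> Y \in L2 -> Z \in L2 ->
  cv (X \+ Y) Z = cv X Z + cv Y Z.
Proof. by move=> X2 Y2 Z2; rewrite covarianceDl // fineD ?cov_fin_num. Qed.

Lemma fine_cov_expand X Y Z W : X \in L2 -> Y \in L2 -> Z \in L2 -> W \in L2 ->
  cv (X \+ Y) (Z \+ W) = cv X Z + cv X W + (cv Y Z + cv Y W).
Proof.
move=> X2 Y2 Z2 W2; have ZW2 : Z \+ W \in L2 by rewrite rpredD // ?lee_fin ?ler1n.
rewrite fine_covDl // (fine_covC X (Z \+ W)) (fine_covC Y (Z \+ W)) !fine_covDl //.
by rewrite (fine_covC Z X) (fine_covC W X) (fine_covC Z Y) (fine_covC W Y).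
Qed.

Lemma fine_cov_le X Y : X \in L2 -> Y \in L2 ->
  cv X Y <= Num.sqrt (cv X X) * Num.sqrt (cv Y Y).
Proof.
move=> X2 Y2; have := covariance_le X2 Y2.
rewrite /variance -(fineK (cov_fin_num X2 Y2)) -(fineK (cov_fin_num X2 X2)).
by rewrite -(fineK (cov_fin_num Y2 Y2)) /= -EFinM lee_fin.
Qed.

Lemma fine_cov_norm_le X Y : X \in L2 -> Y \in L2 ->
  `|cv X Y| <= Num.sqrt (cv X X) * Num.sqrt (cv Y Y).
Proof.
move=> X2 Y2; rewrite ler_norml fine_cov_le // andbT lerNl.
have NX2 : (\- X) \in L2 by rewrite rpredN.
have X1 := Lfun_subset12 Pfin X2; have Y1 := Lfun_subset12 Pfin Y2.
have := fine_cov_le NX2 Y2.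
have -> : cv (\- X) (\- X) = cv X X by have := varianceN X2; rewrite /variance => ->.
by rewrite covarianceNl // ?fineN //; exact: Lfun2_mul_Lfun1.
Qed.

Lemma fine_var_ge0 X : 0 <= cv X X.
Proof. by apply: fine_ge0; exact: variance_ge0. Qed.

Lemma fine_var_le X (r : R) : X \in L2 -> (\int[P]_w ((X w) ^+ 2)%:E <= r%:E)%E -> cv X X <= r.
Proof.
move=> X2 h; have X1 := Lfun_subset12 Pfin X2.
rewrite -lee_fin fineK ?cov_fin_num // -/(variance P X) varianceE //.
rewrite -(fineK (expectation_fin_num X1)) -EFin_expe leeBlDr //.
apply: le_trans (_ : r%:E <= _)%E; last by rewrite -EFinD lee_fin lerDl sqr_ge0.
by rewrite unlock.
Qed.

(* [A = a + U] and [B = b + W], and the three covariances involving [U] or [W] are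
   of lower order by Cauchy-Schwarz. *)
Lemma correlation_perturb (A B a b : T -> R) (V eta : R) :
  A \in L2 -> B \in L2 -> a \in L2 -> b \in L2 ->
  cv a a = V -> cv b b = V -> `|cv a b| <= eta ^+ 2 * V ->
  0 < eta -> eta <= 4^-1 -> (eta ^+ 2)^-1 <= V ->
  cv (A \- a) (A \- a) <= 1 -> cv (B \- b) (B \- b) <= 1 ->
  `|correlation P A B| <= 8 * eta.
Proof.
move=> A2 B2 a2 b2 Va Vb kab e0 e1 Vl UU WW.
set U := A \- a; set W := B \- b.
have U2 : U \in L2 by rewrite rpredB // ?lee_fin ?ler1n.
have W2 : W \in L2 by rewrite rpredB // ?lee_fin ?ler1n.
have AE : A = a \+ U by apply/funext => w /=; rewrite addrC subrK.
have BE : B = b \+ W by apply/funext => w /=; rewrite addrC subrK.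
have V0 : 0 < V by apply: lt_le_trans Vl; rewrite invr_gt0 exprn_gt0.
set s := Num.sqrt V; have s0 : 0 < s by rewrite sqrtr_gt0.
have sV : V = s * s by rewrite -expr2 sqr_sqrtr // ltW.
have es : 1 <= eta * s.
  rewrite -ler_pdivrMl // mulr1 -(ler_pXn2r (ltn0Sn 1)) ?nnegrE ?invr_ge0 ?(ltW e0) ?(ltW s0) //.
  by rewrite exprVn [leRHS]expr2 -sV.
have sU : Num.sqrt (cv U U) <= 1 by rewrite -[leRHS]sqrtr1 ler_sqrt.
have sW : Num.sqrt (cv W W) <= 1 by rewrite -[leRHS]sqrtr1 ler_sqrt.
have c1 : `|cv a W| <= s.
  by apply: le_trans (fine_cov_norm_le a2 W2) _; rewrite Va ler_piMr ?sqrtr_ge0.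
have c2 : `|cv U b| <= s.
  by apply: le_trans (fine_cov_norm_le U2 b2) _; rewrite Vb ler_piMl ?sqrtr_ge0.
have c3 : `|cv U W| <= 1.
  by apply: le_trans (fine_cov_norm_le U2 W2) _; rewrite mulr_ile1 ?sqrtr_ge0.
have c4 : `|cv U a| <= s.
  by apply: le_trans (fine_cov_norm_le U2 a2) _; rewrite Va ler_piMl ?sqrtr_ge0.
have c5 : `|cv W b| <= s.
  by apply: le_trans (fine_cov_norm_le W2 b2) _; rewrite Vb ler_piMl ?sqrtr_ge0.
have AB := fine_cov_expand a2 U2 b2 W2; rewrite -AE -BE in AB.
have AA := fine_cov_expand a2 U2 a2 U2; rewrite -AE Va (fine_covC a U) in AA.
have BB := fine_cov_expand b2 W2 b2 W2; rewrite -BE Vb (fine_covC b W) in BB.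
have sE : s <= eta * V by rewrite sV mulrA ler_peMl ?(ltW s0).
have oE : 1 <= eta ^+ 2 * V.
  rewrite sV (_ : eta ^+ 2 * (s * s) = (eta * s) * (eta * s)); last ring.
  by apply: mulr_ege1.
have eV : eta ^+ 2 * V <= 4^-1 * (eta * V).
  by rewrite expr2 -mulrA ler_wpM2r // mulr_ge0 ?(ltW e0) ?(ltW V0).
have hAB : `|cv A B| <= 4 * (eta * V).
  have t1 := ler_normD (cv a b + cv a W) (cv U b + cv U W).
  have t2 := ler_normD (cv a b) (cv a W); have t3 := ler_normD (cv U b) (cv U W).
  have eV0 : 0 <= eta * V by rewrite mulr_ge0 ?(ltW e0) ?(ltW V0).
  rewrite AB; move: t1 t2 t3 kab c1 c2 c3 sE oE eV eV0; clear; lra.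
have eV2 : eta * V <= 4^-1 * V by rewrite ler_wpM2r // ltW.
have hAA : V / 2 <= cv A A.
  have [n1 _] := andP (etrans (esym (ler_norml _ _)) c4).
  have := fine_var_ge0 U; rewrite AA; move: n1 sE eV2; clear; lra.
have hBB : V / 2 <= cv B B.
  have [n1 _] := andP (etrans (esym (ler_norml _ _)) c5).
  have := fine_var_ge0 W; rewrite BB; move: n1 sE eV2; clear; lra.
have V2 : 0 < V / 2 by rewrite divr_gt0.
have hS : V / 2 <= Num.sqrt (cv A A * cv B B).
  rewrite -[leLHS]ger0_norm ?(ltW V2) // -sqrtr_sqr ler_wsqrtr // expr2.
  by apply: ler_pM => //; exact: ltW.
rewrite /correlation /variance normrM normfV [X in _ / X]ger0_norm ?sqrtr_ge0 //.
rewrite ler_pdivrMr; last exact: lt_le_trans hS.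
apply: le_trans hAB _; have := ler_wpM2l (ltW e0) hS; clear; lra.
Qed.

End CorrelationBound.

(** * Images of finite product laws *)

Section FiniteMarginals.
Variables (R : realType) (I A : finType) (mu : A -> R).

Lemma Ex_image (B : finType) (s : A -> B) (F : {ffun I -> B} -> R) :
  Ex (fun _ => mu) (fun z => F [ffun i => s (z i)]) =
  \sum_(y : {ffun I -> B}) (\prod_i \sum_(a | s a == y i) mu a) * F y.
Proof.
rewrite /Ex (partition_big (fun z : {ffun I -> A} => [ffun i => s (z i)]) predT) //=.
apply: eq_bigr => y _; rewrite bigA_distr_big_dep mulr_suml; apply: eq_big => z.
  apply/eqP/familyP => [<- i|h]; first by rewrite unfold_in ffunE.
  by apply/ffunP => i; rewrite ffunE; have := h i; rewrite unfold_in => /eqP.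
by move/eqP => <-.
Qed.

Lemma Ex_image2 (B : finType) (s s' : A -> B) (F : {ffun I -> B} -> {ffun I -> B} -> R) :
  Ex (fun _ => mu) (fun z => F [ffun i => s (z i)] [ffun i => s' (z i)]) =
  \sum_(x : {ffun I -> B}) \sum_(y : {ffun I -> B})
    (\prod_i \sum_(a | (s a == x i) && (s' a == y i)) mu a) * F x y.
Proof.
rewrite pair_bigA /= /Ex.
rewrite (partition_big (fun z : {ffun I -> A} => ([ffun i => s (z i)], [ffun i => s' (z i)])) predT) //=.
apply: eq_bigr => -[x y] _ /=; rewrite bigA_distr_big_dep mulr_suml; apply: eq_big => z.
  apply/eqP/familyP => [[<- <-] i|h]; first by rewrite unfold_in !ffunE !eqxx.
  by congr pair; apply/ffunP => i; rewrite ffunE; have := h i; rewrite unfold_in => /andP[/eqP ? /eqP].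
by move/eqP => [<- <-].
Qed.

End FiniteMarginals.

(** * Truncation of the weights *)

Section Truncation.
Implicit Types (b : nat -> bool) (w : nat -> nat -> nat).

Lemma lp_perturb w w' e i j :
  (forall x y, (x <= i)%N -> (y <= j)%N -> (w x y <= w' x y + e)%N) ->
  (lp w i j <= lp w' i j + e * (i + j).+1)%N.
Proof.
elim: i j => [|i IHi] j; elim: j => [|j IHj] h.
- by have := h 0%N 0%N isT isT; rewrite muln1.
- have h1 : (lp w 0 j <= lp w' 0 j + e * (0 + j).+1)%N by apply: IHj => x y hx hy; apply: h => //; lia.
  have := h 0%N j.+1 isT (leqnn _); rewrite !lp0S; move: h1; rewrite !add0n !mulnS; lia.
- have h1 : (lp w i 0 <= lp w' i 0 + e * (i + 0).+1)%N by apply: IHi => x y hx hy; apply: h => //; lia.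
  have := h i.+1 0%N (leqnn _) isT; rewrite !lpS0; move: h1; rewrite !addn0 !mulnS; lia.
- have h1 : (lp w i j.+1 <= lp w' i j.+1 + e * (i + j.+1).+1)%N by apply: IHi => x y hx hy; apply: h => //; lia.
  have h2 : (lp w i.+1 j <= lp w' i.+1 j + e * (i.+1 + j).+1)%N by apply: IHj => x y hx hy; apply: h => //; lia.
  have := h i.+1 j.+1 (leqnn _) (leqnn _); rewrite !lpSS; move: h1 h2; rewrite !addSn !addnS !mulnS; lia.
Qed.

Lemma first_successP b :
  (b (first_success b) /\ forall j, (j < first_success b)%N -> b j = false) \/
  ((forall j, b j = false) /\ first_success b = 0%N).
Proof.
rewrite /first_success; case: pselect => [h|h].
  left; case: ex_minnP => m bm hm; split=> // j jm.
  by apply/negbTE/negP => /hm; rewrite leqNgt jm.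
by right; split=> // j; apply/negbTE/negP => bj; apply: h; exists j.
Qed.

(** The weight as seen through the first [c] bits; its value is [c] when all of them fail. *)
Definition tfind b c : nat := find id (mkseq b c).

Lemma tfindP b c : [/\ (tfind b c <= c)%N, (tfind b c < c)%N -> b (tfind b c) &
  forall j, (j < tfind b c)%N -> b j = false].
Proof.
have fc : (tfind b c <= c)%N by rewrite -[leqRHS](size_mkseq b) find_size.
split=> // [h|j h].
  have := @nth_find _ false id (mkseq b c); rewrite has_find size_mkseq => /(_ h).
  by rewrite nth_mkseq.
by have := before_find false h; rewrite nth_mkseq // (leq_trans h).
Qed.

(** A disagreement forces [tfind b c = c]. Then either the first success comes at [c + k + 1], or
    there is none at all and the default value 0 of [first_success] is in play. *)
Lemma first_success_gap b c k : first_success b = (tfind b c + k.+1)%N \/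
  tfind b c = (first_success b + k.+1)%N -> forall i, (i <= c + k)%N -> b i = false.
Proof.
have [fc f1 f2] := tfindP b c; move=> h i ik.
case: (first_successP b) => [[bm hm]|[-> //]].
case: h => h; last by have := f2 (first_success b); rewrite h bm => /(_ _); lia.
suff e : tfind b c = c by apply: hm; move: ik h; lia.
apply/eqP; rewrite eqn_leq fc leqNgt; apply/negP => /f1.
by rewrite hm // h; lia.
Qed.

(** Replacing the value [c] by 0 makes the limit in [c] correct on the null event as well, where
    [first_success] is 0. *)
Lemma tfind_eventually b c : (first_success b < c)%N ->
  (if (tfind b c < c)%N then tfind b c else 0%N) = first_success b.
Proof.
have [fc f1 f2] := tfindP b c; move=> h.
case: (first_successP b) => [[bm hm]|[b0 ->]]; last first.
  by case: ifP => // /f1; rewrite b0.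
have e : tfind b c = first_success b.
  case: (ltngtP (tfind b c) (first_success b)) => // h1; last by rewrite f2 in bm.
  by have := f1 (ltn_trans h1 h); rewrite hm.
by rewrite e h.
Qed.

End Truncation.

Lemma prode_EFin (R : realType) (I : Type) (s : seq I) (f : I -> R) :
  (\prod_(i <- s) (f i)%:E)%E = (\prod_(i <- s) f i)%:E.
Proof. by elim/big_rec2: _ => // i x y _ ->; rewrite EFinM. Qed.

(** A letter records a bit, its replacement, and whether the original bit is still in force at time
    t. *)
Notation A3 := (bool * bool * bool)%type.

(** * Environments driven by a field of independent letters *)

Section Process.
Context (d : measure_display) (T : measurableType d) (R : realType) (P : probability T R).
Variables (mu : A3 -> R) (zt : int * int -> nat -> T -> A3).
Hypothesis zt_meas : forall v i a, measurable [set w | zt v i w = a].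
Hypothesis zt_law : forall (I : finType) (k : I -> (int * int) * nat) (z : {ffun I -> A3}),
  injective k -> P [set w | forall i, zt (k i).1 (k i).2 w = z i] = (\prod_i mu (z i))%:E.

Section FiniteIndex.
Variables (I : finType) (k : I -> (int * int) * nat).

Definition Zf w : {ffun I -> A3} := [ffun i => zt (k i).1 (k i).2 w].

Lemma Zf_eqE z : [set w | Zf w = z] = [set w | forall i, zt (k i).1 (k i).2 w = z i].
Proof.
apply/seteqP; split=> w /=; first by move=> <- i; rewrite ffunE.
by move=> h; apply/ffunP => i; rewrite ffunE.
Qed.

Lemma Zf_meas z : measurable [set w | Zf w = z].
Proof.
rewrite Zf_eqE (_ : [set w | _] = \bigcap_(i in [set: I]) [set w | zt (k i).1 (k i).2 w = z i]).
  by apply: fin_bigcap_measurable => //; exact: finite_finset.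
by apply/seteqP; split=> w /= h i; [move=> _|]; exact: h.
Qed.

Lemma Zf_sum (G : {ffun I -> A3} -> R) w :
  G (Zf w) = \sum_(z : {ffun I -> A3}) G z * \1_[set w | Zf w = z] w.
Proof.
rewrite (bigD1 (Zf w)) //= indicE mem_set // mulr1 big1 ?addr0 // => z /eqP ne.
by rewrite indicE memNset ?mulr0 // => /= h; apply: ne.
Qed.

Lemma Zf_mfun (G : {ffun I -> A3} -> R) : measurable_fun setT (fun w => G (Zf w)).
Proof.
rewrite (_ : (fun w => _) = fun w => \sum_(z : {ffun I -> A3}) G z * \1_[set w | Zf w = z] w).
  apply: measurable_sum => z; apply: measurable_funM; first exact: measurable_cst.
  by apply: measurable_indic; exact: Zf_meas.
by apply/funext => w; exact: Zf_sum.
Qed.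

Lemma Zf_exp (G : {ffun I -> A3} -> R) : injective k ->
  (\int[P]_w (G (Zf w))%:E)%E = (Ex (fun _ => mu) G)%:E.
Proof.
move=> kinj.
under eq_integral do rewrite Zf_sum -sumEFin.
rewrite integral_sum //; last first.
  move=> z; under eq_fun do rewrite EFinM.
  by apply: integrableZl => //; apply: integrable_indic; exact: Zf_meas.
rewrite /Ex -sumEFin; apply: eq_bigr => z _.
under eq_integral do rewrite EFinM.
rewrite integralZl //; last by apply: integrable_indic; exact: Zf_meas.
rewrite integral_indic ?setIT; try exact: Zf_meas; try exact: measurableT.
have PE : P [set w | Zf w = z] = (\prod_i mu (z i))%:E by rewrite Zf_eqE; exact: zt_law.
by apply: etrans (congr1 (fun x => (G z)%:E * x)%E PE) _; rewrite mulrC EFinM.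
Qed.

Lemma Zf_Lfun2 (G : {ffun I -> A3} -> R) : injective k -> (fun w => G (Zf w)) \in Lfun P 2%:E.
Proof.
move=> kinj; apply: Lfun2_sqr_lty; first exact: Zf_mfun.
by rewrite (Zf_exp (fun z => G z ^+ 2)) // ltry.
Qed.

End FiniteIndex.

Section Weights.
Variables (p : R) (s : A3 -> bool).
Hypothesis s_law : forall b, \sum_(a | s a == b) mu a = bit p b.

Lemma Zf_exp_bits (I : finType) (k : I -> (int * int) * nat) (F : {ffun I -> bool} -> R) :
  injective k ->
  (\int[P]_w (F [ffun i => s (Zf k w i)])%:E)%E = (Eb p F)%:E.
Proof.
move=> kinj; rewrite (Zf_exp (fun z => F [ffun i => s (z i)]) kinj) (Ex_image mu s F); congr EFin.
by apply: eq_bigr => y _; congr (_ * _); apply: eq_bigr => i _; rewrite s_law.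
Qed.

Definition wgt w : int * int -> nat := fun v => first_success (fun i => s (zt v i w)).
Definition Aw n w : R := (lpp (wgt w) n)%:R.

Section Box.
Variables (n l c : nat).
Let m := (l ^ 4)%N.

(* The bits of [fsh] live on a box of side [n + m]; its rows [m .. m + n] carry the
   square [0 .. n]^2 of the plane. *)
Definition kk (i : idx (n + l ^ 4) c) : (int * int) * nat :=
  (((i.1.1 : nat)%:Z, (i.1.2 : nat)%:Z - (l ^ 4)%N%:Z), i.2 : nat).

Lemma kk_inj : injective kk.
Proof.
move=> [[a b] k] [[a' b'] k'] /= [/= e1 e2 e3].
congr (_, _, _); apply: val_inj => //=; lia.
Qed.

Definition aw w : R := @fsh R n l c 0 [ffun i => s (Zf kk w i)].

Lemma aw_entry w a b : (a <= n)%N -> (b <= n)%N ->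
  sh 0 (m - 0) (Wt [ffun i : idx (n + m) c => s (Zf kk w i)]) a b =
  tfind (fun i => s (zt (a%:Z, b%:Z) i w)) c.
Proof.
move=> an bn; rewrite shE subn0 /Wt /cellbits /tfind; congr find.
have -> : mkseq (fun i => s (zt (a%:Z, b%:Z) i w)) c =
  [seq s (zt (a%:Z, b%:Z) (val i) w) | i <- enum 'I_c].
  by rewrite /mkseq -val_enum_ord -map_comp.
apply: eq_map => i; rewrite !ffunE /kk /= !inordK; [|by lia..].
by congr (s (zt (_, _) _ w)); rewrite /m; lia.
Qed.

Lemma Aw_lp w : Aw n w = (lp (fun a b => wgt w (a%:Z, b%:Z)) n n)%:R.
Proof. by rewrite /Aw lpp_lp. Qed.

Lemma aw_lp w : aw w = (lp (fun a b => tfind (fun i => s (zt (a%:Z, b%:Z) i w)) c) n n)%:R.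
Proof.
by rewrite /aw fsh_lp; congr (_%:R); apply: lp_ext => a b an bn; exact: aw_entry.
Qed.

(** [k + 1] is the largest gap between a weight and its truncation in the square. It is attained at
    some [v], whose first c + k + 1 bits must then all fail, and each of the 2n + 1 sites of a path
    contributes at most that gap. *)
Lemma Aw_approx w : Aw n w = aw w \/ exists (v : 'I_n.+1 * 'I_n.+1) k,
  (forall i, (i <= c + k)%N -> s (zt ((v.1 : nat)%:Z, (v.2 : nat)%:Z) i w) = false) /\
  (Aw n w - aw w) ^+ 2 <= ((n + n).+1%:R * k.+1%:R) ^+ 2.
Proof.
rewrite Aw_lp aw_lp.
set W := fun a b : nat => wgt w (a%:Z, b%:Z).
set W' := fun a b : nat => tfind _ c.
pose D (v : 'I_n.+1 * 'I_n.+1) := (W v.1 v.2 - W' v.1 v.2 + (W' v.1 v.2 - W v.1 v.2))%N.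
pose M := (\max_v D v)%N.
have DL a b : (a <= n)%N -> (b <= n)%N -> (W a b <= W' a b + M)%N /\ (W' a b <= W a b + M)%N.
  move=> an bn; have := @leq_bigmax _ D (inord a, inord b); rewrite -/M.
  by rewrite /D /= !inordK // => h; split; lia.
have L1 : (lp W n n <= lp W' n n + M * (n + n).+1)%N.
  by apply: lp_perturb => x y hx hy; case: (DL x y hx hy).
have L2 : (lp W' n n <= lp W n n + M * (n + n).+1)%N.
  by apply: lp_perturb => x y hx hy; case: (DL x y hx hy).
have card0 : (0 < #|{: 'I_n.+1 * 'I_n.+1}|)%N by rewrite card_prod card_ord.
have [v hv] := bigop.eq_bigmax D card0.
move: L1 L2; rewrite /M hv; case E : (D v) => [|k] L1 L2.
  by left; congr (_%:R); apply/eqP; rewrite eqn_leq; move: L1 L2; rewrite mul0n !addn0 => -> ->.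
right; exists v, k; split.
  apply: first_success_gap.
  rewrite -/(W v.1 v.2) -/(W' v.1 v.2) in E *; move: E; rewrite /D /W /W' /wgt.
  by move: (first_success _) (tfind _ _) => x y E; lia.
rewrite -(real_normK (num_real (_ - _))) lerXn2r ?nnegrE ?mulr_ge0 //.
rewrite -natrM mulnC; rewrite -(ler_nat R) natrD in L1; rewrite -(ler_nat R) natrD in L2.
by rewrite ler_norml; apply/andP; split; move: L1 L2; lra.
Qed.

End Box.

(** Pointwise limit, as [c] grows, of functions of finitely many bits. *)
Lemma Aw_mfun n : measurable_fun setT (Aw n).
Proof.
pose G c (z : {ffun idx (n + 0 ^ 4) c -> A3}) : R :=
  (lp (fun a b => let f := (sh 0 (0 ^ 4 - 0) (Wt [ffun i => s (z i)])) a b in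
     if (f < c)%N then f else 0%N) n n)%:R.
apply: (@measurable_fun_cvg _ _ _ setT (fun c w => G c (Zf (@kk n 0 c) w))) => [c|w _].
  exact: Zf_mfun.
apply: cvg_near_cst.
exists (\max_(v : 'I_n.+1 * 'I_n.+1) wgt w ((v.1 : nat)%:Z, (v.2 : nat)%:Z)).+1 => // c /= hc.
rewrite /G Aw_lp; congr (_%:R); apply: lp_ext => a b an bn.
rewrite -/(0 ^ 4)%N (@aw_entry n 0 c) //=; apply: tfind_eventually.
have := @leq_bigmax _ (fun v : 'I_n.+1 * 'I_n.+1 => wgt w ((v.1 : nat)%:Z, (v.2 : nat)%:Z)) (inord a, inord b).
by rewrite /= !inordK // => h; apply: leq_ltn_trans h _.
Qed.

Definition allfalse (v : int * int) (m : nat) w : R :=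
  [forall i : 'I_m.+1, ~~ s (zt v i w)]%:R.

Lemma allfalse_exp v m : (\int[P]_w (allfalse v m w)%:E)%E = ((1 - p) ^+ m.+1)%:E /\
  measurable_fun setT (allfalse v m).
Proof.
pose k (i : 'I_m.+1) : (int * int) * nat := (v, i : nat).
have kinj : injective k by move=> i j [/val_inj].
pose F (x : {ffun 'I_m.+1 -> bool}) : R := [forall i, ~~ x i]%:R.
have E w : allfalse v m w = F [ffun i => s (Zf k w i)].
  by rewrite /allfalse /F; congr ((_ : bool)%:R); apply: eq_forallb => i; rewrite !ffunE.
split; last first.
  rewrite (_ : allfalse v m = fun w => F [ffun i => s (Zf k w i)]); last exact/funext.
  exact: (Zf_mfun k (fun z => F [ffun i => s (z i)])).
under eq_integral do rewrite E.
rewrite Zf_exp_bits //; congr EFin; rewrite /Eb /Ex (bigD1 ([ffun=> false] : {ffun 'I_m.+1 -> bool})) //= [X in _ + X]big1 ?addr0.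
  rewrite /F (_ : [forall i, _] = true) ?mulr1; last by apply/forallP => i; rewrite ffunE.
  under eq_bigr => i _ do rewrite ffunE.
  by rewrite prodr_const card_ord.
move=> x /eqP nx; rewrite /F (_ : [forall i, _] = false) ?mulr0 //.
apply/negbTE/negP => /forallP h; apply: nx; apply/ffunP => i; rewrite ffunE.
exact/negbTE.
Qed.

Hypothesis p01 : 0 < p < 1.
Let al := alp p.
(** Chosen so that sgt^2 (1 - p) is [rho al ^+ 2], which is below 1. By [sqr_le_Mtl] the squared gap
    is at most a multiple of sgt^(2k), while k further failures have probability (1 - p)^k, so the
    error series is geometric. *)
Definition sgt : R := (1 + al) / (2 * al).
Definition Mtl : R := (1 + (sgt - 1)^-1) ^+ 2.
Definition Ctl : R := 4 * (Mtl / (1 - rho al ^+ 2)).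

Let al0 : 0 < al. Proof. exact: alp_gt0. Qed.
Let al1 : al < 1. Proof. exact: alp_lt1. Qed.

Lemma sgt_gt1 : 0 < sgt - 1.
Proof.
have -> : sgt - 1 = (1 - al) / (2 * al) by rewrite /sgt; field; rewrite gt_eqF.
by rewrite divr_gt0 ?subr_gt0 // mulr_gt0.
Qed.

Lemma sqr_le_Mtl k : k.+1%:R ^+ 2 <= Mtl * sgt ^+ (2 * k).
Proof.
have h0 := sgt_gt1; set h := sgt - 1 in h0.
have hE : sgt = 1 + h by rewrite /h addrC subrK.
have B j : 1 + j%:R * h <= sgt ^+ j.
  elim: j => [|j IH]; first by rewrite mul0r addr0 expr0.
  rewrite exprSr; apply: le_trans (ler_wpM2r _ IH); last by rewrite hE addr_ge0 // ltW.
  rewrite hE -natr1; have : 0 <= j%:R * h * h by apply: mulr_ge0; [apply: mulr_ge0 => //|]; exact: ltW.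
  lra.
rewrite /Mtl mulnC exprM -exprMn lerXn2r ?nnegrE //.
  apply: mulr_ge0; first by rewrite addr_ge0 // invr_ge0 ltW.
  by apply: exprn_ge0; rewrite hE addr_ge0 // ltW.
apply: le_trans (ler_wpM2l _ (B k)); last by rewrite addr_ge0 // invr_ge0 ltW.
rewrite -/h mulrDl mul1r [h^-1 * _]mulrDr mulr1 [k%:R * h]mulrC mulKf ?gt_eqF // -natr1.
have : 0 <= h^-1 by rewrite invr_ge0 ltW.
have : 0 <= h * k%:R by rewrite mulr_ge0 // ltW.
lra.
Qed.

(** Union bound over the site and the gap of [Aw_approx], written as a series of nonnegative
    functions that can be integrated term by term. Of the power n^4, the squared path length gives
    n^2 and the number of sites the other n^2. *)
Lemma Aw_aw_close n l c :
  (\int[P]_w ((Aw n w - aw n l c w) ^+ 2)%:E <= (Ctl * (n.+1%:R ^+ 4 * (1 - p) ^+ c))%:E)%E.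
Proof.
have [r0 r1] : 0 < rho al /\ rho al < 1 by apply/andP; exact: rho01.
set rh := rho al ^+ 2.
have rh0 : 0 <= rh by exact: sqr_ge0.
have rh1 : rh < 1 by rewrite /rh expr2 mulr_ilt1 // ltW.
have qE : 1 - p = al ^+ 2 by rewrite -qq_alp.
have sr : sgt ^+ 2 * (1 - p) = rh.
  by rewrite qE -exprMn /rh /sgt /rho; congr (_ ^+ 2); field; rewrite gt_eqF.
have q0 : 0 <= 1 - p by rewrite qE sqr_ge0.
have q1 : 1 - p <= 1 by rewrite lerBlDr lerDl; case/andP: (p01) => /ltW.
have M0 : 0 <= Mtl by exact: sqr_ge0.
have s0 : 0 <= sgt by have := sgt_gt1; lra.
pose K0 : R := (n + n).+1%:R ^+ 2 * Mtl.
have K00 : 0 <= K0 by pos.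
pose vv (v : 'I_n.+1 * 'I_n.+1) : int * int := ((v.1 : nat)%:Z, (v.2 : nat)%:Z).
pose h k w : \bar R := ((K0 * sgt ^+ (2 * k))%:E * \sum_(v : 'I_n.+1 * 'I_n.+1) (allfalse (vv v) (c + k) w)%:E)%E.
have af0 v m w : (0 <= (allfalse v m w)%:E)%E by rewrite lee_fin.
have h0 k w : (0 <= h k w)%E.
  by apply: mule_ge0; [rewrite lee_fin mulr_ge0 ?exprn_ge0|apply: sume_ge0].
have ms k : measurable_fun setT (fun w => \sum_(v : 'I_n.+1 * 'I_n.+1) (allfalse (vv v) (c + k) w)%:E)%E.
  by apply: emeasurable_sum => v; apply/measurable_EFinP; case: (allfalse_exp (vv v) (c + k)).
have mh k : measurable_fun setT (h k).
  by apply: emeasurable_funM; [exact: measurable_cst|exact: ms].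
have mA : measurable_fun setT (fun w => ((Aw n w - aw n l c w) ^+ 2)%:E).
  apply/measurable_EFinP; apply: measurable_funX; apply: measurable_funB; first exact: Aw_mfun.
  exact: (Zf_mfun (@kk n l c) (fun z => @fsh R n l c 0 [ffun i => s (z i)])).
apply: (@le_trans _ _ (\int[P]_w (\sum_(0 <= k <oo) h k w))%E).
  apply: ge0_le_integral => //.
  - by move=> w _; rewrite lee_fin sqr_ge0.
  - have := @ge0_emeasurable_sum _ T R setT h xpredT (fun k w _ _ => h0 k w) (fun k _ => mh k).
    by apply: eq_measurable_fun => w _; apply: eq_eseriesl => i.
  - move=> w _; case: (Aw_approx n l c w) => [->|[v [k [bf le]]]].
      by rewrite subrr expr0n /=; apply: nneseries_ge0 => *; exact: h0.
    apply: le_trans (@nneseries_lim_ge R (fun k => h k w) xpredT 0%N k.+1 _); last first.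
      by move=> *; exact: h0.
    rewrite big_nat_recr //=.
    apply: (@le_trans _ _ (h k w)); last by apply: leeDr; apply: sume_ge0.
    rewrite /h (bigD1 v) //= sumEFin -EFinD -EFinM lee_fin.
    apply: le_trans le _.
    have -> : allfalse (vv v) (c + k) w = 1.
      rewrite /allfalse (_ : [forall i, _] = true) //; apply/forallP => i.
      by rewrite bf // -ltnS.
    apply: (@le_trans _ _ (K0 * sgt ^+ (2 * k) * 1)); last first.
      apply: ler_wpM2l; first by rewrite mulr_ge0 ?exprn_ge0.
      by rewrite lerDl sumr_ge0.
    rewrite mulr1 exprMn /K0 -mulrA ler_wpM2l ?exprn_ge0 //; exact: sqr_le_Mtl.
rewrite integral_nneseries //.
have hI k : (\int[P]_w h k w)%E = (K0 * (n.+1 * n.+1)%:R * (1 - p) ^+ c * (1 - p) * rh ^+ k)%:E.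
  rewrite ge0_integralZl_EFin //; [|by move=> w _; apply: sume_ge0|by pos].
  rewrite ge0_integral_sum //; last first.
    by move=> v; apply/measurable_EFinP; case: (allfalse_exp (vv v) (c + k)).
  under eq_bigr => v _ do rewrite (allfalse_exp (vv v) (c + k)).1.
  rewrite sumEFin -EFinM; congr EFin.
  rewrite sumr_const card_prod !card_ord -[X in _ * X = _]mulr_natr.
  have -> : (1 - p) ^+ (c + k).+1 = (1 - p) ^+ c * ((1 - p) ^+ k * (1 - p)) by rewrite -addnS exprD exprSr.
  have -> : sgt ^+ (2 * k) = (sgt ^+ 2) ^+ k by rewrite exprM.
  have -> : rh ^+ k = (sgt ^+ 2) ^+ k * (1 - p) ^+ k by rewrite -sr exprMn.
  by move: ((sgt ^+ 2) ^+ k) ((1 - p) ^+ k) ((1 - p) ^+ c) (n.+1 * n.+1)%:R => x1 x2 x3 x4; ring.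
set K1 := K0 * _ * _ * _ in hI.
have K10 : 0 <= K1 by rewrite /K1; pos.
under eq_eseriesr => k _ do rewrite hI.
apply: lime_le; first by apply: is_cvg_nneseries => k _ _; rewrite lee_fin; pos.
apply: nearW => N; rewrite sumEFin lee_fin -mulr_sumr.
have gs : \sum_(0 <= k < N) rh ^+ k <= (1 - rh)^-1.
  have d0 : 0 < 1 - rh by rewrite subr_gt0.
  rewrite -(ler_pM2l d0) divff ?gt_eqF // big_mkord -[1 - rh]opprB mulNr -subrX1 opprB.
  by rewrite lerBlDr lerDl exprn_ge0.
apply: le_trans (ler_wpM2l K10 gs) _.
have d0 : 0 <= (1 - rh)^-1 by rewrite invr_ge0 subr_ge0 ltW.
have qc : 0 <= (1 - p) ^+ c by rewrite exprn_ge0.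
have n2 : (n + n).+1%:R ^+ 2 * (n.+1 * n.+1)%:R <= 4 * n.+1%:R ^+ 4 :> R.
  have a1 : (n + n).+1%:R <= 2 * n.+1%:R :> R by rewrite -natrM ler_nat; clear; lia.
  rewrite natrM (_ : 4 * n.+1%:R ^+ 4 = (2 * n.+1%:R) ^+ 2 * (n.+1%:R * n.+1%:R)); last by clear; ring.
  by rewrite ler_wpM2r ?mulr_ge0 // lerXn2r ?nnegrE ?mulr_ge0.
have -> : K1 * (1 - rh)^-1 = ((n + n).+1%:R ^+ 2 * (n.+1 * n.+1)%:R) * (Mtl * (1 - rh)^-1 * (1 - p) ^+ c) * (1 - p).
  by rewrite /K1 /K0; ring.
have -> : Ctl * (n.+1%:R ^+ 4 * (1 - p) ^+ c) = 4 * n.+1%:R ^+ 4 * (Mtl * (1 - rh)^-1 * (1 - p) ^+ c) * 1.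
  by rewrite /Ctl -/rh; ring.
have z0 : 0 <= Mtl * (1 - rh)^-1 * (1 - p) ^+ c by pos.
apply: ler_pM => //; first by pos.
by apply: ler_wpM2r.
Qed.

End Weights.
End Process.

(** * The resampled environment *)

Section BitLaws.
Context (d : measure_display) (T : measurableType d) (R : realType) (P : probability T R).

Lemma RV_preimage_measurable (d' : measure_display) (T' : measurableType d') (Y : {RV P >-> T'})
  (A : set T') : measurable A -> measurable (Y @^-1` A).
Proof. by move=> mA; have := measurable_funPT Y measurableT A mA; rewrite setTI. Qed.

Lemma bernoulli_bit (p : R) b : 0 < p < 1 -> bernoulli_prob p [set b] = (bit p b)%:E.
Proof.
move=> /andP[p0 p1]; rewrite bernoulli_probE ?(ltW p0) ?(ltW p1) // !diracE /bit.
have m1 b' : (b' \in [set b]) = (b' == b) by apply/idP/eqP; rewrite inE.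
by rewrite !m1; case: b m1 => _; rewrite /= ?mule0 ?mule1 ?adde0 ?add0e.
Qed.

Definition above (t : R) (b : bool) : set R := [set u | (t < u) = b].

Lemma above_measurable t b : measurable (above t b).
Proof.
case: b; rewrite /above.
  rewrite (_ : [set u | _] = `]t, +oo[%classic) //.
  by apply/seteqP; split=> u; rewrite /= in_itv /= andbT.
rewrite (_ : [set u | _] = `]-oo, t]%classic) //.
by apply/seteqP; split=> u; rewrite /= in_itv /= leNgt; [move=> ->|move/negbTE].
Qed.

Lemma exponential_below (t : R) : 0 < t ->
  exponential_prob 1 (above t false) = (1 - expR (- t))%:E.
Proof.
move=> t0.
have -> : above t false = `]-oo, 0%R[%classic `|` `[0%R, t]%classic.
  apply/seteqP; split=> u; rewrite /above /= !in_itv /=.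
    move=> /negbT; rewrite -leNgt => ut.
    by case: (ltP u 0) => h; [left|right; rewrite ut].
  case=> [u0|/andP[_ ut]]; apply/negbTE; rewrite -leNgt //.
  exact: ltW (lt_trans u0 t0).
have mp : measurable_fun setT (EFin \o exponential_pdf (1 : R)).
  by apply/measurable_EFinP; exact: measurable_exponential_pdf.
rewrite /exponential_prob ge0_integral_setU //=.
- rewrite integral0_eq ?add0e.
    by rewrite -/(exponential_prob 1 _) exponential_prob_itv0c // mulN1r EFinB.
  by move=> u; rewrite /= in_itv /= => u0; rewrite lt0_exponential_pdf.
- by apply: measurable_funS mp.
- by move=> u _; rewrite lee_fin; exact: exponential_pdf_ge0.
- apply/disj_setPS => u [] /=; rewrite !in_itv /= => u0 /andP[u1 _].
  by move: u0; rewrite ltNge u1.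
Qed.

Definition expl (t : R) (b : bool) : R := if b then expR (- t) else 1 - expR (- t).

Lemma exponential_RV (t : R) (Y : {RV P >-> R}) b : 0 < t ->
  (forall A : set R, measurable A -> distribution P Y A = exponential_prob 1 A) ->
  P (Y @^-1` above t b) = (expl t b)%:E.
Proof.
move=> t0 hY.
have hf : P (Y @^-1` above t false) = (1 - expR (- t))%:E.
  by rewrite -exponential_below // -hY //; exact: above_measurable.
case: b => //=.
have -> : Y @^-1` above t true = ~` (Y @^-1` above t false).
  by apply/seteqP; split=> w; rewrite /above /=; case: (t < Y w).
rewrite probability_setC; last exact: RV_preimage_measurable (above_measurable _ _).
by rewrite hf -EFinB; congr EFin; rewrite opprB addrC subrK.
Qed.

End BitLaws.

Section Resampling.
Variables (R : realType) (p t : R).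
Hypothesis p01 : 0 < p < 1.

Definition mu3 (a : A3) : R := bit p a.1.1 * bit p a.1.2 * expl t a.2.
Definition sel1 (a : A3) : bool := a.1.1.
Definition sel2 (a : A3) : bool := if a.2 then a.1.1 else a.1.2.

Lemma sum_A3 (Q : pred A3) (F : A3 -> R) : \sum_(a | Q a) F a =
  \sum_(x : bool) \sum_(y : bool) \sum_(z : bool) (if Q (x, y, z) then F (x, y, z) else 0).
Proof.
rewrite big_mkcond /=.
transitivity (\sum_(xy : bool * bool) \sum_(z : bool) (if Q (xy, z) then F (xy, z) else 0)).
  by rewrite pair_bigA; apply: eq_bigr => -[].
rewrite (pair_bigA _ (fun x y => \sum_(z : bool) (if Q (x, y, z) then F (x, y, z) else 0))) /=.
by apply: eq_bigr => -[].
Qed.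

Lemma sel1_law b : \sum_(a | sel1 a == b) mu3 a = bit p b.
Proof. by rewrite sum_A3 !big_bool /mu3 /expl /bit; case: b => /=; ring. Qed.

Lemma sel2_law b : \sum_(a | sel2 a == b) mu3 a = bit p b.
Proof. by rewrite sum_A3 !big_bool /mu3 /expl /bit; case: b => /=; ring. Qed.

(** With probability [expR (- t)] the two bits coincide, otherwise they are independent; by
    [rr_complete] this mixture is the kernel of [Eb2]. *)
Lemma sel_pair_law x y : \sum_(a | (sel1 a == x) && (sel2 a == y)) mu3 a =
  bit p x * bit p y * (1 + expR (- t) * (rr p x * rr p y)).
Proof.
have [p0 p1] := andP p01; have pn : p != 0 by rewrite gt_eqF.
have qn : 1 - p != 0 by rewrite subr_eq0 eq_sym lt_eqF.
have -> : rr p x * rr p y = (x == y)%:R / bit p x - 1.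
  by rewrite -(rr_complete p01) addrAC subrr add0r.
rewrite sum_A3 !big_bool /mu3 /expl /bit.
by case: x; case: y => /=; field.
Qed.

Lemma Ctl_ge0 : 0 <= Ctl p.
Proof.
have [r0 r1] : 0 < rho (alp p) /\ rho (alp p) < 1.
  by apply/andP; apply: rho01; [exact: alp_gt0|exact: alp_lt1].
rewrite /Ctl; apply: mulr_ge0 => //; apply: divr_ge0; first exact: sqr_ge0.
by rewrite subr_ge0 expr2 mulr_ile1 // ltW.
Qed.

Context (d : measure_display) (T : measurableType d) (P : probability T R).
Variable zt : int * int -> nat -> T -> A3.
Hypothesis zt_meas : forall v i a, measurable [set w | zt v i w = a].
Hypothesis zt_law : forall (I : finType) (k : I -> (int * int) * nat) (z : {ffun I -> A3}),
  injective k -> P [set w | forall i, zt (k i).1 (k i).2 w = z i] = (\prod_i mu3 (z i))%:E.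

Section Fixed.
Variables n l c : nat.
Local Notation f := (@fsh R n l c 0).

Lemma aw_Lfun2 (s : A3 -> bool) : aw R zt s n l c \in Lfun P 2%:E.
Proof.
have h := @Zf_Lfun2 _ _ _ P mu3 zt zt_meas zt_law _ (@kk n l c)
  (fun z => f [ffun i => s (z i)]) (@kk_inj n l c).
exact: h.
Qed.

Lemma cov_aw (s s' : A3 -> bool) :
  (forall b, \sum_(a | s a == b) mu3 a = bit p b) ->
  (forall b, \sum_(a | s' a == b) mu3 a = bit p b) ->
  fine (covariance P (aw R zt s n l c) (aw R zt s' n l c)) =
  Ex (fun _ => mu3) (fun z => f [ffun i => s (z i)] * f [ffun i => s' (z i)]) - Eb p f ^+ 2.
Proof.
move=> hs hs'; have a2 := aw_Lfun2 s; have b2 := aw_Lfun2 s'.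
have Pfin : P setT \is a fin_num by exact: fin_num_measure.
have a1 := Lfun_subset12 Pfin a2; have b1 := Lfun_subset12 Pfin b2.
rewrite covarianceE //; last exact: Lfun2_mul_Lfun1.
have E1 : 'E_P[aw R zt s n l c]%E = (Eb p f)%:E.
  by rewrite unlock; exact: (@Zf_exp_bits _ _ _ P mu3 zt zt_meas zt_law p s hs _ _ f (@kk_inj n l c)).
have E2 : 'E_P[aw R zt s' n l c]%E = (Eb p f)%:E.
  by rewrite unlock; exact: (@Zf_exp_bits _ _ _ P mu3 zt zt_meas zt_law p s' hs' _ _ f (@kk_inj n l c)).
have E3 : 'E_P[(aw R zt s n l c * aw R zt s' n l c)%R]%E =
  (Ex (fun _ => mu3) (fun z => f [ffun i => s (z i)] * f [ffun i => s' (z i)]))%:E.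
  rewrite unlock; exact: (@Zf_exp _ _ _ P mu3 zt zt_meas zt_law _ (@kk n l c)
    (fun z => f [ffun i => s (z i)] * f [ffun i => s' (z i)]) (@kk_inj n l c)).
by rewrite E1 E2 E3.
Qed.

Lemma var_aw (s : A3 -> bool) : (forall b, \sum_(a | s a == b) mu3 a = bit p b) ->
  fine (covariance P (aw R zt s n l c) (aw R zt s n l c)) = Varb p f.
Proof.
move=> hs; rewrite cov_aw // /Varb; congr (_ - _).
rewrite (Ex_image mu3 s (fun x => f x * f x)); apply: eq_bigr => y _; congr (_ * _).
by apply: eq_bigr => i _; rewrite hs.
Qed.

Lemma cov_aw_sel : fine (covariance P (aw R zt sel1 n l c) (aw R zt sel2 n l c)) =
  Eb2 p (expR (- t)) (fun x y => f x * f y) - Eb p f ^+ 2.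
Proof.
rewrite cov_aw; [|exact: sel1_law|exact: sel2_law]; congr (_ - _).
rewrite (Ex_image2 mu3 sel1 sel2 (fun x y => f x * f y)).
apply: eq_bigr => x _; apply: eq_bigr => y _; congr (_ * _).
by apply: eq_bigr => i _; rewrite sel_pair_law.
Qed.

Lemma Aw_aw_Lfun2 (s : A3 -> bool) : (forall b, \sum_(a | s a == b) mu3 a = bit p b) ->
  Ctl p * (n.+1%:R ^+ 4 * (1 - p) ^+ c) <= 1 ->
  Aw R zt s n \in Lfun P 2%:E /\
  fine (covariance P (Aw R zt s n \- aw R zt s n l c) (Aw R zt s n \- aw R zt s n l c)) <= 1.
Proof.
move=> hs h1; have a2 := aw_Lfun2 s.
have cl := @Aw_aw_close _ _ _ P mu3 zt zt_meas zt_law p s hs p01 n l c.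
have U2 : (Aw R zt s n \- aw R zt s n l c) \in Lfun P 2%:E.
  apply: Lfun2_sqr_lty; last by apply: le_lt_trans cl _; exact: ltry.
  apply: measurable_funB; first exact: (@Aw_mfun _ _ _ zt zt_meas s n).
  exact: (@Zf_mfun _ _ _ zt zt_meas _ (@kk n l c) (fun z => f [ffun i => s (z i)])).
split; last first.
  by apply: fine_var_le => //; apply: le_trans cl _; rewrite lee_fin.
rewrite (_ : Aw R zt s n = (Aw R zt s n \- aw R zt s n l c) \+ aw R zt s n l c).
  by rewrite rpredD // ?lee_fin ?ler1n.
by apply/funext => w /=; rewrite subrK.
Qed.

End Fixed.

Hypothesis t0 : 0 < t.

Lemma correlation_to0 : (fun n => correlation P (Aw R zt sel1 n) (Aw R zt sel2 n)) @ \oo --> (0 : R).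
Proof.
apply/cvgrPdist_le => eps eps0.
pose eta : R := Num.min 4^-1 (eps / 8).
have eta0 : 0 < eta by rewrite lt_min invr_gt0 ltr0n divr_gt0.
have eta1 : eta <= 4^-1 by rewrite ge_min lexx.
have eta2 : 8 * eta <= eps.
  have : eta <= eps / 8 by rewrite ge_min lexx orbT.
  lra.
have C0 := Ctl_ge0.
have C1 : 0 < (Ctl p + 1)^-1 by rewrite invr_gt0 ltr_wpDl.
(* The bound by eta^2 serves both the covariance ratio and the lower bound on the variance; the
   second entry makes the truncation error have variance at most 1. *)
pose dl : R := Num.min (eta ^+ 2) (Ctl p + 1)^-1.
have dl0 : 0 < dl by rewrite lt_min exprn_gt0.
have dl1 : dl <= eta ^+ 2 by rewrite ge_min lexx.
have dl2 : dl <= (Ctl p + 1)^-1 by rewrite ge_min lexx orbT.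
have ro01 : 0 <= expR (- t) < 1 by rewrite expR_ge0 expR_lt1 oppr_lt0.
have := finite_decorrelation p01 ro01 dl0; apply: filterS => n.
move=> [l [c /= [l0 /andP[k0 k1] Vl tl]]].
rewrite sub0r normrN; apply: le_trans eta2.
set f := fsh R 0 in k0 k1 Vl.
have V0 : 0 <= Varb p f by apply: le_trans Vl; rewrite invr_ge0 ltW.
have tl1 : Ctl p * (n.+1%:R ^+ 4 * (1 - p) ^+ c) <= 1.
  apply: le_trans (ler_wpM2l C0 (le_trans tl dl2)) _.
  by rewrite ler_pdivrMr ?mul1r ?lerDl // ltr_wpDl.
have [A2 UA] := @Aw_aw_Lfun2 n l c sel1 sel1_law tl1.
have [B2 UB] := @Aw_aw_Lfun2 n l c sel2 sel2_law tl1.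
apply: (@correlation_perturb _ _ _ P _ _ (aw R zt sel1 n l c) (aw R zt sel2 n l c) (Varb p f)) => //.
- exact: aw_Lfun2.
- exact: aw_Lfun2.
- exact: var_aw sel1_law.
- exact: var_aw sel2_law.
- rewrite cov_aw_sel ger0_norm //; apply: le_trans k1 _.
  by rewrite ler_wpM2r.
- apply: le_trans Vl; rewrite lef_pV2 ?posrE // exprn_gt0 //.
Qed.

End Resampling.

(** * Joint law of the bits, their replacements and the clocks *)

Section JointLaw.
Context (d : measure_display) (T : measurableType d) (R : realType) (P : probability T R).
Variables (p t : R) (X X' : int * int -> nat -> {RV P >-> bool}) (U : int * int -> nat -> {RV P >-> R}).
Hypothesis p01 : 0 < p < 1.
Hypothesis t0 : 0 < t.
Hypothesis X_law : forall v i (A : set bool), measurable A ->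
  distribution P (X v i) A = bernoulli_prob p A.
Hypothesis X'_law : forall v i (A : set bool), measurable A ->
  distribution P (X' v i) A = bernoulli_prob p A.
Hypothesis U_law : forall v i (A : set R), measurable A ->
  distribution P (U v i) A = exponential_prob 1 A.
Hypothesis indep : mutually_independent P
  (all_sigmas (fun v i => X v i : T -> bool) (fun v i => X' v i : T -> bool)
              (fun v i => U v i : T -> R)).

Definition triple (v : int * int) (i : nat) (w : T) : A3 := (X v i w, X' v i w, t < U v i w).

Lemma triple_measurable v i a : measurable [set w | triple v i w = a].
Proof.
rewrite (_ : [set w | _] = (X v i @^-1` [set a.1.1] `&` X' v i @^-1` [set a.1.2]) `&`
   U v i @^-1` above t a.2).
  apply: measurableI; first by apply: measurableI; exact: RV_preimage_measurable.
  by apply: RV_preimage_measurable; exact: above_measurable.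
apply/seteqP; split=> w; rewrite /triple /above /=; first by move=> <-.
by case: a => [[a1 a2] a3] /= [[-> ->] ->].
Qed.

Lemma triple_law (I : finType) (k : I -> (int * int) * nat) (z : {ffun I -> A3}) : injective k ->
  P [set w | forall i, triple (k i).1 (k i).2 w = z i] = (\prod_i mu3 p t (z i))%:E.
Proof.
move=> kinj.
(* Extends [z] from the image of [k] to the whole index set, with an arbitrary value elsewhere,
   because independence speaks of events indexed by the whole field. *)
pose zz v : A3 := if [pick i | k i == v] is Some i then z i else (false, false, false).
have zzE i : zz (k i) = z i.
  by rewrite /zz; case: pickP => [j /eqP/kinj ->//|/(_ i)]; rewrite eqxx.
pose KT := ((int * int) * nat + ((int * int) * nat + (int * int) * nat))%type.
pose E (x : KT) : set T := match x with
  | inl v => X v.1 v.2 @^-1` [set (zz v).1.1]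
  | inr (inl v) => X' v.1 v.2 @^-1` [set (zz v).1.2]
  | inr (inr v) => U v.1 v.2 @^-1` above t (zz v).2
  end.
pose J : seq KT := [seq inl (k i) | i <- enum I] ++
  ([seq inr (inl (k i)) | i <- enum I] ++ [seq inr (inr (k i)) | i <- enum I]).
have uJ : uniq J.
  rewrite !cat_uniq; apply/and3P; split.
  - by rewrite map_inj_uniq ?enum_uniq // => i j [/kinj].
  - apply/hasPn => x; rewrite mem_cat => /orP[] /mapP[i _ ->]; by apply/negP => /mapP[].
  - apply/and3P; split.
    + by rewrite map_inj_uniq ?enum_uniq // => i j [/kinj].
    + by apply/hasPn => x /mapP[i _ ->]; apply/negP => /mapP[].
    + by rewrite map_inj_uniq ?enum_uniq // => i j [/kinj].
have FJ j : j \in J -> all_sigmas (fun v i => X v i : T -> bool) (fun v i => X' v i : T -> bool)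
              (fun v i => U v i : T -> R) j (E j).
  move=> _; case: j => [[v i]|[[v i]|[v i]]] /=.
  - by exists [set (zz (v, i)).1.1].
  - by exists [set (zz (v, i)).1.2].
  - by exists (above t (zz (v, i)).2); [exact: above_measurable|].
have := indep uJ FJ.
have -> : [set w | forall j, j \in J -> E j w] = [set w | forall i, triple (k i).1 (k i).2 w = z i].
  apply/seteqP; split=> w /= h.
    move=> i.
    have h1 : E (inl (k i)) w by apply: h; rewrite mem_cat map_f ?mem_enum.
    have h2 : E (inr (inl (k i))) w.
      by apply: h; rewrite !mem_cat; apply/orP; right; apply/orP; left; rewrite map_f ?mem_enum.
    have h3 : E (inr (inr (k i))) w.
      by apply: h; rewrite !mem_cat; apply/orP; right; apply/orP; right; rewrite map_f ?mem_enum.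
    rewrite /E /= zzE in h1; rewrite /E /= zzE in h2; rewrite /E /above /= zzE in h3.
    by rewrite /triple h1 h2 h3; case: (z i) => [[]].
  move=> j; rewrite !mem_cat => /or3P[] /mapP[i _ ->]; rewrite /E /= zzE -(h i) //.
move=> ->; rewrite /J !big_cat /= !big_map /=.
have e1 i : P (X (k i).1 (k i).2 @^-1` [set (zz (k i)).1.1]) = (bit p (z i).1.1)%:E.
  by rewrite zzE -bernoulli_bit // -(X_law (k i).1 (k i).2).
have e2 i : P (X' (k i).1 (k i).2 @^-1` [set (zz (k i)).1.2]) = (bit p (z i).1.2)%:E.
  by rewrite zzE -bernoulli_bit // -(X'_law (k i).1 (k i).2).
have e3 i : P (U (k i).1 (k i).2 @^-1` above t (zz (k i)).2) = (expl t (z i).2)%:E.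
  by rewrite zzE; apply: exponential_RV => // A mA; exact: U_law.
under eq_bigr do rewrite e1.
under [X in (_ * (X * _))%E]eq_bigr do rewrite e2.
under [X in (_ * (_ * X))%E]eq_bigr do rewrite e3.
rewrite !prode_EFin -!EFinM; congr EFin; rewrite -!big_split /= -enumT big_enum /=.
by apply: eq_bigr => i _; rewrite /mu3 mulrA.
Qed.

End JointLaw.

Theorem theorem1p1 (d : measure_display) (T : measurableType d) (R : realType)
  (P : probability T R) (p t : R)
  (X X' : int * int -> nat -> {RV P >-> bool})
  (U : int * int -> nat -> {RV P >-> R}) :
  0 < p < 1 -> 0 < t ->
  (forall v i (A : set bool), measurable A ->
     distribution P (X v i) A = bernoulli_prob p A) ->
  (forall v i (A : set bool), measurable A ->
     distribution P (X' v i) A = bernoulli_prob p A) ->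
  (forall v i (A : set R), measurable A ->
     distribution P (U v i) A = exponential_prob 1 A) ->
  mutually_independent P
    (all_sigmas (fun v i => X v i : T -> bool) (fun v i => X' v i : T -> bool)
                (fun v i => U v i : T -> R)) ->
  (fun n : nat =>
     correlation P
       (fun w => (lpp (weights (fun v i => X v i : T -> bool) w) n)%:R)
       (fun w => (lpp (weights
                         (resampled t (fun v i => X v i : T -> bool)
                            (fun v i => X' v i : T -> bool)
                            (fun v i => U v i : T -> R)) w) n)%:R))
    @ \oo --> 0.
Proof.
move=> p01 t0 hX hX' hU hind.
(* The third entry of [triple] is the test in [resampled], so the two passage times are those of
   [sel1] and [sel2] by computation. *)
exact: (correlation_to0 p01 (triple_measurable t X X' U)
  (triple_law p01 t0 hX hX' hU hind) t0).
Qed.
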